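(* Let $d\in\{2,3\}$, let $m>0$ and let $Q : K_m \to K_0$ be the symplectomorphism $$Q: \omega_m^{-1/2} f + i\omega_m^{1/2} g \mapsto \omega_0^{-1/2} f + i \omega_0^{1/2} g, \qquad f \in H^{-1/2}_{\mathbb R}(B),\ g \in H^{1/2}_{\mathbb R}(B),$$ extended by $\mathbb C$-linearity to a bijection $K_m+iK_m \to K_0+iK_0$. For every $\lambda \in \mathbb C\setminus[0,+\infty)$, the operator $$R(\lambda,\delta_m) - Q^{-1}R(\lambda,\delta_0)Q$$ is Hilbert-Schmidt on $K_m+iK_m$ (with respect to the scalar product $\langle\cdot,\cdot\rangle_{s_m}$), and its Hilbert-Schmidt norm vanishes in the limit $m\to 0^+$.
   Context: Let $H = L^2(\mathbb R^d)$ with scalar product linear in the second variable. For $m \ge 0$ and $s\in\mathbb R$, $\omega_m^s$ is the operator of multiplication by $\omega_m(p)^s = (m^2+|p|^2)^{s/2}$ in Fourier transform. $B \subset \mathbb R^d$ is the ball of radius 1 centered at the origin, and $H^s_{\mathbb R}(B)$ is the closure of $C_c^\infty(B,\mathbb R)$ in the Sobolev space of real tempered distributions $f$ with $\int_{\mathbb R^d} dp\,(1+|p|^2)^s |\hat f(p)|^2 < +\infty$. Set $$K_m = \omega_m^{-1/2} H^{-1/2}_{\mathbb R}(B) + i \omega_m^{1/2} H^{1/2}_{\mathbb R}(B) \subset H .$$ It is known that $K_m$ is a standard subspace (a closed real subspace with $K_m+iK_m$ dense and $K_m\cap iK_m=\{0\}$) and a factor (i.e. $K_m\cap K_m'=\{0\}$,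 where $K_m'$ is the symplectic complement with respect to $\mathrm{Im}\langle\cdot,\cdot\rangle$). A symplectomorphism between standard subspaces is a real linear bijection preserving $\mathrm{Im}\langle\cdot,\cdot\rangle$. The Tomita operator of $K_m$ is the closed conjugate linear operator $s_m(h+ik) = h-ik$, $h,k\in K_m$, with domain $K_m+iK_m$; its polar decomposition is $s_m=j_m\delta_m^{1/2}$, and $\delta_m$ is the modular operator (positive self-adjoint on $H$). $K_m+iK_m$ is a complex Hilbert space with $\langle x,y\rangle_{s_m} = \langle x,y\rangle + \langle s_m y, s_m x\rangle$. For $\lambda\in\mathbb C\setminus\sigma(\delta_m)$, $R(\lambda,\delta_m) = (\delta_m-\lambda 1)^{-1}$ is the resolvent; it leaves $K_m+iK_m$ invariant, and in the claim it is considered as an operator on $K_m+iK_m$. *)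

(* Defs.v *)
From HB Require Import structures.
From mathcomp Require Import all_boot all_order all_algebra.
From mathcomp Require Import generic_quotient ring_quotient complex.
From mathcomp Require Import all_classical all_reals all_analysis.

Set Implicit Arguments.
Unset Strict Implicit.
Unset Printing Implicit Defensive.

Import Order.TTheory GRing.Theory Num.Theory.
Import numFieldNormedType.Exports.

Local Open Scope classical_set_scope.
Local Open Scope ring_scope.
Local Open Scope quotient_scope.
Local Open Scope complex_scope.

Local Notation Re := (@complex.Re _).
Local Notation Im := (@complex.Im _).

Definition rV_display : measure_display. Proof. exact: default_measure_display. Qed.

Section measurable_rV.
Context (R : realType) (n : nat).

Definition rV_coord (i : 'I_n) (x : 'rV[R]_n) : measurableTypeR R := x 0 i.

Let rV_set0 : g_sigma_preimage rV_coord set0.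
Proof. exact: sigma_algebra0. Qed.

Let rV_setC A : g_sigma_preimage rV_coord A -> g_sigma_preimage rV_coord (~` A).
Proof. exact: sigma_algebraC. Qed.

Let rV_bigcup (F : (set 'rV[R]_n)^nat) :
  (forall i, g_sigma_preimage rV_coord (F i)) ->
  g_sigma_preimage rV_coord (\bigcup_i (F i)).
Proof. exact: sigma_algebra_bigcup. Qed.

(* The Borel sigma-algebra of R^n, generated by the coordinates, as the library
   does for [n.-tuple T]. *)
HB.instance Definition _ := @isMeasurable.Build rV_display
  'rV[R]_n (g_sigma_preimage rV_coord) rV_set0 rV_setC rV_bigcup.

End measurable_rV.

Section measurable_rV_lemmas.
Context (R : realType).

Lemma measurable_rV_coord n (i : 'I_n) :
  measurable_fun [set: 'rV[R]_n] (@rV_coord R n i).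
Proof.
move=> _ Y mY; rewrite setTI; apply: sub_sigma_algebra => /=.
rewrite -bigcup_seq/=; exists i => /=; first by rewrite mem_index_enum.
by exists Y => //; rewrite setTI.
Qed.

Lemma measurable_fun_rVP d1 (T1 : measurableType d1) n (f : T1 -> 'rV[R]_n) :
  (forall i, measurable_fun [set: T1] (@rV_coord R n i \o f)) ->
  measurable_fun [set: T1] f.
Proof.
move=> mf _ Y mY; rewrite setTI.
suff : g_sigma_preimage (@rV_coord R n) `<=` [set A | measurable (f @^-1` A)].
  by move/(_ Y); apply.
apply: smallest_sub => /=.
  split => /=.
  - by rewrite preimage_set0.
  - by move=> A mA; rewrite setTD preimage_setC; exact: measurableC.
  - move=> F mF; rewrite preimage_bigcup; exact: bigcup_measurable.
rewrite -bigcup_seq/= => A [i _ /= [B mB <-]].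
by rewrite setTI -comp_preimage -[X in measurable X]setTI; exact: mf.
Qed.

Definition rV_cons n (u : R * 'rV[R]_n) : 'rV[R]_n.+1 :=
  row_mx (u.1)%:M u.2 : 'rV_(1 + n).

Lemma measurable_rV_cons n :
  measurable_fun [set: measurableTypeR R * 'rV[R]_n] (@rV_cons n).
Proof.
apply: measurable_fun_rVP => i.
have [j ij|j ij] := split_ordP (i : 'I_(1 + n)).
  rewrite [X in measurable_fun _ X](_ : _ = fst); first exact: measurable_fst.
  by apply/funext => u /=; rewrite /rV_coord /rV_cons/= ij (@row_mxEl _ 1 1 n) mxE ord1 eqxx.
rewrite [X in measurable_fun _ X](_ : _ = rV_coord j \o snd).
  by apply: measurableT_comp; [exact: measurable_rV_coord|exact: measurable_snd].
by apply/funext => u /=; rewrite /rV_coord /rV_cons/= ij (@row_mxEr _ 1 1 n).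
Qed.

Definition rV_uncons n (v : 'rV[R]_n.+1) : R * 'rV[R]_n :=
  (v 0 0, rsubmx (v : 'rV_(1 + n))).

Lemma rV_consK n : cancel (@rV_cons n) (@rV_uncons n).
Proof.
move=> [x v]; rewrite /rV_uncons /rV_cons (@row_mxKr _ 1 1 n); congr pair.
rewrite (_ : 0 = lshift n (0 : 'I_1)) ?(@row_mxEl _ 1 1 n); last exact/val_inj.
by rewrite mxE eqxx.
Qed.

Lemma measurable_rV_uncons n :
  measurable_fun [set: 'rV[R]_n.+1]
    (@rV_uncons n : _ -> measurableTypeR R * 'rV[R]_n).
Proof.
apply/measurable_fun_pairP; split; first exact: measurable_rV_coord.
apply: measurable_fun_rVP => i.
rewrite [X in measurable_fun _ X](_ : _ = rV_coord (rshift 1 i)).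
  exact: measurable_rV_coord.
by apply/funext => v; rewrite /rV_coord/= mxE.
Qed.

End measurable_rV_lemmas.

Section lebesgue_rV.
Context (R : realType).
Local Open Scope ereal_scope.

Section step.
Context (n : nat) (mu : {sigma_finite_measure set 'rV[R]_n -> \bar R}).

Definition leb_step : set 'rV[R]_n.+1 -> \bar R :=
  pushforward ((@lebesgue_measure R) \x mu) (@rV_cons R n).

Let mcons := @measurable_rV_cons R n.

Let leb_step0 : leb_step set0 = 0.
Proof. by rewrite /leb_step /pushforward preimage_set0 measure0. Qed.

Let leb_step_ge0 A : 0 <= leb_step A.
Proof. exact: measure_ge0. Qed.

Let leb_step_sigma_additive : semi_sigma_additive leb_step.
Proof.
move=> F mF tF mUF; rewrite /leb_step /pushforward preimage_bigcup.
apply: measure_semi_sigma_additive.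
- by move=> k; rewrite -[X in measurable X]setTI; exact: mcons.
- apply/trivIsetP => /= i j _ _ ij; rewrite -preimage_setI.
  by move/trivIsetP : tF => /(_ _ _ _ _ ij) ->//; rewrite preimage_set0.
- by rewrite -preimage_bigcup -[X in measurable X]setTI; exact: mcons.
Qed.

HB.instance Definition _ := isMeasure.Build _ _ _ leb_step
  leb_step0 leb_step_ge0 leb_step_sigma_additive.

Let leb_step_sigma_finite : sigma_finite setT leb_step.
Proof.
have /sigma_finiteP[F [TF ndF Foo]] := sigma_finiteT (@lebesgue_measure R).
have /sigma_finiteP[G [TG ndG Goo]] := sigma_finiteT mu.
pose H k := F k `*` G k.
have UH : setT = \bigcup_k H k.
  rewrite -setXTT TF TG predeqE => -[x y]; split.
    move=> [/= [p _ Fpx] [q _ Gqy]]; exists (maxn p q) => //; split.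
    - by move: x Fpx; exact/subsetPset/ndF/leq_maxl.
    - by move: y Gqy; exact/subsetPset/ndG/leq_maxr.
  by move=> [p _ []/= ? ?]; split; exists p.
exists (fun k => @rV_uncons R n @^-1` H k).
  by rewrite -preimage_bigcup -UH preimage_setT.
move=> k; have [mFk Fkoo] := Foo k; have [mGk Gkoo] := Goo k.
have mHk : measurable (H k) by exact: measurableX.
split.
  by rewrite -[X in measurable X]setTI; exact: measurable_rV_uncons.
rewrite /leb_step /pushforward -comp_preimage.
rewrite (_ : _ \o _ = id); last by apply/funext => u /=; rewrite rV_consK.
by rewrite preimage_id product_measure1E// lte_mul_pinfty// ge0_fin_numE.
Qed.

HB.instance Definition _ := @Measure_isSigmaFinite.Build _ _ _ leb_step
  leb_step_sigma_finite.

End step.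

(* Lebesgue measure on R^n, as an iterated product along rV_cons *)
Fixpoint leb n : {sigma_finite_measure set 'rV[R]_n -> \bar R} :=
  match n with
  | 0 => \d_(0%R : 'rV[R]_0)
  | k.+1 => leb_step (leb k)
  end.

End lebesgue_rV.

Section cintegral.
Context d (T : measurableType d) (R : realType) (mu : {measure set T -> \bar R}).

Definition cmeasurable (f : T -> R[i]) :=
  measurable_fun setT (Re \o f : T -> R) /\ measurable_fun setT (Im \o f : T -> R).

Definition cintegrable (f : T -> R[i]) :=
  mu.-integrable setT (EFin \o (Re \o f)) /\
  mu.-integrable setT (EFin \o (Im \o f)).

Definition cintegral (f : T -> R[i]) : R[i] :=
  (\int[mu]_x Re (f x)) +i* (\int[mu]_x Im (f x)).

Definition Lfun2C : {pred T -> R[i]} :=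
  mem [set f : T -> R[i] | (Re \o f : T -> R) \in Lfun mu 2%:E /\
                           (Im \o f : T -> R) \in Lfun mu 2%:E].

Lemma Lfun2C_submod_closed : submod_closed Lfun2C.
Proof.
have p1 : (1 <= 2%:E :> \bar R)%E by rewrite lee_fin ler1n.
have [L0 LD] := @Lfun_submod_closed _ _ _ mu _ p1.
have LZ (a : R) (f : T -> R) : f \in Lfun mu 2%:E -> a *: f \in Lfun mu 2%:E.
  by move=> Lf; have := LD a _ _ Lf L0; rewrite addr0.
have LDD (f g : T -> R) : f \in Lfun mu 2%:E -> g \in Lfun mu 2%:E ->
    f + g \in Lfun mu 2%:E.
  by move=> Lf Lg; have := LD 1 _ _ Lf Lg; rewrite scale1r.
split.
  by rewrite inE /=; split; rewrite (_ : _ \o _ = 0).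
move=> a f g /[!inE]/= -[fR fI] [gR gI]; split.
- rewrite (_ : _ \o _ = Re a *: (Re \o f : T -> R) +
      ((- Im a) *: (Im \o f : T -> R) + (Re \o g : T -> R))).
    by apply: (LDD); [exact: LZ|apply: LDD => //; exact: LZ].
  apply/funext => x; rewrite !fctE/=; case: a (f x) (g x) => [a b] [u v] [p q] /=.
  by rewrite addrA scaleNr.
- rewrite (_ : _ \o _ = Re a *: (Im \o f : T -> R) +
      (Im a *: (Re \o f : T -> R) + (Im \o g : T -> R))).
    by apply: (LDD); [exact: LZ|apply: LDD => //; exact: LZ].
  apply/funext => x; rewrite !fctE/=; case: a (f x) (g x) => [a b] [u v] [p q] /=.
  by rewrite addrA.
Qed.

HB.instance Definition _ :=
  GRing.isSubmodClosed.Build _ _ Lfun2C Lfun2C_submod_closed.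

Record L2fun := MkL2fun { L2val :> T -> R[i]; _ : L2val \in Lfun2C }.

HB.instance Definition _ := [isSub for L2val].
HB.instance Definition _ := [Choice of L2fun by <:].
HB.instance Definition _ := [SubChoice_isSubLmodule of L2fun by <:].

Definition L2null : {pred L2fun} :=
  mem [set f : L2fun | {ae mu, forall x, f x = 0}].

Lemma L2null_zmod_closed : zmod_closed L2null.
Proof.
split; first by rewrite inE /=; apply/nearW => x.
move=> f g /[!inE]/= f0 g0; near=> x.
have fx : f x = 0 by near: x.
have gx : g x = 0 by near: x.
by rewrite !fctE/= fx gx subr0.
Unshelve. all: by end_near. Qed.

HB.instance Definition _ :=
  GRing.isZmodClosed.Build _ L2null L2null_zmod_closed.

Definition L2 := Quotient.quot L2null.

HB.instance Definition _ := Choice.on L2.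
HB.instance Definition _ := EqQuotient.on L2.
HB.instance Definition _ := GRing.Zmodule.on L2.

Definition L2_scale (a : R[i]) : L2 -> L2 := lift_op1 L2 ( *:%R a).

Lemma pi_L2_scale a : {morph \pi_L2 : f / a *: f >-> L2_scale a f}.
Proof.
move=> f; unlock L2_scale; apply/eqP.
rewrite -Quotient.idealrBE -scalerBr.
have : f - repr (\pi_L2 f) \in L2null.
  by rewrite Quotient.idealrBE reprK.
rewrite !inE/=; apply: filterS => x; rewrite !fctE => /= h.
by rewrite h scaler0.
Qed.

Lemma L2_scaleA a b v : L2_scale a (L2_scale b v) = L2_scale (a * b) v.
Proof. by rewrite -[v]reprK -!pi_L2_scale scalerA. Qed.

Lemma L2_scale1 : left_id 1 L2_scale.
Proof. by move=> v; rewrite -[v]reprK -!pi_L2_scale scale1r. Qed.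

Lemma L2_scaleDr : right_distributive L2_scale +%R.
Proof.
move=> a u v; rewrite -[u]reprK -[v]reprK -!pi_L2_scale.
by rewrite -!raddfD -pi_L2_scale scalerDr raddfD.
Qed.

Lemma L2_scaleDl v : {morph L2_scale^~ v : a b / a + b}.
Proof.
move=> a b; rewrite -[v]reprK -!pi_L2_scale scalerDl.
by rewrite raddfD.
Qed.

HB.instance Definition _ := GRing.Zmodule_isLmodule.Build R[i] L2
  L2_scaleA L2_scale1 L2_scaleDr L2_scaleDl.

Definition L2_dot (u v : L2) : R[i] :=
  cintegral (fun x => (repr u x)^* * repr v x).

End cintegral.

(* Operators with a domain are represented by their graphs, and
   [dot] is a scalar product, linear in the second variable. *)
Section operators.
Context (R : realType) (V : lmodType R[i]).

Definition operator := V -> V -> Prop.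

Implicit Types (A B S T : operator) (K W D : set V) (dot : V -> V -> R[i]).

Definition dom A : set V := [set x | exists y, A x y].

Definition op_app A (x : V) : V := xget 0 [set y | A x y].

Definition op_comp A B : operator := fun x z => exists y, B x y /\ A y z.

Definition op_inv A : operator := fun x y => A y x.

Definition op_sub A B : operator :=
  fun x y => exists u v, [/\ A x u, B x v & y = u - v].

Definition resolvent (lambda : R[i]) A : operator :=
  op_inv (op_sub A (fun x y => y = lambda *: x)).

Definition sqnorm dot (x : V) : R := Re (dot x x).

Definition is_dense dot D : Prop :=
  forall x (e : R), 0 < e -> exists y, D y /\ sqnorm dot (x - y) < e.

Definition adjoint dot A : operator :=
  fun y z => forall x w, A x w -> dot y w = dot z x.

Definition self_adjoint dot A : Prop :=
  is_dense dot (dom A) /\ forall x y, A x y <-> adjoint dot A x y.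

Definition is_positive dot A : Prop := forall x y, A x y -> 0 <= dot x y.

Definition complexification K : set V :=
  [set x | exists h k, [/\ K h, K k & x = h + 'i *: k]].

Definition tomita K : operator :=
  fun x y => exists h k, [/\ K h, K k, x = h + 'i *: k & y = h - 'i *: k].

(* [j] is a conjugate linear partial isometry with initial space the orthogonal
   complement of the kernel of [A] *)
Definition conj_partial_isometry dot A (j : V -> V) : Prop :=
  [/\ forall (a : R[i]) x y, j (a *: x + y) = a^* *: j x + j y,
      forall x, A x 0 -> j x = 0
    & forall x, (forall k, A k 0 -> dot k x = 0) ->
        sqnorm dot (j x) = sqnorm dot x].

(* S = j A is the polar decomposition of the conjugate linear operator S *)
Definition conj_polar dot S (j : V -> V) A : Prop :=
  [/\ self_adjoint dot A, is_positive dot A, conj_partial_isometry dot A j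
    & forall x y, S x y <-> op_comp (fun u v => v = j u) A x y].

(* delta = A A, where s = j A, A = delta^(1/2), is the polar decomposition of
   the Tomita operator s of K *)
Definition modular dot K : operator :=
  fun x y => exists j A, conj_polar dot (tomita K) j A /\ op_comp A A x y.

Definition graph_dot dot S (x y : V) : R[i] :=
  dot x y + dot (op_app S y) (op_app S x).

Definition complex_linear_extension A : operator :=
  fun x y => exists h k h' k',
    [/\ A h h', A k k', x = h + 'i *: k & y = h' + 'i *: k'].

Definition bounded_linear_on W dot A : Prop :=
  [/\ dom A = W,
      forall x y, A x y -> W y,
      forall x y y', A x y -> A x y' -> y = y',
      forall (a : R[i]) x y x' y',
        A x y -> A x' y' -> A (a *: x + x') (a *: y + y')
    & exists M : R, forall x y, A x y -> sqnorm dot y <= M * sqnorm dot x].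

Definition orthonormal_basis W dot (E : set V) : Prop :=
  [/\ E `<=` W,
      forall e e', E e -> E e' -> dot e e' = (e == e')%:R
    & forall x, W x -> (forall e, E e -> dot e x = 0) -> x = 0].

Definition hs_sum dot A (E : set V) : \bar R :=
  (\esum_(e in E) (sqnorm dot (op_app A e))%:E)%E.

Definition hilbert_schmidt W dot A : Prop :=
  bounded_linear_on W dot A /\
  exists E, orthonormal_basis W dot E /\ (hs_sum dot A E < +oo)%E.

(* For a bounded operator, [hs_sum] is the same for all orthonormal bases of the
   Hilbert space (W, dot); the infimum picks this common value. *)
Definition hs_norm W dot A : \bar R :=
  ereal_inf [set ((hs_sum dot A E) `^ 2^-1)%E | E in orthonormal_basis W dot].

End operators.

Section sobolev.
Context (R : realType) (d : nat).
Local Notation Rd := 'rV[R]_d.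

Definition inner (x y : Rd) : R := \sum_(i < d) x 0 i * y 0 i.

Definition eucl2 (x : Rd) : R := inner x x.

Definition partial (s : seq 'I_d) (f : Rd -> R) : Rd -> R :=
  foldr (fun i g => 'D_(delta_mx 0 i) g) f s.

Definition smooth (f : Rd -> R) : Prop :=
  forall s, continuous (partial s f) /\
    forall i x, derivable (partial s f) x (delta_mx 0 i).

Definition csmooth (f : Rd -> R[i]) : Prop :=
  smooth (Re \o f) /\ smooth (Im \o f).

Definition cpartial (s : seq 'I_d) (f : Rd -> R[i]) (x : Rd) : R[i] :=
  partial s (Re \o f) x +i* partial s (Im \o f) x.

Definition schwartz_weight (k : nat) (s : seq 'I_d) (f : Rd -> R[i]) (x : Rd) : R :=
  (1 + eucl2 x) ^+ k * ComplexField.Normc.normc (cpartial s f x).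

Definition schwartz (f : Rd -> R[i]) : Prop :=
  csmooth f /\
  forall k s, exists C : R, forall x, schwartz_weight k s f x <= C.

(* Only the values on Schwartz functions matter. *)
Definition distribution := (Rd -> R[i]) -> R[i].

Definition tempered (T : distribution) : Prop :=
  (forall (a : R[i]) f g, schwartz f -> schwartz g ->
     T (a *: f + g) = a * T f + T g) /\
  exists k n (C : R), forall f (M : R), schwartz f ->
    (forall s x, (size s <= n)%N -> schwartz_weight k s f x <= M) ->
    ComplexField.Normc.normc (T f) <= C * M.

Definition real_distribution (T : distribution) : Prop :=
  forall f, schwartz f -> (forall x, Im (f x) = 0) -> Im (T f) = 0.

Definition dist_of_fun (f : Rd -> R[i]) : distribution :=
  fun g => cintegral (leb R d) (fun x => f x * g x).

(* unitary normalization *)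
Definition fourier (f : Rd -> R[i]) (p : Rd) : R[i] :=
  ((2 * trigo.pi) `^ (- (d%:R / 2)))%:C *
  cintegral (leb R d) (fun x => f x * (cos (inner x p) -i* sin (inner x p))).

(* The Fourier transform of T, defined by duality, is the function v. If T is
   induced by an element of L^2, v is its Fourier-Plancherel transform. *)
Definition dist_fourier (T : distribution) (v : Rd -> R[i]) : Prop :=
  cmeasurable v /\
  forall f, schwartz f ->
    cintegrable (leb R d) (fun p => v p * f p) /\
    T (fourier f) = dist_of_fun v f.

(* the square of the H^s norm of T, when the Fourier transform of T is v *)
Definition sobolev_sqnorm (s : R) (v : Rd -> R[i]) : \bar R :=
  (\int[leb R d]_p
     ((1 + eucl2 p) `^ s * (ComplexField.Normc.normc (v p)) ^+ 2)%:E)%E.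

Definition sobolev (s : R) (T : distribution) : Prop :=
  [/\ tempered T, real_distribution T
    & exists v, dist_fourier T v /\ (sobolev_sqnorm s v < +oo)%E].

Definition unit_ball : set Rd := [set x | eucl2 x < 1].

Definition test_function (f : Rd -> R) : Prop :=
  [/\ smooth f, compact (closure [set x | f x != 0])
    & closure [set x | f x != 0] `<=` unit_ball].

Definition sobolev_ball (s : R) (T : distribution) : Prop :=
  sobolev s T /\
  forall e : R, 0 < e -> exists f, test_function f /\
    exists v,
      dist_fourier (fun g => T g - dist_of_fun (fun x => (f x)%:C) g) v /\
      (sobolev_sqnorm s v < e%:E)%E.

Definition Hspace := L2 (leb R d).

Definition Hdot : Hspace -> Hspace -> R[i] := @L2_dot _ _ _ (leb R d).

(* u = omega_m^s T, where omega_m^s multiplies the Fourier transform; for m = 0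
   the value of the multiplier at p = 0 is irrelevant. *)
Definition omega_pow (m s : R) (T : distribution) (u : Hspace) : Prop :=
  exists v, dist_fourier T v /\
    dist_fourier (dist_of_fun (repr u))
      (fun p => ((m ^+ 2 + eucl2 p) `^ (s / 2))%:C * v p).

Definition Kspace (m : R) : set Hspace :=
  [set x | exists f g u v,
    [/\ sobolev_ball (- 2^-1) f, sobolev_ball 2^-1 g,
        omega_pow m (- 2^-1) f u, omega_pow m 2^-1 g v & x = u + 'i *: v]].

Definition Qsymp (m : R) : operator Hspace :=
  fun x y => exists f g,
    [/\ sobolev_ball (- 2^-1) f, sobolev_ball 2^-1 g,
        exists u v, [/\ omega_pow m (- 2^-1) f u, omega_pow m 2^-1 g v
                      & x = u + 'i *: v]
      & exists u v, [/\ omega_pow 0 (- 2^-1) f u, omega_pow 0 2^-1 g v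
                      & y = u + 'i *: v]].

Definition Qext (m : R) : operator Hspace := complex_linear_extension (Qsymp m).

Definition K_complex (m : R) : set Hspace := complexification (Kspace m).

Definition dot_s (m : R) : Hspace -> Hspace -> R[i] :=
  graph_dot Hdot (tomita (Kspace m)).

Definition modular_K (m : R) : operator Hspace := modular Hdot (Kspace m).

Definition resolvent_difference (m : R) (lambda : R[i]) : operator Hspace :=
  op_sub (resolvent lambda (modular_K m))
    (op_comp (op_inv (Qext m)) (op_comp (resolvent lambda (modular_K 0)) (Qext m))).

End sobolev.

Arguments K_complex {R} d m.
Arguments dot_s {R} d m.
Arguments modular_K {R} d m.
Arguments Qext {R} d m.
Arguments Kspace {R} d m.
Arguments resolvent_difference {R} d m lambda.

(* Main.v *)
(* Identify K_m + i K_m with the space X of pairs (a, b), a and b in the closures of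
   the <p>^(-1/2) f^ and <p>^(1/2) f^ for test functions f supported in B, through
   (a, b) |-> U^-1 (sqrt (<p> / omega_m) a) + i U^-1 (sqrt (omega_m / <p>) b). The graph
   scalar product becomes M_m = 2 (int (<p> / omega_m) a^* a' + int (omega_m / <p>) b^* b'),
   while the symplectic form does not depend on m; injectivity and density of this map
   come from the vanishing of v whenever v and omega_m v annihilate the Fourier
   transforms of all test functions of a ball (Gevrey bumps and uniqueness in the
   Stieltjes moment problem). The resolvents of delta_m and delta_0 solve coercive
   variational problems on X whose forms differ by (M_m - M_0) / 2. Elements of X have
   point values bounded by their norm (insert a cut-off function), so Bessel's inequality
   bounds the Hilbert-Schmidt norm of the difference by integrals of the differences of
   the weights, which are O(sqrt m) as m -> 0 thanks to a product majorant that is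
   integrable in dimensions 2 and 3. *)

From HB Require Import structures.
From mathcomp Require Import all_boot all_order all_algebra.
From mathcomp Require Import generic_quotient ring_quotient complex.
From mathcomp Require Import all_classical all_reals all_analysis measurable_realfun.
From mathcomp Require Import ring lra zify.
Require Import Defs.

Set Implicit Arguments.
Unset Strict Implicit.
Unset Printing Implicit Defensive.

Import Order.TTheory GRing.Theory Num.Theory.
Import numFieldNormedType.Exports.

Local Open Scope classical_set_scope.
Local Open Scope ring_scope.
Local Open Scope complex_scope.

Local Notation Re := (@complex.Re _).
Local Notation Im := (@complex.Im _).
Local Notation nc := (@ComplexField.Normc.normc _).
Local Notation mfun := (measurable_fun setT).
Local Notation L1 mu f := (mu.-integrable setT (EFin \o f)).
Local Notation cint := cintegral.
Local Notation cL1 := cintegrable.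
Local Notation cmeas := cmeasurable.

(** The modular operators are never computed: a weak identity on K + iK ([modularE]) characterises
    delta and turns its resolvent equation into a variational problem for the form (M - sigma)/2 -
    lambda (M + sigma)/2, with sigma the symplectic form. As Q preserves sigma, it becomes the
    identity of X, and only the graph products M_m and M_0 remain to be compared. The obstacle is
    the point p = 0, where <p>/omega_m does not converge uniformly as m -> 0. The point bound
    |a(p)|^2 <= K |a|^2 on X repairs this: it makes a multiplier bounded as soon as its square is
    integrable up to a constant, and with Bessel's inequality at each p it gives Hilbert-Schmidt
    bounds. What is needed is an integrable function above |p|^(-3/2) near 0, the price for a factor
    sqrt m, and above |p|^(-4) at infinity, the decay of the squared weight differences; these
    exponents single out d = 2 and d = 3. The Hilbert-Schmidt norm being an infimum over orthonormal
    bases, one basis with a small sum is enough for the limit. *)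

Definition cconj (R : realType) (z : R[i]) : R[i] := conjc z.
Arguments cconj : simpl never.
Local Notation "z ^*" := (cconj z) : ring_scope.
Local Notation "z ^*" := (cconj z) : complex_scope.

Lemma eqW disp (T : porderType disp) (x y : T) : x = y -> (x <= y)%O.
by move=> ->. Qed.

(** * Modulus, real part, imaginary part and conjugate of complex numbers *)

Section complex_facts.
Context (R : realType).
Implicit Types z w : R[i].

Lemma ncE z : nc z = Num.sqrt (Re z ^+ 2 + Im z ^+ 2).
by case: z. Qed.

Lemma sqr_nc z : nc z ^+ 2 = Re z ^+ 2 + Im z ^+ 2.
by rewrite ncE sqr_sqrtr// addr_ge0// sqr_ge0. Qed.

Lemma nc_ge0 z : 0 <= nc z.
by rewrite ncE. Qed.

Lemma ncM z w : nc (z * w) = nc z * nc w.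
exact: ComplexField.Normc.normcM. Qed.

Lemma nc0 : nc (0 : R[i]) = 0.
exact: ComplexField.Normc.normc0. Qed.

Lemma nc1 : nc (1 : R[i]) = 1.
exact: ComplexField.Normc.normc1. Qed.

Lemma nc_eq0 z : nc z = 0 -> z = 0.
exact: ComplexField.Normc.eq0_normc. Qed.

Lemma ncD z w : nc (z + w) <= nc z + nc w.
exact: le_normcD. Qed.

Lemma ncN z : nc (- z) = nc z.
by case: z => a b; rewrite !ncE /= !sqrrN. Qed.

Lemma ncB z w : nc (z - w) <= nc z + nc w.
by rewrite -(ncN w); exact: ncD. Qed.

Lemma nc_conj z : nc z^* = nc z.
by case: z => a b; rewrite !ncE /= sqrrN. Qed.

Lemma nc_real (a : R) : nc a%:C = `|a|.
by rewrite ncE /= expr0n/= addr0 sqrtr_sqr. Qed.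

Lemma nc_Re z : `|Re z| <= nc z.
by rewrite ncE -sqrtr_sqr ler_wsqrtr// lerDl sqr_ge0. Qed.

Lemma nc_Im z : `|Im z| <= nc z.
by rewrite ncE -sqrtr_sqr ler_wsqrtr// lerDr sqr_ge0. Qed.

Lemma nc_le_ReIm z : nc z <= `|Re z| + `|Im z|.
rewrite ncE -[leRHS]ger0_norm// -sqrtr_sqr ler_wsqrtr//.
rewrite sqrrD -!normrX !(ger0_norm (sqr_ge0 _)).
have : 0 <= `|Re z| * `|Im z| by [].
lra.
Qed.

Lemma ncX z n : nc (z ^+ n) = nc z ^+ n.
by elim: n => [|n ih]; rewrite ?nc1// !exprS ncM ih. Qed.

Lemma ReD z w : Re (z + w) = Re z + Re w. by case: z w => [? ?] []. Qed.
Lemma ImD z w : Im (z + w) = Im z + Im w. by case: z w => [? ?] []. Qed.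
Lemma ReN z : Re (- z) = - Re z. by case: z. Qed.
Lemma ImN z : Im (- z) = - Im z. by case: z. Qed.
Lemma ReM z w : Re (z * w) = Re z * Re w - Im z * Im w.
by case: z w => [? ?] []. Qed.
Lemma ImM z w : Im (z * w) = Re z * Im w + Im z * Re w.
by case: z w => [? ?] [? ?] /=. Qed.
Lemma ReJ z : Re z^* = Re z. by case: z. Qed.
Lemma ImJ z : Im z^* = - Im z. by case: z. Qed.
Lemma ReZ (a : R) z : Re (a%:C * z) = a * Re z.
by rewrite ReM /= mul0r subr0. Qed.
Lemma ImZ (a : R) z : Im (a%:C * z) = a * Im z.
by rewrite ImM /= mul0r addr0. Qed.

Lemma complex_eqP z w : Re z = Re w -> Im z = Im w -> z = w.
by case: z w => [? ?] [? ?] /= -> ->. Qed.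

Lemma mul_conjC z : z^* * z = (nc z ^+ 2)%:C.
apply: complex_eqP; rewrite ?ReM ?ImM ?ReJ ?ImJ sqr_nc /=; ring.
Qed.

Lemma conjcE z : conjc z = z^*. by []. Qed.
Lemma conjE z : Num.conj z = z^*. by []. Qed.
Lemma conjcD z w : (z + w)^* = z^* + w^*. exact: (rmorphD (@conjc R)). Qed.
Lemma conjcM z w : (z * w)^* = z^* * w^*. exact: (rmorphM (@conjc R)). Qed.
Lemma conjcN z : (- z)^* = - z^*. exact: (rmorphN (@conjc R)). Qed.
Lemma conjcB z w : (z - w)^* = z^* - w^*. exact: (rmorphB (@conjc R)). Qed.
Lemma cconjK z : z^*^* = z. exact: conjcK. Qed.
Lemma cconj0 : (0 : R[i])^* = 0. exact: conjc0. Qed.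
Lemma cconj1 : (1 : R[i])^* = 1. exact: conjc1. Qed.
Lemma cconj_real (a : R) : a%:C^* = a%:C. exact: conjc_real. Qed.
Lemma cconj_inv z : (z^-1)^* = (z^*)^-1. exact: conjc_inv. Qed.
Lemma cconj_i : ('i : R[i])^* = - 'i. by apply: complex_eqP => /=; rewrite ?oppr0. Qed.
End complex_facts.

(** The inverse is y (y^2)^(-1), also at y = 0 where both vanish; this reduces the claim to the
    measurability of a real power of a nonnegative argument. *)
Lemma mfun_funV d (T : measurableType d) (R : realType) (f : T -> R) :
  mfun f -> mfun (fun x => (f x)^-1).
move=> mf; rewrite (_ : (fun x => _) = (fun x => f x * (f x ^+ 2) `^ (-1))).
  by apply: measurable_funM => //; apply: (measurableT_comp (measurable_powR _)); exact: measurable_funX.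
apply/funext => x; rewrite powR_inv1 ?sqr_ge0// invfM mulrA.
by have [->|f0] := eqVneq (f x) 0; rewrite ?invr0 ?mulr0// divff// mul1r.
Qed.

(** * Measurability and integration of complex-valued functions *)

Section cintegral_theory.
Context d (T : measurableType d) (R : realType).
Variable mu : {measure set T -> \bar R}.
Implicit Types f g : T -> R[i].

Lemma cmeas_real (f : T -> R) : mfun f -> cmeas (fun x => (f x)%:C).
by move=> mf; split => //; exact: measurable_cst. Qed.

Lemma cmeas_cst (c : R[i]) : cmeas (fun _ : T => c).
by split; exact: measurable_cst. Qed.

Lemma cmeasD f g : cmeas f -> cmeas g -> cmeas (fun x => f x + g x).
move=> [f1 f2] [g1 g2]; split.
  rewrite (_ : _ \o _ = (Re \o f : T -> R) \+ (Re \o g : T -> R)).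
    exact: measurable_funD.
  by apply/funext => x /=; rewrite ReD.
rewrite (_ : _ \o _ = (Im \o f : T -> R) \+ (Im \o g : T -> R)).
  exact: measurable_funD.
by apply/funext => x /=; rewrite ImD.
Qed.

Lemma cmeasM f g : cmeas f -> cmeas g -> cmeas (fun x => f x * g x).
move=> [f1 f2] [g1 g2]; split.
  rewrite (_ : _ \o _ = ((Re \o f : T -> R) \* (Re \o g : T -> R)) \- ((Im \o f : T -> R) \* (Im \o g : T -> R))).
    by apply: measurable_funB; exact: measurable_funM.
  by apply/funext => x /=; rewrite ReM.
rewrite (_ : _ \o _ = ((Re \o f : T -> R) \* (Im \o g : T -> R)) \+ ((Im \o f : T -> R) \* (Re \o g : T -> R))).
  by apply: measurable_funD; exact: measurable_funM.
by apply/funext => x /=; rewrite ImM.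
Qed.

Lemma cmeasZ (c : R[i]) f : cmeas f -> cmeas (fun x => c * f x).
by move=> mf; apply: cmeasM => //; exact: cmeas_cst. Qed.

Lemma cmeas_conj f : cmeas f -> cmeas (fun x => (f x)^*).
move=> [f1 f2]; split.
  by rewrite (_ : _ \o _ = Re \o f)//; apply/funext => x /=; rewrite ReJ.
rewrite (_ : _ \o _ = \- (Im \o f : T -> R)); first exact: measurable_funN f2.
by apply/funext => x /=; rewrite ImJ.
Qed.

Lemma cmeasN f : cmeas f -> cmeas (fun x => - f x).
by move=> /(cmeasZ (-1)); rewrite (_ : (fun x => _) = (fun x => - f x))//;
  apply/funext => x; rewrite mulN1r.
Qed.

Lemma cmeasB f g : cmeas f -> cmeas g -> cmeas (fun x => f x - g x).
by move=> mf mg; apply: cmeasD => //; exact: cmeasN. Qed.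

Lemma cmeas_nc f : cmeas f -> mfun (fun x => nc (f x)).
move=> [f1 f2]; under eq_fun do rewrite ncE.
apply: (measurableT_comp (continuous_measurable_fun (@sqrt_continuous R))).
by apply: measurable_funD; exact: measurable_funX.
Qed.

Lemma L1_meas (f : T -> R) : L1 mu f -> mfun f.
by move=> /measurable_int /measurable_EFinP. Qed.

Lemma L1Z (k : R) (f : T -> R) : L1 mu f ->
  L1 mu (fun x => k * f x).
exact: (integrableZl measurableT).
Qed.

Lemma L1D (f g : T -> R) : L1 mu f ->
  L1 mu g ->
  L1 mu (fun x => f x + g x).
exact: integrableD.
Qed.

Lemma le_L1 (f g : T -> R) : mfun f ->
  (forall x, `|f x| <= g x) -> L1 mu g ->
  L1 mu f.
move=> mf fg ig; apply: (le_integrable measurableT _ _ ig).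
  exact/measurable_EFinP.
by move=> x _ /=; rewrite lee_fin (le_trans (fg x))// ler_norm.
Qed.

Lemma ge0_L1 (f : T -> R) : mfun f -> (forall x, 0 <= f x) ->
  (\int[mu]_x (f x)%:E < +oo)%E -> L1 mu f.
move=> mf f0 h; apply/integrableP; split; first exact/measurable_EFinP.
by under eq_integral do rewrite /= ger0_norm//.
Qed.

Lemma ae_L1 (f g : T -> R) : mfun g -> {ae mu, forall x, f x = g x} ->
  L1 mu f -> L1 mu g.
move=> /measurable_EFinP mg fg /integrableP[mf]; rewrite (_ : (\int[mu]_x _)%E = (\int[mu]_x `|(EFin \o g) x|)%E).
  by move=> h; apply/integrableP.
by apply: ae_eq_integral => //; [exact: measurableT_comp|exact: measurableT_comp|apply: filterS fg => x /= ->].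
Qed.

Lemma cint_nc f : cL1 mu f -> L1 mu (fun x => nc (f x)).
move=> [f1 f2].
apply: (@le_L1 _ (fun x => `|Re (f x)| + `|Im (f x)|)).
- by apply: cmeas_nc; split; exact: L1_meas.
- by move=> x; rewrite ger0_norm ?nc_ge0// nc_le_ReIm.
- rewrite (_ : _ \o _ = (EFin \o (fun x => `|Re (f x)|)) \+ (EFin \o (fun x => `|Im (f x)|))).
    by apply: integrableD => //; exact: integrable_norm.
  by [].
Qed.

Lemma cL1_le f (g : T -> R) : cmeas f -> (forall x, nc (f x) <= g x) ->
  L1 mu g -> cL1 mu f.
move=> [f1 f2] fg ig; split; apply: le_L1 _ _ ig => // x.
  exact: (le_trans (nc_Re _)).
exact: (le_trans (nc_Im _)).
Qed.

Lemma cL1_meas f : cL1 mu f -> cmeas f.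
by move=> [? ?]; split; exact: L1_meas. Qed.

Lemma cL1P f : cL1 mu f <->
  cmeas f /\ L1 mu (fun x => nc (f x)).
split=> [fi|[mf fi]]; last exact: cL1_le mf _ fi.
by split; [exact: cL1_meas|exact: cint_nc].
Qed.

Lemma cL1D f g : cL1 mu f -> cL1 mu g ->
  cL1 mu (fun x => f x + g x).
move=> [f1 f2] [g1 g2]; split.
  rewrite (_ : _ \o _ = (EFin \o (Re \o f : T -> R)) \+ (EFin \o (Re \o g : T -> R))); last first.
    by apply/funext => x /=; rewrite ReD.
  exact: integrableD.
rewrite (_ : _ \o _ = (EFin \o (Im \o f : T -> R)) \+ (EFin \o (Im \o g : T -> R))); last first.
  by apply/funext => x /=; rewrite ImD.
exact: integrableD.
Qed.

Lemma cL1Z (c : R[i]) f : cL1 mu f -> cL1 mu (fun x => c * f x).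
move=> fi; have [mf ncf] := (cL1P f).1 fi.
apply: (@cL1_le _ (fun x => nc c * nc (f x))); first exact: cmeasZ.
  by move=> x; rewrite ncM.
exact: L1Z.
Qed.

Lemma cL1_conj f : cL1 mu f -> cL1 mu (fun x => (f x)^*).
move=> fi; have [mf ncf] := (cL1P f).1 fi.
apply: (@cL1_le _ (fun x => nc (f x))) => //; first exact: cmeas_conj.
by move=> x; rewrite nc_conj.
Qed.

Lemma cL1N f : cL1 mu f -> cL1 mu (fun x => - f x).
by move=> /(cL1Z (-1)); under eq_fun do rewrite mulN1r.
Qed.

Lemma cL1B f g : cL1 mu f -> cL1 mu g ->
  cL1 mu (fun x => f x - g x).
by move=> fi gi; apply: cL1D => //; exact: cL1N. Qed.

Lemma cL10 : cL1 mu (fun _ : T => 0).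
by split; exact: integrable0. Qed.

Lemma cL1_sum I (r : seq I) (F : I -> T -> R[i]) :
  (forall i, cL1 mu (F i)) -> cL1 mu (fun x => \sum_(i <- r) F i x).
move=> Fi; elim: r => [|i r ih].
  by under eq_fun do rewrite big_nil; exact: cL10.
by under eq_fun do rewrite big_cons; exact: cL1D.
Qed.

Lemma cL1_bound f g (M : R) : cL1 mu f -> cmeas g ->
  (forall x, nc (g x) <= M) -> cL1 mu (fun x => g x * f x).
move=> fi mg gM; have [mf ncf] := (cL1P f).1 fi.
apply: (@cL1_le _ (fun x => M * nc (f x))).
- exact: cmeasM.
- by move=> x; rewrite ncM ler_wpM2r// nc_ge0.
- exact: L1Z.
Qed.

Lemma Rintegral_sumR I (r : seq I) (F : I -> T -> R) :
  (forall i, L1 mu (F i)) ->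
  L1 mu (fun x => \sum_(i <- r) F i x) /\
  \int[mu]_x (\sum_(i <- r) F i x) = \sum_(i <- r) \int[mu]_x F i x.
move=> Fi; elim: r => [|i r [ih1 ih2]].
  have -> : (fun x => \sum_(i <- [::]) F i x) = fun=> 0 by apply/funext => x; rewrite big_nil.
  by rewrite Rintegral_cst// mul0r big_nil; split => //; exact: integrable0.
have -> : (fun x => \sum_(j <- i :: r) F j x) = (fun x => F i x + \sum_(j <- r) F j x).
  by apply/funext => x; rewrite big_cons.
by rewrite big_cons -ih2 -RintegralD//; split; [exact: L1D|].
Qed.

Lemma eq_cint f g : f =1 g -> cint mu f = cint mu g.
by move=> /funext ->. Qed.

Lemma cint0 : cint mu (fun _ : T => 0) = 0.
by rewrite /cint /= /Rintegral integral0. Qed.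

Lemma cintD f g : cL1 mu f -> cL1 mu g ->
  cint mu (fun x => f x + g x) = cint mu f + cint mu g.
move=> [f1 f2] [g1 g2]; apply: complex_eqP; rewrite /=.
  rewrite -RintegralD//; apply: eq_Rintegral => x _; exact: ReD.
rewrite -RintegralD//; apply: eq_Rintegral => x _; exact: ImD.
Qed.

Lemma cintZ (c : R[i]) f : cL1 mu f ->
  cint mu (fun x => c * f x) = c * cint mu f.
move=> [f1 f2].
have i1 a := L1Z a f1; have i2 a := L1Z a f2.
apply: complex_eqP; rewrite ?ReM ?ImM /=.
  rewrite -RintegralZl// -RintegralZl// -RintegralB//.
  by apply: eq_Rintegral => x _; rewrite ReM.
rewrite -RintegralZl// -RintegralZl// -RintegralD//.
by apply: eq_Rintegral => x _; rewrite ImM.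
Qed.

Lemma cintN f : cL1 mu f ->
  cint mu (fun x => - f x) = - cint mu f.
by move=> fi; rewrite -mulN1r -cintZ//; apply: eq_cint => x; rewrite mulN1r.
Qed.

Lemma cintB f g : cL1 mu f -> cL1 mu g ->
  cint mu (fun x => f x - g x) = cint mu f - cint mu g.
by move=> fi gi; rewrite cintD// ?cintN//; exact: cL1N. Qed.

Lemma cint_sum I (r : seq I) (F : I -> T -> R[i]) :
  (forall i, cL1 mu (F i)) ->
  cint mu (fun x => \sum_(i <- r) F i x) = \sum_(i <- r) cint mu (F i).
move=> Fi; elim: r => [|i r ih].
  by rewrite big_nil -[RHS]cint0; apply: eq_cint => x; rewrite big_nil.
rewrite big_cons -ih -cintD//; last exact: cL1_sum.
by apply: eq_cint => x; rewrite big_cons.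
Qed.

Lemma cint_conj f : cL1 mu f ->
  cint mu (fun x => (f x)^*) = (cint mu f)^*.
move=> [f1 f2]; apply: complex_eqP; rewrite /=.
  by apply: eq_Rintegral => x _; rewrite ReJ.
rewrite -mulN1r -RintegralZl//.
by apply: eq_Rintegral => x _; rewrite ImJ mulN1r.
Qed.

Lemma cint_real (f : T -> R) : cint mu (fun x => (f x)%:C) = (\int[mu]_x f x)%:C.
by apply: complex_eqP => //=; rewrite /Rintegral integral0. Qed.

(** With z the integral, |z|^2 is the real part of the integral of (conj z) f, hence at most |z| int
    |f|; then divide by |z|. *)
Lemma le_nc_cint f : cL1 mu f -> nc (cint mu f) <= \int[mu]_x nc (f x).
move=> fi; have inc := cint_nc fi.
have [->|z0] := eqVneq (nc (cint mu f)) 0.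
  by apply: Rintegral_ge0 => x _; exact: nc_ge0.
rewrite -(@ler_pM2l _ (nc (cint mu f))); last by rewrite lt_neqAle eq_sym z0 nc_ge0.
rewrite -expr2.
have -> : nc (cint mu f) ^+ 2 = Re ((cint mu f)^* * cint mu f).
  by rewrite mul_conjC.
rewrite -cintZ// /= -RintegralZl//.
apply: le_Rintegral => //; first exact: (cL1Z (cint mu f)^* fi).1.
  exact: L1Z.
move=> x _; apply: (le_trans (ler_norm _)); apply: (le_trans (nc_Re _)).
by rewrite ncM nc_conj.
Qed.

Lemma ae_eq_Rintegral (f g : T -> R) :
  mfun f -> mfun g ->
  {ae mu, forall x, f x = g x} -> \int[mu]_x f x = \int[mu]_x g x.
move=> mf mg fg; rewrite /Rintegral; congr fine.
apply: ae_eq_integral => //; [exact/measurable_EFinP|exact/measurable_EFinP|].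
by apply: filterS fg => x /= -> .
Qed.

Lemma ae_eq_cint f g : cmeas f -> cmeas g ->
  {ae mu, forall x, f x = g x} -> cint mu f = cint mu g.
move=> [f1 f2] [g1 g2] fg; apply: complex_eqP => /=.
  by apply: ae_eq_Rintegral => //; apply: filterS fg => x /= ->.
by apply: ae_eq_Rintegral => //; apply: filterS fg => x /= ->.
Qed.

Lemma ae_cintegrable f g : cmeas g ->
  {ae mu, forall x, f x = g x} -> cL1 mu f -> cL1 mu g.
by move=> [g1 g2] fg [f1 f2]; split; [apply: ae_L1 f1|apply: ae_L1 f2];
  rewrite //; apply: filterS fg => x /= ->.
Qed.

Lemma dominated_cvgR (f_ : nat -> T -> R) (f : T -> R) (g : T -> R) :
  (forall n, mfun (f_ n)) -> mfun f ->
  {ae mu, forall x, f_ ^~ x @ \oo --> f x} ->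
  L1 mu g ->
  (forall n x, `|f_ n x| <= g x) ->
  (\int[mu]_x f_ n x) @[n --> \oo] --> \int[mu]_x f x.
move=> mfn mf fnf ig fg.
have [|||||] := @dominated_convergence _ T R mu setT measurableT
    (fun n => EFin \o f_ n) (EFin \o f) (EFin \o g).
- by move=> n; exact/measurable_EFinP.
- exact/measurable_EFinP.
- by apply: filterS fnf => x /= h _; apply/cvg_EFin; [exact: nearW|exact: h].
- by [].
- by apply: nearW => x n _ /=; rewrite lee_fin.
move=> iff _ h; rewrite /Rintegral.
apply: fine_cvg; rewrite fineK//.
exact: integrable_fin_num.
Qed.

(** Fatou's lemma for a sequence converging everywhere: a uniform bound on the integrals passes to
    the limit without a dominating function. *)
Lemma fatou_bound (f_ : nat -> T -> R) (f : T -> R) (C : R) :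
  (forall n, mfun (f_ n)) -> (forall n x, 0 <= f_ n x) ->
  (forall x, f_ n x @[n --> \oo] --> f x) ->
  (forall n, (\int[mu]_x (f_ n x)%:E <= C%:E)%E) -> (\int[mu]_x (f x)%:E <= C%:E)%E.
move=> mf f0 cf hC; pose g n x := (f_ n x)%:E.
rewrite (_ : (\int[mu]_x _)%E = (\int[mu]_x limn_einf (g ^~ x))%E); last first.
  by apply: eq_integral => x _; apply/esym/(cvg_limn_einf_sup _).1/cvg_EFin; [exact: nearW|exact: cf].
apply: (le_trans (fatou mu measurableT _ _)).
- by move=> n; exact/measurable_EFinP.
- by move=> n x _; rewrite lee_fin.
rewrite limn_einf_lim; apply: lime_le; first exact: is_cvg_einfs.
by apply: nearW => n; apply: le_trans (hC n); apply: ereal_inf_lbound; exists n => /=.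
Qed.

Lemma nc_cvg0P (u : nat -> R[i]) : nc (u n) @[n --> \oo] --> (0 : R) <->
  (Re (u n) @[n --> \oo] --> (0 : R)) /\ (Im (u n) @[n --> \oo] --> (0 : R)).
split=> [h|[h1 h2]].
  split; apply/norm_cvg0P; apply: squeeze_cvgr _ (cvg_cst 0) h; apply: nearW => n.
    by rewrite normr_ge0 nc_Re.
  by rewrite normr_ge0 nc_Im.
have h3 : `|Re (u n)| + `|Im (u n)| @[n --> \oo] --> 0.
  by rewrite -[X in _ --> X]addr0; apply: cvgD; apply/norm_cvg0P.
apply: squeeze_cvgr _ (cvg_cst 0) h3; apply: nearW => n.
by rewrite nc_ge0 nc_le_ReIm.
Qed.

Lemma dominated_cvgC (f_ : nat -> T -> R[i]) (f : T -> R[i]) (g : T -> R) :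
  (forall n, cmeas (f_ n)) -> cmeas f ->
  {ae mu, forall x, nc (f_ n x - f x) @[n --> \oo] --> (0 : R)} ->
  L1 mu g ->
  (forall n x, nc (f_ n x) <= g x) ->
  nc (cint mu (f_ n) - cint mu f) @[n --> \oo] --> (0 : R).
move=> mfn mf fnf ig fg; have conv (p : R[i] -> R) : (forall z w, p (z - w) = p z - p w) ->
    (forall z, `|p z| <= nc z) -> (forall h : T -> R[i], cmeas h -> mfun (p \o h)) ->
    \int[mu]_x p (f_ n x) @[n --> \oo] --> \int[mu]_x p (f x).
  move=> pB pn pm; apply: (dominated_cvgR (g := g)) => // [n|||n x]; [exact/pm/mfn|exact: pm| |].
    apply: filterS fnf => x h; apply/subr_cvg0/norm_cvg0P; apply: squeeze_cvgr _ (cvg_cst 0) h.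
    by apply: nearW => n; rewrite normr_ge0 -pB pn.
  exact: le_trans (fg n x).
apply/nc_cvg0P; split; under eq_fun do rewrite ?ReD ?ReN ?ImD ?ImN /=; apply/subr_cvg0.
  by apply: (conv Re) => [z w|z|h []]; rewrite ?ReD ?ReN ?nc_Re.
by apply: (conv Im) => [z w|z|h []]; rewrite ?ImD ?ImN ?nc_Im.
Qed.

End cintegral_theory.

(** * Fubini's theorem for real and complex integrals *)

Section cfubini.
Context d1 d2 (T1 : measurableType d1) (T2 : measurableType d2) (R : realType).
Variable m1 : {sigma_finite_measure set T1 -> \bar R}.
Variable m2 : {sigma_finite_measure set T2 -> \bar R}.

(** The inner integrals are finite only almost everywhere, which is enough to replace them by their
    [fine] part under the outer integral. *)
Lemma Rintegral_fubini (f : T1 * T2 -> R) : L1 (m1 \x m2)%E f ->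
  \int[m1]_x \int[m2]_y f (x, y) = \int[m2]_y \int[m1]_x f (x, y).
move=> fi; have := Fubini fi; rewrite /Rintegral /= => h.
have a2 := ae_integrable2 fi.
congr fine.
transitivity (\int[m1]_x \int[m2]_y (EFin \o f) (x, y))%E.
  apply: ae_eq_integral => //.
  - apply/measurable_EFinP; apply: (measurableT_comp (fine_measurable measurableT)).
    exact: measurable_fubini_F fi.
  - exact: measurable_fubini_F fi.
  - by apply: filterS (ae_integrable1 fi) => x ix _; rewrite fineK//; exact: integrable_fin_num.
rewrite h; apply/esym; apply: ae_eq_integral => //.
- apply/measurable_EFinP; apply: (measurableT_comp (fine_measurable measurableT)).
  exact: measurable_fubini_G fi.
- exact: measurable_fubini_G fi.
- by apply: filterS a2 => x ix _; rewrite fineK//; exact: integrable_fin_num.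
Qed.

Lemma Rintegral_prod (f : T1 * T2 -> R) : L1 (m1 \x m2)%E f ->
  \int[(m1 \x m2)%E]_z f z = \int[m1]_x \int[m2]_y f (x, y).
move=> fi; have := integral12_prod_meas1 fi; rewrite /Rintegral /= => h.
congr fine; rewrite -h.
apply/esym; apply: ae_eq_integral => //.
- apply/measurable_EFinP; apply: (measurableT_comp (fine_measurable measurableT)).
  exact: measurable_fubini_F fi.
- exact: measurable_fubini_F fi.
- by apply: filterS (ae_integrable1 fi) => x ix _; rewrite fineK//; exact: integrable_fin_num.
Qed.

Lemma cint_fubini (f : T1 * T2 -> R[i]) : cL1 (m1 \x m2)%E f ->
  cint m1 (fun x => cint m2 (fun y => f (x, y))) =
  cint m2 (fun y => cint m1 (fun x => f (x, y))).
by move=> [f1 f2]; apply: complex_eqP; [exact: Rintegral_fubini f1|exact: Rintegral_fubini f2].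
Qed.

Lemma cint_prod (f : T1 * T2 -> R[i]) : cL1 (m1 \x m2)%E f ->
  cint (m1 \x m2)%E f = cint m1 (fun x => cint m2 (fun y => f (x, y))).
by move=> [f1 f2]; apply: complex_eqP; [exact: Rintegral_prod f1|exact: Rintegral_prod f2].
Qed.

Lemma cL1_prodP (f : T1 * T2 -> R[i]) : cmeas f ->
  (\int[m1]_x \int[m2]_y (nc (f (x, y)))%:E < +oo)%E ->
  cL1 (m1 \x m2)%E f.
move=> mf h; apply/cL1P; split => //.
apply/integrable12ltyP; first by apply/measurable_EFinP; exact: cmeas_nc.
by under eq_integral do under eq_integral do rewrite /= ger0_norm ?nc_ge0//.
Qed.

Lemma cL1_prod_mul (f : T1 -> R[i]) (g : T2 -> R[i]) :
  cL1 m1 f -> cL1 m2 g ->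
  cL1 (m1 \x m2)%E (fun z => f z.1 * g z.2).
move=> fi gi; apply: cL1_prodP => /=.
  apply: cmeasM.
    have [h1 h2] := cL1_meas fi.
    by split; [exact: measurableT_comp h1 measurable_fst|exact: measurableT_comp h2 measurable_fst].
  have [h1 h2] := cL1_meas gi.
  by split; [exact: measurableT_comp h1 measurable_snd|exact: measurableT_comp h2 measurable_snd].
have hf := cint_nc fi; have hg := cint_nc gi.
under eq_integral => x _.
  under eq_integral do rewrite ncM EFinM.
  rewrite ge0_integralZl//; [|exact: measurable_int hg|by move=> y _; rewrite lee_fin nc_ge0|by rewrite lee_fin nc_ge0].
  over.
rewrite ge0_integralZr//.
- rewrite lte_mul_pinfty//.
  + by apply: integral_ge0 => x _; rewrite lee_fin nc_ge0.
  + exact: integrable_fin_num.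
  + by rewrite -ge0_fin_numE; [exact: integrable_fin_num|by apply: integral_ge0 => x _; rewrite lee_fin nc_ge0].
- exact: measurable_int hf.
- by move=> x _; rewrite lee_fin nc_ge0.
- by apply: integral_ge0 => x _; rewrite lee_fin nc_ge0.
Qed.

End cfubini.

(** * Change of variables along a map that multiplies the measure by a constant *)

Section cpushforward.
Context d1 d2 (T1 : measurableType d1) (T2 : measurableType d2) (R : realType).
Variables (mu : {measure set T1 -> \bar R}) (nu : {measure set T2 -> \bar R}).
Variable (phi : T1 -> T2).
Hypothesis mphi : mfun phi.
(* [phi] pushes [mu] forward to [c nu] *)
Variable (c : R).
Hypothesis c0 : 0 < c.
Hypothesis munu : forall A, measurable A -> mu (phi @^-1` A) = (c%:E * nu A)%E.

Lemma cmeas_comp (f : T2 -> R[i]) : cmeas f -> cmeas (f \o phi).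
by move=> [f1 f2]; split; [exact: measurableT_comp f1 mphi|exact: measurableT_comp f2 mphi].
Qed.

Lemma ge0_integral_push (f : T2 -> \bar R) : mfun f ->
  (forall x, 0 <= f x)%E -> (\int[mu]_x f (phi x) = c%:E * \int[nu]_y f y)%E.
move=> mf f0.
have := @ge0_integral_pushforward _ _ _ _ R phi mphi mu setT f.
rewrite /= => h; rewrite -[LHS]h => {h}//.
pose cc := NngNum (ltW c0).
transitivity (\int[mscale cc nu]_y f y)%E.
  apply: eq_measure_integral => A mA _.
  exact: munu mA.
by rewrite ge0_integral_mscale//.
Qed.

Lemma Rintegrable_push (f : T2 -> R) : L1 nu f ->
  L1 mu (f \o phi).
move=> /integrableP[mf fi]; apply/integrableP; split.
  by apply: (measurableT_comp mf).
rewrite (@ge0_integral_push (fun y => `|(EFin \o f) y|%E)) //; last first.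
  by apply: measurableT_comp.
rewrite lte_mul_pinfty//; exact: ltW.
Qed.

Lemma Rintegral_push (f : T2 -> R) : L1 nu f ->
  \int[mu]_x f (phi x) = c * \int[nu]_y f y.
move=> fi; rewrite /Rintegral integralE [in RHS]integralE.
have mf := measurable_int _ fi.
have e2 := @ge0_integral_push (EFin \o f)^\-%E (measurable_funeneg mf) (fun x => funeneg_ge0 _ x).
rewrite (_ : (fun x => (f (phi x))%:E) = (EFin \o f) \o phi)//.
rewrite funepos_comp funeneg_comp /= (@ge0_integral_push (EFin \o f)^\+%E (measurable_funepos mf) (fun x => funepos_ge0 _ x)) e2.
have /fineK <- := integrable_pos_fin_num measurableT fi.
have /fineK <- := integrable_neg_fin_num measurableT fi.
by rewrite /= mulrBr.
Qed.

Lemma cL1_push (f : T2 -> R[i]) : cL1 nu f -> cL1 mu (f \o phi).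
by move=> [f1 f2]; split; [exact: Rintegrable_push f1|exact: Rintegrable_push f2]. Qed.

Lemma cint_push (f : T2 -> R[i]) : cL1 nu f ->
  cint mu (f \o phi) = c%:C * cint nu f.
move=> [f1 f2]; apply: complex_eqP; rewrite ?ReZ ?ImZ /=.
  exact: Rintegral_push f1.
exact: Rintegral_push f2.
Qed.

End cpushforward.

(** [side] closes goals on signs, measurability, integrability and continuity by recursion on the
    shape of the goal. [side_leaf] is its hook, redefined whenever a block of the development brings
    in new basic functions. *)
Ltac side_leaf := fail.
Ltac side := solve [assumption | side_leaf | side_sign | side_meas | done]
with side_sign := match goal with
  | |- is_true (_ && _) => apply/andP; split; side
  | |- is_true (_ != _) => apply: lt0r_neq0; side
  | |- is_true (Order.le _ (EFin _)) => rewrite lee_fin; side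
  | |- is_true (Order.lt _ (EFin _)) => rewrite lte_fin; side
  | |- is_true (0 <= _ ^+ 2) => exact: sqr_ge0
  | |- is_true (0 <= nc _) => exact: nc_ge0
  | |- is_true (0 <= Num.sqrt _) => exact: sqrtr_ge0
  | |- is_true (0 <= `|_|) => exact: normr_ge0
  | |- is_true (0 <= _%:R) => exact: ler0n
  | |- is_true (0 <= _ * _) => apply: mulr_ge0; side
  | |- is_true (0 <= _ + _) => apply: addr_ge0; side
  | |- is_true (0 <= _ ^+ _) => apply: exprn_ge0; side
  | |- is_true (0 <= _^-1) => rewrite invr_ge0; side
  | |- is_true (0 <= bigop.body _ _ _) => first [apply: sumr_ge0 => *; side | apply: prodr_ge0 => *; side]
  | |- is_true (0 <= Rintegral _ _ _) => apply: Rintegral_ge0 => *; side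
  | |- is_true (0 < _%:R) => by rewrite ltr0n
  | |- is_true (0 < _ * _) => apply: mulr_gt0; side
  | |- is_true (0 < _ ^+ _) => apply: exprn_gt0; side
  | |- is_true (0 < _^-1) => rewrite invr_gt0; side
  | |- is_true (0 < _ + _) => apply: ltr_pwDl; side
  | |- is_true (0 < _ + _) => apply: ltr_wpDl; side
  | |- is_true (0 < Num.sqrt _) => rewrite sqrtr_gt0; side
  | |- is_true (0 <= _) => apply: ltW; side
  end
with side_meas := match goal with
  | |- forall _, _ => move=> ?; side
  | |- measurable_fun _ (fun _ => ?c) => exact: measurable_cst
  | |- measurable_fun _ (EFin \o _) => apply/measurable_EFinP; side
  | |- measurable_fun _ (fun _ => EFin _) => apply/measurable_EFinP; side
  | |- measurable_fun _ (fun _ => _ ^+ _) => apply: measurable_funX; side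
  | |- measurable_fun _ (fun _ => nc _) => apply: cmeas_nc; side
  | |- measurable_fun _ (fun _ => _ * _) => apply: measurable_funM; side
  | |- measurable_fun _ (fun _ => _ - _) => apply: measurable_funB; side
  | |- measurable_fun _ (fun _ => _ + _) => apply: measurable_funD; side
  | |- measurable_fun _ (fun _ => _^-1) => apply: mfun_funV; side
  | |- measurable_fun _ (fun _ => - _) => apply: measurable_funN; side
  | |- cmeas (fun _ => ?c) => exact: cmeas_cst
  | h : cL1 _ ?f |- cmeas ?f => exact: cL1_meas h
  | |- cmeas (fun _ => cconj _) => apply: cmeas_conj; side
  | |- cmeas (fun _ => _%:C) => apply: cmeas_real; side
  | |- cmeas (fun _ => _ * _) => apply: cmeasM; side
  | |- cmeas (fun _ => _ - _) => apply: cmeasB; side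
  | |- cmeas (fun _ => _ + _) => apply: cmeasD; side
  | |- cmeas (fun _ => - _) => apply: cmeasN; side
  | |- cL1 _ (fun _ => _ - _) => apply: cL1B; side
  | |- cL1 _ (fun _ => _ + _) => apply: cL1D; side
  | |- cL1 _ (fun _ => _ * _) => apply: cL1Z; side
  | |- integrable _ _ (EFin \o (fun _ => _ * _)) => apply: L1Z; side
  | |- integrable _ _ (EFin \o (fun _ => _ + _)) => apply: L1D; side
  | |- continuous (fun _ => ?c) => exact: cst_continuous
  | |- measurable_fun ?A ?f => let g := eval red in f in change (measurable_fun A g); side
  | |- cmeas ?f => let g := eval red in f in change (cmeas g); side
  end.

(** * Affine maps and Lebesgue measure on the line *)

Section lebesgue_line.
Context (R : realType).
Local Notation mu := (@lebesgue_measure R).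

(** The image of Lebesgue measure under x |-> b + a x, multiplied by a, agrees with Lebesgue measure
    on half-open intervals, and these determine it. *)
Lemma lebesgue_affine_pos (a b : R) (A : set (measurableTypeR R)) : 0 < a ->
  measurable A -> mu ((fun x => b + a * x) @^-1` A) = ((a^-1)%:E * mu A)%E.
move=> a0 mA.
have mphi : mfun (fun x : measurableTypeR R => b + a * x : measurableTypeR R) by side.
pose c := NngNum (ltW a0).
have : mu A = mscale c (measure_function_pushforward__canonical__measure_function_Measure mu mphi) A.
  apply: lebesgue_measure_unique => // _ [[x y]] _ <-.
  have ee : (fun z => b + a * z) @^-1` `]x, y]%classic = `](x - b) / a, (y - b) / a]%classic.
    apply/seteqP; split => z /=; rewrite !in_itv /= => /andP[h1 h2].
      by rewrite ltr_pdivrMr// ler_pdivlMr// ltrBlDl lerBrDl (mulrC z) h1 h2.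
    by move: h1 h2; rewrite ltr_pdivrMr// ler_pdivlMr// ltrBlDl lerBrDl (mulrC z) => -> ->.
  change (mu `]x, y]%classic = (a%:E * mu ((fun z => b + a * z)%R @^-1` `]x, y]%classic))%E).
  rewrite ee.
  rewrite !lebesgue_measure_itv/= !lte_fin ltr_pM2r ?invr_gt0// ltrD2r.
  case: ifPn => _; last by rewrite mule0.
  by rewrite -EFinM; congr EFin; field; rewrite gt_eqF.
move=> ->; rewrite /mscale /= muleA -EFinM mulVf ?gt_eqF// mul1e.
by [].
Qed.

Lemma lebesgue_affine (a b : R) (A : set (measurableTypeR R)) : a != 0 ->
  measurable A -> mu ((fun x => b + a * x) @^-1` A) = ((`|a|^-1)%:E * mu A)%E.
move=> a0 mA; have [a1|a1] := ltP 0 a.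
  by rewrite gtr0_norm// lebesgue_affine_pos.
have a2 : a < 0 by rewrite lt_neqAle a0.
have -> : (fun x => b + a * x) @^-1` A = (fun x => b + `|a| * x) @^-1` A \o -%R.
  by apply/funext => x /=; rewrite ltr0_norm// mulrNN.
rewrite -[RHS](lebesgue_affine_pos b) ?normr_gt0//.
rewrite -[RHS]lebesgue_measureN//.
rewrite -[X in measurable X]setTI.
have mphi : mfun (fun x : measurableTypeR R => b + `|a| * x : measurableTypeR R) by side.
exact: mphi.
Qed.

Lemma mfun_affine (a b : R) :
  mfun (fun x : measurableTypeR R => b + a * x : measurableTypeR R).
by side. Qed.

End lebesgue_line.

(** * Lebesgue measure on R^n: product structure, affine maps, open sets *)

Section leb_theory.
Context (R : realType).
Local Notation rV n := ('rV[R]_n).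

Lemma rV_consE0 n (z : R * rV n) : rV_cons z 0 0 = z.1.
by have := rV_consK z; case: z => a b [-> _]. Qed.

Lemma rV_consES n (z : R * rV n) i : rV_cons z 0 (lift ord0 i) = z.2 0 i.
rewrite -{2}(rV_consK z) /= [RHS]mxE; congr (fun_of_matrix (rV_cons z) _ _); exact/val_inj.
Qed.

Lemma rV_unconsS n (v : rV n.+1) i : (rV_uncons v).2 0 i = v 0 (lift ord0 i).
by rewrite /rV_uncons /= mxE; congr fun_of_matrix; exact/val_inj. Qed.

Lemma rV_consK' n (v : rV n.+1) : rV_cons (rV_uncons v) = v.
apply/rowP => i; case: (unliftP ord0 i) => [j|] ->.
  by rewrite rV_consES rV_unconsS.
by rewrite rV_consE0.
Qed.

Lemma mfun_rVP d1 (T1 : measurableType d1) n (f : T1 -> rV n) :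
  (forall i, measurable_fun [set: T1] (fun x => f x 0 i)) -> measurable_fun [set: T1] f.
by move=> h; apply: measurable_fun_rVP => i; exact: h. Qed.

Lemma mfun_coord n (i : 'I_n) : mfun (fun x : rV n => x 0 i).
exact: measurable_rV_coord. Qed.

Lemma leb_consE n (A : set (rV n.+1)) : measurable A ->
  ((@lebesgue_measure R) \x leb R n)%E (@rV_cons R n @^-1` A) = (1%:E * leb R n.+1 A)%E.
by move=> mA; rewrite mul1e. Qed.

Lemma cL1_leb n (f : rV n.+1 -> R[i]) : cL1 (leb R n.+1) f ->
  cL1 ((@lebesgue_measure R) \x leb R n)%E (f \o @rV_cons R n).
exact: (@cL1_push _ _ _ _ R _ _ _ (@measurable_rV_cons R n) 1 ltr01 (@leb_consE n)).
Qed.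

(** Transport along [rV_uncons], the measurable inverse of [rV_cons], which preserves the measures
    as well. *)
Lemma cL1_lebP n (f : rV n.+1 -> R[i]) :
  cL1 ((@lebesgue_measure R) \x leb R n)%E (f \o @rV_cons R n) ->
  cL1 (leb R n.+1) f.
move=> fi; have := cL1_meas fi.
have -> : f = (f \o @rV_cons R n) \o (@rV_uncons R n).
  by apply/funext => x /=; rewrite rV_consK'.
move: (f \o @rV_cons R n) fi => g gi mg.
have pc A : measurable A -> leb R n.+1 (@rV_uncons R n @^-1` A) =
    (1%:E * ((@lebesgue_measure R) \x leb R n) A)%E.
  move=> mA; rewrite mul1e /= /leb_step /pushforward -comp_preimage.
  by rewrite (_ : _ \o _ = id)//; apply/funext => u /=; rewrite rV_consK.
exact: (@cL1_push _ _ _ _ R _ _ _ (@measurable_rV_uncons R n) 1 ltr01 pc).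
Qed.

Lemma cint_leb n (f : rV n.+1 -> R[i]) : cL1 (leb R n.+1) f ->
  cint (leb R n.+1) f =
  cint (@lebesgue_measure R) (fun x => cint (leb R n) (fun y => f (rV_cons (x, y)))).
move=> fi.
have := @cint_push _ _ _ _ R ((@lebesgue_measure R) \x leb R n)%E (leb R n.+1)
  _ (@measurable_rV_cons R n) 1 ltr01 (@leb_consE n) f fi.
rewrite mul1r => <-.
by rewrite cint_prod//; exact: cL1_leb.
Qed.

Lemma mfun_affine_rV n (a : R) (b : rV n) :
  mfun (fun x : rV n => b + a *: x).
apply: mfun_rVP => i; under eq_fun do rewrite !mxE.
apply: measurable_funD => //; apply: measurable_funM => //.
exact: mfun_coord.
Qed.

(** Induction on the dimension: the sections of the preimage are affine preimages of sections, and
    the first coordinate contributes one more factor 1/|a|. *)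
Lemma leb_affine n (a : R) (b : rV n) (A : set (rV n)) : a != 0 -> measurable A ->
  leb R n ((fun x => b + a *: x) @^-1` A) = (((`|a|^-1) ^+ n)%:E * leb R n A)%E.
move=> a0; elim: n b A => [|n ih] b A mA.
  rewrite expr0 mul1e /=.
  by rewrite (_ : _ @^-1` A = A)//; apply/funext => x /=; congr (A _); apply/rowP; case.
pose C := @rV_cons R n @^-1` A.
have mC : measurable C by rewrite -[X in measurable X]setTI; exact: measurable_rV_cons.
have -> : leb R n.+1 A = (\int[@lebesgue_measure R]_x leb R n (xsection C x))%E by [].
have -> : leb R n.+1 ((fun x => b + a *: x) @^-1` A) = (\int[@lebesgue_measure R]_x
    (((`|a|^-1) ^+ n)%:E * leb R n (xsection C (b 0%R 0%R + a * x)%R)))%E.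
  apply: eq_integral => x _ /=.
  rewrite -(ih (rV_uncons b).2); last exact: measurable_xsection.
  rewrite -/(leb R n); congr (leb R n _); apply/seteqP; split => y /=;
    rewrite /xsection /= !inE /C /=;
    (suff -> : b + a *: rV_cons (x, y) =
       rV_cons (b 0 0 + a * x, (rV_uncons b).2 + a *: y) by []);
    (apply/rowP => i; case: (unliftP ord0 i) => [j|] ->;
     rewrite mxE [(a *: rV_cons (x, y)) _ _]mxE ?rV_consES ?rV_consE0 /= ?mxE//;
     by congr (_ + _); congr (fun_of_matrix b _ _); exact/val_inj).
have mx : mfun (fun x => leb R n (xsection C x)) by exact: measurable_fun_xsection.
rewrite ge0_integralZl//; last 1 first.
  exact: measurableT_comp mx (@mfun_affine R a (b 0 0)).
rewrite (@ge0_integral_push _ _ _ _ R _ (@lebesgue_measure R) _ (@mfun_affine R a (b 0 0)) (`|a|^-1) _ _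
   (fun x => leb R n (xsection C x)))//.
- by rewrite muleA -EFinM -exprSr.
- by rewrite invr_gt0 normr_gt0.
- by move=> B mB; exact: lebesgue_affine.
Qed.

Lemma leb_affineP n (a : R) (b : rV n) : a != 0 -> forall A, measurable A ->
  leb R n ((fun x => b + a *: x) @^-1` A) = (((`|a|^-1) ^+ n)%:E * leb R n A)%E.
by move=> a0 A mA; exact: leb_affine. Qed.

Lemma cint_affine n (a : R) (b : rV n) (f : rV n -> R[i]) : a != 0 ->
  cL1 (leb R n) f ->
  cL1 (leb R n) (fun x => f (b + a *: x)) /\
  cint (leb R n) (fun x => f (b + a *: x)) = ((`|a|^-1) ^+ n)%:C * cint (leb R n) f.
move=> a0 fi; have c0 : 0 < (`|a|^-1) ^+ n by rewrite exprn_gt0// invr_gt0 normr_gt0.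
split.
  exact: (@cL1_push _ _ _ _ R _ _ _ (mfun_affine_rV a b) _ c0 (leb_affineP b a0)).
exact: (@cint_push _ _ _ _ R _ _ _ (mfun_affine_rV a b) _ c0 (leb_affineP b a0)).
Qed.

Lemma ae_affine n (a : R) (b : rV n) (P : rV n -> Prop) : a != 0 ->
  {ae leb R n, forall x, P x} -> {ae leb R n, forall x, P (b + a *: x)}.
move=> a0 [N [mN N0 PN]]; exists ((fun x => b + a *: x) @^-1` N); split.
- by rewrite -[X in measurable X]setTI; exact: mfun_affine_rV.
- by rewrite leb_affine// N0 mule0.
- by move=> x /= h; exact: PN.
Qed.

Lemma ae_coord_neq n (i : 'I_n) (c : R) : {ae leb R n, forall x : rV n, x 0 i != c}.
elim: n i => [|n ih] i; first by case: i.
pose A := [set x : rV n.+1 | x 0 i = c].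
have mA : measurable A.
  rewrite /A (_ : mkset _ = (fun x : rV n.+1 => x 0 i) @^-1` [set c])//.
  by rewrite -[X in measurable X]setTI; exact: mfun_coord.
exists A; split => //; last by move=> x /= /negP; rewrite negbK => /eqP.
case: (unliftP ord0 i) => [j|] ij.
  transitivity (\int[@lebesgue_measure R]_x 0)%E; last by rewrite integral0.
  apply: eq_integral => x _ /=.
  have [N [mN N0 hN]] := ih j.
  apply/eqP; rewrite eq_le measure_ge0 andbT -N0.
  apply: le_measure => //; rewrite ?inE//.
    apply: measurable_xsection; rewrite -[X in measurable X]setTI; exact: measurable_rV_cons.
  move=> y; rewrite /xsection /= inE /A /= ij rV_consES /= => yc.
  by apply: hN => /=; rewrite yc eqxx.
have -> : leb R n.+1 A = ((@lebesgue_measure R) \x leb R n)%E ([set c] `*` setT).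
  rewrite /= /leb_step /pushforward; apply: (congr1 (fun B => ((@lebesgue_measure R) \x leb R n)%E B)).
  apply/seteqP; split => z /=; rewrite /A /= ij rV_consE0 //.
  by move=> [].
by rewrite product_measure1E// [X in (X * _)%E](lebesgue_measure_set1 c) mul0e.
Qed.

Lemma cint_prodf n (F : 'I_n -> R -> R[i]) :
  (forall i, cL1 (@lebesgue_measure R) (F i)) ->
  cL1 (leb R n) (fun x : rV n => \prod_(i < n) F i (x 0 i)) /\
  cint (leb R n) (fun x : rV n => \prod_(i < n) F i (x 0 i)) =
    \prod_(i < n) cint (@lebesgue_measure R) (F i).
elim: n F => [|n ih] F Fi.
  under eq_fun do rewrite big_ord0.
  rewrite big_ord0.
  have i1 : (leb R 0).-integrable setT (EFin \o (fun=> 1)).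
    apply/integrableP; split; first side.
    rewrite (eq_integral (cst 1%E)); last by move=> x _; rewrite /= normr1.
    by rewrite integral_cst// mul1e; rewrite [X in (X < _)%E](_ : _ = 1%E) ?ltry//; exact: diracT.
  split; first by split => //=; exact: integrable0.
  apply: complex_eqP => /=; rewrite /Rintegral ?integral0//=.
  rewrite integral_cst// mul1e; rewrite [X in fine X](_ : _ = 1%E)//; exact: diracT.
have [ihi ihe] := ih (fun i => F (lift ord0 i)) (fun i => Fi _).
have hc : (fun x : rV n.+1 => \prod_(i < n.+1) F i (x 0 i)) \o @rV_cons R n =
   (fun z => F ord0 z.1 * (\prod_(i < n) F (lift ord0 i) (z.2 0 i))).
  apply/funext => z /=; rewrite big_ord_recl rV_consE0; congr (_ * _).
  by apply: eq_bigr => i _; rewrite rV_consES.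
have h1 : cL1 (leb R n.+1) (fun x : rV n.+1 => \prod_(i < n.+1) F i (x 0 i)).
  apply: cL1_lebP; rewrite hc.
  exact: cL1_prod_mul (Fi ord0) ihi.
split => //; rewrite cint_leb// big_ord_recl -ihe.
transitivity (cint (@lebesgue_measure R) (fun x =>
   cint (leb R n) (fun y : rV n => \prod_(i < n) F (lift ord0 i) (y 0 i)) * F ord0 x)).
  apply: eq_cint => x; rewrite mulrC -cintZ//; apply: eq_cint => y.
  exact: (congr1 (fun f => f (x, y)) hc).
by rewrite cintZ// mulrC.
Qed.

Lemma Rint_prodf n (F : 'I_n -> R -> R) :
  (forall i, (@lebesgue_measure R).-integrable setT (EFin \o F i)) ->
  (leb R n).-integrable setT (EFin \o (fun x : rV n => \prod_(i < n) F i (x 0 i))) /\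
  \int[leb R n]_x (\prod_(i < n) F i ((x : rV n) 0 i)) = \prod_(i < n) \int[@lebesgue_measure R]_x F i x.
move=> Fi; have [|[h1 _] h2] := @cint_prodf n (fun i x => (F i x)%:C).
  by move=> i; split; [exact: Fi|exact: integrable0].
have e (x : rV n) : \prod_(i < n) (F i (x 0 i))%:C = (\prod_(i < n) F i (x 0 i))%:C.
  by rewrite rmorph_prod.
move: h1 h2; rewrite (_ : Re \o _ = fun x : rV n => \prod_(i < n) F i (x 0 i)); last first.
  by apply/funext => x /=; rewrite e.
move=> h1 h2; split => //.
apply: (@complexI R); rewrite -cint_real rmorph_prod /=.
under eq_cint do rewrite -e.
by rewrite h2; apply: eq_bigr => i _; rewrite cint_real.
Qed.

(** An open set is the union of the cubes with rational centre and half-side 1/(k+1) that it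
    contains; they are countably many, and measurable because the coordinates are. *)
Lemma open_measurable_rV n (U : set 'rV[R]_n) : open U -> measurable U.
move=> oU.
pose box (q : 'rV[rat]_n * nat) := [set x : rV n | forall i, `|ratr (q.1 0 i) - x 0 i| < (q.2.+1%:R)^-1].
have mbox q : measurable (box q).
  have -> : box q = \bigcap_(i in [set: 'I_n]) [set x : rV n | `|ratr (q.1 0 i) - x 0 i| < (q.2.+1%:R)^-1].
    by apply/seteqP; split => [x h i _|x h i]; exact: h.
  apply: fin_bigcap_measurable => // i _.
  rewrite (_ : mkset _ = (fun x : rV n => x 0 i) @^-1` (ball (ratr (q.1 0 i) : R) (q.2.+1%:R)^-1))//.
  rewrite -[X in measurable X]setTI; apply: mfun_coord => //.
  exact: measurable_ball.
rewrite (_ : U = \bigcup_(q in [set q | box q `<=` U]) box q); last first.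
  apply/seteqP; split => [x Ux|x [q /= qU]]; last exact: qU.
  have := oU _ Ux; rewrite -nbhs_ballE => -[e /= e0 xe].
  have [k ke] : exists k : nat, (k.+1%:R)^-1 < e / 2.
    have [k _ hk] := near_infty_natSinv_lt (PosNum (divr_gt0 e0 (ltr0Sn R 1))).
    by exists k; apply: hk => /=.
  have k0 : 0 < (k.+1%:R)^-1 by side.
  have hq i : exists q : rat, `|ratr q - x 0 i| < (k.+1%:R)^-1.
    have [q] := @rat_in_itvoo R (x 0 i) (x 0 i + (k.+1%:R)^-1) ltac:(by rewrite ltrDl).
    rewrite in_itv /= => /andP[q1 q2]; exists q.
    by rewrite gtr0_norm ?subr_gt0// ltrBlDl.
  have [qq hqq] := choice hq.
  exists (\row_i qq i, k); last by move=> i /=; rewrite mxE; exact: hqq.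
  move=> y /= hy; apply: xe; split => // i j; rewrite ord1.
  rewrite /ball /= -(subrK (ratr (qq j)) (x 0 j)) -addrA (le_lt_trans (ler_normD _ _))//.
  rewrite (splitr e) ltrD// (lt_trans _ ke)//; first by rewrite distrC; exact: hqq.
  by have := hy j; rewrite mxE.
pose B (k : nat) := if (unpickle k : option ('rV[rat]_n * nat)) is Some q then
  if pselect (box q `<=` U) then box q else set0 else set0.
rewrite (_ : \bigcup_(_ in _) _ = \bigcup_k B k).
  apply: bigcup_measurable => k _; rewrite /B; case: unpickle => // q.
  by case: (pselect (box q `<=` U)) => //= _; exact: mbox.
apply/seteqP; split => [x [q /= qU qx]|x [k _]].
  by exists (pickle q) => //; rewrite /B pickleK; case: (pselect (box q `<=` U)).
by rewrite /B; case: unpickle => // q; case: (pselect (box q `<=` U)) => //= qU qx; exists q.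
Qed.

Lemma continuous_measurable_rV n (f : 'rV[R]_n -> R) : continuous f -> mfun f.
move=> cf; apply: (@measurability _ _ _ _ setT f _ (@RGenOpens.measurableE R)).
move=> _ [_ [a [b ->]] <-]; rewrite setTI; apply: open_measurable_rV.
by move/continuousP : cf; apply; exact: interval_open.
Qed.

End leb_theory.

(** * Hilbert spaces: projection, Riesz representation, Lax-Milgram *)

Section inner_product.
Context (R : realType) (V : lmodType R[i]).
Implicit Types (dot : V -> V -> R[i]) (x y z : V).

(** Definiteness is a separate condition, so that Cauchy-Schwarz also applies to the form <x, A y>
    of a positive operator A. *)
Definition semi_inner dot : Prop :=
  [/\ forall z x y, dot z (x + y) = dot z x + dot z y,
      forall z a x, dot z (a *: x) = a * dot z x,
      forall x y, dot x y = (dot y x)^*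
    & forall x, 0 <= Re (dot x x)].

Definition tends dot (u : nat -> V) x : Prop :=
  forall e : R, 0 < e -> exists N, forall n, (N <= n)%N -> sqnorm dot (u n - x) < e.

Definition cauchy_seq dot (u : nat -> V) : Prop :=
  forall e : R, 0 < e -> exists N, forall n m, (N <= n)%N -> (N <= m)%N ->
    sqnorm dot (u n - u m) < e.

Definition hilbert dot : Prop :=
  [/\ semi_inner dot, forall x, sqnorm dot x = 0 -> x = 0
    & forall u, cauchy_seq dot u -> exists x, tends dot u x].

Section semi_inner_theory.
Variable dot : V -> V -> R[i].
Local Notation nsq := (sqnorm dot).
Hypothesis ip : semi_inner dot.
Let nrm x := Num.sqrt (nsq x).

Lemma dotDr z x y : dot z (x + y) = dot z x + dot z y. by case: ip. Qed.
Lemma dotZr z a x : dot z (a *: x) = a * dot z x. by case: ip. Qed.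
Lemma dotC x y : dot x y = (dot y x)^*. by case: ip. Qed.
Lemma sqnorm_ge0 x : 0 <= nsq x. by case: ip => _ _ _; apply. Qed.
Lemma dotDl x y z : dot (x + y) z = dot x z + dot y z.
by rewrite dotC dotDr conjcD (dotC x z) (dotC y z). Qed.
Lemma dotZl a x z : dot (a *: x) z = a^* * dot x z.
by rewrite dotC dotZr conjcM (dotC x z). Qed.
Lemma dotNr z x : dot z (- x) = - dot z x.
by rewrite -scaleN1r dotZr mulN1r. Qed.
Lemma dotNl z x : dot (- z) x = - dot z x.
by rewrite dotC dotNr conjcN (dotC z x). Qed.
Lemma dotBr z x y : dot z (x - y) = dot z x - dot z y.
by rewrite dotDr dotNr. Qed.
Lemma dotBl x y z : dot (x - y) z = dot x z - dot y z.
by rewrite dotDl dotNl. Qed.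
Lemma dot0r z : dot z 0 = 0.
by rewrite -(scale0r 0) dotZr mul0r. Qed.
Lemma dot0l z : dot 0 z = 0.
by rewrite dotC dot0r cconj0. Qed.

Lemma dotxx x : dot x x = (nsq x)%:C.
apply: complex_eqP => //=; have := dotC x x.
by move/(congr1 Im); rewrite ImJ; lra.
Qed.

Lemma sqnorm0 : nsq 0 = 0.
by rewrite /sqnorm dot0r. Qed.

Lemma sqnormD x y : nsq (x + y) = nsq x + 2 * Re (dot x y) + nsq y.
rewrite /sqnorm dotDr !dotDl !ReD (dotC y x) ReJ; ring.
Qed.

Lemma sqnormZ a x : nsq (a *: x) = nc a ^+ 2 * nsq x.
by rewrite /sqnorm dotZr dotZl mulrA (mulrC a) mul_conjC ReZ.
Qed.

Lemma sqnormN x : nsq (- x) = nsq x.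
by rewrite -scaleN1r sqnormZ ncN nc1 expr1n mul1r. Qed.

Lemma sqnormBC x y : nsq (x - y) = nsq (y - x).
by rewrite -opprB sqnormN. Qed.

Lemma sqnormB x y : nsq (x - y) = nsq x - 2 * Re (dot x y) + nsq y.
by rewrite sqnormD sqnormN dotNr ReN mulrN. Qed.

Lemma parallelogram x y :
  nsq (x + y) + nsq (x - y) = 2 * nsq x + 2 * nsq y.
rewrite sqnormD sqnormB; ring. Qed.

Lemma cauchy_schwarz x y : nc (dot x y) ^+ 2 <= nsq x * nsq y.
pose b := nc (dot x y); pose u := nsq x; pose v := nsq y.
have h t : 0 <= u - 2 * t * b ^+ 2 + t ^+ 2 * b ^+ 2 * v.
  have := sqnorm_ge0 (x - (t%:C * (dot x y)^*) *: y).
  rewrite sqnormB sqnormZ dotZr ncM nc_real nc_conj exprMn -[_ * dot x y]mulrA mul_conjC ReZ /=.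
  by rewrite real_normK ?num_real// -/b -/u -/v !mulrA.
have u0 : 0 <= u := sqnorm_ge0 x; have v0 : 0 <= v := sqnorm_ge0 y.
have [v1|v1] := eqVneq v 0.
  have [b0|b0] := eqVneq (b ^+ 2) 0; first by rewrite b0 mulr_ge0.
  (* For v = 0 the expression in [h] is u - 2 t b^2, which is negative for this t. *)
  have := h ((u + 1) / b ^+ 2); rewrite v1 -mulrA divfK//; lra.
have v2 : 0 < v by rewrite lt_neqAle eq_sym v1.
have := h v^-1.
rewrite (_ : u - 2 * v^-1 * b ^+ 2 + v^-1 ^+ 2 * b ^+ 2 * v = u - b ^+ 2 / v); last by field.
by rewrite subr_ge0 ler_pdivrMr.
Qed.

Lemma nrm_ge0 x : 0 <= nrm x. exact: sqrtr_ge0. Qed.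
Lemma sqr_nrm x : nrm x ^+ 2 = nsq x. by rewrite sqr_sqrtr// sqnorm_ge0. Qed.

Lemma dot_le_nrm x y : nc (dot x y) <= nrm x * nrm y.
rewrite -(@ler_sqr _ (nc _)) ?nnegrE ?nc_ge0 ?mulr_ge0 ?nrm_ge0//.
by rewrite exprMn !sqr_nrm cauchy_schwarz.
Qed.

Lemma nrmD x y : nrm (x + y) <= nrm x + nrm y.
rewrite -(@ler_sqr _ (nrm _)) ?nnegrE ?addr_ge0 ?nrm_ge0//.
rewrite sqrrD !sqr_nrm sqnormD.
have := le_trans (le_trans (ler_norm _) (nc_Re (dot x y))) (dot_le_nrm x y).
rewrite mulr2n; lra.
Qed.

Lemma nrmB x y : nrm (x - y) <= nrm x + nrm y.
by apply: (le_trans (nrmD _ _)); rewrite /nrm sqnormN. Qed.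

Lemma sqnormD_le x y : nsq (x + y) <= 2 * nsq x + 2 * nsq y.
by rewrite -parallelogram lerDl sqnorm_ge0. Qed.

Lemma tendsP u x : tends dot u x <->
  forall e : R, 0 < e -> exists N, forall n, (N <= n)%N -> nrm (u n - x) < e.
split=> h e e0.
  have [N hN] := h (e ^+ 2) (exprn_gt0 _ e0); exists N => n /hN hn.
  by rewrite -(@ltr_sqr _ (nrm _)) ?nnegrE ?nrm_ge0 ?(ltW e0)// sqr_nrm.
have [N hN] := h (Num.sqrt e) ltac:(by side); exists N => n /hN hn.
by rewrite -sqr_nrm -(sqr_sqrtr (ltW e0)) ltr_sqr ?nnegrE ?sqrtr_ge0.
Qed.

Lemma tends_cst x : tends dot (fun=> x) x.
by move=> e e0; exists 0%N => n _; rewrite subrr sqnorm0. Qed.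

Lemma tendsD u v x y : tends dot u x -> tends dot v y ->
  tends dot (fun n => u n + v n) (x + y).
move=> ux vy e e0; have e4 : 0 < e / 4 by side.
have [N hN] := ux _ e4; have [M hM] := vy _ e4; exists (maxn N M) => n.
rewrite geq_max => /andP[/hN h1 /hM h2].
rewrite opprD addrACA; apply: (le_lt_trans (sqnormD_le _ _)); lra.
Qed.

Lemma tendsZ a u x : tends dot u x -> tends dot (fun n => a *: u n) (a *: x).
move=> ux e e0; have [N hN] := ux (e / (nc a ^+ 2 + 1)) ltac:(by side).
exists N => n /hN h; rewrite -scalerBr sqnormZ.
have a0 : 0 <= nc a ^+ 2 by side.
move: h; rewrite ltr_pdivlMr ?ltr_wpDl//.
have := sqnorm_ge0 (u n - x); lra.
Qed.

Lemma tends_cauchy u x : tends dot u x -> cauchy_seq dot u.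
move=> ux e e0; have [N hN] := ux (e / 4) ltac:(by side).
exists N => n m /hN h1 /hN h2.
rewrite (_ : u n - u m = (u n - x) + (x - u m)); last by rewrite addrA subrK.
by apply: (le_lt_trans (sqnormD_le _ _)); rewrite (sqnormBC x); lra.
Qed.

Lemma tends_dot0 z u x : tends dot u x -> (forall e : R, 0 < e -> exists N,
   forall n, (N <= n)%N -> nc (dot z (u n)) < e) -> dot z x = 0.
move=> /tendsP ux h; apply: nc_eq0; apply/eqP; rewrite eq_le nc_ge0 andbT.
apply/ler_addgt0Pl => e e0; rewrite addr0.
have e2 : 0 < e / 2 by side.
have [N hN] := h _ e2; have z1 : 0 < nrm z + 1 by rewrite ltr_wpDl// nrm_ge0.
have [M hM] := ux (e / 2 / (nrm z + 1)) ltac:(by side).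
have := hN _ (leq_maxl N M); have := hM _ (leq_maxr N M).
set k := maxn N M => h1 h2.
rewrite (_ : dot z x = dot z (u k) - dot z (u k - x)); last by rewrite dotBr opprB addrC subrK.
apply: (le_trans (ncB _ _)); rewrite [leRHS]splitr lerD ?(ltW h2)//.
apply: (le_trans (dot_le_nrm _ _)).
move: h1; rewrite ltr_pdivlMr// => h1.
have := nrm_ge0 (u k - x); have := nrm_ge0 z; nra.
Qed.

(** Carries an identity between scalar products from two approximating sequences to their limits,
    the form in which density arguments are used below. *)
Lemma tends_dot_eq z z' u x v w : tends dot u x -> tends dot v w ->
  (forall n, dot z (u n) = dot z' (v n)) -> dot z x = dot z' w.
move=> /tendsP hu /tendsP hv e; apply/eqP; rewrite -subr_eq0; apply/eqP/nc_eq0.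
apply/eqP; rewrite eq_le nc_ge0 andbT; apply/ler_addgt0Pr => eps e0; rewrite add0r.
pose K := nrm z + nrm z' + 1.
have K0 : 0 < K by rewrite ltr_wpDl// addr_ge0 ?nrm_ge0.
have [N hN] := hu _ (divr_gt0 e0 K0); have [N' hN'] := hv _ (divr_gt0 e0 K0).
pose n := maxn N N'.
have h1 := hN n (leq_maxl _ _); have h2 := hN' n (leq_maxr _ _).
have -> : dot z x - dot z' w = dot z' (v n - w) - dot z (u n - x).
  by rewrite !dotBr e; ring.
apply: (le_trans (ncB _ _)).
apply: (@le_trans _ _ (nrm z' * (eps / K) + nrm z * (eps / K))).
  by apply: lerD; apply: (le_trans (dot_le_nrm _ _)); rewrite ler_wpM2l ?nrm_ge0// ltW.
rewrite -mulrDl mulrC -mulrA ler_piMr ?(ltW e0)// mulrC ler_pdivrMr// /K; lra.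
Qed.

Lemma nrm_approx (u : nat -> V) x n : nrm x <= nrm (u n) + nrm (u n - x).
by rewrite [X in nrm X <= _](_ : x = u n - (u n - x)) ?nrmB// opprB addrC subrK.
Qed.

Lemma tends_nrm_le u x (c : R) : tends dot u x -> (forall n, nsq (u n) <= c) ->
  nsq x <= c.
move=> /tendsP ux h.
have c0 : 0 <= c by rewrite (le_trans _ (h 0%N))// sqnorm_ge0.
rewrite -sqr_nrm -(sqr_sqrtr c0) ler_sqr ?nnegrE ?sqrtr_ge0//.
apply/ler_addgt0Pl => e e0; have [N hN] := ux _ e0; have h1 := hN _ (leqnn N).
by rewrite addrC; apply: (le_trans (nrm_approx u x N)); rewrite lerD// ?ler_wsqrtr// ltW.
Qed.

End semi_inner_theory.

Definition subspace (M : set V) : Prop := M 0 /\ forall a x y, M x -> M y -> M (a *: x + y).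

Definition closed_for dot (M : set V) : Prop :=
  forall u x, (forall n, M (u n)) -> tends dot u x -> M x.

Section hilbert_theory.
Variable dot : V -> V -> R[i].
Local Notation nsq := (sqnorm dot).
Hypothesis H : hilbert dot.
Let ip : semi_inner dot. by case: H. Qed.
Let nrm x := Num.sqrt (nsq x).

Lemma sqnorm_eq0 x : nsq x = 0 -> x = 0. by case: H => _ h _; exact: h. Qed.

Lemma sqnorm_le0 x : nsq x <= 0 -> x = 0.
by move=> h; apply: sqnorm_eq0; apply/eqP; rewrite eq_le h (sqnorm_ge0 ip). Qed.

Lemma dot_nondeg x : (forall z, dot z x = 0) -> x = 0.
by move=> h; apply: sqnorm_eq0; rewrite /sqnorm h. Qed.

Lemma tends_unique u x y : tends dot u x -> tends dot u y -> x = y.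
move=> ux uy; apply/eqP; rewrite -subr_eq0; apply/eqP/dot_nondeg => z.
rewrite (dotBr ip); apply/eqP; rewrite subr_eq0; apply/eqP.
exact: (tends_dot_eq ip ux uy).
Qed.

Lemma inv_lt (e : R) : 0 < e -> exists N : nat, forall n, (N <= n)%N -> n.+1%:R^-1 < e.
move=> e0; have [N _ hN] := near_infty_natSinv_lt (PosNum e0).
by exists N => n Nn; apply: hN.
Qed.

(** A minimizing sequence is Cauchy by the parallelogram identity, because the midpoint of two of
    its terms stays in M. Orthogonality is the first variation of the distance at the minimizer. *)
Lemma projection (M : set V) x : subspace M -> closed_for dot M ->
  exists y, M y /\ forall z, M z -> dot z (x - y) = 0.
move=> [M0 Ml] Mc.
have MZ a y : M y -> M (a *: y) by move=> My; rewrite -[X in M X]addr0; exact: Ml.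
have MD y z : M y -> M z -> M (y + z) by move=> My Mz; rewrite -[y]scale1r; exact: Ml.
pose E := [set r : R | exists y, M y /\ r = nsq (x - y)].
have Ei : has_inf E.
  split; first by exists (nsq (x - 0)), 0.
  by exists 0 => _ [y [_ ->]]; exact: sqnorm_ge0 ip _.
have hy n : exists y, M y /\ nsq (x - y) < inf E + n.+1%:R^-1.
  have [_ [y [My ->]] hy] := @inf_adherent _ E (n.+1%:R^-1) ltac:(by side) Ei.
  by exists y.
have [y_ hy_] := choice hy.
have dle y : M y -> inf E <= nsq (x - y).
  by move=> My; apply: ge_inf; [exact: Ei.2|exists y].
have cy : cauchy_seq dot y_.
  move=> e e0; have [N hN] := inv_lt (divr_gt0 e0 (ltr0Sn R 3)).
  exists N => n m /hN h1 /hN h2.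
  have := parallelogram ip (x - y_ n) (x - y_ m).
  rewrite (_ : x - y_ n - (x - y_ m) = - (y_ n - y_ m)); last first.
    by rewrite !opprB addrC addrA subrK.
  rewrite (sqnormN ip).
  have -> : x - y_ n + (x - y_ m) = 2 *: (x - 2^-1 *: (y_ n + y_ m)).
    rewrite scalerBr scalerA divff ?pnatr_eq0// scale1r scaler_nat mulr2n.
    by rewrite opprD addrACA.
  have := dle (2^-1 *: (y_ n + y_ m)) (MZ _ _ (MD _ _ (hy_ n).1 (hy_ m).1)).
  rewrite (sqnormZ ip) (_ : nc 2 ^+ 2 = 4); last first.
    by rewrite sqr_nc /= addr0 expr0n addr0 /=; ring.
  move: (hy_ n).2 (hy_ m).2 h1 h2; set A1 := n.+1%:R^-1; set A2 := m.+1%:R^-1; lra.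
have [y ly] : exists y, tends dot y_ y by case: H => _ _; apply.
have My : M y by apply: (Mc y_) => // n; exact: (hy_ n).1.
exists y; split=> // z Mz; pose w := x - y.
have tz : tends dot (fun n => x - y_ n) (x - y).
  apply: (tendsD ip); first exact: tends_cst.
  by rewrite -scaleN1r; under eq_fun do rewrite -scaleN1r; exact: tendsZ.
have my : nsq (x - y) <= inf E.
  apply/ler_addgt0Pl => e e0; have [N hN] := inv_lt e0; rewrite [leRHS]addrC.
  apply: (tends_nrm_le ip (u := fun n => x - y_ (n + N)%N)) => [e' /tz[K hK]|n].
    by exists K => n Kn; apply: hK; exact: leq_trans Kn (leq_addr _ _).
  by rewrite ltW// (lt_trans (hy_ _).2)// ltrD2l hN// leq_addl.
have key t : 2 * t * nc (dot z w) ^+ 2 - t ^+ 2 * nc (dot z w) ^+ 2 * nsq z <= 0.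
  have := dle (y + (t%:C * dot z w) *: z) (MD _ _ My (MZ _ _ Mz)).
  rewrite opprD addrA -/w (sqnormB ip) (sqnormZ ip) (dotZr ip) ncM nc_real exprMn.
  rewrite (dotC ip w z) -[t%:C * dot z w * _]mulrA [dot z w * _]mulrC mul_conjC ReZ real_normK ?num_real//.
  have := my; rewrite -/w [Re (_ ^+ 2)%:C]/= !mulrA.
  set A2 := nc (dot z w) ^+ 2; set A3 := nsq w; set A4 := nsq z; lra.
apply: nc_eq0; apply/eqP; rewrite -sqrf_eq0 eq_le sqr_ge0 andbT.
have s0 : 0 < nsq z + 1 by rewrite ltr_wpDl// (sqnorm_ge0 ip).
(* For t = 1 / (|z|^2 + 1) the left-hand side of [key] is |<z, w>|^2 times a positive number, so the
   scalar product vanishes; the added 1 avoids a division by zero. *)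
have := key (nsq z + 1)^-1; rewrite -/w; move: s0 (sqr_ge0 (nc (dot z w))).
move: (nc _ ^+ 2) (nsq z) => b s s0 b0; apply: contraTT; rewrite -!ltNge => {}b0.
rewrite (_ : 2 * _ * b - _ = b / (s + 1) + b / (s + 1) ^+ 2); last by field; rewrite gt_eqF.
by rewrite addr_gt0// divr_gt0// exprn_gt0.
Qed.

Lemma dense_closed (M : set V) : subspace M -> closed_for dot M ->
  (forall x, (forall z, M z -> dot z x = 0) -> x = 0) -> forall x, M x.
move=> Ms Mc h x; have [y [My hy]] := projection x Ms Mc.
by have /eqP := h _ hy; rewrite subr_eq0 => /eqP ->.
Qed.

Definition closure_of (M : set V) : set V := [set x | exists u, (forall n, M (u n)) /\ tends dot u x].

Lemma closure_of_approx (M : set V) x :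
  (forall e : R, 0 < e -> exists y, M y /\ nsq (x - y) < e) -> closure_of M x.
move=> h; have [u hu] := choice (fun n : nat => h (n.+1%:R^-1) ltac:(by side)).
exists u; split; first by move=> n; exact: (hu n).1.
move=> e e0; have [N hN] := inv_lt e0; exists N => n /hN hn.
by rewrite (sqnormBC ip); apply: lt_trans (hu n).2 hn.
Qed.

Lemma dense_of_orth (M : set V) : subspace M ->
  (forall x, (forall z, M z -> dot z x = 0) -> x = 0) -> forall x, closure_of M x.
move=> [M0 Ml] h; apply: dense_closed.
- split; first by exists (fun=> 0); split => //; exact: tends_cst.
  move=> a x y [u [Mu ux]] [v [Mv vy]]; exists (fun n => a *: u n + v n).
  by split; [move=> n; exact: Ml|apply: (tendsD ip) => //; exact: tendsZ].
- move=> u x hu ux; apply: closure_of_approx => e e0.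
  have [N hN] := ux (e / 4) ltac:(by side).
  have [v [Mv vN]] := hu N; have [k hk] := vN (e / 4) ltac:(by side).
  exists (v k); split => //.
  rewrite (_ : x - v k = (x - u N) + (u N - v k)); last by rewrite addrA subrK.
  apply: (le_lt_trans (sqnormD_le ip _ _)).
  by have := hN N (leqnn _); have := hk k (leqnn _); rewrite (sqnormBC ip (u N) (v k)) (sqnormBC ip x); lra.
- move=> x hx; apply: h => z Mz; apply: hx; exists (fun=> z); split => //; exact: tends_cst.
Qed.

(** The representing vector is a multiple of the component w, orthogonal to the kernel, of some x0
    outside the kernel: x - (phi x / phi w) w lies in the kernel for every x. *)
Lemma riesz (phi : V -> R[i]) (C : R) :
  (forall a x y, phi (a *: x + y) = a * phi x + phi y) ->
  (forall x, nc (phi x) ^+ 2 <= C * nsq x) ->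
  exists v, forall x, phi x = dot v x.
move=> pl pb.
have p0 : phi 0 = 0.
  by apply: nc_eq0; apply/eqP; rewrite -sqrf_eq0 eq_le sqr_ge0 (le_trans (pb _))// sqnorm0// mulr0.
have pD x y : phi (x + y) = phi x + phi y by rewrite -{1}[x]scale1r pl mul1r.
have pZ a x : phi (a *: x) = a * phi x by rewrite -{1}[a *: x]addr0 pl p0 addr0.
have [[x0 hx0]|hn] := pselect (exists x, phi x <> 0); last first.
  exists 0 => x; rewrite (dot0l ip); apply: contrapT => h; apply: hn; by exists x.
pose M := [set x | phi x = 0].
have Ms : subspace M by split => // a x y /= hx hy; rewrite /M /= pl hx hy mulr0 addr0.
have Mc : closed_for dot M.
  move=> u x hu ux; apply: nc_eq0; apply/eqP; rewrite -sqrf_eq0 eq_le sqr_ge0 andbT.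
  apply/ler_addgt0Pl => e e0; rewrite addr0.
  have C1 : 0 < `|C| + 1 by side.
  have [N hN] := ux (e / (`|C| + 1)) (divr_gt0 e0 C1).
  have := hN N (leqnn _); rewrite ltr_pdivlMr// => h.
  have -> : phi x = phi (x - u N) by rewrite pD -scaleN1r pZ (hu N) mulr0 addr0.
  apply: (le_trans (pb _)); rewrite (sqnormBC ip).
  have := sqnorm_ge0 ip (u N - x); have := ler_norm C; nra.
have [y [My hy]] := projection x0 Ms Mc.
pose w := x0 - y; have pw : phi w = phi x0 by rewrite /w pD -scaleN1r pZ My mulr0 addr0.
have pw0 : phi w != 0 by rewrite pw; apply/eqP.
have sw : (nsq w)%:C != 0.
  apply/eqP => /(@complexI R) /sqnorm_eq0 w0; by move: pw0; rewrite w0 p0 eqxx.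
exists (((phi w)^* / (nsq w)%:C) *: w) => x.
have : M (x - (phi x / phi w) *: w) by rewrite /M /= pD -scaleNr pZ mulNr divfK// subrr.
move=> /hy; rewrite -/w (dotBl ip) (dotZl ip) (dotxx ip) => /eqP.
rewrite subr_eq0 => /eqP h.
rewrite (dotZl ip) (dotC ip w x) h.
rewrite !conjcM !cconjK !cconj_inv !cconj_real; field.
by rewrite sw pw0.
Qed.

Lemma riesz_conj (psi : V -> R[i]) (C : R) :
  (forall a x y, psi (a *: x + y) = a^* * psi x + psi y) ->
  (forall x, nc (psi x) ^+ 2 <= C * nsq x) ->
  exists v, forall x, psi x = dot x v.
move=> pl pb; have [||v hv] := @riesz (fun x => (psi x)^*) C.
- by move=> a x y; rewrite pl conjcD conjcM cconjK.
- by move=> x; rewrite nc_conj.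
by exists v => x; rewrite (dotC ip) -hv cconjK.
Qed.

(** The vectors representing the functionals a(., y) form a subspace that is closed, since
    coercivity bounds y by its representing vector, and has trivial orthogonal complement, since
    a(x, x) = 0 forces x = 0. Coercivity is asked of the modulus of a(x, x), which covers the form
    of delta - lambda with complex lambda. *)
Lemma lax_milgram (a : V -> V -> R[i]) (C c : R) (psi : V -> R[i]) (D : R) :
  (forall z k x y, a z (k *: x + y) = k * a z x + a z y) ->
  (forall z k x y, a (k *: x + y) z = k^* * a x z + a y z) ->
  (forall z x, nc (a z x) ^+ 2 <= C * nsq z * nsq x) ->
  0 < c -> (forall x, c * nsq x <= nc (a x x)) ->
  (forall k x y, psi (k *: x + y) = k^* * psi x + psi y) ->
  (forall x, nc (psi x) ^+ 2 <= D * nsq x) ->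
  exists y, forall z, a z y = psi z.
move=> al1 al2 ab c0 ac pl pb.
have [v0 hv0] := riesz_conj pl pb.
have hA y : exists v, forall z, a z y = dot z v.
  apply: (@riesz_conj (fun z => a z y) (C * nsq y)) => // x.
  by apply: (le_trans (ab x y)); rewrite mulrAC.
pose M := [set v | exists y, forall z, a z y = dot z v].
suff [y hy] : M v0 by exists y => z; rewrite hy hv0.
have a0 z : a z 0 = 0.
  have := al1 z 0 0 0; rewrite scale0r add0r mul0r add0r => _.
  have := al1 z 1 0 0; rewrite scale1r addr0 mul1r => h; apply: (addrI (a z 0)); rewrite addr0 -{1}h//.
have a0' z : a 0 z = 0.
  have := al2 z 1 0 0; rewrite scale1r addr0 cconj1 mul1r => h; apply: (addrI (a 0 z)); rewrite addr0 -{1}h//.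
have aB z x y : a z (x - y) = a z x - a z y.
  by rewrite addrC -scaleN1r al1 mulN1r addrC.
apply: dense_closed.
- split; first by exists 0 => z; rewrite a0 (dot0r ip).
  move=> k x y [x' hx] [y' hy]; exists (k *: x' + y') => z.
  by rewrite al1 hx hy (dotDr ip) (dotZr ip).
- move=> u x hu ux; have [y_ hy_] := choice hu.
  have est n m : c ^+ 2 * nsq (y_ n - y_ m) <= nsq (u n - u m).
    set d := y_ n - y_ m.
    have e : a d d = dot d (u n - u m) by rewrite [in LHS]/d aB !hy_ (dotBr ip).
    have h1 := ac d; rewrite e in h1.
    have s0 := sqnorm_ge0 ip d.
    have [s1|s1] := eqVneq (nsq d) 0; first by rewrite s1 mulr0 (sqnorm_ge0 ip).
    have s2 : 0 < nsq d by rewrite lt_neqAle eq_sym s1.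
    rewrite -(ler_pM2l s2).
    apply: le_trans (cauchy_schwarz ip d (u n - u m)); rewrite [leLHS](_ : _ = (c * nsq d) ^+ 2); last by ring.
    by rewrite ler_sqr ?nnegrE ?nc_ge0 ?mulr_ge0// ltW.
  have cy : cauchy_seq dot y_.
    move=> e e0; have c2 : 0 < c ^+ 2 by side.
    have [N hN] := tends_cauchy ip ux (mulr_gt0 c2 e0).
    exists N => n m Nn Nm; rewrite -(ltr_pM2l c2).
    by apply: (le_lt_trans (est n m)); exact: hN.
  have [y ly] : exists y, tends dot y_ y by case: H => _ _; apply.
  have [v hv] := hA y.
  exists y => z; rewrite hv; apply/esym.
  apply/eqP; rewrite -subr_eq0 -(dotBr ip); apply/eqP.
  apply: (tends_dot0 ip (u := fun n => u n - v)).
    apply: (tendsD ip) => //; exact: tends_cst.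
  move=> e e0; have K0 : 0 < `|C| * nsq z + 1 by rewrite ltr_wpDl// mulr_ge0// (sqnorm_ge0 ip).
  have [N hN] := ly (e ^+ 2 / (`|C| * nsq z + 1)) (divr_gt0 (exprn_gt0 2 e0) K0).
  exists N => n /hN; rewrite ltr_pdivlMr// => hn.
  rewrite (dotBr ip) -hy_ -hv -aB -ltr_sqr ?nnegrE ?nc_ge0 ?(ltW e0)//.
  apply: (le_lt_trans (ab _ _)).
  apply: le_lt_trans hn; have q0 := sqnorm_ge0 ip (y_ n - y).
  rewrite mulrDr mulr1 (mulrC _ (_ * _)) ler_wpDr// ler_wpM2r// ler_wpM2r ?ler_norm//.
  exact: sqnorm_ge0 ip z.
- move=> x hx; have [v hv] := hA x.
  have : a x x = 0.
    by rewrite hv (dotC ip) hx ?cconj0//; exists x.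
  move=> e; apply: sqnorm_le0.
  by have := ac x; rewrite e nc0 pmulr_rle0.
Qed.

End hilbert_theory.
End inner_product.

Ltac side_leaf3 := lazymatch goal with
  | |- is_true (0 <= sqnorm _ _) => apply: sqnorm_ge0; side
  end.
Ltac side_leaf ::= side_leaf3.

(** * Square root of a positive contraction *)

Section square_root.
Context (R : realType) (V : lmodType R[i]) (dot : V -> V -> R[i]).
Local Notation nsq := (sqnorm dot).
Hypothesis H : hilbert dot.
Let ip : semi_inner dot. by case: H. Qed.
Local Notation nrm x := (Num.sqrt (nsq x)).
Implicit Types (A B C : V -> V).

Definition lin A := forall a x y, A (a *: x + y) = a *: A x + A y.
Definition bounded_by (k : R) A := forall x, nrm (A x) <= k * nrm x.
Definition bounded_op A := exists k, bounded_by k A.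
Definition symmetric_op A := forall x y, dot x (A y) = dot (A x) y.

Lemma lin0 A : lin A -> A 0 = 0.
move=> l; have := l 0 0 0; rewrite !scale0r => _.
by have := l 1 0 0; rewrite !scale1r addr0 => h; apply: (addrI (A 0)); rewrite addr0 -h.
Qed.
Lemma linZ A a x : lin A -> A (a *: x) = a *: A x.
by move=> l; rewrite -[a *: x]addr0 l (lin0 l) addr0. Qed.
Lemma linD A x y : lin A -> A (x + y) = A x + A y.
by move=> l; rewrite -{1}[x]scale1r l scale1r. Qed.
Lemma linB A x y : lin A -> A (x - y) = A x - A y.
by move=> l; rewrite linD// -scaleN1r linZ// scaleN1r. Qed.

Lemma nrm_tends A u x : lin A -> bounded_op A -> tends dot u x ->
  tends dot (fun n => A (u n)) (A x).
move=> l [k bk] /(tendsP ip) ux; apply/(tendsP ip) => e e0.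
have k0 : 0 < `|k| + 1 by side.
have [N hN] := ux _ (divr_gt0 e0 k0); exists N => n /hN.
rewrite ltr_pdivlMr// -linB// => h; apply: (le_lt_trans (bk _)); apply: le_lt_trans h.
by rewrite mulrC ler_wpM2l// (le_trans (ler_norm _))// lerDl.
Qed.

(** Cauchy-Schwarz for the form <x, A y> at the pair (A x, x) gives |A x|^4 <= <A x, A A x> <x, A x>
    <= |A x|^2 |x|^2. *)
Lemma posop_contraction A : lin A -> symmetric_op A ->
  (forall x, 0 <= Re (dot x (A x))) -> (forall x, Re (dot x (A x)) <= nsq x) ->
  forall x, nsq (A x) <= nsq x.
move=> l s p q x.
have ipA : semi_inner (fun x y => dot x (A y)).
  split=> //.
  - by move=> z u v; rewrite linD// (dotDr ip).
  - by move=> z a u; rewrite linZ// (dotZr ip).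
  - by move=> u v; rewrite s (dotC ip).
have := cauchy_schwarz ipA (A x) x; rewrite /sqnorm /= => h.
have e : nc (dot (A x) (A x)) = nsq (A x).
  by rewrite (dotxx ip) nc_real ger0_norm// (sqnorm_ge0 ip).
rewrite e in h.
have s0 := sqnorm_ge0 ip (A x); change (nsq (A x) <= nsq x).
have [s1|s1] := eqVneq (nsq (A x)) 0; first by rewrite s1; side.
have s2 : 0 < nsq (A x) by rewrite lt_neqAle eq_sym s1.
rewrite -(ler_pM2l s2); rewrite expr2 in h; apply: (le_trans h).
by apply: ler_pM.
Qed.

Variable C : V -> V.
Hypothesis Cl : lin C.
Hypothesis Cs : symmetric_op C.
Hypothesis C0 : forall x, 0 <= Re (dot x (C x)).
Hypothesis C1 : forall x, Re (dot x (C x)) <= nsq x.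

Let X x := x - C x.
Let Xl : lin X.
by move=> a x y; rewrite /X Cl scalerBr opprD addrACA. Qed.
Let Xs : symmetric_op X.
by move=> x y; rewrite /X (dotBr ip) (dotBl ip) Cs. Qed.
Let X1 : bounded_by 1 X.
move=> x; rewrite mul1r ler_wsqrtr//; apply: posop_contraction => // {}x.
  by rewrite /X (dotBr ip) ReD ReN subr_ge0; exact: C1.
by rewrite /X (dotBr ip) ReD ReN gerDl oppr_le0; exact: C0.
Qed.

(* The iteration Y <- (X + Y^2) / 2 increases to 1 - (1 - X)^(1/2). *)
Fixpoint Yit n : V -> V :=
  if n is k.+1 then fun x => (2^-1 : R)%:C *: (X x + Yit k (Yit k x)) else fun=> 0.
(** The same recursion with X replaced by its norm bound 1. These numbers bound the norms of the
    iterates and their increments bound those of the iterates, so that convergence is inherited from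
    a bounded monotone real sequence. *)
Fixpoint yit n : R := if n is k.+1 then 2^-1 * (1 + yit k ^+ 2) else 0.

Let Yl n : lin (Yit n).
elim: n => [|n ih] a x y /=; first by rewrite scaler0 addr0.
rewrite Xl !ih !scalerDr !scalerA (mulrC a) addrACA.
by [].
Qed.

Let Ys n : symmetric_op (Yit n).
elim: n => [|n ih] x y /=; first by rewrite (dot0l ip) (dot0r ip).
by rewrite (dotZl ip) (dotZr ip) (dotDl ip) (dotDr ip) Xs !ih cconj_real.
Qed.

Let y01 n : 0 <= yit n <= 1.
elim: n => [|n /andP[h1 h2]] /=; first by side.
have : yit n ^+ 2 <= 1 by rewrite expr_le1.
by have := sqr_ge0 (yit n); lra.
Qed.

Lemma nrmZ a x : nrm (a *: x) = nc a * nrm x.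
by rewrite (sqnormZ ip) sqrtrM ?sqr_ge0// sqrtr_sqr ger0_norm// nc_ge0. Qed.

Let nc_half : nc ((2^-1 : R)%:C) = 2^-1.
by rewrite nc_real ger0_norm//. Qed.

Let Yb n : bounded_by (yit n) (Yit n).
elim: n => [|n ih] x /=; first by rewrite (sqnorm0 ip) sqrtr0.
rewrite nrmZ nc_half -mulrA ler_pM2l//.
apply: (le_trans (nrmD ip _ _)); rewrite mulrDl; apply: lerD; first exact: X1.
apply: (le_trans (ih _)); rewrite -mulrA ler_wpM2l//.
by case/andP: (y01 n).
Qed.

Let Ycomm B n : lin B -> (forall x, B (C x) = C (B x)) -> forall x, B (Yit n x) = Yit n (B x).
move=> Bl BC; elim: n => [|n ih] x /=; first by rewrite lin0.
by rewrite linZ// linD// !ih /X linB// BC.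
Qed.

Let YC n x : C (Yit n x) = Yit n (C x). exact: Ycomm. Qed.

Let YY n m x : Yit m (Yit n x) = Yit n (Yit m x).
by apply: Ycomm => // {}x; rewrite YC. Qed.

Let y_mono n : yit n <= yit n.+1.
elim: n => [|n ih]; first by case/andP: (y01 1).
rewrite [leLHS]/= [leRHS]/= ler_pM2l// lerD2l.
rewrite ler_sqr//; first by case/andP: (y01 n).
by case/andP: (y01 n.+1).
Qed.

(** The iterates commute, so Y_(n+2) - Y_(n+1) = (Y_(n+1) - Y_n)(Y_(n+1) + Y_n) / 2, and the numbers
    [yit] satisfy the same identity. *)
Let Yd n : bounded_by (yit n.+1 - yit n) (fun x => Yit n.+1 x - Yit n x).
elim: n => [|n ih] x.
  by rewrite /= subr0 subr0; exact: (Yb 1).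
have -> : Yit n.+2 x - Yit n.+1 x =
    (2^-1 : R)%:C *: ((Yit n.+1 (Yit n.+1 x + Yit n x)) - Yit n (Yit n.+1 x + Yit n x)).
  have eS k : Yit k.+1 x = (2^-1 : R)%:C *: (X x + Yit k (Yit k x)) by [].
  rewrite (eS n.+1) [in X in _ - X = _](eS n) -scalerBr; congr (_ *: _).
  rewrite (linD _ _ (Yl n.+1)) (linD _ _ (Yl n)) (YY n n.+1) opprD addrACA subrr add0r.
  rewrite opprD addrA; move: (Yit n.+1 (Yit n.+1 x)) (Yit n (Yit n.+1 x)) (Yit n (Yit n x)) => a b c.
  by rewrite addrK.
rewrite nrmZ nc_half.
have -> : yit n.+2 - yit n.+1 = 2^-1 * ((yit n.+1 - yit n) * (yit n.+1 + yit n)).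
  have eS k : yit k.+1 = 2^-1 * (1 + yit k ^+ 2) by [].
  rewrite (eS n.+1) {2}(eS n); ring.
rewrite -mulrA ler_pM2l// -mulrA.
apply: (le_trans (ih _)); rewrite ler_wpM2l ?subr_ge0//.
by apply: (le_trans (nrmD ip _ _)); rewrite mulrDl lerD// Yb.
Qed.

Let Ydm n k : bounded_by (yit (k + n) - yit n) (fun x => Yit (k + n) x - Yit n x).
elim: k => [|k ih] x; first by rewrite subrr (sqnorm0 ip) sqrtr0 subrr.
have -> : Yit (k + n).+1 x - Yit n x = (Yit (k + n).+1 x - Yit (k + n) x) + (Yit (k + n) x - Yit n x).
  by rewrite addrA subrK.
apply: (le_trans (nrmD ip _ _)).
have -> : yit (k + n).+1 - yit n = (yit (k + n).+1 - yit (k + n)) + (yit (k + n) - yit n) by rewrite addrA subrK.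
rewrite mulrDl; apply: lerD; [exact: Yd|exact: ih].
Qed.

Let ycvg : cvgn yit.
apply: nondecreasing_is_cvgn.
  by apply/nondecreasing_seqP => n; exact: y_mono.
by exists 1 => _ [n _ <-]; case/andP: (y01 n).
Qed.

Let Ycauchy x : cauchy_seq dot (fun n => Yit n x).
have key e : 0 < e -> exists N, forall n, (N <= n)%N -> nrm (Yit n x - Yit N x) < e.
  move=> e0; have n0 : 0 < nrm x + 1 by side.
  have /cvgrPdist_lt /(_ _ (divr_gt0 e0 n0)) [N _ hN] := ycvg.
  exists N => n Nn; rewrite -(subnK Nn).
  apply: (le_lt_trans (Ydm _ _ _)).
  have ylim k : yit k <= limn yit.
    by apply: nondecreasing_cvgn_le => //; apply/nondecreasing_seqP => i; exact: y_mono.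
  have := hN N (leqnn N); rewrite /= ger0_norm ?subr_ge0// ltr_pdivlMr// => h.
  apply: le_lt_trans h; apply: ler_pM; rewrite ?lerD2r ?lerDl//.
  rewrite subr_ge0; elim: (n - N)%N => [|k ih]; first by rewrite add0n.
  by rewrite (le_trans ih).
move=> e e0; have [N hN] := key (Num.sqrt e / 2) ltac:(by side).
exists N => n m /hN h1 /hN h2.
rewrite -(sqr_sqrtr (sqnorm_ge0 ip _)) -(sqr_sqrtr (ltW e0)) ltr_sqr ?nnegrE//.
rewrite [X in nrm X](_ : _ = (Yit n x - Yit N x) - (Yit m x - Yit N x)); last first.
  by rewrite opprB addrA subrK.
by apply: (le_lt_trans (nrmB ip _ _)); rewrite [ltRHS]splitr ltrD.
Qed.

Let hlim x : exists y, tends dot (fun n => Yit n x) y.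
by case: H => _ _; apply. Qed.

Let Y x := projT1 (cid (hlim x)).
Let Yt x : tends dot (fun n => Yit n x) (Y x). by rewrite /Y; case: cid. Qed.

Let YL : lin Y.
move=> a x y; apply: (tends_unique H (Yt _)).
by under eq_fun do rewrite Yl; apply: (tendsD ip) => //; exact: tendsZ.
Qed.

Let Ybd x : nsq (Y x) <= nsq x.
apply: (tends_nrm_le ip (Yt x)) => n.
rewrite -(sqr_sqrtr (sqnorm_ge0 ip (Yit n x))) -(sqr_sqrtr (sqnorm_ge0 ip x)).
rewrite ler_sqr ?nnegrE//; apply: (le_trans (Yb _ _)).
by rewrite ler_piMl//; case/andP: (y01 n).
Qed.

Let YSym : symmetric_op Y.
move=> x y; apply/eqP; rewrite -subr_eq0; apply/eqP/nc_eq0/eqP; rewrite eq_le nc_ge0 andbT.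
apply/ler_addgt0Pl => e e0; rewrite addr0; pose K := nrm x + nrm y + 1.
have K0 : 0 < K by rewrite ltr_wpDl//; side.
have [N hN] := (tendsP ip _ _).1 (Yt y) _ (divr_gt0 e0 K0).
have [M hM] := (tendsP ip _ _).1 (Yt x) _ (divr_gt0 e0 K0).
have := hN _ (leq_maxl N M); have := hM _ (leq_maxr N M); set n := maxn N M => h2 h3.
have -> : dot x (Y y) - dot (Y x) y = dot (Yit n x - Y x) y - dot x (Yit n y - Y y).
  by rewrite (dotBl ip) (dotBr ip) (Ys n); ring.
apply: (le_trans (ncB _ _)); apply: (@le_trans _ _ (nrm y * (e / K) + nrm x * (e / K))).
  apply: lerD; apply: (le_trans (dot_le_nrm ip _ _)); last by rewrite ler_wpM2l// ltW.
  by rewrite mulrC ler_wpM2l// ltW.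
rewrite -mulrDl mulrC -mulrA ler_piMr ?(ltW e0)// mulrC ler_pdivrMr// /K; lra.
Qed.

Let Ycommutes B : lin B -> bounded_op B -> (forall x, B (C x) = C (B x)) ->
  forall x, B (Y x) = Y (B x).
move=> Bl Bb BC x; apply: (tends_unique H _ (Yt (B x))).
under eq_fun do rewrite -Ycomm//.
exact: nrm_tends.
Qed.

Let Ysq x : Y (Y x) = 2 *: Y x - X x.
have h1 : tends dot (fun n => Yit n (Yit n x)) (Y (Y x)).
  apply/(tendsP ip) => e e0; have e2 : 0 < e / 2 by side.
  have [N hN] := (tendsP ip _ _).1 (Yt x) _ e2.
  have [M hM] := (tendsP ip _ _).1 (Yt (Y x)) _ e2.
  exists (maxn N M) => n; rewrite geq_max => /andP[/hN h1 /hM h2].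
  rewrite [X in nrm X](_ : _ = Yit n (Yit n x - Y x) + (Yit n (Y x) - Y (Y x))); last first.
    by rewrite (linB _ _ (Yl n)) addrA subrK.
  apply: (le_lt_trans (nrmD ip _ _)); rewrite [ltRHS]splitr ltrD//.
  apply: le_lt_trans h1; apply: (le_trans (Yb _ _)).
  by rewrite ler_piMl//; case/andP: (y01 n).
have h2 : tends dot (fun n => Yit n (Yit n x)) (2 *: Y x - X x).
  have : tends dot (fun n => 2 *: Yit n.+1 x + (-1) *: X x) (2 *: Y x - X x).
    rewrite -(scaleN1r (X x)).
    apply: (tendsD ip); last by apply: (tendsZ ip); exact: tends_cst.
    apply: (tendsZ ip) => e e0; have [N hN] := Yt x e0; exists N => n Nn.
    by apply: hN; rewrite (leq_trans Nn).
  rewrite (_ : (fun n => 2 *: Yit n.+1 x + (-1) *: X x) = (fun n => Yit n (Yit n x)))//.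
  apply/funext => n /=.
  rewrite scalerA (_ : 2 * (2^-1 : R)%:C = 1); last first.
    by apply: complex_eqP => /=; rewrite ?mulfV//; ring.
  by rewrite scale1r scaleN1r addrAC subrr add0r.
exact: (tends_unique H h1 h2).
Qed.

(** P = 1 - Y for the limit Y of the iterates: Y^2 = 2 Y - X gives (1 - Y)^2 = 1 - X = C. A bounded
    operator commuting with C commutes with every iterate, hence with P. *)
Lemma sqrt_op : exists P : V -> V,
  [/\ lin P /\ symmetric_op P, forall x, 0 <= Re (dot x (P x)),
      forall x, P (P x) = C x, forall x, nsq (P x) <= nsq x
    & forall B, lin B -> bounded_op B -> (forall x, B (C x) = C (B x)) ->
        forall x, B (P x) = P (B x)].
exists (fun x => x - Y x).
have hl : lin (fun x => x - Y x) by move=> a x y; rewrite YL scalerBr opprD addrACA.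
have hs : symmetric_op (fun x => x - Y x).
  by move=> x y; rewrite (dotBr ip) (dotBl ip) YSym.
have hsq x : x - Y x - Y (x - Y x) = C x.
  rewrite linB// Ysq /X scaler_nat.
  have aux (p q r : V) : p - q - (q - (q + q - (p - r))) = r.
    have -> : q - (q + q - (p - r)) = (p - r) - q.
      by rewrite opprB (addrC q) opprD addrA subrK.
    by rewrite opprB addrA subrK opprB addrC subrK.
  exact: aux.
split => //.
- move=> x; rewrite (dotBr ip) ReD ReN subr_ge0.
  apply: (le_trans (ler_norm _)); apply: (le_trans (nc_Re _)).
  apply: (le_trans (dot_le_nrm ip _ _)).
  rewrite -[leRHS](sqr_sqrtr (sqnorm_ge0 ip x)) ler_wpM2l//.
  by rewrite ler_wsqrtr.
- move=> x; rewrite -[X in X <= _]/(Re (dot _ _)) hs hsq.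
  by rewrite (dotC ip) ReJ; exact: C1.
- by move=> B Bl Bb BC x; rewrite linB// Ycommutes.
Qed.

End square_root.

(** * Limits of norms and polarization *)

Section norm_limits.
Context (R : realType) (V : lmodType R[i]) (W : lmodType R[i]).
Variables (dot : V -> V -> R[i]) (M : W -> W -> R[i]).
Hypotheses (ip : semi_inner dot) (ipM : semi_inner M).

Lemma tends_sqnorm_le u x w y : tends dot u x -> tends M w y ->
  (forall n, sqnorm dot (u n) = sqnorm M (w n)) -> sqnorm dot x <= sqnorm M y.
move=> /(tendsP ip) ux /(tendsP ipM) wy h.
rewrite -(sqr_sqrtr (sqnorm_ge0 ip x)) -(sqr_sqrtr (sqnorm_ge0 ipM y)).
rewrite ler_sqr ?nnegrE//; apply/ler_addgt0Pl => e e0.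
have e2 : 0 < e / 2 by side.
have [N hN] := ux _ e2; have [K hK] := wy _ e2.
have h1 := hN _ (leq_maxl N K); have h2 := hK _ (leq_maxr N K).
set n := maxn N K in h1 h2.
have h3 := nrm_approx ip u x n.
have h4 : Num.sqrt (sqnorm M (w n)) <= Num.sqrt (sqnorm M (w n - y)) + Num.sqrt (sqnorm M y).
  by rewrite -{1}(subrK y (w n)); exact: nrmD.
rewrite h in h3; lra.
Qed.

Lemma polarize (T : V -> W) : (forall a x y, T (a *: x + y) = a *: T x + T y) ->
  (forall x, sqnorm M (T x) = sqnorm dot x) -> forall x y, M (T x) (T y) = dot x y.
move=> Tl Ts x y.
have hRe u v : Re (M (T u) (T v)) = Re (dot u v).
  have := Ts (u + v); rewrite -{1}[u]scale1r Tl scale1r !sqnormD// !Ts; lra.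
apply: complex_eqP; first exact: hRe.
have TZ a v : T (a *: v) = a *: T v.
  have T0 : T 0 = 0 by have := Tl 1 0 0; rewrite !scale1r addr0 => h; apply: (addrI (T 0)); rewrite addr0 -h.
  by have := Tl a v 0; rewrite T0 !addr0.
have := hRe x ('i *: y); rewrite TZ !dotZr// !ReM /= !mul0r !mul1r !sub0r.
by move/oppr_inj.
Qed.

(** The domain D serves the phase of a polar decomposition, which is isometric only on the
    orthogonal complement of a kernel. *)
Lemma polarize_conj (D : set V) (T : V -> W) : subspace D ->
  (forall a x y, T (a *: x + y) = a^* *: T x + T y) ->
  (forall x, D x -> sqnorm M (T x) = sqnorm dot x) ->
  forall x y, D x -> D y -> M (T x) (T y) = dot y x.
move=> [D0 Dl] Tl Ts x y Dx Dy.
have hRe u v : D u -> D v -> Re (M (T u) (T v)) = Re (dot v u).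
  move=> Du Dv; have := Ts (u + v).
  rewrite -{1 2}[u]scale1r => /(_ (Dl _ _ _ Du Dv)).
  by rewrite Tl cconj1 scale1r !sqnormD// !Ts// (dotC ip u) ReJ; lra.
apply: complex_eqP; first exact: hRe.
have TZ a v : T (a *: v) = a^* *: T v.
  have T0 : T 0 = 0.
    have := Tl 1 0 0; rewrite !scale1r addr0 cconj1 scale1r => h.
    by apply: (addrI (T 0)); rewrite addr0 -h.
  by have := Tl a v 0; rewrite T0 !addr0.
have Diy : D ('i *: y) by have := Dl 'i y 0 Dy D0; rewrite addr0.
have := hRe x ('i *: y) Dx Diy.
rewrite TZ dotZr// dotZl// !ReM /= !mul0r; lra.
Qed.

End norm_limits.

(** * Polar decomposition of the Tomita operator and its modular operator *)

(* [X] with [M] is the domain of the Tomita operator S with its graph scalar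
   product, [J] its inclusion in the Hilbert space [V], and S (J x) = J (star x). *)
Section polar.
Context (R : realType) (V X : lmodType R[i]).
Variables (dot : V -> V -> R[i]) (M : X -> X -> R[i]) (J : X -> V) (star : X -> X).
Local Notation nsq := (sqnorm dot).
Hypothesis H : hilbert dot.
Hypothesis HM : hilbert M.
Hypothesis Jl : forall a x y, J (a *: x + y) = a *: J x + J y.
Hypothesis Jinj : forall x, J x = 0 -> x = 0.
Hypothesis Jdense : forall v, (forall x, dot (J x) v = 0) -> v = 0.
Hypothesis starl : forall a x y, star (a *: x + y) = a^* *: star x + star y.
Hypothesis starK : forall x, star (star x) = x.
Hypothesis ME : forall x y, M x y = dot (J x) (J y) + dot (J (star y)) (J (star x)).

Let ip : semi_inner dot. by case: H. Qed.
Let ipM : semi_inner M. by case: HM. Qed.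
Local Notation nrm x := (Num.sqrt (nsq x)).

Definition real_part : set V := [set v | exists x, star x = x /\ v = J x].

Let J0 : J 0 = 0.
by have := Jl 1 0 0; rewrite !scale1r addr0 => h; apply: (addrI (J 0)); rewrite addr0 -h. Qed.
Let JD x y : J (x + y) = J x + J y. by have := Jl 1 x y; rewrite !scale1r. Qed.
Let JZ a x : J (a *: x) = a *: J x. by have := Jl a x 0; rewrite J0 !addr0. Qed.
Let JB x y : J (x - y) = J x - J y. by rewrite JD -scaleN1r JZ scaleN1r. Qed.
Let Jinj' x y : J x = J y -> x = y.
by move=> h; apply/eqP; rewrite -subr_eq0; apply/eqP/Jinj; rewrite JB h subrr. Qed.
Let star0 : star 0 = 0.
by have := starl 1 0 0; rewrite !scale1r cconj1 scale1r addr0 => h; apply: (addrI (star 0)); rewrite addr0 -h. Qed.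
Let starD x y : star (x + y) = star x + star y. by have := starl 1 x y; rewrite scale1r cconj1 scale1r. Qed.
Let starZ a x : star (a *: x) = a^* *: star x. by have := starl a x 0; rewrite star0 !addr0. Qed.
Let starB x y : star (x - y) = star x - star y.
by rewrite starD -scaleN1r starZ -[(-1)^*]/(conjc (-1)) rmorphN1 scaleN1r. Qed.

Lemma M_star x y : M (star x) (star y) = M y x.
by rewrite !ME !starK addrC. Qed.

Lemma re_im_star x : exists x1 x2, [/\ star x1 = x1, star x2 = x2,
  x = x1 + 'i *: x2 & star x = x1 - 'i *: x2].
have h2 : (2^-1 : R)%:C + (2^-1 : R)%:C = 1.
  by apply: complex_eqP => /=; field.
have i2 : 'i * ('i * (- 2^-1 : R)%:C) = (2^-1 : R)%:C.
  by apply: complex_eqP => /=; ring.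
exists ((2^-1 : R)%:C *: (x + star x)), (('i * (- 2^-1 : R)%:C) *: (x - star x)); split.
- by rewrite starZ starD starK cconj_real addrC.
- rewrite starZ starB starK -[star x - x]opprB scalerN -scaleNr; congr (_ *: _).
  by apply: complex_eqP; rewrite /= /=; ring.
- by rewrite scalerA i2 -scalerDr addrACA subrr addr0 scalerDr -scalerDl h2 scale1r.
- rewrite scalerA i2 -scalerBr opprB addrC addrA subrK scalerDr -scalerDl h2 scale1r//.
Qed.

Lemma tomitaE u v : tomita real_part u v <-> exists x, u = J x /\ v = J (star x).
split=> [[h [k [[x1 [s1 ->]] [x2 [s2 ->]] -> ->]]]|[x [-> ->]]].
  exists (x1 + 'i *: x2); rewrite JD JZ; split => //.
  by rewrite starD starZ s1 s2 cconj_i scaleNr JB JZ.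
have [x1 [x2 [s1 s2 e1 e2]]] := re_im_star x.
exists (J x1), (J x2); split; [by exists x1|by exists x2| |].
  by rewrite e1 JD JZ.
by rewrite e2 JB JZ.
Qed.

Lemma complexification_real_part : complexification real_part = range J.
apply/seteqP; split => v.
  by move=> [h [k [[x1 [_ ->]] [x2 [_ ->]] ->]]]; exists (x1 + 'i *: x2) => //; rewrite JD JZ.
move=> [x _ <-]; have [x1 [x2 [s1 s2 e1 e2]]] := re_im_star x.
by exists (J x1), (J x2); split; [exists x1|exists x2|rewrite e1 JD JZ].
Qed.

Let sqJ x : nsq (J x) <= sqnorm M x.
by rewrite /sqnorm ME ReD lerDl; exact: (sqnorm_ge0 ip). Qed.

(** C is the adjoint of the inclusion [J] from (X, M) into V; by the graph form of M, J C = (1 +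
    delta)^(-1), a positive contraction. *)
Let hC v : exists x, forall z, dot (J z) v = M z x.
apply: (@riesz_conj _ _ M HM (fun z => dot (J z) v) (nsq v)).
  by move=> a x y; rewrite Jl (dotDl ip) (dotZl ip).
move=> x; apply: (le_trans (cauchy_schwarz ip _ _)); rewrite mulrC ler_wpM2l ?(sqnorm_ge0 ip)//.
Qed.

Let C v := projT1 (cid (hC v)).
Let CE v z : dot (J z) v = M z (C v). by rewrite /C; case: cid. Qed.
Let M_eq x y : (forall z, M z x = M z y) -> x = y.
move=> h; apply/eqP; rewrite -subr_eq0; apply/eqP/(dot_nondeg HM) => z.
by rewrite (dotBr ipM) h subrr.
Qed.
Let Clin a u v : C (a *: u + v) = a *: C u + C v.
by apply: M_eq => z; rewrite (dotDr ipM) (dotZr ipM) -!CE (dotDr ip) (dotZr ip). Qed.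
Let JC v := J (C v).
Let JCl : lin JC. by move=> a x y; rewrite /JC Clin Jl. Qed.
Let JCM u v : dot u (JC v) = M (C u) (C v).
by rewrite (dotC ip) CE -(dotC ipM). Qed.
Let JCs : symmetric_op dot JC.
by move=> u v; rewrite JCM (dotC ip) JCM -(dotC ipM). Qed.
Let JC0 v : 0 <= Re (dot v (JC v)).
by rewrite JCM; exact: (sqnorm_ge0 ipM). Qed.
Let JC1 v : Re (dot v (JC v)) <= nsq v.
have h : sqnorm M (C v) ^+ 2 <= nsq v * sqnorm M (C v).
  have := cauchy_schwarz ip v (JC v); rewrite JCM (dotxx ipM) nc_real real_normK ?num_real// => h.
  by apply: (le_trans h); rewrite ler_wpM2l ?(sqnorm_ge0 ip)// sqJ.
rewrite JCM -/(sqnorm M (C v)); have s0 := sqnorm_ge0 ipM (C v).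
have [->|s1] := eqVneq (sqnorm M (C v)) 0; first side.
have s2 : 0 < sqnorm M (C v) by rewrite lt_neqAle eq_sym s1.
by move: h; rewrite ler_pM2r.
Qed.

Let hP := sqrt_op H JCl JCs JC0 JC1.
Let P := projT1 (cid hP).
Let Pl : lin P. by rewrite /P; case: cid => p [] []. Qed.
Let Ps : symmetric_op dot P. by rewrite /P; case: cid => p [] []. Qed.
Let P0 v : 0 <= Re (dot v (P v)). by rewrite /P; case: cid => p []. Qed.
Let PP v : P (P v) = JC v. by rewrite /P; case: cid => p []. Qed.
Let P1 v : nsq (P v) <= nsq v. by rewrite /P; case: cid => p []. Qed.
Let Pcomm B : lin B -> bounded_op dot B -> (forall x, B (JC x) = JC (B x)) ->
  forall x, B (P x) = P (B x).
by rewrite /P; case: cid => p [? ? ? ? h]; exact: h. Qed.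

Let P1b v : Re (dot v (P v)) <= nsq v.
apply: (le_trans (ler_norm _)); apply: (le_trans (nc_Re _)).
apply: (le_trans (dot_le_nrm ip _ _)).
rewrite -[leRHS](sqr_sqrtr (sqnorm_ge0 ip v)) ler_wpM2l//.
by rewrite ler_wsqrtr.
Qed.

Let Pinj v : P v = 0 -> v = 0.
move=> h; apply: Jdense => x; rewrite CE.
have -> : C v = 0 by apply: Jinj; rewrite -/(JC v) -PP h (lin0 Pl).
exact: (dot0r ipM).
Qed.

Let ranP v : exists u : nat -> V, tends dot (fun n => P (u n)) v.
have [] := @dense_of_orth _ _ dot H (range P) _ _ v.
- split; first by exists 0 => //; exact: lin0 Pl.
  by move=> a _ _ [x _ <-] [y _ <-]; exists (a *: x + y).
- move=> x hx; apply: Pinj; apply: (dot_nondeg H) => z.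
  by rewrite Ps; apply: hx; exists z.
- move=> w [hw wv].
  have hw' n : exists x, P x = w n by have [x _ <-] := hw n; exists x.
  have [u hu] := choice hw'.
  by exists u; under eq_fun do rewrite hu.
Qed.

Let MC w : sqnorm M (C w) = nsq (P w).
by rewrite /sqnorm -JCM -PP Ps. Qed.

(** P = (1 + delta)^(-1/2) factors through [J]: since M (C w, C w) = |P w|^2, the map P w |-> C w
    extends by density to an isometry T with J T = P. It is onto because [J] sends a vector
    orthogonal to its range to 0. *)
Let hT v : exists x, J x = P v /\ sqnorm M x = nsq v.
have [u hu] := ranP v.
have cu : cauchy_seq M (fun n => C (u n)).
  move=> e e0; have [N hN] := tends_cauchy ip hu e0; exists N => n m Nn Nm.
  have -> : C (u n) - C (u m) = C (u n - u m).
    by rewrite addrC -scaleN1r -Clin scaleN1r addrC.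
  by rewrite MC (linB _ _ Pl); exact: hN.
have [x hx] : exists x, tends M (fun n => C (u n)) x by case: HM => _ _; apply.
exists x; split.
  have h1 : tends dot (fun n => JC (u n)) (J x).
    move=> e e0; have [N hN] := hx e e0; exists N => n /hN h.
    by rewrite -JB; apply: le_lt_trans h.
  have h2 : tends dot (fun n => P (P (u n))) (P v).
    apply: (nrm_tends H Pl) => //; exists 1 => y.
    by rewrite mul1r ler_wsqrtr.
  by apply: (tends_unique H h1); under eq_fun do rewrite -PP.
have e n : sqnorm M (C (u n)) = nsq (P (u n)) by [].
apply/eqP; rewrite eq_le (tends_sqnorm_le ipM ip hx hu e).
by rewrite (tends_sqnorm_le ip ipM hu hx)// => n; rewrite e.
Qed.

Let T v := projT1 (cid (hT v)).
Let TE v : J (T v) = P v. by rewrite /T; case: cid => x []. Qed.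
Let TM v : sqnorm M (T v) = nsq v. by rewrite /T; case: cid => x []. Qed.
Let Tl a u v : T (a *: u + v) = a *: T u + T v.
by apply: Jinj'; rewrite TE Jl !TE Pl. Qed.
Let TB u v : T (u - v) = T u - T v.
by rewrite addrC -scaleN1r Tl scaleN1r addrC. Qed.
Let Tdot u v : M (T u) (T v) = dot u v.
exact: (polarize ip ipM Tl TM). Qed.
Let Tinj u v : T u = T v -> u = v.
move=> h; apply/eqP; rewrite -subr_eq0; apply/eqP/(sqnorm_eq0 H).
by rewrite -TM TB h subrr (sqnorm0 ipM).
Qed.
Let TPC w : T (P w) = C w.
by apply: Jinj'; rewrite TE PP. Qed.

Let Tsurj x : exists v, T v = x.
suff [v _ <-] : range T x by exists v.
apply: (dense_closed HM).
- split.
    by exists 0 => //; apply: (sqnorm_eq0 HM); rewrite TM (sqnorm0 ip).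
  by move=> a _ _ [u _ <-] [v _ <-]; exists (a *: u + v) => //; rewrite Tl.
- move=> w y hw wy.
  have hw' n : exists v, T v = w n by have [v _ <-] := hw n; exists v.
  have [u hu] := choice hw'.
  have cu : cauchy_seq dot u.
    move=> e e0; have [N hN] := tends_cauchy ipM wy e0; exists N => n m Nn Nm.
    by rewrite -TM TB !hu; exact: hN.
  have [v hv] : exists v, tends dot u v by case: H => _ _; apply.
  exists v => //; apply: (tends_unique HM _ wy).
  move=> e e0; have [N hN] := hv e e0; exists N => n /hN.
  by rewrite -TM TB hu.
- move=> z hz; apply: Jinj; apply: (dot_nondeg H) => w.
  by rewrite (dotC ip) CE (dotC ipM) hz ?cconjK//; exists (P w).
Qed.

(** Transporting the involution of X to V by the unitary T gives the antiunitary phase j of the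
    polar decomposition. *)
Let hj v : exists w, T w = star (T v). exact: Tsurj. Qed.
Let j v := projT1 (cid (hj v)).
Let jE v : T (j v) = star (T v). by rewrite /j; case: cid. Qed.
Let jl a u v : j (a *: u + v) = a^* *: j u + j v.
by apply: Tinj; rewrite jE !Tl !jE. Qed.
Let jj v : j (j v) = v. by apply: Tinj; rewrite !jE. Qed.
Let jiso v : nsq (j v) = nsq v.
by rewrite -!TM jE /sqnorm M_star. Qed.
Let jdot u v : dot (j u) (j v) = dot v u.
exact: (@polarize_conj _ _ _ _ _ ip ip setT j). Qed.
Let jdotr u v : dot u (j v) = dot v (j u). by rewrite -{1}(jj u) jdot. Qed.
Let jdotl u v : dot (j u) v = dot (j v) u. by rewrite -{1}(jj v) jdot. Qed.

Let starCJ x : star (C (J (star x))) = x - C (J x).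
apply: M_eq => z; rewrite -{1}(starK z) M_star (dotC ipM) -CE -(dotC ip).
by rewrite (dotBr ipM) -CE ME addrAC subrr add0r.
Qed.

Let TJC v : T (JC v) = C (J (T v)).
by apply: Jinj'; rewrite TE -PP -/(JC (J (T v))) TE -PP. Qed.

Let jJCj v : j (JC (j v)) = v - JC v.
by apply: Tinj; rewrite jE TJC jE TB TJC. Qed.

(** P conjugated by j, that is (delta (1 + delta)^(-1))^(1/2): by [jJCj], j maps (1 + delta)^(-1) to
    1 - (1 + delta)^(-1), so that P^2 + N^2 = 1. *)
Let N v := j (P (j v)).
Let Nl : lin N.
by move=> a u v; rewrite /N jl Pl jl cconjK. Qed.
Let Ns : symmetric_op dot N.
by move=> u v; rewrite /N jdotr -Ps [in RHS]jdotl. Qed.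
Let N0 v : 0 <= Re (dot v (N v)).
by rewrite /N jdotr -Ps; exact: P0. Qed.
Let NN v : N (N v) = v - JC v.
by rewrite /N jj PP jJCj. Qed.
Let N1 v : nsq (N v) <= nsq v.
by rewrite /N jiso (le_trans (P1 _))// jiso. Qed.
Let Nb : bounded_op dot N.
by exists 1 => v; rewrite mul1r ler_wsqrtr. Qed.
Let NP v : N (P v) = P (N v).
apply: Pcomm => // x.
have e y : JC y = y - N (N y) by rewrite NN opprB addrC subrK.
by rewrite !e (linB _ _ Nl).
Qed.
Let Ninj v : N v = 0 -> v = 0.
have j0 : j 0 = 0 by apply: (sqnorm_eq0 H); rewrite jiso (sqnorm0 ip).
by rewrite /N => /(congr1 j); rewrite jj j0 => /Pinj /(congr1 j); rewrite jj j0.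
Qed.

(** P and N are commuting positive operators; a square root Q of P commutes with N as well, which
    rewrites the scalar product as <Q v, N Q v>. *)
Let PN0 v : 0 <= dot (P v) (N v).
have [Q [[Ql Qs] _ QQ _ Qc]] := sqrt_op H Pl Ps P0 P1b.
have QN x : N (Q x) = Q (N x) by exact: Qc.
have -> : dot (P v) (N v) = dot (Q v) (N (Q v)).
  by rewrite -QQ -Qs QN.
have : dot (Q v) (N (Q v)) = (dot (Q v) (N (Q v)))^* by rewrite {1}Ns (dotC ip).
move/(congr1 Im); rewrite ImJ => h.
by rewrite lecE /= N0 andbT; apply/eqP; lra.
Qed.

(** This is delta^(1/2) = N P^(-1), its graph being parametrized by v. *)
Let A : operator V := fun x y => exists v, x = P v /\ y = N v.

Let A_sa : self_adjoint dot A.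
split.
  move=> x e e0; have [u hu] := ranP x; have [K hK] := hu _ e0.
  exists (P (u K)); split; first by exists (N (u K)), (u K).
  by rewrite (sqnormBC ip); exact: hK.
move=> y z; split.
  move=> [v [-> ->]] _ _ [w [-> ->]].
  by rewrite -Ps -NP Ns.
move=> h; have e : N y = P z.
  apply/eqP; rewrite -subr_eq0; apply/eqP/(dot_nondeg H) => v.
  have := h (P v) (N v); rewrite Ns Ps => /(_ ltac:(by exists v)) hh.
  by rewrite (dotBr ip) (dotC ip v) hh -(dotC ip) subrr.
(* N y = P z, P^2 + N^2 = 1 and N P = P N make this vector the parameter of the pair (y, z). *)
exists (P y + N z); split.
  rewrite (linD _ _ Pl) PP -NP -e NN addrC subrK//.
by rewrite (linD _ _ Nl) NP e PP NN addrC subrK.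
Qed.

Lemma polar_exists : exists j A, conj_polar dot (tomita real_part) j A.
exists j, A; split => //.
- by move=> _ _ [v [-> ->]]; exact: PN0.
- split => //.
    move=> x [v [-> /esym /Ninj ->]]; rewrite (lin0 Pl).
    by apply: (sqnorm_eq0 H); rewrite jiso (sqnorm0 ip).
- move=> x y; rewrite tomitaE; split.
    move=> [a [-> ->]]; have [v <-] := Tsurj a; exists (N v).
    by split; [exists v; rewrite TE|rewrite /N jj -jE TE].
  move=> [_ [[v [-> ->]] ->]]; exists (T v).
  by rewrite TE -jE TE /N jj.
Qed.

(** The right-hand side reads <z, delta u> = <S u, S z> for all z in the domain of S. The inner
    statement [gen] derives it from an arbitrary polar decomposition, so the existential in
    [modular] determines a single operator, and [polar_exists] provides the decomposition needed for
    the converse. *)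
Lemma modularE u v : modular dot real_part u v <->
  exists x, u = J x /\ forall z, dot (J (star x)) (J (star z)) = dot (J z) v.
have gen j' A' : conj_polar dot (tomita real_part) j' A' ->
    op_comp A' A' u v <->
    exists x, u = J x /\ forall z, dot (J (star x)) (J (star z)) = dot (J z) v.
  move=> [[_ sa] _ [j'l j'0 j'i] S].
  pose D := [set x | forall k, A' k 0 -> dot k x = 0].
  have Dsub : subspace D.
    split; first by move=> k _; rewrite (dot0r ip).
    by move=> a x y Dx Dy k /[dup] /Dx h1 /Dy h2; rewrite (dotDr ip) (dotZr ip) h1 h2 mulr0 addr0.
  have Dran p w : A' p w -> D w.
    by move=> pw k /sa /(_ _ _ pw) ->; rewrite (dot0l ip).
  have j'd p w p' w' : A' p w -> A' p' w' -> dot (j' w) (j' w') = dot w' w.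
    move=> pw pw'; apply: (@polarize_conj _ _ _ _ _ ip ip D j') => //.
    - exact: Dran pw.
    - exact: Dran pw'.
  have hS z : exists w, A' (J z) w /\ J (star z) = j' w.
    by apply: (S (J z) (J (star z))).1; apply/tomitaE; exists z.
  split.
    move=> [w [uw wv]].
    have [x [ux jx]] : exists x, u = J x /\ j' w = J (star x).
      by apply/tomitaE/S; exists w.
    exists x; split => // z; have [wz [zw ->]] := hS z.
    rewrite -jx (j'd u w (J z) wz)//.
    by rewrite (dotC ip) ((sa _ _).1 wv _ _ zw) -(dotC ip).
  move=> [x [-> h]]; have [w [xw jw]] := hS x.
  exists w; split => //; apply/sa => p wp pw.
  have [z [pz jz]] : exists z, p = J z /\ j' wp = J (star z).
    by apply/tomitaE/S; exists wp.
  rewrite (dotC ip v) pz -h jw -jz (j'd (J x) w p wp)//.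
  by rewrite -(dotC ip).
split.
  by move=> [j' [A' [h1 h2]]]; exact/(gen _ _ h1).
move=> h; have [j' [A' h1]] := polar_exists; exists j', A'; split => //.
exact/(gen _ _ h1).
Qed.

End polar.

(** * Orthonormal bases and Bessel's inequality *)

Section orthonormal.
Context (R : realType) (X : lmodType R[i]) (M : X -> X -> R[i]).
Hypothesis ip : semi_inner M.
Hypothesis M_def : forall x, sqnorm M x = 0 -> x = 0.

Definition orthonormal_set (E : set X) := forall e e', E e -> E e' -> M e e' = (e == e')%:R.

Lemma exists_orthonormal_basis : exists E : set X, orthonormal_set E /\
  forall x, (forall e, E e -> M e x = 0) -> x = 0.
(* Zorn's lemma: a nonzero vector orthogonal to a maximal orthonormal set could be normalized and
   added to it. *)
have [F FP Ftot|E [oE Emax]] := @Zorn_bigcup X orthonormal_set.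
  move=> e e' [A FA Ae] [B FB Be'].
  by have [AB|BA] := Ftot _ _ FA FB; [apply: (FP _ FB) => //; exact: AB|apply: (FP _ FA) => //; exact: BA].
exists E; split => // x hx; apply: contrapT => x0.
have s0 : 0 < sqnorm M x.
  rewrite lt_neqAle (sqnorm_ge0 ip) andbT; apply/eqP => h; exact/x0/M_def.
pose f := ((Num.sqrt (sqnorm M x))^-1)%:C *: x.
have ff : M f f = 1.
  rewrite (dotxx ip) (sqnormZ ip) nc_real ger0_norm//.
  by rewrite exprVn sqr_sqrtr ?(ltW s0)// mulVf ?gt_eqF.
have Ef e : E e -> M e f = 0 by move=> Ee; rewrite (dotZr ip) hx// mulr0.
have fE : ~ E f by move=> /Ef; rewrite ff => /eqP; rewrite oner_eq0.
apply: (Emax (E `|` [set f])).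
  split; first by move=> e; left.
  by move=> /(_ f) h; apply/fE/h; right.
move=> e e' [Ee|->] [Ee'|->].
- exact: oE.
- by rewrite Ef//; case: eqP => // h; case: fE; rewrite -h.
- by rewrite (dotC ip) Ef// cconj0; case: eqP => // h; case: fE; rewrite h.
- by rewrite ff eqxx.
Qed.

(** At x = sum of conj(phi e) e over s, both phi x and |x|^2 equal the sum S in question, so that
    S^2 <= C S. *)
Lemma bessel (phi : X -> R[i]) (C : R) (s : seq X) :
  (forall a x y, phi (a *: x + y) = a * phi x + phi y) ->
  0 <= C -> (forall x, nc (phi x) ^+ 2 <= C * sqnorm M x) ->
  uniq s -> {in s &, forall e e', M e e' = (e == e')%:R} ->
  \sum_(e <- s) nc (phi e) ^+ 2 <= C.
move=> pl C0 pb us os.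
have p0 : phi 0 = 0.
  by have := pl 1 0 0; rewrite scale1r addr0 mul1r => h; apply: (addrI (phi 0)); rewrite addr0 -h.
pose x := \sum_(e <- s) (phi e)^* *: e.
have px : phi x = (\sum_(e <- s) nc (phi e) ^+ 2)%:C.
  rewrite /x; elim: (s) => [|e r ih]; first by rewrite !big_nil.
  by rewrite !big_cons pl ih mul_conjC rmorphD.
have ex e : e \in s -> M e x = (phi e)^*.
  move=> es; rewrite /x.
  have h r : uniq r -> {subset r <= s} ->
     M e (\sum_(e <- r) (phi e)^* *: e) = if e \in r then (phi e)^* else 0.
    elim: r => [|a r ih] /=; first by rewrite big_nil (dot0r ip).
    move=> /andP[ar ur] rs; rewrite big_cons (dotDr ip) (dotZr ip) ih//; last first.
      by move=> z zr; apply: rs; rewrite inE zr orbT.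
    rewrite os// ?rs ?mem_head// inE; case: eqP => [->|_] /=.
      by rewrite (negbTE ar) mulr1 addr0.
    by rewrite mulr0 add0r.
  by rewrite h// es.
set S := \sum_(e <- s) _ in px *.
have xx : sqnorm M x = S.
  have h r : {subset r <= s} -> Re (M (\sum_(e <- r) (phi e)^* *: e) x) = \sum_(e <- r) nc (phi e) ^+ 2.
    elim: r => [|a r ih] rs; first by rewrite !big_nil (dot0l ip).
    rewrite !big_cons (dotDl ip) (dotZl ip) ReD ih; last first.
      by move=> z zr; apply: rs; rewrite inE zr orbT.
    by rewrite ex ?rs ?mem_head// cconjK mulrC mul_conjC.
  exact: h.
have S0 : 0 <= S by apply: sumr_ge0 => e _; side.
have := pb x; rewrite px nc_real ger0_norm// xx.
have [->//|S1] := eqVneq S 0.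
by rewrite ler_pM2r// lt_neqAle eq_sym S1.
Qed.

End orthonormal.

(** * Resolvents as variational problems and their difference *)

Section resolvents.
Context (R : realType).

(** For negative lambda the real part s + |lambda| t suffices. Otherwise Im lambda is nonzero and
    bounds t, after which the real part bounds s. *)
Lemma coercive_scalar (l : R[i]) : ~~ (0 <= l) ->
  exists c : R, 0 < c /\ forall s t : R, 0 <= s -> 0 <= t -> c * (s + t) <= nc (s%:C - l * t%:C).
rewrite lecE /= negb_and; have [i0|i0 _] := eqVneq (Im l) 0.
  rewrite /= -ltNge => r0.
  exists (Num.min 1 (- Re l)); split; first by rewrite lt_min ltr01 oppr_gt0.
  move=> s t s0 t0.
  apply: le_trans (nc_Re _); rewrite ReD ReN ReM /= i0 mul0r subr0.
  apply: le_trans (ler_norm _).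
  rewrite mulrDr; apply: lerD; first by rewrite ler_piMl// ge_min lexx.
  by rewrite -mulNr ler_wpM2r// ge_min lexx orbT.
pose b := `|Im l|; have b0 : 0 < b by rewrite normr_gt0.
have p0 : 0 < 1 + (1 + `|Re l|) / b by side.
exists (1 + (1 + `|Re l|) / b)^-1; split; first by side.
move=> s t s0 t0; rewrite ler_pdivrMl//.
set w := nc _.
have h1 : s - `|Re l| * t <= w.
  apply: le_trans (nc_Re _); rewrite ReD ReN ReM /= mulr0 subr0.
  by apply: le_trans (ler_norm _); rewrite lerB// ler_wpM2r// ler_norm.
have h2 : b * t <= w.
  apply: le_trans (nc_Im _); rewrite ImD ImN ImM /= mulr0 !add0r normrN normrM.
  by rewrite ler_wpM2l ?normr_ge0// ler_norm.
have h3 : t <= w / b by rewrite ler_pdivlMr// mulrC.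
have h4 : (1 + `|Re l|) * t <= (1 + `|Re l|) * (w / b) by rewrite ler_wpM2l//.
have -> : (1 + (1 + `|Re l|) / b) * w = w + (1 + `|Re l|) * (w / b) by rewrite mulrDl mul1r mulrAC mulrA.
apply: le_trans (lerD h1 h4); rewrite mulrDl; lra.
Qed.

Context (V X : lmodType R[i]).
Variables (dot : V -> V -> R[i]) (star : X -> X).
Hypothesis H : hilbert dot.
Hypothesis starl : forall a x y, star (a *: x + y) = a^* *: star x + star y.
Hypothesis starK : forall x, star (star x) = x.
Let ip : semi_inner dot. by case: H. Qed.

Record tomita_data (J : X -> V) (M : X -> X -> R[i]) : Prop := TomitaData {
  td_hilbert : hilbert M;
  td_lin : forall a x y, J (a *: x + y) = a *: J x + J y;
  td_inj : forall x, J x = 0 -> x = 0;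
  td_dense : forall v, (forall x, dot (J x) v = 0) -> v = 0;
  td_graph : forall x y, M x y = dot (J x) (J y) + dot (J (star y)) (J (star x)) }.

Variables (l : R[i]) (c : R).
Hypothesis c0 : 0 < c.
Hypothesis hc : forall s t : R, 0 <= s -> 0 <= t -> c * (s + t) <= nc (s%:C - l * t%:C).

Section one.
Variables (J : X -> V) (M : X -> X -> R[i]).
Hypothesis D : tomita_data J M.
Let ipM : semi_inner M. by case: (td_hilbert D). Qed.
Let Jl := td_lin D.

(** The form <z, (delta - lambda) x> pulled back to X, which makes sense for x in the domain of
    delta^(1/2) only. *)
Definition res_form z x := dot (J (star x)) (J (star z)) - l * dot (J z) (J x).

Lemma resolventE u v : resolvent l (modular dot (real_part J star)) u v <->
  exists x, v = J x /\ forall z, res_form z x = dot (J z) u.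
have mE := modularE H (td_hilbert D) (td_lin D) (td_inj D) (td_dense D) starl starK (td_graph D).
rewrite /resolvent /op_inv /op_sub /res_form; split.
  move=> [w [_ [/mE[x [vx hx]] -> ->]]]; exists x; split => // z.
  by rewrite hx (dotBr ip) (dotZr ip) vx.
move=> [x [vx hx]]; exists (u + l *: v), (l *: v); split => //; last by rewrite addrK.
apply/mE; exists x; split => // z.
by rewrite (dotDr ip) (dotZr ip) vx -hx subrK.
Qed.

Lemma res_form_lin1 z k x y : res_form z (k *: x + y) = k * res_form z x + res_form z y.
by rewrite /res_form starl !Jl (dotDl ip) (dotZl ip) (dotDr ip) (dotZr ip) cconjK; ring.
Qed.

Lemma res_form_lin2 z k x y : res_form (k *: x + y) z = k^* * res_form x z + res_form y z.
by rewrite /res_form starl !Jl (dotDl ip) (dotZl ip) (dotDr ip) (dotZr ip); ring.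
Qed.

Lemma M_xx x : sqnorm M x = sqnorm dot (J (star x)) + sqnorm dot (J x).
by rewrite {1}/sqnorm (td_graph D) ReD addrC. Qed.

Lemma sqJ_le x : sqnorm dot (J x) <= sqnorm M x.
by rewrite M_xx lerDr (sqnorm_ge0 ip). Qed.

Lemma sqJs_le x : sqnorm dot (J (star x)) <= sqnorm M x.
by rewrite M_xx lerDl (sqnorm_ge0 ip). Qed.

Lemma res_form_coercive x : c * sqnorm M x <= nc (res_form x x).
by rewrite /res_form !(dotxx ip) M_xx; apply: hc; side.
Qed.

Lemma res_form_bounded z x : nc (res_form z x) ^+ 2 <= (1 + nc l) ^+ 2 * sqnorm M z * sqnorm M x.
have A0 : 0 <= (1 + nc l) ^+ 2 * sqnorm M z by side.
have A1 : 0 <= (1 + nc l) ^+ 2 * sqnorm M z * sqnorm M x by side.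
rewrite -[leRHS](sqr_sqrtr A1) ler_sqr ?nnegrE ?nc_ge0//.
rewrite (sqrtrM _ A0) (sqrtrM _ (sqr_ge0 _)) sqrtr_sqr ger0_norm ?addr_ge0 ?nc_ge0//.
rewrite -mulrA mulrDl mul1r; apply: (le_trans (ncB _ _)); apply: lerD.
  apply: (le_trans (dot_le_nrm ip _ _)); rewrite mulrC.
  by apply: ler_pM; rewrite// ler_wsqrtr// sqJs_le.
rewrite ncM ler_wpM2l ?nc_ge0//; apply: (le_trans (dot_le_nrm ip _ _)).
by apply: ler_pM; rewrite// ler_wsqrtr// sqJ_le.
Qed.

Lemma res_exists u : exists x, forall z, res_form z x = dot (J z) u.
apply: (@lax_milgram _ _ M (td_hilbert D) res_form ((1 + nc l) ^+ 2) c _ (sqnorm dot u)) => //.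
- exact: res_form_lin1.
- by move=> z k x y; exact: res_form_lin2.
- exact: res_form_bounded.
- exact: res_form_coercive.
- by move=> k x y; rewrite Jl (dotDl ip) (dotZl ip).
- move=> x; apply: (le_trans (cauchy_schwarz ip _ _)); rewrite mulrC.
  by rewrite ler_wpM2l ?(sqnorm_ge0 ip)// sqJ_le.
Qed.

Definition res_of u := projT1 (cid (res_exists u)).
Lemma res_ofE u z : res_form z (res_of u) = dot (J z) u.
by rewrite /res_of; case: cid. Qed.

Lemma res_form_inj x y : (forall z, res_form z x = res_form z y) -> x = y.
move=> h; apply/eqP; rewrite -subr_eq0; apply/eqP/(sqnorm_eq0 (td_hilbert D)).
have e : res_form (x - y) (x - y) = 0.
  have eB z : res_form z (x - y) = res_form z x - res_form z y.
    by rewrite addrC -scaleN1r res_form_lin1 mulN1r addrC.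
  by rewrite eB h subrr.
have := res_form_coercive (x - y); rewrite e nc0 => h1.
by apply/eqP; rewrite eq_le (sqnorm_ge0 ipM) andbT -(pmulr_rle0 _ c0).
Qed.

Lemma res_of_lin a u v : res_of (a *: u + v) = a *: res_of u + res_of v.
apply: res_form_inj => z; rewrite res_form_lin1 !res_ofE.
by rewrite (dotDr ip) (dotZr ip).
Qed.

Lemma res_of_bound x : c ^+ 2 * sqnorm M (res_of (J x)) <= sqnorm M x.
set y := res_of _.
have h1 := res_form_coercive y; rewrite res_ofE in h1.
have s0 := sqnorm_ge0 ipM y.
have [->|s1] := eqVneq (sqnorm M y) 0; first by rewrite mulr0 (sqnorm_ge0 ipM).
have s2 : 0 < sqnorm M y by rewrite lt_neqAle eq_sym s1.
rewrite -(ler_pM2l s2) [leLHS](_ : _ = (c * sqnorm M y) ^+ 2); last by ring.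
apply: (@le_trans _ _ (nc (dot (J y) (J x)) ^+ 2)).
  by rewrite ler_sqr ?nnegrE ?nc_ge0 ?mulr_ge0// ltW.
by apply: (le_trans (cauchy_schwarz ip (J y) (J x))); apply: ler_pM; rewrite ?(sqnorm_ge0 ip)// sqJ_le.
Qed.

Lemma tomita_app x : op_app (tomita (real_part J star)) (J x) = J (star x).
have tE := tomitaE Jl starl starK.
rewrite /op_app; apply: xget_unique.
  by apply/tE; exists x.
move=> v /tE[y [xy ->]]; congr (J (star _)); apply/eqP; rewrite -subr_eq0; apply/eqP.
by apply: (td_inj D); rewrite addrC -scaleN1r Jl scaleN1r xy addrC subrr.
Qed.

Lemma graph_dotE x y : graph_dot dot (tomita (real_part J star)) (J x) (J y) = M x y.
by rewrite /graph_dot !tomita_app (td_graph D). Qed.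

End one.

Variables (J J' : X -> V) (M M' : X -> X -> R[i]).
Hypothesis D : tomita_data J M.
Hypothesis D' : tomita_data J' M'.
Hypothesis same_symplectic : forall x y,
  dot (J x) (J y) - dot (J (star y)) (J (star x)) =
  dot (J' x) (J' y) - dot (J' (star y)) (J' (star x)).
Variable kap : R.
Hypothesis kap0 : 0 < kap.
Hypothesis MM' : forall x, sqnorm M' x <= kap * sqnorm M x.
Hypothesis M'M : forall x, sqnorm M x <= kap * sqnorm M' x.
Let ipM : semi_inner M. by case: (td_hilbert D). Qed.
Let ipM' : semi_inner M'. by case: (td_hilbert D'). Qed.

(** The factor 1/2 comes from <J x, J y> = (M + sigma) / 2, with sigma the symplectic part common to
    both embeddings. *)
Definition form_diff z x := (2^-1 : R)%:C * (M z x - M' z x).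
Let y' x := res_of D' (J' x).
Let Dx x := res_of D (J x) - y' x.
Let Bx x := x - (1 - l) *: y' x.

Let y'l : lin y'.
by move=> a x y; rewrite /y' (td_lin D') res_of_lin. Qed.
Let Bl : lin Bx.
move=> a x y; rewrite /Bx y'l scalerDr scalerBr !scalerA (mulrC a) opprD.
by rewrite addrACA.
Qed.
Let Dl : lin Dx.
by move=> a x y; rewrite /Dx (td_lin D) res_of_lin y'l scalerBr opprD addrACA.
Qed.

(** With sigma the symplectic part, the form of delta - lambda is (M - sigma)/2 - lambda (M +
    sigma)/2, and the resolvent of x is where it equals (M + sigma)/2 at x. Subtracting the
    equations for M and M', which share sigma, leaves (M - M')/2 at x - (1 - lambda) y'. *)
Lemma res_form_Dx z x : res_form J z (Dx x) = form_diff z (Bx x).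
have e1 : res_form J z (res_of D (J x)) = dot (J z) (J x) by rewrite res_ofE.
have e2 : res_form J' z (y' x) = dot (J' z) (J' x) by rewrite res_ofE.
have eD : res_form J z (Dx x) = res_form J z (res_of D (J x)) - res_form J z (y' x).
  by rewrite /Dx addrC -scaleN1r (res_form_lin1 D) mulN1r addrC.
rewrite eD e1 /form_diff /Bx.
rewrite !(dotBr ipM) !(dotBr ipM') !(dotZr ipM) !(dotZr ipM').
have s1 := same_symplectic z x; have s2 := same_symplectic z (y' x).
move: e2; rewrite /res_form !(td_graph D) !(td_graph D').
move: s1 s2.
set a := dot (J z) (J x); set b := dot _ (J (star z)) ; set a' := dot (J' z) (J' x).
set p := dot (J z) (J (y' x)); set q := dot (J (star (y' x))) (J (star z)).
set p' := dot (J' z) (J' (y' x)); set q' := dot (J' (star (y' x))) (J' (star z)).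
set b' := dot (J' (star x)) (J' (star z)) => s1 s2 e2.
have hb : b = a - (a' - b') by rewrite -s1; ring.
have hq : q = p - (p' - q') by rewrite -s2; ring.
have hq' : q' = a' + l * p' by rewrite -e2; ring.
rewrite hb hq hq'.
have h2 : (2^-1 : R)%:C * (1 + 1) = 1 by apply: complex_eqP => /=; field.
transitivity ((2^-1 : R)%:C * (1 + 1) * (a - (p - (p' - (a' + l * p')) - l * p))).
  by rewrite h2 mul1r.
ring.
Qed.

(** Two comparisons between M and M' account for the square of [kap], and the resolvent bound for 1
    / c^2. *)
Let bet := 2 + 2 * (nc (1 - l) ^+ 2 * (kap * (kap / c ^+ 2))).

Lemma Bx_bound x : sqnorm M (Bx x) <= bet * sqnorm M x.
rewrite /Bx -scaleNr; apply: (le_trans (sqnormD_le ipM _ _)).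
rewrite /bet [leRHS]mulrDl lerD2l (sqnormZ ipM) ncN -[leRHS]mulrA ler_pM2l//.
rewrite -[leRHS]mulrA; apply: ler_wpM2l; first side.
rewrite -!mulrA.
apply: (le_trans (M'M _)); rewrite ler_pM2l//.
have := res_of_bound D' x; rewrite mulrC -ler_pdivlMr ?exprn_gt0// => h.
apply: (le_trans h); rewrite mulrCA mulrC ler_wpM2l ?invr_ge0 ?sqr_ge0//.
Qed.

Variable eps : R.
Hypothesis eps0 : 0 <= eps.
(** The only analytic input of this section: f e bounds the squared norm of z |-> [form_diff] z (B
    e), and eps controls the sum of these bounds over finite orthonormal families. It is established
    in [form_diff_hs]. *)
Hypothesis HSE : forall (B : X -> X) (b : R) (s : seq X), lin B -> 0 <= b ->
  (forall x, sqnorm M (B x) <= b * sqnorm M x) -> uniq s ->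
  {in s &, forall e e', M e e' = (e == e')%:R} ->
  exists f : X -> R, [/\ forall e, 0 <= f e,
    {in s, forall e z, nc (form_diff z (B e)) ^+ 2 <= f e * sqnorm M z}
    & \sum_(e <- s) f e <= b * eps].

Let bet0 : 0 <= bet.
have k := ltW kap0; apply: addr_ge0 => //; apply: mulr_ge0 => //.
by side.
Qed.

Let Dsum (s : seq X) : uniq s -> {in s &, forall e e', M e e' = (e == e')%:R} ->
  \sum_(e <- s) sqnorm M (Dx e) <= bet * eps / c ^+ 2.
move=> us os; have [f [f0 fb fs]] := HSE Bl bet0 Bx_bound us os.
have h e : e \in s -> sqnorm M (Dx e) <= f e / c ^+ 2.
  (* Testing with z = D e itself: c |D e|^2 <= |form_diff (D e) (B e)| <= sqrt(f e) |D e|. *)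
  move=> es; have h1 := res_form_coercive D (Dx e); rewrite res_form_Dx in h1.
  have s0 := sqnorm_ge0 ipM (Dx e).
  have [->|s1] := eqVneq (sqnorm M (Dx e)) 0; first by side.
  have s2 : 0 < sqnorm M (Dx e) by rewrite lt_neqAle eq_sym s1.
  rewrite ler_pdivlMr ?exprn_gt0// -(ler_pM2r s2); apply: le_trans (fb e es (Dx e)).
  rewrite [leLHS](_ : _ = (c * sqnorm M (Dx e)) ^+ 2); last by ring.
  by rewrite ler_sqr ?nnegrE ?nc_ge0 ?mulr_ge0// ltW.
apply: (@le_trans _ _ (\sum_(e <- s) f e / c ^+ 2)).
  by rewrite big_seq [leRHS]big_seq; exact: ler_sum.
by rewrite -mulr_suml ler_wpM2r// invr_ge0 sqr_ge0.
Qed.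

Variable Q : operator V.
Hypothesis QE : forall u v, Q u v <-> exists x, u = J x /\ v = J' x.

Let A : operator V := op_sub (resolvent l (modular dot (real_part J star)))
  (op_comp (op_inv Q) (op_comp (resolvent l (modular dot (real_part J' star))) Q)).

Let AE u v : A u v <-> exists x, u = J x /\ v = J (Dx x).
have JB x y : J (x - y) = J x - J y by rewrite addrC -scaleN1r (td_lin D) scaleN1r addrC.
have Jinj x y : J x = J y -> x = y.
  by move=> h; apply/eqP; rewrite -subr_eq0; apply/eqP/(td_inj D); rewrite JB h subrr.
have J'inj x y : J' x = J' y -> x = y.
  move=> h; apply/eqP; rewrite -subr_eq0; apply/eqP/(td_inj D').
  by rewrite addrC -scaleN1r (td_lin D') scaleN1r h addrC subrr.
rewrite /A /op_sub; split.
  move=> [p [q [/(resolventE D)[y [py hy]] [w [[k [Quk rk]] qw]] ->]]].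
  have [x [ux kx]] := (QE _ _).1 Quk.
  have [t [qt wt]] := (QE _ _).1 qw.
  have [y0 [wy0 hy0]] := (resolventE D' _ _).1 rk.
  exists x; split => //; rewrite /Dx JB py qt; congr (J _ - J _).
    by apply: (res_form_inj D) => z; rewrite hy res_ofE ux.
  apply: J'inj; rewrite -wt wy0; congr J'.
  by apply: (res_form_inj D') => z; rewrite hy0 res_ofE kx.
move=> [x [-> ->]]; exists (J (res_of D (J x))), (J (y' x)); split; last by rewrite /Dx JB.
  by apply/(resolventE D); exists (res_of D (J x)); split => // z; rewrite res_ofE.
exists (J' (y' x)); split; last by apply/QE; exists (y' x).
exists (J' x); split; first by apply/QE; exists x.
by apply/(resolventE D'); exists (y' x); split => // z; rewrite res_ofE.
Qed.

Let W := complexification (real_part J star).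
Let gd := graph_dot dot (tomita (real_part J star)).

Let WE : W = range J.
exact: complexification_real_part (td_lin D) starl starK. Qed.

Lemma resolvent_difference_hs : exists E, [/\ orthonormal_basis W gd E,
  bounded_linear_on W gd A
  & (hs_sum gd A E <= (bet * eps / c ^+ 2)%:E)%E].
have Jinj x y : J x = J y -> x = y.
  move=> h; apply/eqP; rewrite -subr_eq0; apply/eqP/(td_inj D).
  by rewrite addrC -scaleN1r (td_lin D) scaleN1r h addrC subrr.
have gdE x y : gd (J x) (J y) = M x y by exact: (graph_dotE D).
have Aapp x : op_app A (J x) = J (Dx x).
  rewrite /op_app; apply: xget_unique; first by apply/AE; exists x.
  by move=> v /AE[y [/Jinj -> ->]].
have [E [oE Emax]] := exists_orthonormal_basis ipM (fun x => @sqnorm_eq0 _ _ _ (td_hilbert D) x).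
exists (J @` E); split.
- split.
  + by rewrite WE => _ [x _ <-]; exists x.
  + move=> _ _ [x Ex <-] [y Ey <-]; rewrite gdE oE//; congr (_%:R).
    by congr nat_of_bool; apply/eqP/eqP => [->//|/Jinj].
  + rewrite WE => _ [x _ <-] h; rewrite (Emax x) ?(td_lin D)//.
      have := td_lin D 1 0 0; rewrite !scale1r addr0 => h0.
      by apply: (addrI (J 0)); rewrite addr0 -h0.
    by move=> e Ee; rewrite -gdE; apply: h; exists e.
- split.
  + rewrite WE; apply/seteqP; split => u.
      by move=> [v /AE[x [-> _]]]; exists x.
    by move=> [x _ <-]; exists (J (Dx x)); apply/AE; exists x.
  + by move=> u v /AE[x [_ ->]]; rewrite WE; exists (Dx x).
  + by move=> u v v' /AE[x [-> ->]] /AE[y [/Jinj -> ->]].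
  + move=> a u v u' v' /AE[x [-> ->]] /AE[y [-> ->]]; apply/AE.
    by exists (a *: x + y); rewrite Dl !(td_lin D).
  + exists (2 * (1 / c ^+ 2) + 2 * (kap * (kap / c ^+ 2))) => u v /AE[x [-> ->]].
    have sE y : sqnorm gd (J y) = sqnorm M y by rewrite /sqnorm gdE.
    rewrite !sE /Dx -scaleN1r; apply: (le_trans (sqnormD_le ipM _ _)).
    rewrite [leRHS]mulrDl; apply: lerD.
      rewrite -mulrA ler_pM2l// mul1r mulrC ler_pdivlMr ?exprn_gt0// mulrC.
      exact: res_of_bound.
    rewrite (sqnormZ ipM) ncN nc1 expr1n mul1r -!mulrA ler_pM2l//.
    apply: (le_trans (M'M _)); rewrite ler_pM2l//.
    have := res_of_bound D' x; rewrite mulrC -ler_pdivlMr ?exprn_gt0// => h.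
    apply: (le_trans h); rewrite mulrCA mulrC ler_wpM2l ?invr_ge0 ?sqr_ge0//.
- rewrite /hs_sum; apply: ub_ereal_sup => _ [F [Ffin FE] <-].
  (* Inverse of [J] on its range; it pulls a finite subset of the basis back to a list of vectors of
     X. *)
  pose g v := xget 0 [set x | J x = v].
  have gJ x : g (J x) = x.
    by rewrite /g; apply: xget_unique => // y /Jinj.
  rewrite fsbig_finite//=.
  pose s := map g (finmap.enum_fset (fset_set F)).
  have sF v : v \in finmap.enum_fset (fset_set F) -> exists2 x, E x & v = J x.
    move=> vF; have : v \in F by rewrite -(in_fset_set Ffin).
    by move=> /set_mem/FE[x Ex <-]; exists x.
  have -> : (\sum_(v <- finmap.enum_fset (fset_set F)) (sqnorm gd (op_app A v))%:E =
     (\sum_(e <- s) sqnorm M (Dx e))%:E)%E.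
    rewrite -sumEFin /s big_map big_seq [RHS]big_seq; apply: eq_bigr => v /sF[x Ex ->].
    by rewrite gJ Aapp /sqnorm gdE.
  rewrite lee_fin; apply: Dsum.
    rewrite map_inj_in_uniq ?finmap.fset_uniq// => u v /sF[x _ ->] /sF[y _ ->].
    by rewrite !gJ => ->.
  move=> _ _ /mapP[u /sF[x Ex ->] ->] /mapP[v /sF[y Ey ->] ->].
  by rewrite !gJ oE.
Qed.

End resolvents.

(** * L^2 as a Hilbert space *)

Section L2_space.
Context d (T : measurableType d) (R : realType) (mu : {measure set T -> \bar R}).
Implicit Types (f g : T -> R[i]) (u v : L2 mu).

Lemma Lfun2P (f : T -> R) : f \in Lfun mu 2%:E <->
  mfun f /\ L1 mu (fun x => f x ^+ 2).
split.
  move=> Lf; split; first by have := sub_Lfun_mfun Lf; rewrite inE.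
  exact: Lfun2_integrable_sqr.
move=> [mf If]; apply/andP; split; rewrite inE//= /finite_norm unlock /Lnorm.
have /integrableP[_] := If.
under [X in _ -> (X `^ _ < _)%E]eq_integral do rewrite poweR_EFin powR_mulrn// -normrX.
exact: poweR_lty.
Qed.

Definition sqint f := cmeas f /\ L1 mu (fun x => nc (f x) ^+ 2).

Lemma sqintP f : sqint f <-> f \in Lfun2C mu.
rewrite inE /= /sqint; split.
  move=> [[mr mi] If]; split; apply/Lfun2P; split => //; apply: le_L1 If => //.
  - by side.
  - by move=> x; rewrite ger0_norm ?sqr_ge0// sqr_nc lerDl sqr_ge0.
  - by side.
  - by move=> x; rewrite ger0_norm ?sqr_ge0// sqr_nc lerDr sqr_ge0.
move=> [/Lfun2P[mr Ir] /Lfun2P[mi Ii]]; split => //.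
under eq_fun do rewrite sqr_nc.
exact: L1D.
Qed.

Lemma sqint_le f (g : T -> R) : cmeas f ->
  (forall x, nc (f x) ^+ 2 <= g x) -> L1 mu g -> sqint f.
move=> mf fg Ig; split => //; apply: le_L1 Ig => [|x].
  by side.
by rewrite ger0_norm; side.
Qed.

Lemma sqint_lin (a : R[i]) f g : sqint f -> sqint g -> sqint (fun x => a * f x + g x).
move=> /sqintP hf /sqintP hg; apply/sqintP.
by have := (Lfun2C_submod_closed mu).2 a _ _ hf hg.
Qed.

Lemma sqint0 : sqint (fun _ => 0).
by apply/sqintP; exact: (Lfun2C_submod_closed mu).1. Qed.

Lemma sqint_conj f : sqint f -> sqint (fun x => (f x)^*).
move=> [mf If]; split; first side.
by under eq_fun do rewrite nc_conj.
Qed.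

Lemma sqint_mul f g : sqint f -> sqint g -> cL1 mu (fun x => f x * g x).
move=> [mf If] [mg Ig].
apply: (@cL1_le _ _ _ mu _ (fun x => nc (f x) ^+ 2 + nc (g x) ^+ 2)).
- by side.
- move=> x; rewrite ncM.
  have := sqr_ge0 (nc (f x) - nc (g x)); have := mulr_ge0 (nc_ge0 (f x)) (nc_ge0 (g x)).
  rewrite sqrrB; lra.
- exact: L1D.
Qed.

Lemma repr_sqint u : sqint (repr u).
by apply/sqintP; case: (repr u). Qed.

(** Functions that are not square integrable are sent to the class of 0. *)
Definition L2_of f : L2 mu := \pi_(L2 mu)%qT (insubd (0 : L2fun mu) f).

Lemma L2_pi_ae (f : L2fun mu) : {ae mu, forall x, repr (\pi_(L2 mu)%qT f) x = f x}.
have : repr (\pi_(L2 mu)%qT f) - f \in @L2null _ _ _ mu.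
  by rewrite Quotient.idealrBE reprK.
by rewrite inE /=; apply: filterS => x; rewrite !fctE => /eqP; rewrite subr_eq0 => /eqP.
Qed.

Lemma L2_of_ae f : sqint f -> {ae mu, forall x, repr (L2_of f) x = f x}.
move=> /sqintP hf; have := L2_pi_ae (insubd (0 : L2fun mu) f).
by apply: filterS => x ->; rewrite /insubd insubT.
Qed.

Lemma L2_eqP u v : {ae mu, forall x, repr u x = repr v x} <-> u = v.
split; last by move=> ->; exact: nearW.
move=> h; rewrite -[u]reprK -[v]reprK; apply/eqP; rewrite -Quotient.idealrBE inE /=.
by apply: filterS h => x; rewrite !fctE => ->; rewrite subrr.
Qed.

Lemma L2_of_eq f u : sqint f -> {ae mu, forall x, f x = repr u x} -> L2_of f = u.
by move=> hf h; apply/L2_eqP; apply: filterS2 (L2_of_ae hf) h => x -> ->.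
Qed.

Lemma L2_of_repr u : L2_of (repr u) = u.
by apply: L2_of_eq; [exact: repr_sqint|exact: nearW]. Qed.

Lemma repr_lin (a : R[i]) u v : {ae mu, forall x, repr (a *: u + v) x = a * repr u x + repr v x}.
have -> : a *: u + v = \pi_(L2 mu)%qT (a *: repr u + repr v).
  rewrite raddfD /= reprK; congr (_ + _).
  by rewrite -[in LHS](reprK u) /GRing.scale /= -pi_L2_scale.
by apply: filterS (L2_pi_ae (a *: repr u + repr v)) => x ->.
Qed.

Lemma reprZ (a : R[i]) u : {ae mu, forall x, repr (a *: u) x = a * repr u x}.
have h0 : {ae mu, forall x, repr (0 : L2 mu) x = 0}.
  by have := repr_lin (-1) 0 0; rewrite scaler0 addr0; apply: filterS => x; rewrite mulN1r addNr.
have := repr_lin a u 0; rewrite addr0; apply: filterS2 h0 => x -> ->.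
by rewrite addr0.
Qed.

Lemma reprB u v : {ae mu, forall x, repr (u - v) x = repr u x - repr v x}.
have := repr_lin (-1) v u; rewrite scaleN1r addrC; apply: filterS => x ->.
by rewrite mulN1r addrC.
Qed.

Lemma L2_dotE u v f g : cmeas f -> cmeas g ->
  {ae mu, forall x, repr u x = f x} -> {ae mu, forall x, repr v x = g x} ->
  L2_dot u v = cint mu (fun x => (f x)^* * g x).
move=> mf mg hu hv; apply: ae_eq_cint.
- by apply: cmeasM; [apply: cmeas_conj|]; case: (repr_sqint u) (repr_sqint v) => ? ? [].
- by side.
- by apply: filterS2 hu hv => x -> ->.
Qed.

Lemma L2_dot_of f g : sqint f -> sqint g ->
  L2_dot (L2_of f) (L2_of g) = cint mu (fun x => (f x)^* * g x).
by move=> hf hg; apply: L2_dotE; rewrite ?hf.1.1//; [case: hf|case: hg|exact: L2_of_ae|exact: L2_of_ae]. Qed.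

Lemma L2_semi_inner : semi_inner (@L2_dot _ _ _ mu).
have mr u : cmeas (repr u) by case: (repr_sqint u).
have ir u v : cL1 mu (fun x => (repr u x)^* * repr v x).
  by apply: sqint_mul; [apply: sqint_conj|]; exact: repr_sqint.
have L (z : L2 mu) a (x y : L2 mu) : L2_dot z (a *: x + y) = a * L2_dot z x + L2_dot z y.
  rewrite (@L2_dotE z (a *: x + y) (repr z) (fun t => a * repr x t + repr y t))//; last 3 first.
  - by side.
  - exact: nearW.
  - exact: repr_lin.
  rewrite /L2_dot -cintZ; last exact: ir.
  rewrite -cintD; [|exact/cL1Z/ir|exact: ir].
  by apply: eq_cint => t; ring.
split.
- by move=> z x y; have := L z 1 x y; rewrite scale1r mul1r.
- move=> z a x; have := L z a x 0; rewrite addr0 => ->.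
  by have := L z 1 0 0; rewrite scale1r addr0 mul1r => /(congr1 (fun t => t - L2_dot z 0)); rewrite subrr addrK => <-; rewrite addr0.
- move=> x y; rewrite /L2_dot -cint_conj; last exact: ir.
  by apply: eq_cint => t; rewrite -conjcE conjcE conjcM cconjK mulrC.
- by move=> x; apply: Rintegral_ge0 => t _ /=; rewrite mul_conjC sqr_ge0.
Qed.

Lemma sqnorm_L2 u f : cmeas f -> {ae mu, forall x, repr u x = f x} ->
  sqnorm (@L2_dot _ _ _ mu) u = \int[mu]_x nc (f x) ^+ 2.
move=> mf h; rewrite /sqnorm (L2_dotE mf mf h h) /=.
by apply: eq_Rintegral => x _; rewrite mul_conjC.
Qed.

Lemma sqnorm_L2E u f : cmeas f -> {ae mu, forall x, repr u x = f x} ->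
  (sqnorm (@L2_dot _ _ _ mu) u)%:E = (\int[mu]_x (nc (f x) ^+ 2)%:E)%E.
move=> mf h; rewrite (sqnorm_L2 mf h) fineK//.
have [mu0 Iu] := repr_sqint u.
have /integrable_fin_num -> // : L1 mu (fun x => nc (f x) ^+ 2).
by apply: ae_L1 Iu; [side|apply: filterS h => x ->].
Qed.

Lemma L2_def u : sqnorm (@L2_dot _ _ _ mu) u = 0 -> u = 0.
move=> h; have mr : cmeas (repr u) by case: (repr_sqint u).
have r0 : {ae mu, forall x, repr (0 : L2 mu) x = 0}.
  by have := reprZ 0 u; rewrite scale0r; apply: filterS => x ->; rewrite mul0r.
apply/L2_eqP.
have : (\int[mu]_x `|(nc (repr u x) ^+ 2)%:E| = 0)%E.
  by under eq_integral do rewrite /= ger0_norm ?sqr_ge0//; rewrite -(@sqnorm_L2E u)// ?h//; exact: nearW.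
have mn : mfun (fun x => (nc (repr u x) ^+ 2)%:E) by side.
move/(ae_eq_integral_abs mu measurableT mn); rewrite /ae_eq => hh; apply: filterS2 r0 hh => x -> /(_ I)[].
by move=> /eqP; rewrite sqrf_eq0 => /eqP/nc_eq0.
Qed.

Lemma geometric_cauchy (r : nat -> R) (C : R) :
  (forall k, `|r k.+1 - r k| <= C * 2^-1 ^+ k) -> cvgn r.
move=> h.
have -> : r = (fun n => r 0%N + series (telescope r) n) by apply/funext => n; rewrite -eq_sum_telescope.
apply: is_cvgD; first exact: is_cvg_cst.
apply: normed_cvg; apply: (@series_le_cvg _ _ (geometric C 2^-1)) => [n|n|n|].
- by rewrite normr_ge0.
- apply: mulr_ge0 => //; by have := h 0%N; rewrite mulr1; exact: le_trans.
- exact: h.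
- by apply: is_cvg_geometric_series; rewrite ger0_norm// invf_lt1// ltr1n.
Qed.

Lemma nc_cvg (h : nat -> R[i]) (z : R[i]) :
  Re (h n) @[n --> \oo] --> Re z -> Im (h n) @[n --> \oo] --> Im z ->
  forall w, nc (h n - w) ^+ 2 @[n --> \oo] --> nc (z - w) ^+ 2.
move=> hr hi w; rewrite sqr_nc; under eq_fun do rewrite sqr_nc !ReD !ImD !ReN !ImN.
rewrite !ReD !ImD !ReN !ImN; apply: cvgD.
  by apply: @cvg_comp _ _ _ _ (fun x => x ^+ 2) _ _ _ _ (@exprn_continuous _ 2 _); apply: cvgB => //; exact: cvg_cst.
by apply: @cvg_comp _ _ _ _ (fun x => x ^+ 2) _ _ _ _ (@exprn_continuous _ 2 _); apply: cvgB => //; exact: cvg_cst.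
Qed.

(** Riesz-Fischer: along a subsequence with squared increments at most 16^(-k), the series of 4^k
    |F_(k+1) - F_k|^2 has a finite integral, hence is finite almost everywhere, which makes the
    pointwise increments O(2^(-k)). Fatou's lemma shows that the pointwise limit is the limit in
    norm. *)
Lemma L2_complete (u : nat -> L2 mu) : cauchy_seq (@L2_dot _ _ _ mu) u ->
  exists x, tends (@L2_dot _ _ _ mu) u x.
set dot := @L2_dot _ _ _ mu => cu; have ip : semi_inner dot := L2_semi_inner.
have [N hN] : exists N : nat -> nat, forall k n m, (N k <= n)%N -> (N k <= m)%N ->
    sqnorm dot (u n - u m) < 16^-1 ^+ k.
  have h k : exists N, forall n m, (N <= n)%N -> (N <= m)%N -> sqnorm dot (u n - u m) < 16^-1 ^+ k.
    by apply: cu; side.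
  by have [N hN] := choice h; exists N.
pose phi k := (\max_(j < k.+1) N j)%N.
have Nphi j k : (j <= k)%N -> (N j <= phi k)%N.
  by move=> jk; exact: (@leq_bigmax _ (fun j : 'I_k.+1 => N j) (Ordinal (jk : (j < k.+1)%N))).
pose F k := repr (u (phi k)).
have mF k : cmeas (F k) by case: (repr_sqint (u (phi k))).
have hF j k : (k <= j)%N -> (\int[mu]_x (nc (F j x - F k x) ^+ 2)%:E <= (16^-1 ^+ k)%:E)%E.
  move=> kj; rewrite -(@sqnorm_L2E (u (phi j) - u (phi k))) ?lee_fin.
  - by apply/ltW/hN; exact: Nphi.
  - by side.
  - exact: reprB.
pose D k x := nc (F k.+1 x - F k x) ^+ 2.
have mD k : mfun (D k) by side.
have D0 k x : 0 <= D k x by rewrite sqr_ge0.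
pose G x := (\sum_(0 <= k <oo) (4 ^+ k * D k x)%:E)%E.
have t0 k x : (0 <= (4 ^+ k * D k x)%:E)%E by side.
have mt k : mfun (fun x => (4 ^+ k * D k x)%:E) by side.
have mG : mfun G by apply: ge0_emeasurable_sum.
have G0 x : (0 <= G x)%E by apply: nneseries_ge0.
have IG : (\int[mu]_x G x < +oo)%E.
  rewrite /G integral_nneseries//.
  apply: (@le_lt_trans _ _ (\sum_(0 <= k <oo) (4^-1 ^+ k)%:E)%E).
    apply: lee_nneseries => [k _ _|k _]; [by apply: integral_ge0 => x _; exact: t0|].
    have -> : (\int[mu]_x (4 ^+ k * D k x)%:E)%E = ((4 ^+ k)%:E * \int[mu]_x (D k x)%:E)%E.
      rewrite -ge0_integralZl//; first exact/measurable_EFinP.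
      by move=> x _; rewrite lee_fin.
    have -> : (4^-1 ^+ k)%:E = ((4 ^+ k)%:E * (16^-1 ^+ k)%:E)%E :> \bar R.
      rewrite -EFinM -exprMn; congr (_ ^+ _)%:E.
      by rewrite (_ : 16 = 4 * 4) ?invfM ?mulrA ?divff ?mul1r// -natrM.
    by rewrite lee_pmul2l// ?lte_fin ?exprn_gt0//; exact: hF.
  have -> : (\sum_(0 <= k <oo) (4^-1 ^+ k)%:E = limn (EFin \o series (geometric 1 4^-1 : nat -> R)))%E.
    apply: congr_lim; apply/funext => n /=.
    by rewrite -sumEFin /series /=; apply: eq_bigr => i _; rewrite mul1r.
  have c : cvgn (series (geometric 1 4^-1 : nat -> R)).
    by apply: is_cvg_geometric_series; rewrite ger0_norm ?invr_ge0// invf_lt1// ltr1n.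
  by rewrite EFin_lim// ltry.
pose E := [set x | (G x < +oo)%E].
have mE : measurable E.
  by rewrite /E -[X in measurable X]setTI; exact: emeasurable_fun_infty_o.
have aeE : {ae mu, forall x, E x}.
  have iG : mu.-integrable setT G.
    apply/integrableP; split => //.
    have -> : (\int[mu]_x `|G x| = \int[mu]_x G x)%E by apply: eq_integral => x _; rewrite gee0_abs.
    exact: IG.
  have := integrable_ae measurableT iG; apply: filterS => x /(_ I).
  by rewrite /E /= ge0_fin_numE.
have step x k : E x -> nc (F k.+1 x - F k x) <= Num.sqrt (fine (G x)) * 2^-1 ^+ k.
  move=> Ex; rewrite -[leLHS](ger0_norm (nc_ge0 _)) -sqrtr_sqr.
  rewrite -[X in _ * X](ger0_norm (exprn_ge0 _ _)) ?invr_ge0// -sqrtr_sqr -sqrtrM ?fine_ge0//.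
  apply: ler_wsqrtr; rewrite -exprM mulnC exprM exprVn -natrX.
  rewrite exprVn ler_pdivlMr ?exprn_gt0// -lee_fin fineK ?ge0_fin_numE//.
  rewrite mulrC; apply: le_trans _ (nneseries_lim_ge k.+1 _) => //=.
  rewrite big_nat_recr//=; exact/leeDr/sume_ge0.
(* Set to 0 where the series diverges, so that the limit exists at every point. *)
pose h k x := F k x * (\1_E x)%:C.
have mh k : cmeas (h k) by side.
have hc x k : nc (h k.+1 x - h k x) <= Num.sqrt (fine (G x)) * 2^-1 ^+ k.
  rewrite -mulrBl ncM nc_real indicE; case: (boolP (x \in E)) => [/set_mem Ex|_].
    by rewrite normr1 mulr1; exact: step.
  by rewrite normr0 mulr0 mulr_ge0 ?sqrtr_ge0// exprn_ge0 // invr_ge0.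
have cR x : cvgn (fun k => Re (h k x)).
  apply: (@geometric_cauchy _ (Num.sqrt (fine (G x)))) => k.
  by apply: le_trans (hc x k); rewrite -ReN -ReD; exact: nc_Re.
have cI x : cvgn (fun k => Im (h k x)).
  apply: (@geometric_cauchy _ (Num.sqrt (fine (G x)))) => k.
  by apply: le_trans (hc x k); rewrite -ImN -ImD; exact: nc_Im.
pose f x := (limn (fun k => Re (h k x))) +i* (limn (fun k => Im (h k x))).
have mf : cmeas f.
  split; rewrite /f /=.
    by apply: (@measurable_fun_cvg _ _ _ _ (fun k x => Re (h k x))) => [m|x _]; [case: (mh m)|exact: cR].
  by apply: (@measurable_fun_cvg _ _ _ _ (fun k x => Im (h k x))) => [m|x _]; [case: (mh m)|exact: cI].
have fF k : (\int[mu]_x (nc (f x - F k x) ^+ 2)%:E <= (16^-1 ^+ k)%:E)%E.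
  apply: (@fatou_bound _ _ _ mu (fun j x => nc (h (j + k)%N x - F k x) ^+ 2)) => [j|j x|x|j].
  - by side.
  - exact: sqr_ge0.
  - by apply: (@nc_cvg (fun j => h (j + k)%N x)); [exact: cvg_comp (cvg_addnr k) (cR x)|exact: cvg_comp (cvg_addnr k) (cI x)].
  rewrite (ae_eq_integral (fun x => (nc (F (j + k)%N x - F k x) ^+ 2)%:E))//; [exact/hF/leq_addl|by side|by side|].
  by apply: filterS aeE => x Ex _; rewrite /h indicE mem_set//= mulr1.
have sf : sqint f.
  rewrite (_ : f = (fun x => 1 * (f x - F 0%N x) + F 0%N x)); last by apply/funext => x; rewrite mul1r subrK.
  apply: sqint_lin (repr_sqint _); split; first by side.
  by apply: ge0_L1 => [|x|]; [side|exact: sqr_ge0|exact: le_lt_trans (fF 0%N) (ltry _)].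
exists (L2_of f) => e e0.
have [k hk] : exists k, 4 * 16^-1 ^+ k < e.
  have c : (fun k => 4 * 16^-1 ^+ k : R) @ \oo --> (4 * 0 : R).
    apply: cvgMr; apply: cvg_expr; by rewrite ger0_norm ?invr_ge0// invf_lt1// ltr1n.
  rewrite mulr0 in c; have /cvgrPdist_lt/(_ e e0)[n _ hn] := c; exists n.
  have := hn n (leqnn _); rewrite /= sub0r normrN; exact: le_lt_trans (ler_norm _).
exists (phi k) => n kn; apply: le_lt_trans hk.
have -> : u n - L2_of f = (u n - u (phi k)) + (u (phi k) - L2_of f) by rewrite addrA subrK.
apply: (le_trans (sqnormD_le ip _ _)).
have h1 : sqnorm dot (u n - u (phi k)) <= 16^-1 ^+ k.
  by apply/ltW/hN; [apply: leq_trans kn; exact: Nphi|exact: Nphi].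
have h2 : sqnorm dot (u (phi k) - L2_of f) <= 16^-1 ^+ k.
  rewrite -lee_fin (@sqnorm_L2E _ (fun x => F k x - f x)); last 2 first.
  - by side.
  - by apply: filterS2 (reprB (u (phi k)) (L2_of f)) (L2_of_ae sf) => x -> ->.
  apply: le_trans (fF k); apply/eqW.
  by apply: eq_integral => x _; rewrite -ncN opprB.
lra.
Qed.

Lemma L2_hilbert : hilbert (@L2_dot _ _ _ mu).
by split; [exact: L2_semi_inner|exact: L2_def|exact: L2_complete]. Qed.

End L2_space.

Ltac side_leaf7 := match goal with
  | _ => side_leaf3
  | |- semi_inner (@L2_dot _ _ _ _) => exact: L2_semi_inner
  | |- sqint _ (repr _) => exact: repr_sqint
  | |- cmeas (repr _) => exact: (repr_sqint _).1
  | h : sqint _ ?f |- cmeas ?f => exact: h.1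
  | h : sqint _ ?f |- integrable _ _ (EFin \o (fun _ => nc (?f _) ^+ 2)) => exact: h.2
  | |- sqint _ (fun _ => cconj _) => apply: sqint_conj; side
  | |- cL1 _ (fun _ => _ * _) => apply: sqint_mul; side
  end.
Ltac side_leaf ::= side_leaf7.

(** * Rules of differentiation *)

Section derive_rules.
Context (R : realType) (V : normedModType R).
Implicit Types (f g : V -> R) (x v : V) (a b k : R).

Lemma derD f g x v a b : is_derive x v f a -> is_derive x v g b ->
  is_derive x v (fun y => f y + g y) (a + b).
exact: (@is_deriveD _ _ _ f g x v). Qed.

Lemma derN f x v a : is_derive x v f a -> is_derive x v (fun y => - f y) (- a).
exact: (@is_deriveN _ _ _ f x v). Qed.

Lemma derM f g x v a b : is_derive x v f a -> is_derive x v g b ->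
  is_derive x v (fun y => f y * g y) (f x * b + g x * a).
exact: (@is_deriveM _ _ f g x v). Qed.

Lemma derZ f x v a k : is_derive x v f a -> is_derive x v (fun y => k * f y) (k * a).
exact: (@is_deriveZ _ _ _ f k x v). Qed.

End derive_rules.

Lemma der_comp (R : realType) (f g : R -> R) (x a b : R) :
  is_derive (g x) 1 f a -> is_derive x 1 g b -> is_derive x 1 (fun y => f (g y)) (a * b).
exact: is_derive1_comp. Qed.

Lemma der_affine (R : realType) (a b x : R) : is_derive x 1 (fun y : R => a * y + b) a.
apply: (is_derive_eq (derD (derZ a (is_derive_id x 1)) (is_derive_cst b x 1))).
by rewrite mulr1 addr0.
Qed.

(** * Smooth bumps with Gevrey bounds on all derivatives *)

Section smooth_bump.
Context (R : realType).
Implicit Types (x y : R) (p : {poly R}).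

Lemma expR_ge_pow n y : 0 <= y -> y ^+ n <= n`!%:R * expR y.
move=> y0; case: n => [|n].
  rewrite mul1r; apply: le_trans (expR_ge1Dx y); by rewrite lerDl.
rewrite -ler_pdivrMl//; apply: le_trans (expR_ge1Dxn n y0).
by rewrite mulrC lerDr.
Qed.

(** The weight i! is a bound of y^i exp(-y) for y >= 0. *)
Definition fact_norm N p : R := \sum_(i < N) `|p`_i| * i`!%:R.

Lemma horner_expR_le N p y : (size p <= N)%N -> 0 <= y ->
  `|p.[y] * expR (- y)| <= fact_norm N p.
move=> pN y0; rewrite (horner_coef_wide _ pN) mulr_suml; apply: (le_trans (ler_norm_sum _ _ _)).
apply: ler_sum => i _; rewrite -mulrA normrM ler_wpM2l//.
rewrite ger0_norm ?mulr_ge0 ?exprn_ge0// expRN ler_pdivrMr ?expR_gt0//.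
exact: expR_ge_pow.
Qed.

(** For x > 0 the n-th derivative of exp(-1/x) is this polynomial at 1/x times exp(-1/x):
    differentiating P(1/x) exp(-1/x) replaces P by X^2 (P - P'). *)
Fixpoint bump_poly n : {poly R} :=
  if n is k.+1 then 'X^2 * (bump_poly k - (bump_poly k)^`()) else 1.

Lemma size_bump_poly n : (size (bump_poly n) <= n.*2.+1)%N.
elim: n => [|n ih] /=; first by rewrite size_poly1.
apply: (leq_trans (size_polyMleq _ _)); rewrite size_polyXn /= doubleS !ltnS.
apply: (leq_trans (size_polyD _ _)); rewrite size_polyN geq_max ih /=.
by apply: leq_trans ih; rewrite (leq_trans (size_poly _ _))// leq_pred.
Qed.

(** In the step to n + 1 the coefficient of X^i moves to degree i + 2 at the cost (i + 1)(i + 2),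
    and through the derivative to degree i + 1 at the cost i (i + 1): together 2 (i + 1)^2, at most
    8 (n + 1)^2 as i <= 2 n. The growth n!^2 is what the moment problem below tolerates. *)
Lemma fact_norm_bump n : fact_norm n.*2.+1 (bump_poly n) <= 8 ^+ n * n`!%:R ^+ 2.
elim: n => [|n ih]; first by rewrite /fact_norm big_ord1 /= coef1 normr1 expr1n.
rewrite /fact_norm big_ord_recl big_ord_recl.
set P := bump_poly n in ih *.
have c0 i : (bump_poly n.+1)`_i = if (i < 2)%N then 0 else P`_(i - 2) - P`_(i - 2).+1 *+ (i - 2).+1.
  by rewrite /= coefXnM coefB coef_deriv.
have z0 : (bump_poly n.+1)`_(ord0 : 'I_n.*2.+3) = 0 by [].
have z1 : (bump_poly n.+1)`_(lift ord0 (ord0 : 'I_n.*2.+2)) = 0 by [].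
rewrite z0 z1 normr0 !mul0r !add0r.
have -> : \sum_(i < n.*2.+1) `|(bump_poly n.+1)`_(lift ord0 (lift ord0 i))| *
   (lift ord0 (lift ord0 i))`!%:R = \sum_(i < n.*2.+1) `|P`_i - P`_i.+1 *+ i.+1| * i.+2`!%:R.
  apply: eq_bigr => i _; rewrite (c0 (lift _ _)).
  by rewrite (_ : nat_of_ord (lift _ _) = i.+2) ?subn2.
apply: (@le_trans _ _ (\sum_(i < n.*2.+1) (`|P`_i| * i.+2`!%:R + `|P`_i.+1| * (i.+1%:R * i.+2`!%:R)))).
  apply: ler_sum => i _; rewrite mulrA -mulrDl ler_wpM2r//.
  by apply: (le_trans (ler_normB _ _)); rewrite normrMn mulr_natr.
rewrite big_split /=.
have -> : \sum_(i < n.*2.+1) `|P`_i.+1| * (i.+1%:R * i.+2`!%:R) = \sum_(i < n.*2.+1) `|P`_i| * (i%:R * i.+1`!%:R).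
  have Pz : P`_n.*2.+1 = 0 by apply: nth_default; exact: size_bump_poly.
  rewrite [LHS]big_ord_recr [RHS]big_ord_recl /= Pz normr0 mul0r addr0 mul0r mulr0 add0r.
  by [].
rewrite -big_split /=.
apply: (@le_trans _ _ ((8 * n.+1%:R ^+ 2) * fact_norm n.*2.+1 P)).
  rewrite /fact_norm mulr_sumr; apply: ler_sum => i _.
  rewrite -mulrDr [leRHS]mulrCA ler_wpM2l//.
  rewrite !natrM !mulrA -mulrDl ler_wpM2r//.
  have : (i : nat)%:R <= 2 * n%:R :> R.
    by rewrite -natrM ler_nat mul2n -ltnS.
  rewrite -!natr1; have : 0 <= (i : nat)%:R :> R by [].
  nra.
apply: (@le_trans _ _ ((8 * n.+1%:R ^+ 2) * (8 ^+ n * n`!%:R ^+ 2))).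
  by rewrite ler_wpM2l////.
by apply/eqW; rewrite (exprS 8) natrM; ring.
Qed.

Definition psi n x : R := if 0 < x then (bump_poly n).[x^-1] * expR (- x^-1) else 0.

Lemma psi_le n x : `|psi n x| <= 8 ^+ n * n`!%:R ^+ 2.
rewrite /psi; case: ifP => x0; last by rewrite normr0; side.
apply: le_trans (fact_norm_bump n); apply: horner_expR_le; first exact: size_bump_poly.
by side.
Qed.

(** Quadratic smallness at 0 gives differentiability there, with derivative 0. *)
Lemma psi_le_sqr n : exists2 C, 0 <= C & forall x, `|psi n x| <= C * x ^+ 2.
set N := size ('X^2 * bump_poly n).
exists (fact_norm N ('X^2 * bump_poly n)).
  by apply: sumr_ge0 => i _; side.
move=> x; rewrite /psi; case: ifP => x0; last first.
  by rewrite normr0 mulr_ge0 ?sqr_ge0// sumr_ge0// => i _; side.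
rewrite -ler_pdivrMr ?exprn_gt0//.
have := @horner_expR_le N ('X^2 * bump_poly n) x^-1 (leqnn _) (ltW _).
rewrite invr_gt0 => /(_ x0); apply: le_trans.
rewrite hornerM hornerXn -mulrA [in leRHS]normrM mulrC exprVn ger0_norm//.
by side.
Qed.

(** A smooth function given with all its derivatives, so that bounds on every order stay
    explicit. *)
Definition dseq (g : nat -> R -> R) := forall n x, is_derive x 1 (g n) (g n.+1 x).

Lemma dseq_psi : dseq psi.
move=> n x; have [x0|x0|x0] := ltgtP 0 x.
- apply: (@near_eq_is_derive _ _ _ (fun y => (bump_poly n).[y^-1] * expR (- y^-1))).
    near=> y; rewrite /psi ifT//; near: y; exact: lt_nbhsr.
  have x1 : x != 0 by rewrite gt_eqF.
  have dV : is_derive x 1 (fun y => y^-1) (- x ^- 2).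
    apply: (is_derive_eq (is_deriveV (f := id) x1 (is_derive_id x 1))).
    by rewrite /GRing.scale /= mulr1.
  have dP : is_derive x 1 (fun y => (bump_poly n).[y^-1]) ((bump_poly n)^`().[x^-1] * (- x ^- 2)).
    exact: (@is_derive1_comp _ (horner (bump_poly n)) (fun y => y^-1)).
  have dE : is_derive x 1 (fun y => expR (- y^-1)) (expR (- x^-1) * x ^- 2).
    have dN : is_derive x 1 (fun y => - y^-1) (x ^- 2).
      by apply: (is_derive_eq (derN dV)); rewrite opprK.
    exact: (@is_derive1_comp _ (@expR R) (fun y => - y^-1)).
  apply: (is_derive_eq (derM dP dE)).
  rewrite /psi x0 /= hornerM hornerXn hornerD hornerN exprVn.
  ring.
- apply: (@near_eq_is_derive _ _ _ (cst 0)).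
    near=> y; rewrite /psi ifF//; apply/negbTE; rewrite -leNgt ltW//; near: y; exact: lt_nbhsl.
  by rewrite /psi ifF; [exact: is_derive_cst|apply/negbTE; rewrite -leNgt ltW].
- rewrite -x0 {2}/psi ltxx; apply/is_derive1_caratheodory.
  exists (fun z => psi n z / z); split.
  + move=> z; have -> : psi n 0 = 0 by rewrite /psi ltxx.
    rewrite !subr0; have [->|z0] := eqVneq z 0; first by rewrite mulr0 /psi ltxx.
    by rewrite divfK.
  + have [C C0 hC] := psi_le_sqr n.
    rewrite /prop_for /continuous_at invr0 mulr0; apply/cvgr0Pnorm_lt => e e0; near=> z.
    have [->|z0] := eqVneq z 0; first by rewrite invr0 mulr0 normr0.
    rewrite normrM normfV ltr_pdivrMr ?normr_gt0//.
    apply: (le_lt_trans (hC z)); rewrite -real_normK ?num_real// mulrA.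
    rewrite ltr_pM2r ?normr_gt0//.
    have C1 : 0 < C + 1 by side.
    apply: (@le_lt_trans _ _ ((C + 1) * `|z|)); first by rewrite ler_wpM2r// lerDl.
    rewrite mulrC -ltr_pdivlMr// -normrN -sub0r; near: z.
    have eC : 0 < e / (C + 1) by side.
    exact: nbhsx_ballx (0 : R) _ eC.
  + by rewrite invr0 mulr0.
Unshelve. all: by end_near. Qed.

Lemma psi0E x : psi 0 x = if 0 < x then expR (- x^-1) else 0.
by rewrite /psi hornerC mul1r. Qed.

Lemma psi0_ge0 x : 0 <= psi 0 x.
by rewrite psi0E; case: ifP => // _; side. Qed.

Lemma psi0_le1 x : psi 0 x <= 1.
by apply: (le_trans (ler_norm _)); have := psi_le 0 x; rewrite expr1n mulr1.
Qed.

Lemma psi0_eq0 x : x <= 0 -> psi 0 x = 0.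
by move=> x0; rewrite psi0E ltNge x0. Qed.

Lemma psi0_gt0 x : 0 < x -> 0 < psi 0 x.
by move=> x0; rewrite psi0E x0 expR_gt0. Qed.

Lemma psi0_mono x y : x <= y -> psi 0 x <= psi 0 y.
move=> xy; rewrite [leLHS]psi0E; case: ifP => [x0|_]; last exact: psi0_ge0.
rewrite psi0E (lt_le_trans x0 xy) ler_expR lerN2 lef_pV2//.
by rewrite posrE (lt_le_trans x0 xy).
Qed.

Lemma psi0_cvg x : psi 0 (n.+1%:R * x) @[n --> \oo] --> (if 0 < x then 1 else 0 : R).
case: ifP => x0; last first.
  rewrite (_ : (fun n => _) = cst 0); first exact: cvg_cst.
  apply/funext => n; rewrite psi0_eq0//= pmulr_rle0// leNgt x0//.
rewrite (_ : (fun n => _) = (fun n => expR (- (x^-1 * n.+1%:R^-1)))); last first.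
  by apply/funext => n; rewrite psi0E mulr_gt0// invfM mulrC.
rewrite -[X in _ --> X]expR0; apply: @cvg_comp _ _ _ _ (@expR R) _ _ _ _ (@continuous_expR _ _).
rewrite -oppr0 -(mulr0 x^-1); apply: cvgN; apply: cvgMr; exact: cvg_harmonic.
Qed.

Lemma dseq_affine (g : nat -> R -> R) (a b : R) : dseq g ->
  dseq (fun n x => a ^+ n * g n (a * x + b)).
move=> dg n x.
have dc : is_derive x 1 (fun x => g n (a * x + b)) (g n.+1 (a * x + b) * a).
  exact: der_comp (dg n _) (der_affine a b x).
apply: (is_derive_eq (derZ (a ^+ n) dc)).
by rewrite exprSr -mulrA (mulrC _ a).
Qed.

(* n-th derivative of a product, as a sum over the 2 ^ n words in the two
   factors: this avoids binomial coefficients *)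
Fixpoint leibniz (f g : nat -> R -> R) n a b x : R :=
  if n is k.+1 then leibniz f g k a.+1 b x + leibniz f g k a b.+1 x else f a x * g b x.

Lemma leibniz_derive f g n a b x : dseq f -> dseq g ->
  is_derive x 1 (leibniz f g n a b) (leibniz f g n.+1 a b x).
move=> df dg; elim: n a b => [|n ih] a b.
  by apply: (is_derive_eq (derM (df a x) (dg b x))); rewrite addrC mulrC.
exact: derD (ih a.+1 b) (ih a b.+1).
Qed.

Definition dmul f g n x := leibniz f g n 0 0 x.

Lemma dseq_mul f g : dseq f -> dseq g -> dseq (dmul f g).
by move=> df dg n x; exact: leibniz_derive. Qed.

(** Each of the 2^n words is bounded through a! b! <= (a + b)!, so that functions with derivatives
    of size A^n n!^2 are stable under products, with 2 A in place of A. *)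
Lemma leibniz_le f g A n a b x : 0 <= A ->
  (forall k x, `|f k x| <= A ^+ k * k`!%:R ^+ 2) ->
  (forall k x, `|g k x| <= A ^+ k * k`!%:R ^+ 2) ->
  `|leibniz f g n a b x| <= 2 ^+ n * (A ^+ (n + a + b) * (n + a + b)`!%:R ^+ 2).
move=> A0 hf hg; elim: n a b => [|n ih] a b.
  rewrite /= add0n mul1r normrM; apply: (@le_trans _ _ ((A ^+ a * a`!%:R ^+ 2) * (A ^+ b * b`!%:R ^+ 2))).
    by apply: ler_pM.
  rewrite mulrACA -exprD ler_wpM2l ?exprn_ge0// -exprMn ler_sqr ?nnegrE// -natrM ler_nat.
  by rewrite -(bin_fact (leq_addr b a)) addKn leq_pmull// bin_gt0 leq_addr.
have := ih a.+1 b; have := ih a b.+1; rewrite !addnS /= => h1 h2.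
apply: (le_trans (ler_normD _ _)); rewrite exprS -mulrA.
set X := _ * _ in h1 h2 *; lra.
Qed.

Lemma dmul_le f g A n x : 0 <= A ->
  (forall k x, `|f k x| <= A ^+ k * k`!%:R ^+ 2) ->
  (forall k x, `|g k x| <= A ^+ k * k`!%:R ^+ 2) ->
  `|dmul f g n x| <= (2 * A) ^+ n * n`!%:R ^+ 2.
move=> A0 hf hg; have := leibniz_le n 0 0 x A0 hf hg.
by rewrite !addn0 exprMn mulrA.
Qed.

Lemma dseq_continuous g n : dseq g -> continuous (g n).
move=> dg x; apply/differentiable_continuous/derivable1_diffP.
by have [] := dg n x.
Qed.

Lemma dseq_support g (M : R) : dseq g -> (forall x, M < `|x| -> g 0%N x = 0) ->
  forall n x, M < `|x| -> g n x = 0.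
move=> dg g0; elim=> [//|n ih] x Mx.
have [_ <-] := dg n x.
rewrite (near_eq_derive (g := cst 0)) ?derive_cst//.
near=> y; apply: ih; near: y.
by apply: (cvgr_gt `|x|) => //; exact: norm_continuous.
Unshelve. all: by end_near. Qed.

Lemma dseq_bounded g (M : R) : dseq g -> (forall x, M < `|x| -> g 0%N x = 0) ->
  forall n, exists2 C, 0 <= C & forall x, `|g n x| <= C.
move=> dg g0 n; have gs := dseq_support dg g0.
have cg : continuous (fun x => `|g n x|).
  by move=> x; apply: cvg_norm; exact: dseq_continuous.
have [M0|M0] := leP 0 M; last first.
  by exists 0 => // x; rewrite gs ?normr0// (lt_le_trans M0).
have MM : - M <= M by rewrite (le_trans _ M0)// oppr_le0.
have [c _ hc] := @EVT_max _ (fun x => `|g n x|) (- M) M MM (continuous_subspaceT cg).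
  exists `|g n c| => // x; have [xM|/gs ->] := leP `|x| M; last by rewrite normr0.
  by apply: hc; rewrite in_itv /= -ler_norml.
Qed.

(* supported in [a, b] *)
Definition bumpf (a b : R) (k : nat) : nat -> R -> R :=
  dmul (fun n x => k.+1%:R ^+ n * psi n (k.+1%:R * x + - (k.+1%:R * a)))
       (fun n x => (- k.+1%:R) ^+ n * psi n (- k.+1%:R * x + k.+1%:R * b)).

Lemma dseq_bump a b k : dseq (bumpf a b k).
by apply: dseq_mul; apply: dseq_affine; exact: dseq_psi. Qed.

Lemma bumpE a b k x : bumpf a b k 0 x = psi 0 (k.+1%:R * (x - a)) * psi 0 (k.+1%:R * (b - x)).
rewrite /bumpf /dmul /= !expr0 !mul1r; congr (psi 0 _ * psi 0 _); first by rewrite mulrBr.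
by rewrite mulrBr addrC mulNr.
Qed.

Lemma bump_ge0 a b k x : 0 <= bumpf a b k 0 x.
by rewrite bumpE mulr_ge0 ?psi0_ge0. Qed.

Lemma bump_le1 a b k x : bumpf a b k 0 x <= 1.
by rewrite bumpE mulr_ile1 ?psi0_ge0 ?psi0_le1. Qed.

Lemma bump_eq0 a b k x : (x <= a) || (b <= x) -> bumpf a b k 0 x = 0.
rewrite bumpE => /orP[h|h].
  by rewrite psi0_eq0 ?mul0r// pmulr_rle0// subr_le0.
by rewrite (@psi0_eq0 (_ * (b - x))) ?mulr0// pmulr_rle0// subr_le0.
Qed.

Lemma bump_cvg a b x : bumpf a b k 0 x @[k --> \oo] --> (((a < x) && (x < b))%:R : R).
under eq_fun do rewrite bumpE.
rewrite (_ : _%:R = (if 0 < x - a then 1 else 0) * (if 0 < b - x then 1 else 0)).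
  by apply: cvgM; exact: psi0_cvg.
by rewrite !subr_gt0; case: (a < x); case: (x < b); rewrite /= ?mulr0 ?mulr1.
Qed.

Lemma bump_le a b n x : `|bumpf a b 0 n x| <= 16 ^+ n * n`!%:R ^+ 2.
have -> : 16 = 2 * 8 :> R by rewrite -natrM.
rewrite /bumpf; apply: dmul_le => // k y.
  by rewrite expr1n mul1r; exact: psi_le.
by rewrite normrM normrX normrN normr1 expr1n mul1r; exact: psi_le.
Qed.

End smooth_bump.

(** * Products of one-variable bumps as Schwartz and test functions *)

Section product_functions.
Context (R : realType) (d : nat).
Local Notation Rd := 'rV[R]_d.
Implicit Types (G : 'I_d -> nat -> R -> R) (k : 'I_d -> nat).

Lemma is_derive_line (f : Rd -> R) (x v : Rd) (a : R) :
  is_derive (0 : R) 1 (fun t : R => f (t *: v + x)) a -> is_derive x v f a.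
have E : (fun h => h^-1 *: (((fun t => f (t *: v + x)) \o shift 0) (h *: 1) - f (0 *: v + x))) =
         (fun h => h^-1 *: ((f \o shift x) (h *: v) - f x)).
  by apply/funext => h /=; rewrite /shift /= addr0 scale0r add0r /GRing.scale /= mulr1.
by move=> [d1 d2]; split; rewrite /derivable /derive -E.
Qed.

Definition prodf G k (x : Rd) : R := \prod_(i < d) G i (k i) (x 0 i).

Lemma prodf_derive G k i x : (forall i, dseq (G i)) ->
  is_derive x (delta_mx 0 i) (prodf G k) (prodf G (fun j => k j + (j == i))%N x).
move=> dG; apply: is_derive_line.
pose C := \prod_(j < d | j != i) G j (k j) (x 0 j).
rewrite (_ : (fun t => _) = (fun t => C * G i (k i) (1 * t + x 0 i))); last first.
  apply/funext => t; rewrite /prodf (bigD1 i)//= mulrC; congr (_ * _).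
    apply: eq_bigr => j ji; rewrite !mxE eqxx /= (negbTE ji) mulr0 add0r//.
  by rewrite !mxE !eqxx /= mulr1 mul1r.
apply: (is_derive_eq (derZ C (der_comp (dG i (k i) _) (der_affine 1 (x 0 i) 0)))).
rewrite mulr0 add0r mulr1 /prodf (bigD1 i)//= eqxx addn1 mulrC; congr (_ * _).
by apply: eq_bigr => j ji; rewrite (negbTE ji) addn0.
Qed.

Lemma continuous_prodr (I : Type) (r : seq I) (P : pred I) (F : I -> Rd -> R) :
  (forall i, continuous (F i)) -> continuous (fun x => \prod_(i <- r | P i) F i x).
move=> cF x; elim: r => [|i r ih].
  have -> : (fun x => \prod_(i <- [::] | P i) F i x) = cst 1 by apply/funext => y; rewrite big_nil.
  exact: cst_continuous.
have [Pi|Pi] := boolP (P i); last first.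
  rewrite (_ : (fun x => _) = (fun x => \prod_(i <- r | P i) F i x)) //.
  by apply/funext => y; rewrite big_cons (negbTE Pi).
under eq_fun do rewrite big_cons Pi.
by apply: continuousM; [exact: cF i x|exact: ih].
Qed.

Lemma prodf_continuous G k : (forall i, dseq (G i)) -> continuous (prodf G k).
move=> dG; apply: continuous_prodr => i x.
apply: (@cvg_comp _ _ _ (fun x : Rd => x 0 i) (G i (k i)) _ _ _ (@coord_continuous R 1 d 0 i x)).
exact: dseq_continuous.
Qed.

Lemma partial_prodf G k s : (forall i, dseq (G i)) ->
  partial s (prodf G k) = prodf G (fun i => k i + count_mem i s)%N.
move=> dG; elim: s => [|i s ih].
  by rewrite /=; congr prodf; apply/funext => i; rewrite addn0.
rewrite /= ih; apply/funext => x.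
have [_ ->] := prodf_derive (fun i => k i + count_mem i s)%N i x dG.
congr prodf; apply/funext => j /=.
by rewrite -addnA (addnC (count_mem _ _)) (eq_sym j).
Qed.

Lemma smooth_prodf G k : (forall i, dseq (G i)) -> smooth (prodf G k).
move=> dG s; rewrite partial_prodf//; split; first exact: prodf_continuous.
by move=> i x; have [] := prodf_derive (fun i => k i + count_mem i s)%N i x dG.
Qed.

Lemma partial0 s : partial s (fun _ : Rd => 0 : R) = (fun=> 0).
by elim: s => //= i s ->; apply/funext => x; exact: derive_cst. Qed.

Lemma smooth0 : smooth (fun _ : Rd => 0 : R).
move=> s; rewrite partial0; split; first side.
by [].
Qed.

Lemma eucl2_ge0 (x : Rd) : 0 <= eucl2 x.
by apply: sumr_ge0 => i _; rewrite sqr_ge0. Qed.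

Lemma prodf_support G k M (x : Rd) : (forall i, dseq (G i)) ->
  (forall i y, M < `|y| -> G i 0%N y = 0) -> prodf G k x != 0 -> forall i, `|x 0 i| <= M.
move=> dG G0 Gx i; rewrite leNgt; apply: contra Gx => Mx.
by rewrite /prodf (bigD1 i)//= (dseq_support (dG i) (G0 i))// mul0r.
Qed.

Lemma schwartz_prodf G k M : (forall i, dseq (G i)) ->
  (forall i y, M < `|y| -> G i 0%N y = 0) -> schwartz (fun x => (prodf G k x)%:C).
move=> dG G0; split; first by split; [exact: smooth_prodf|exact: smooth0].
move=> n s.
have h i : exists C, 0 <= C /\ forall x, `|G i (k i + count_mem i s)%N x| <= C.
  by have [C C0 hC] := dseq_bounded (dG i) (G0 i) (k i + count_mem i s)%N; exists C.
have [C hC] := choice h.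
exists ((1 + d%:R * M ^+ 2) ^+ n * \prod_(i < d) C i) => x.
have A0 : 0 <= (1 + d%:R * M ^+ 2) ^+ n * \prod_(i < d) C i.
  apply: mulr_ge0; last by apply: prodr_ge0 => i _; case: (hC i).
  by side.
have cE : cpartial s (fun x => (prodf G k x)%:C) x = (prodf G (fun i => k i + count_mem i s)%N x)%:C.
  by rewrite /cpartial /= -partial_prodf//; congr Complex; have /(congr1 (fun f => f x)) := partial0 s.
rewrite /schwartz_weight [cpartial _ _ _]cE nc_real.
have [->|/eqP P0] := eqVneq (prodf G (fun i => k i + count_mem i s)%N x) 0.
  by rewrite normr0 mulr0.
have xM i := prodf_support dG G0 (introN eqP P0) i.
apply: ler_pM => //.
- by rewrite exprn_ge0// addr_ge0// eucl2_ge0.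
- apply: lerXn2r; rewrite ?nnegrE ?addr_ge0 ?eucl2_ge0 ?(mulr_ge0 (ler0n _ _) (sqr_ge0 _))// lerD2l.
  apply: (@le_trans _ _ (\sum_(i < d) M ^+ 2)); last by rewrite sumr_const card_ord mulr_natl.
  apply: ler_sum => i _; rewrite -expr2 -real_normK ?num_real//.
  by rewrite ler_sqr ?nnegrE// (le_trans _ (xM i)).
- rewrite normr_prod; apply: ler_prod => i _; rewrite normr_ge0 /=.
  by case: (hC i).
Qed.

(** The condition d M^2 < 1 places the cube of half-side M inside the open unit ball. *)
Lemma test_prodf G k M : (forall i, dseq (G i)) -> d%:R * M ^+ 2 < 1 ->
  (forall i y, M < `|y| -> G i 0%N y = 0) -> test_function (prodf G k).
move=> dG M1 G0.
pose B := [set x : Rd | forall i, `[- M, M]%classic (x 0 i)].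
have cB : compact B by apply: (@rV_compact R d (fun=> `[- M, M]%classic)) => i; exact: segment_compact.
have clB : closed B by apply: compact_closed => //; exact: norm_hausdorff.
have sB : closure [set x | prodf G k x != 0] `<=` B.
  rewrite [X in _ `<=` X]((closure_id B).1 clB); apply: closure_subset => x /= Gx i.
  by rewrite /= in_itv /= -ler_norml (prodf_support dG G0 Gx).
split; first exact: smooth_prodf.
  by apply: subclosed_compact sB => //; exact: closed_closure.
move=> x /sB Bx; rewrite /unit_ball /=; apply: le_lt_trans M1.
apply: (@le_trans _ _ (\sum_(i < d) M ^+ 2)); last by rewrite sumr_const card_ord mulr_natl.
apply: ler_sum => i _; rewrite -expr2 -real_normK ?num_real//.
have := Bx i; rewrite /= in_itv /= -ler_norml => h.
by rewrite ler_sqr ?nnegrE// (le_trans _ h).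
Qed.

End product_functions.

(** * Schwartz functions separate measurable functions *)

Section separation.
Context (R : realType) (d : nat).
Local Notation Rd := 'rV[R]_d.
Local Notation leb := (leb R d).

Definition octant (a : Rd) : set Rd := [set x | forall i, a 0 i < x 0 i].

Lemma measurable_all (P : 'I_d -> set Rd) : (forall i, measurable (P i)) ->
  measurable [set x | forall i, P i x].
move=> mP; rewrite (_ : [set x | _] = \big[setI/setT]_(i <- enum 'I_d) P i).
  by apply: bigsetI_measurable => i _; exact: mP.
rewrite -bigcap_seq; apply/seteqP; split => x h.
  by [].
by move=> i; apply: h => /=; rewrite mem_enum.
Qed.

Lemma mfun_octant a : measurable (octant a).
apply: measurable_all => i.
rewrite [X in measurable X](_ : _ = (fun x : Rd => x 0 i) @^-1` `]a 0 i, +oo[%classic).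
  rewrite -[X in measurable X]setTI; apply: mfun_coord => //.
by apply/seteqP; split => x; rewrite /= in_itv /= andbT.
Qed.

(** A half-space x_i > c is a countable union of octants, with the other coordinates of the corner
    tending to minus infinity. *)
Lemma octant_generate : @measurable _ Rd = <<s range octant >>.
apply/seteqP; split; last first.
  apply: smallest_sub; first exact: sigma_algebra_measurable.
  by move=> _ [a _ <-]; exact: mfun_octant.
have sg : sigma_algebra setT <<s range octant >> := smallest_sigma_algebra _ _.
apply: smallest_sub => //=.
rewrite -bigcup_seq /= => A [i _ /= [B mB <-]]; rewrite setTI.
suff : @measurable _ (measurableTypeR R) `<=` [set B | <<s range octant >> ((fun x : Rd => x 0 i) @^-1` B)].
  exact.
have -> : @measurable _ (measurableTypeR R) = (@RGenOInfty.G R).-sigma.-measurable by exact: RGenOInfty.measurableE.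
apply: smallest_sub => /=.
  case: sg => s1 s2 s3; split => /=.
  - by [].
  - by move=> C hC; rewrite setTD -setTD; exact: s2.
  - by move=> F hF; rewrite preimage_bigcup; exact: s3.
move=> _ [c ->] /=.
rewrite (_ : _ @^-1` _ = \bigcup_n octant (\row_j if j == i then c else - n%:R)).
  case: sg => _ _; apply => n; apply: sub_sigma_algebra; by exists (\row_j if j == i then c else - n%:R).
apply/seteqP; split => x /=.
  rewrite in_itv /= andbT => cx.
  have h j : exists n : nat, - n%:R < x 0 j.
    exists (Num.truncn `|x 0 j|).+1; rewrite ltrNl; apply: le_lt_trans (truncnS_gt _).
    by rewrite -normrN ler_norm.
  have [n hn] := choice h; exists (\max_j n j)%N => // j; rewrite mxE; case: eqP => [->//|_].
  by apply: le_lt_trans (hn j); rewrite lerN2 ler_nat leq_bigmax.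
by move=> [n _ /(_ i)]; rewrite mxE eqxx in_itv /= andbT.
Qed.

(** Octants are stable under intersection and generate the Borel sets, so by Dynkin's argument the
    integral of w over every measurable set vanishes. *)
Lemma octant_unique (w : Rd -> R) (a0 : Rd) : L1 leb w ->
  (forall x, ~ octant a0 x -> w x = 0) ->
  (forall a, \int[leb]_(x in octant a) (w x)%:E = 0)%E -> {ae leb, forall x, w x = 0}.
move=> iw w0 wa.
have iA A : measurable A -> leb.-integrable A (EFin \o w).
  by move=> mA; exact: integrableS iw.
have T0 : (\int[leb]_x (w x)%:E = 0)%E.
  rewrite -(wa a0) [RHS]integral_mkcond; apply: eq_integral => x _.
  by rewrite patchE; case: ifPn => // /negP h; rewrite w0// => ax; apply: h; rewrite inE.
have P A : measurable A -> (\int[leb]_(x in A) (w x)%:E = 0)%E.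
  move=> mA; apply: (@dynkin_induction _ Rd (range octant) (fun A => \int[leb]_(x in A) (w x)%:E = 0)%E octant_generate) => //.
  - move=> _ _ [a _ <-] [b _ <-]; exists (\row_i Num.max (a 0 i) (b 0 i)) => //.
    apply/seteqP; split => x /=.
      by move=> h; split => i; have := h i; rewrite mxE gt_max => /andP[].
    by move=> [h1 h2] i; rewrite mxE gt_max h1 h2.
  - by move=> _ [a _ <-].
  - move=> S mS hS; have : (\int[leb]_(x in S `|` ~` S) (w x)%:E = 0)%E by rewrite setUv.
    rewrite integral_setU//=; last 3 first.
    + exact: measurableC.
    + by rewrite setUv; exact: measurable_int iw.
    + by apply/disj_setPCl.
    by rewrite hS add0e.
  - move=> F mF tF hF; rewrite integral_bigcup//; last exact/iA/bigcupT_measurable.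
    by apply: eseries0 => i _ _; exact: hF.
  - by rewrite -octant_generate.
have ae : ae_eq leb setT (EFin \o w) (cst 0%E).
  apply: integral_ae_eq => //.
  by move=> E _ mE; rewrite integral0 P.
by apply: filterS ae => y /(_ I)[].
Qed.

Definition box (a b : Rd) : set Rd := [set x | forall i, a 0 i < x 0 i < b 0 i].
Definition bumps (a b : Rd) n : Rd -> R :=
  prodf (fun i => bumpf (a 0 i) (b 0 i) n) (fun=> 0%N).

Lemma schwartz_bumps a b n : schwartz (fun x => (bumps a b n x)%:C).
pose M := \sum_(i < d) (`|a 0 i| + `|b 0 i|).
apply: (@schwartz_prodf _ _ _ _ M) => [i|i y My]; first exact: dseq_bump.
apply: bump_eq0.
have hM : `|a 0 i| + `|b 0 i| <= M by rewrite /M (bigD1 i)//= lerDl sumr_ge0// => j _; side.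
have [y0|y0] := leP 0 y.
  rewrite (ger0_norm y0) in My; rewrite orbC; apply/orP; left.
  by apply: le_trans (ltW My); apply: le_trans hM; rewrite (le_trans (ler_norm _))// lerDr.
rewrite (ltr0_norm y0) in My; apply/orP; left.
rewrite -lerN2; apply: le_trans (ltW My); apply: le_trans hM.
by rewrite -normrN (le_trans (ler_norm _))// lerDl.
Qed.

Lemma bumps_ge0 a b n x : 0 <= bumps a b n x.
by apply: prodr_ge0 => i _; exact: bump_ge0. Qed.

Lemma bumps_le1 a b n x : bumps a b n x <= 1.
apply: (@le_trans _ _ (\prod_(i < d) 1)); last by rewrite big1.
by apply: ler_prod => i _; rewrite bump_ge0 bump_le1. Qed.

Lemma bumps_support a b n x : ~ box a b x -> bumps a b n x = 0.
move=> /existsNP[i /negP]; rewrite negb_and -!leNgt => h.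
by rewrite /bumps /prodf (bigD1 i)//= bump_eq0 ?mul0r.
Qed.

Lemma bumps_cvg a b x : bumps a b n x @[n --> \oo] --> (\1_(box a b) x : R).
have -> : \1_(box a b) x = \prod_(i < d) ((a 0 i < x 0 i) && (x 0 i < b 0 i))%:R :> R.
  rewrite indicE; have [h|h] := pselect (box a b x).
    by rewrite mem_set// big1// => i _; rewrite (h i).
  rewrite memNset//=; by have /existsNP[i /negP hi] := h; rewrite (bigD1 i)//= (negbTE hi) mul0r.
rewrite /bumps /prodf; elim: (index_enum _) => [|i r ih].
  rewrite big_nil; under eq_fun do rewrite big_nil; exact: cvg_cst.
rewrite big_cons; under eq_fun do rewrite big_cons.
by apply: cvgM => //; exact: bump_cvg.
Qed.

(** A lower bound on the box for the bump of a larger box turns integrability of v times that bump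
    into integrability of v on the box. *)
Lemma bumps_lower (a b : Rd) : exists2 c : R, 0 < c & forall x, box a b x ->
  c <= bumps (a - const_mx 1) (b + const_mx 1) 0 x.
exists (\prod_(i < d) (psi 0 1 * psi 0 1)).
  by apply: prodr_gt0 => i _; rewrite mulr_gt0// psi0_gt0.
move=> x abx; apply: ler_prod => i _; rewrite mulr_ge0 ?psi0_ge0//= bumpE !mxE.
have /andP[h1 h2] := abx i.
by apply: ler_pM; rewrite ?psi0_ge0// psi0_mono//; lra.
Qed.

Lemma mfun_box a b : measurable (box a b).
apply: measurable_all => i.
rewrite [X in measurable X](_ : _ = (fun x : Rd => x 0 i) @^-1` `]a 0 i, b 0 i[%classic).
  rewrite -[X in measurable X]setTI; apply: mfun_coord => //.
by [].
Qed.

Lemma mfun_bumps a b n : mfun (bumps a b n).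
by apply: continuous_measurable_rV; apply: prodf_continuous => i; exact: dseq_bump. Qed.

(** The indicator of a box is a bounded limit of bumps supported in it, so v integrates to 0 over
    every box. Octants cut boxes out of a large cube, so that [octant_unique] applies to v
    restricted to the cube. *)
Theorem schwartz_separates (v : Rd -> R[i]) : cmeas v ->
  (forall f, schwartz f -> cL1 leb (fun p => v p * f p) /\
     cint leb (fun p => v p * f p) = 0) -> {ae leb, forall p, v p = 0}.
move=> mv hv.
have ib a b : L1 leb (fun x => nc (v x) * \1_(box a b) x).
  have [c c0 hc] := bumps_lower a b.
  have [iv _] := hv _ (schwartz_bumps (a - const_mx 1) (b + const_mx 1) 0).
  apply: (@le_L1 _ _ _ _ _ (fun x => c^-1 * nc (v x * (bumps (a - const_mx 1) (b + const_mx 1) 0 x)%:C))).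
  - by apply: measurable_funM; [side|exact: measurable_indic (mfun_box a b)].
  - move=> x; rewrite ncM nc_real indicE ger0_norm; last by side.
    case: (boolP (x \in _)) => [/set_mem bx|_] /=; last first.
      by rewrite mulr0 !mulr_ge0 ?nc_ge0 ?invr_ge0// ltW.
    rewrite mulr1 mulrCA ler_peMr ?nc_ge0// ler_pdivlMl// mulr1.
    by rewrite ger0_norm ?bumps_ge0//; exact: hc.
  - exact/L1Z/cint_nc.
have ci a b : cL1 leb (fun x => v x * (\1_(box a b) x)%:C).
  apply: cL1_le (ib a b) => [|x].
    by apply: cmeasM => //; apply: cmeas_real; exact: measurable_indic (mfun_box a b).
  by rewrite ncM nc_real ger0_norm.
have z a b : cint leb (fun x => v x * (\1_(box a b) x)%:C) = 0.
  have ae : {ae leb, forall x, nc (v x * (bumps a b n x)%:C - v x * (\1_(box a b) x)%:C) @[n --> \oo] --> 0}.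
    apply: nearW => x; under eq_fun do rewrite -mulrBr ncM -rmorphB nc_real.
    rewrite -(mulr0 (nc (v x))) -(normr0 R); apply: cvgMr; apply: cvg_norm.
    by apply/subr_cvg0; exact: bumps_cvg.
  have mb n : cmeas (fun x => v x * (bumps a b n x)%:C).
    by apply: cmeasM => //; apply: cmeas_real; exact: mfun_bumps.
  have bd n x : nc (v x * (bumps a b n x)%:C) <= nc (v x) * \1_(box a b) x.
    rewrite ncM nc_real ler_wpM2l ?nc_ge0// ger0_norm ?bumps_ge0// indicE.
    have [h|h] := pselect (box a b x); first by rewrite mem_set// bumps_le1.
    by rewrite memNset// bumps_support.
  have := dominated_cvgC mb (cL1_meas (ci a b)) ae (ib a b) bd.
  rewrite (_ : (fun n => _) = cst (nc (cint leb (fun x => v x * (\1_(box a b) x)%:C)))).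
    by move=> h; apply: nc_eq0; apply: cvg_unique _ (cvg_cst _) h.
  by apply/funext => n; have [_ ->] := hv _ (schwartz_bumps a b n); rewrite sub0r ncN.
have hN (N : nat) : {ae leb, forall x, box (const_mx (- N%:R)) (const_mx N%:R) x -> v x = 0}.
  pose K := box (const_mx (- N%:R)) (const_mx N%:R).
  have oc a : octant a `&` K = box (\row_i Num.max (a 0 i) (- N%:R)) (const_mx N%:R).
    apply/seteqP; split => x /=.
      by move=> [h1 h2] i; have := h2 i; rewrite !mxE gt_max h1 => /andP[-> ->].
    move=> h; split => i; have := h i; rewrite !mxE gt_max => /andP[/andP[h1 h2] h3] //.
    by rewrite h2.
  have oR a (u : Rd -> R) : (\int[leb]_(x in octant a) (u x * \1_K x)%:E =
      \int[leb]_x (u x * \1_(box (\row_i Num.max (a 0 i) (- N%:R)) (const_mx N%:R)) x)%:E)%E.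
    rewrite integral_mkcond; apply: eq_integral => x _.
    rewrite -oc patchE !indicE in_setI; case: (x \in octant a) => //=.
    by rewrite mulr0.
  have w0 (u : Rd -> R) x : ~ octant (const_mx (- N%:R)) x -> u x * \1_K x = 0.
    move=> h; rewrite indicE; case: (boolP (x \in K)) => [/set_mem Kx|_]; last by rewrite mulr0.
    by case: h => i; have /andP[] := Kx i.
  have [iR iI] := ci (const_mx (- N%:R)) (const_mx N%:R).
  have hR : {ae leb, forall x, Re (v x) * \1_K x = 0}.
    apply: (@octant_unique _ (const_mx (- N%:R))).
    - apply: eq_integrable iR => // x _ /=; by rewrite ReM /= mulr0 subr0.
    - by move=> x /(w0 (fun x => Re (v x))).
    - move=> a; rewrite (oR a (fun x => Re (v x))).
      have [iR2 _] := ci (\row_i Num.max (a 0 i) (- N%:R)) (const_mx N%:R).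
      have /(congr1 (fun z => Re z)) := z (\row_i Num.max (a 0 i) (- N%:R)) (const_mx N%:R).
      rewrite /cint /= => h; rewrite -[RHS]/(0%:E) -h fineK ?integrable_fin_num//.
      by apply: eq_integral => x _; rewrite ReM /= mulr0 subr0.
  have hI : {ae leb, forall x, Im (v x) * \1_K x = 0}.
    apply: (@octant_unique _ (const_mx (- N%:R))).
    - apply: eq_integrable iI => // x _ /=; by rewrite ImM /= mulr0 add0r.
    - by move=> x /(w0 (fun x => Im (v x))).
    - move=> a; rewrite (oR a (fun x => Im (v x))).
      have [_ iI2] := ci (\row_i Num.max (a 0 i) (- N%:R)) (const_mx N%:R).
      have /(congr1 (fun z => Im z)) := z (\row_i Num.max (a 0 i) (- N%:R)) (const_mx N%:R).
      rewrite /cint /= => h; rewrite -[RHS]/(0%:E) -h fineK ?integrable_fin_num//.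
      by apply: eq_integral => x _; rewrite ImM /= mulr0 add0r.
  apply: filterS2 hR hI => x h1 h2 Kx; move: h1 h2; rewrite indicE mem_set// !mulr1 => h1 h2.
  exact: complex_eqP.
have := ae_foralln hN; apply: filterS => x h.
have [n hn] : exists n : nat, forall i, `|x 0 i| < n%:R.
  have g j : exists n : nat, `|x 0 j| < n%:R by exists (Num.truncn `|x 0 j|).+1; exact: truncnS_gt.
  have [n hn] := choice g; exists (\max_j n j)%N => j.
  by apply: lt_le_trans (hn j) _; rewrite ler_nat leq_bigmax.
by apply: (h n) => i; rewrite !mxE -ltr_norml.
Qed.

End separation.

Lemma der_continuous (R : realType) (f : R -> R) (x a : R) :
  is_derive x 1 f a -> f y @[y --> x] --> f x.
by move=> [df _]; apply: differentiable_continuous; apply/derivable1_diffP. Qed.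

Lemma RintZ d (T : measurableType d) (R : realType) (mu : {measure set T -> \bar R}) (k : R) (f : T -> R) :
  L1 mu f -> \int[mu]_x (k * f x) = k * \int[mu]_x f x.
exact: RintegralZl. Qed.

(** * The Fourier integral of exp(-e |p|) and the Cauchy density *)

Section poisson_line.
Context (R : realType).
Implicit Types x e p : R.
Local Notation mu := (@lebesgue_measure R).

Definition expn e p : R := expR (- (e * `|p|)).

Lemma expn_ge0 e p : 0 <= expn e p. exact: expR_ge0. Qed.

Lemma expn_le1 e p : 0 <= e -> expn e p <= 1.
by move=> e0; rewrite -expR0 ler_expR oppr_le0 mulr_ge0. Qed.

Lemma continuous_expn e : continuous (expn e).
move=> p; apply: @cvg_comp _ _ _ (fun p => - (e * `|p|)) (@expR R) _ _ _ _ (@continuous_expR _ _).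
by apply: cvgN; apply: cvgMr; exact: norm_continuous.
Qed.

(** Adding 1 to the cosine makes the integrand nonnegative, as the fundamental theorem on a
    half-line requires; the extra term 1/e is subtracted again in [Rint_expn_cos]. *)
Lemma expn_cos_FTC e x : 0 < e ->
  (\int[mu]_(p in `[0%R, +oo[) (expR (- (e * p)) * (1 + cos (x * p)))%:E = (e^-1 + e / (e ^+ 2 + x ^+ 2))%:E)%E.
move=> e0; have e2 : 0 < e ^+ 2 + x ^+ 2 by side.
pose F p := expR (- (e * p)) * ((x * sin (x * p) - e * cos (x * p)) / (e ^+ 2 + x ^+ 2) - e^-1).
have dx p : is_derive p 1 (fun p => x * p) x.
  by apply: (is_derive_eq (derZ x (is_derive_id p 1))); rewrite mulr1.
have dE p : is_derive p 1 (fun p => expR (- (e * p))) (- e * expR (- (e * p))).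
  have de : is_derive p 1 (fun p => - (e * p)) (- e).
    by apply: (is_derive_eq (derN (derZ e (is_derive_id p 1)))); rewrite mulr1.
  by apply: (is_derive_eq (der_comp (is_derive_expR _) de)); rewrite mulrC.
have dS p := der_comp (is_derive_sin _) (dx p).
have dC p := der_comp (is_derive_cos _) (dx p).
have dF p : is_derive p 1 F (expR (- (e * p)) * (1 + cos (x * p))).
  have d2 := derD (derZ (e ^+ 2 + x ^+ 2)^-1 (derD (derZ x (dS p)) (derN (derZ e (dC p))))) (is_derive_cst (- e^-1) p 1).
  have FE : F = (fun y => expR (- (e * y)) * ((e ^+ 2 + x ^+ 2)^-1 * (x * sin (x * y) + - (e * cos (x * y))) + cst (- e^-1) y)).
    by apply/funext => y; rewrite /F [(_ / _)]mulrC.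
  rewrite FE; apply: (is_derive_eq (derM (dE p) d2)) => /=.
  by field; rewrite !gt_eqF.
have F0 : F 0 = - (e^-1 + e / (e ^+ 2 + x ^+ 2)).
  by rewrite /F !mulr0 oppr0 expR0 sin0 cos0 mulr0 mulr1 mul1r sub0r mulNr opprD addrC.
rewrite (@ge0_continuous_FTC2y _ _ F _ 0).
- by rewrite F0 sub0e -EFinN opprK.
- by [].
- apply: continuous_subspaceT => p; apply: cvgM.
    exact: der_continuous (dE p).
  apply: cvgD; first exact: cvg_cst.
  exact: der_continuous (dC p).
- pose B := (`|x| + e) / (e ^+ 2 + x ^+ 2) + e^-1.
  have FB p : `|F p| <= B * expR (- (e * p)).
    rewrite /F normrM mulrC (ger0_norm (expR_ge0 _)) ler_wpM2r//.
    apply: (le_trans (ler_normB _ _)); rewrite normfV (gtr0_norm e0) lerD2r.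
    rewrite normrM normfV (gtr0_norm e2) ler_wpM2r ?invr_ge0 ?(ltW e2)//.
    apply: (le_trans (ler_normB _ _)); rewrite !normrM (gtr0_norm e0); apply: lerD.
      by rewrite ler_piMr// ler_norml sin_geN1 sin_le1.
    by rewrite ler_piMr ?(ltW e0)// ler_norml cos_geN1 cos_le1.
  have cE : B * expR (- (e * p)) @[p --> +oo] --> 0.
    rewrite -(mulr0 B); apply: cvgMr.
    apply: (@cvg_comp _ _ _ (fun p => e * p) (fun y => expR (- y)) _ +oo); last exact: cvgr_expR.
    by apply: gt0_cvgMry.
  apply/cvgr0Pnorm_le => eps eps0; near=> p.
  apply: (le_trans (FB p)); apply: (le_trans (ler_norm _)).
  by near: p; move/cvgr0Pnorm_le : cE; exact.
- by [].
- apply: cvg_at_right_filter; exact: der_continuous (dF 0).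
- by move=> p _; rewrite derive1E; have [_ ->] := dF p.
Unshelve. all: by end_near. Qed.

Lemma expn_cos_integral e x : 0 < e ->
  (\int[mu]_p (expn e p * (1 + cos (x * p)))%:E = (2 * (e^-1 + e / (e ^+ 2 + x ^+ 2)))%:E)%E.
move=> e0; rewrite ge0_symfun_integralT.
- rewrite (_ : [set x | 0 <= x] = `[0, +oo[%classic); last first.
    by apply/seteqP; split => p /=; rewrite in_itv/= andbT.
  rewrite EFinM -(expn_cos_FTC x e0); congr (_ * _)%E; apply: eq_integral => p.
  by rewrite inE /= in_itv /= andbT => p0; rewrite /expn ger0_norm.
- move=> p; by rewrite mulr_ge0 ?expn_ge0// -lerBlDl sub0r ?cos_geN1.
- move=> p; apply: cvgM; first exact: continuous_expn.
  apply: cvgD; first exact: cvg_cst.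
  apply: @cvg_comp _ _ _ (fun p => x * p) (@cos R) _ _ _ _ (@continuous_cos _ _).
  by apply: cvgMr.
- by move=> p /=; rewrite /expn normrN mulrN cosN.
Qed.

Lemma L1_expn e : 0 < e -> L1 mu (expn e).
move=> e0; have me : mfun (expn e).
  by apply: continuous_measurable_fun; exact: continuous_expn.
apply/integrableP; split; first exact/measurable_EFinP.
have := expn_cos_integral 0 e0.
rewrite (_ : (\int[mu]_p _)%E = (\int[mu]_p (2%:E * `|(EFin \o expn e) p|)))%E; last first.
  apply: eq_integral => p _; rewrite /= ger0_norm ?expn_ge0// mul0r cos0; congr EFin.
  by rewrite mulrC.
rewrite ge0_integralZl//; last by apply: measurableT_comp => //; exact/measurable_EFinP.
move=> h; rewrite ltNge leye_eq; apply/eqP => h2; move: h; rewrite h2.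
by rewrite gt0_muley; side.
Qed.

Lemma mfun_cosM x : mfun (fun p : R => cos (x * p)).
apply: continuous_measurable_fun => p.
apply: @cvg_comp _ _ _ (fun p => x * p) (@cos R) _ _ _ _ (@continuous_cos _ _).
by apply: cvgMr.
Qed.

Lemma mfun_sinM x : mfun (fun p : R => sin (x * p)).
apply: continuous_measurable_fun => p.
apply: @cvg_comp _ _ _ (fun p => x * p) (@sin R) _ _ _ _ (@continuous_sin _ _).
by apply: cvgMr.
Qed.

Lemma mfun_expn e : mfun (expn e).
by apply: continuous_measurable_fun; exact: continuous_expn. Qed.

Lemma L1_expn_cos e x : 0 < e -> L1 mu (fun p => expn e p * cos (x * p)).
move=> e0; apply: le_L1 (L1_expn e0) => [|p].
  by apply: measurable_funM; [exact: mfun_expn|exact: mfun_cosM].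
by rewrite normrM ger0_norm ?expn_ge0// ler_piMr ?expn_ge0// ler_norml cos_geN1 cos_le1.
Qed.

Lemma L1_expn_sin e x : 0 < e -> L1 mu (fun p => expn e p * sin (x * p)).
move=> e0; apply: le_L1 (L1_expn e0) => [|p].
  by apply: measurable_funM; [exact: mfun_expn|exact: mfun_sinM].
by rewrite normrM ger0_norm ?expn_ge0// ler_piMr ?expn_ge0// ler_norml sin_geN1 sin_le1.
Qed.

Lemma Rint_expn_cos e x : 0 < e ->
  \int[mu]_p (expn e p * cos (x * p)) = 2 * e / (e ^+ 2 + x ^+ 2).
move=> e0; have h y : \int[mu]_p (expn e p * (1 + cos (y * p))) = 2 * (e^-1 + e / (e ^+ 2 + y ^+ 2)).
  by rewrite /Rintegral expn_cos_integral.
have D y : \int[mu]_p (expn e p * (1 + cos (y * p))) = \int[mu]_p expn e p + \int[mu]_p (expn e p * cos (y * p)).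
  rewrite -RintegralD//; [|exact: L1_expn|exact: L1_expn_cos].
  by apply: eq_Rintegral => p _; rewrite mulrDr mulr1.
have h0 : \int[mu]_p expn e p = 2 * e^-1.
  have := h 0; rewrite D (_ : \int[mu]_p (expn e p * cos (0 * p)) = \int[mu]_p expn e p).
    rewrite expr0n /= addr0 invfM mulrA divff//; lra.
  by apply: eq_Rintegral => p _; rewrite mul0r cos0 mulr1.
apply: (addrI (2 * e^-1)); rewrite -[in LHS]h0 -D h; ring.
Qed.

Lemma Rint_expn_sin e x : 0 < e -> \int[mu]_p (expn e p * sin (x * p)) = 0.
move=> e0; have := @Rintegral_push _ _ (measurableTypeR R) (measurableTypeR R) R mu mu (fun p => 0 + (-1) * p)
  (mfun_affine (-1) 0) 1 ltr01 _ (fun p => expn e p * sin (x * p)) (L1_expn_sin x e0).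
have hA (A : set (measurableTypeR R)) : measurable A -> mu ((fun p => 0 + (-1) * p) @^-1` A) = (1%:E * mu A)%E.
  by move=> mA; rewrite lebesgue_affine// normrN normr1 invr1.
move=> /(_ hA); rewrite mul1r.
rewrite (_ : \int[mu]_p (expn e (0 + -1 * p) * sin (x * (0 + -1 * p))) = - \int[mu]_p (expn e p * sin (x * p))).
  lra.
rewrite -[RHS]mulN1r -(RintZ _ (L1_expn_sin x e0)).
by apply: eq_Rintegral => p _; rewrite /expn add0r mulN1r normrN mulrN sinN mulrN mulN1r.
Qed.

Definition cis (t : R) : R[i] := cos t +i* sin t.

Lemma cisD s t : cis (s + t) = cis s * cis t.
by apply: complex_eqP; rewrite /= ?cosD// sinD [X in _ + X]mulrC; ring. Qed.

Lemma cisN t : cis (- t) = (cis t)^*.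
by apply: complex_eqP; rewrite /= ?cosN ?sinN. Qed.

Lemma cis0 : cis 0 = 1. by rewrite /cis cos0 sin0. Qed.

Lemma nc_cis t : nc (cis t) = 1.
by rewrite ncE /= cos2Dsin2 sqrtr1. Qed.

Lemma cis_sum I (r : seq I) (P : pred I) (F : I -> R) :
  cis (\sum_(i <- r | P i) F i) = \prod_(i <- r | P i) cis (F i).
exact: (big_morph cis cisD cis0). Qed.

Lemma cint_expn_cis e x : 0 < e ->
  cL1 mu (fun p => (expn e p)%:C * cis (- (x * p))) /\
  cint mu (fun p => (expn e p)%:C * cis (- (x * p))) = (2 * e / (e ^+ 2 + x ^+ 2))%:C.
move=> e0.
have ReE p : Re ((expn e p)%:C * cis (- (x * p))) = expn e p * cos (x * p).
  by rewrite ReZ /= cosN.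
have ImE p : Im ((expn e p)%:C * cis (- (x * p))) = -1 * (expn e p * sin (x * p)).
  by rewrite ImZ /= sinN mulrN mulN1r.
split.
  split.
    by apply: eq_integrable (L1_expn_cos x e0) => // p _ /=; rewrite -[LHS]/((_)%:E) -ReE.
  by apply: eq_integrable (L1Z (-1) (L1_expn_sin x e0)) => // p _; rewrite /comp ImE.
apply: complex_eqP => /=.
  by rewrite -Rint_expn_cos//; apply: eq_Rintegral => p _; rewrite -ReE.
rewrite (_ : \int[mu]_p _ = -1 * \int[mu]_p (expn e p * sin (x * p))).
  by rewrite Rint_expn_sin// mulr0.
rewrite -(RintZ _ (L1_expn_sin x e0)).
by apply: eq_Rintegral => p _; rewrite -ImE.
Qed.

Lemma integral_cauchy : (\int[mu]_x (2 / (1 + x ^+ 2))%:E = (2 * pi)%:E)%E.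
have c1 x : 0 < 1 + x ^+ 2 by side.
have cc : continuous (fun x => 2 / (1 + x ^+ 2)).
  move=> x; apply: cvgMr; apply: cvgV; first by rewrite gt_eqF.
  by apply: cvgD; [exact: cvg_cst|exact: exprn_continuous].
rewrite ge0_symfun_integralT//.
- rewrite (_ : [set x | 0 <= x] = `[0, +oo[%classic); last first.
    by apply/seteqP; split => p /=; rewrite in_itv/= andbT.
  rewrite (@ge0_continuous_FTC2y _ _ (fun x => 2 * atan x) _ (2 * (pi / 2))).
  + by rewrite atan0; congr EFin; field.
  + by side.
  + exact: continuous_subspaceT.
  + by apply: cvgMr; exact: cvgy_atan.
  + by [].
  + by apply: cvgMr; apply: cvg_at_right_filter; exact: continuous_atan.
  + by move=> x _; rewrite derive1E; have [_ ->] := derZ 2 (is_derive1_atan x).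
- by side.
- by move=> x /=; rewrite sqrrN.
Qed.

Lemma L1_cauchy : L1 mu (fun x : R => 2 / (1 + x ^+ 2)).
have c1 x : 0 < 1 + x ^+ 2 by side.
apply/integrableP; split.
  by side.
rewrite (_ : (\int[mu]_x _)%E = (\int[mu]_x (2 / (1 + x ^+ 2))%:E)%E); first by rewrite integral_cauchy ltry.
by apply: eq_integral => x _; rewrite /= ger0_norm// divr_ge0// ltW.
Qed.

Lemma Rint_cauchy : \int[mu]_x (2 / (1 + x ^+ 2)) = 2 * pi.
by rewrite /Rintegral integral_cauchy. Qed.

End poisson_line.

Lemma eq_cintegrable d (T : measurableType d) (R : realType) (mu : {measure set T -> \bar R})
  (f g : T -> R[i]) : cL1 mu f -> f =1 g -> cL1 mu g.
by move=> h /funext <-. Qed.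

Lemma cmeas_cis d1 (T : measurableType d1) (R : realType) (h : T -> R) : mfun h ->
  cmeas (fun x => cis (h x)).
move=> mh; split.
  by apply: (measurableT_comp (f := @cos R)) => //; apply: continuous_measurable_fun; exact: continuous_cos.
by apply: (measurableT_comp (f := @sin R)) => //; apply: continuous_measurable_fun; exact: continuous_sin.
Qed.

Lemma cmeas_section d1 d2 (T1 : measurableType d1) (T2 : measurableType d2) (R : realType)
   (m1 : {sigma_finite_measure set T1 -> \bar R}) (m2 : {sigma_finite_measure set T2 -> \bar R})
   (f : T1 * T2 -> R[i]) :
  cL1 (m1 \x m2)%E f -> cmeas (fun y => cint m1 (fun x => f (x, y))).
move=> [i1 i2]; split; rewrite /comp /cint /= /Rintegral.
  by apply: (measurableT_comp (fine_measurable measurableT)); exact: measurable_fubini_G i1.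
by apply: (measurableT_comp (fine_measurable measurableT)); exact: measurable_fubini_G i2.
Qed.

(** * Fourier transform of integrable functions and its Abel means *)

Section fourier_nice.
Context (R : realType) (d : nat).
Local Notation Rd := 'rV[R]_d.
Local Notation leb := (leb R d).
Implicit Types (f g : Rd -> R[i]) (x p : Rd).

Definition fourier_cst : R := (2 * pi) `^ (- (d%:R / 2)).
Local Notation cd := fourier_cst.

Lemma fourier_cst_ge0 : 0 <= cd. exact: powR_ge0. Qed.

Lemma fourier_cst_gt0 : 0 < cd. by apply: powR_gt0; rewrite mulr_gt0// pi_gt0. Qed.

Lemma fourier_cst_sqr : cd ^+ 2 * (2 * pi) ^+ d = 1.
rewrite -!powR_mulrn ?powR_ge0 ?mulr_ge0 ?pi_ge0// /cd -powRrM -powRD; last first.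
  by apply/implyP => _; rewrite gt_eqF// mulr_gt0// pi_gt0.
by rewrite (_ : _ + _ = 0) ?powRr0//; field.
Qed.

Lemma innerC x y : inner x y = inner y x.
by apply: eq_bigr => i _; rewrite mulrC. Qed.

Lemma innerDl x y z : inner (x + y) z = inner x z + inner y z.
by rewrite /inner -big_split; apply: eq_bigr => i _; rewrite mxE mulrDl. Qed.

Lemma innerZl (a : R) x y : inner (a *: x) y = a * inner x y.
by rewrite /inner mulr_sumr; apply: eq_bigr => i _; rewrite mxE mulrA. Qed.

Lemma innerNl x y : inner (- x) y = - inner x y.
by rewrite -scaleN1r innerZl mulN1r. Qed.

Lemma fourierE f p : fourier f p = cd%:C * cint leb (fun x => f x * cis (- inner x p)).
by congr (_ * _); apply: eq_cint => x; rewrite /cis cosN sinN. Qed.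

Lemma mfun_inner2 : mfun (fun z : Rd * Rd => inner z.1 z.2).
rewrite /inner; apply: measurable_sum => i; apply: measurable_funM.
  by apply: (measurableT_comp (f := fun x => x 0 i)); [exact: mfun_coord|side].
by apply: (measurableT_comp (f := fun x => x 0 i)); [exact: mfun_coord|side].
Qed.

Lemma mfun_inner p : mfun (fun x : Rd => inner x p).
rewrite /inner; apply: measurable_sum => i; apply: measurable_funM; last side.
exact: mfun_coord.
Qed.

Lemma cmeas_cis_inner p : cmeas (fun x : Rd => cis (inner x p)).
by apply: cmeas_cis; exact: mfun_inner. Qed.

Lemma cmeas_cisN_inner p : cmeas (fun x : Rd => cis (- inner x p)).
by apply/cmeas_cis/measurableT_comp; first side; exact: mfun_inner.
Qed.

Lemma cint_cis f p : cL1 leb f -> cL1 leb (fun x => f x * cis (- inner x p)).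
move=> fi; under eq_fun do rewrite mulrC.
by apply: (cL1_bound (M := 1) fi) => [|x]; [exact: cmeas_cisN_inner|rewrite nc_cis].
Qed.

Lemma cint_fourierE f p : cint leb (fun x => f x * cis (- inner x p)) = (cd^-1)%:C * fourier f p.
by rewrite fourierE mulrA -rmorphM mulVf ?mul1r// gt_eqF// fourier_cst_gt0. Qed.

Lemma nc_fourier_le f p : cL1 leb f -> nc (fourier f p) <= cd * \int[leb]_x nc (f x).
move=> fi; rewrite fourierE ncM nc_real (ger0_norm fourier_cst_ge0) ler_wpM2l ?fourier_cst_ge0//.
apply: (le_trans (le_nc_cint (cint_cis p fi))).
by apply/eqW; apply: eq_Rintegral => x _; rewrite ncM nc_cis mulr1.
Qed.

Lemma cint_section f g : cL1 leb f -> cL1 leb g ->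
  cL1 (leb \x leb)%E (fun z : Rd * Rd => cis (- inner z.1 z.2) * (f z.1 * g z.2)).
move=> fi gi; apply: (cL1_bound (M := 1) (cL1_prod_mul fi gi)) => [|z]; last by rewrite nc_cis.
by apply/cmeas_cis/measurableT_comp; first side; exact: mfun_inner2.
Qed.

(** An Abel factor and its Fourier integral, a product of rescaled Cauchy densities: both split into
    one-variable factors, so the line computation suffices. *)
Definition En (e : R) p : R := \prod_(i < d) expn e (p 0 i).
Definition Pn (e : R) x : R := \prod_(i < d) (2 * e / (e ^+ 2 + x 0 i ^+ 2)).

Lemma En_gt0 e p : 0 < En e p.
by apply: prodr_gt0 => i _; exact: expR_gt0. Qed.

Lemma En_le1 e p : 0 <= e -> En e p <= 1.
move=> e0; apply: (@le_trans _ _ (\prod_(i < d) 1)); last by rewrite big1.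
by apply: ler_prod => i _; rewrite expn_ge0 expn_le1.
Qed.

Lemma cL1_En e : 0 < e -> cL1 leb (fun p => (En e p)%:C).
move=> e0; have [h _] := @Rint_prodf R d (fun _ t => expn e t) (fun=> L1_expn e0).
by split => //; exact: integrable0.
Qed.

Lemma cint_En e x : 0 < e -> cint leb (fun p => (En e p)%:C * cis (- inner x p)) = (Pn e x)%:C.
move=> e0; have [_] := @cint_prodf R d (fun i t => (expn e t)%:C * cis (- (x 0 i * t)))
  (fun i => (cint_expn_cis (x 0 i) e0).1).
rewrite (eq_bigr (fun i => (2 * e / (e ^+ 2 + x 0 i ^+ 2))%:C)); last first.
  by move=> i _; rewrite (cint_expn_cis (x 0 i) e0).2.
rewrite -rmorph_prod => <-; apply: eq_cint => p.
by rewrite big_split /= -rmorph_prod -cis_sum sumrN.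
Qed.

Lemma Pn_ge0 e x : 0 <= e -> 0 <= Pn e x.
by move=> e0; apply: prodr_ge0 => i _; side. Qed.

Lemma Pn_scale e x : 0 < e -> Pn e (e *: x) = e^-1 ^+ d * Pn 1 x.
move=> e0; rewrite /Pn (_ : e^-1 ^+ d = \prod_(i < d) e^-1); last by rewrite prodr_const card_ord.
rewrite -big_split; apply: eq_bigr => i _ /=; rewrite mxE.
rewrite (_ : e ^+ 2 + (e * x 0 i) ^+ 2 = e * (e * (1 + x 0 i ^+ 2))); last by ring.
rewrite expr1n !invfM mulr1; have e1 : e != 0 by rewrite gt_eqF.
by rewrite -!mulrA (mulVKf e1) (mulrCA e^-1).
Qed.

Lemma Pn1_int : L1 leb (Pn 1) /\ \int[leb]_x Pn 1 x = (2 * pi) ^+ d.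
have E : Pn 1 = (fun x => \prod_(i < d) (2 / (1 + x 0 i ^+ 2))).
  by apply/funext => x; apply: eq_bigr => i _; rewrite mulr1 expr1n.
have [h1 h2] := @Rint_prodf R d (fun _ t => 2 / (1 + t ^+ 2)) (fun=> L1_cauchy R).
by rewrite E; split => //; rewrite h2 prodr_const card_ord Rint_cauchy.
Qed.

Lemma cmeas_Pn e : 0 < e -> cmeas (fun x => (Pn e x)%:C).
move=> e0; apply: cmeas_real; apply: continuous_measurable_rV; apply: continuous_prodr => i x.
apply: (@cvg_comp _ _ _ (fun x => x 0 i) (fun y => 2 * e / (e ^+ 2 + y ^+ 2)) _ _ _ (@coord_continuous R 1 d 0 i x)).
apply: cvgMr; apply: cvgV; first by side.
by apply: cvgD; [exact: cvg_cst|exact: exprn_continuous].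
Qed.

(** Measurability in p is read off from Fubini's theorem, which needs a kernel integrable in (x, p):
    it is multiplied by [En 1], and this factor is divided out afterwards. *)
Lemma cmeas_fourier f : cL1 leb f -> cmeas (fourier f).
move=> fi; have h := cmeas_section (cint_section fi (cL1_En ltr01)).
rewrite (_ : fourier f = (fun p => (((En 1 p)^-1)%:C * cd%:C) * cint leb (fun x => cis (- inner x p) * (f x * (En 1 p)%:C)))).
  apply: cmeasM => //; apply: cmeasM; last side.
  apply: cmeas_real; apply: continuous_measurable_rV.
  rewrite (_ : (fun p => _) = (fun p => \prod_(i < d) expn (-1) (p 0 i))).
    apply: continuous_prodr => i x.
    apply: (@cvg_comp _ _ _ (fun x => x 0 i) (expn (-1)) _ _ _ (@coord_continuous R 1 d 0 i x)).
    exact: continuous_expn.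
  by apply/funext => p; rewrite /En -prodfV; apply: eq_bigr => i _; rewrite /expn -expRN mulNr.
apply/funext => p; rewrite fourierE.
rewrite (_ : cint leb (fun x => cis (- inner x p) * (f x * (En 1 p)%:C)) =
   (En 1 p)%:C * cint leb (fun x => f x * cis (- inner x p))); last first.
  by rewrite -cintZ; [apply: eq_cint => x; ring|exact: cint_cis].
rewrite [_ * cd%:C]mulrC -!mulrA; congr (_ * _); rewrite mulrA -rmorphM mulVf ?gt_eqF ?En_gt0//.
by rewrite mul1r.
Qed.

Lemma cint_fourier_mul f g : cL1 leb f -> cL1 leb g ->
  cL1 leb (fun p => fourier f p * g p).
move=> fi gi; apply: (cL1_bound gi) => [|p]; first exact: cmeas_fourier.
exact: nc_fourier_le.
Qed.

Lemma fourier_mul f g : cL1 leb f -> cL1 leb g ->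
  cint leb (fun p => fourier f p * g p) = cint leb (fun x => f x * fourier g x).
move=> fi gi; transitivity (cd%:C * cint leb (fun p => cint leb (fun x => cis (- inner x p) * (f x * g p)))).
  rewrite -cintZ.
    apply: eq_cint => p; rewrite fourierE -mulrA; congr (_ * _).
    by rewrite mulrC -cintZ; [apply: eq_cint => x; ring|exact: cint_cis].
  apply: (eq_cintegrable (cL1Z (cd^-1)%:C (cint_fourier_mul fi gi))) => p.
  rewrite mulrA -cint_fourierE mulrC -cintZ; last exact: cint_cis.
  by apply: eq_cint => x; ring.
rewrite -(cint_fubini (cint_section fi gi)) -cintZ.
  apply: eq_cint => x; rewrite fourierE mulrCA; congr (_ * _).
  rewrite -cintZ; last exact: cint_cis.
  by apply: eq_cint => p; rewrite innerC /=; ring.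
apply: (eq_cintegrable (cL1Z (cd^-1)%:C (cint_fourier_mul gi fi))) => p.
rewrite mulrA -cint_fourierE mulrC -cintZ; last exact: cint_cis.
by apply: eq_cint => x; rewrite /= (innerC x p); ring.
Qed.

(** On these functions the Abel means converge pointwise. Schwartz functions belong to the class,
    and so does the Lipschitz cut-off used later. *)
Definition nice f := [/\ continuous (Re \o f : Rd -> R), continuous (Im \o f : Rd -> R),
  exists M : R, forall x, nc (f x) <= M & cL1 leb f].

(** The conjugate of an Abel mean of the inversion integral of g; conjugation lets the forward
    transform do the work of the inverse one. *)
Definition smoothed g e x := fourier (fun p => (En e p)%:C * (fourier g p)^*) x.

Lemma cint_smoothed g e : 0 < e -> cL1 leb g -> cL1 leb (fun p => (En e p)%:C * (fourier g p)^*).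
move=> e0 gi; under eq_fun do rewrite mulrC.
apply: (cL1_bound (cL1_En e0)) => [|p]; first exact/cmeas_conj/cmeas_fourier.
by rewrite nc_conj; exact: nc_fourier_le.
Qed.

Lemma cint_Pn_bounded g e x M : 0 < e -> cmeas g -> (forall x, nc (g x) <= M) ->
  cL1 leb (fun t => (Pn 1 t)%:C * (g (x + e *: t))^*).
move=> e0 mg gM; apply: (@cL1_le _ _ _ _ _ (fun t => M * Pn 1 t)).
- apply: cmeasM; first exact: cmeas_Pn.
  apply: cmeas_conj; apply: cmeas_comp mg; exact: mfun_affine_rV.
- move=> t; rewrite ncM nc_real nc_conj (ger0_norm (Pn_ge0 _ _))// mulrC.
  by apply: ler_wpM2r; [exact: Pn_ge0|exact: gM].
- exact/L1Z/Pn1_int.1.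
Qed.

(** The multiplication formula moves the Abel factor to the other side, where it becomes convolution
    with the kernel [Pn e]; a dilation then puts e into the argument of g, leaving a fixed
    integrable weight. *)
Lemma smoothedE g e x M : 0 < e -> cL1 leb g -> (forall x, nc (g x) <= M) ->
  smoothed g e x = (cd ^+ 2)%:C * cint leb (fun t => (Pn 1 t)%:C * (g (x + e *: t))^*).
move=> e0 gi gM; rewrite /smoothed fourierE rmorphXn /= expr2 -mulrA; congr (_ * _).
pose h p := (En e p)%:C * cis (inner x p).
have hi : cL1 leb h.
  rewrite (_ : h = (fun p => cis (inner x p) * (En e p)%:C)); last by apply/funext => p; rewrite mulrC.
  apply: (cL1_bound (M := 1) (cL1_En e0)) => [|p]; last by rewrite nc_cis.
  by under eq_fun do rewrite innerC; exact: cmeas_cis_inner.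
have hF y : fourier h y = cd%:C * (Pn e (y - x))%:C.
  rewrite fourierE -cint_En//; congr (_ * _); apply: eq_cint => p.
  by rewrite /h -mulrA -cisD innerDl innerNl (innerC p y) opprB addrC.
transitivity ((cint leb (fun p => fourier g p * h p))^*).
  rewrite -cint_conj; last exact: cint_fourier_mul.
  apply: eq_cint => p; rewrite /h (conjcM (fourier g p)) conjcM cconj_real -cisN (innerC p x); ring.
rewrite fourier_mul//.
have gh : cL1 leb (fun y => (Pn e (y - x))%:C * g y).
  apply: (eq_cintegrable (cL1Z (cd^-1)%:C (cint_fourier_mul hi gi))) => y.
  by rewrite hF !mulrA -rmorphM mulVf ?gt_eqF ?fourier_cst_gt0// mul1r.
rewrite (_ : cint leb (fun x0 => g x0 * fourier h x0) = cd%:C * cint leb (fun y => (Pn e (y - x))%:C * g y)); last first.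
  by rewrite -cintZ//; apply: eq_cint => y; rewrite hF; ring.
rewrite conjcM cconj_real; congr (_ * _).
have [_ ] := @cint_affine R d e x (fun y => (Pn e (y - x))%:C * g y) (lt0r_neq0 e0) gh.
rewrite (gtr0_norm e0) => H.
have {H} H : cint leb (fun t => (Pn 1 t)%:C * g (x + e *: t)) = cint leb (fun y => (Pn e (y - x))%:C * g y).
  have c0 : (e^-1 ^+ d)%:C != 0.
    by rewrite (inj_eq (@complexI R)) expf_neq0// invr_neq0// gt_eqF.
  apply: (mulfI c0); rewrite -H -cintZ; last first.
    apply: (eq_cintegrable (cL1_conj (cint_Pn_bounded x e0 (cL1_meas gi) gM))) => t.
    by rewrite conjcM cconjK cconj_real.
  by apply: eq_cint => t; rewrite (addrC x) addrK Pn_scale// rmorphM /= mulrA.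
rewrite -H -cint_conj.
  by apply: eq_cint => t; rewrite conjcM cconj_real.
apply: (eq_cintegrable (cL1_conj (cint_Pn_bounded x e0 (cL1_meas gi) gM))) => t.
by rewrite conjcM cconjK cconj_real.
Qed.

Lemma smoothed_le g e x M : 0 < e -> cL1 leb g -> (forall x, nc (g x) <= M) ->
  nc (smoothed g e x) <= M.
move=> e0 gi gM; rewrite (smoothedE x e0 gi gM) ncM nc_real ger0_norm ?sqr_ge0//.
have [pi1 pi2] := Pn1_int.
rewrite -[leRHS]mul1r -[X in _ <= X * _]fourier_cst_sqr -[leRHS]mulrA ler_wpM2l ?sqr_ge0//.
have ci := cint_Pn_bounded x e0 (cL1_meas gi) gM.
apply: (le_trans (le_nc_cint ci)).
rewrite mulrC -pi2 -RintZ//; apply: le_Rintegral => //.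
- exact: cint_nc ci.
- exact: L1Z.
- move=> t _; rewrite ncM nc_real nc_conj (ger0_norm (Pn_ge0 _ _))// mulrC.
  by apply: ler_wpM2r; [exact: Pn_ge0|exact: gM].
Qed.

Definition en (n : nat) : R := n.+1%:R^-1.

Lemma en_gt0 n : 0 < en n. by rewrite invr_gt0. Qed.

Lemma smoothed_cvg g x : nice g ->
  nc (smoothed g (en n) x - (g x)^*) @[n --> \oo] --> (0 : R).
move=> [cR cI [M gM] gi].
have [pi1 pi2] := Pn1_int.
have gE : (g x)^* = (cd ^+ 2)%:C * cint leb (fun t => (Pn 1 t)%:C * (g x)^*).
  rewrite (_ : cint leb _ = (g x)^* * ((2 * pi) ^+ d)%:C).
    by rewrite mulrCA -rmorphM /= fourier_cst_sqr mulr1.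
  have ip : cL1 leb (fun t => (Pn 1 t)%:C) by split => //; exact: integrable0.
  by rewrite -pi2 -cint_real -cintZ//; apply: eq_cint => t; rewrite mulrC.
have sE n : smoothed g (en n) x - (g x)^* = (cd ^+ 2)%:C *
   (cint leb (fun t => (Pn 1 t)%:C * (g (x + en n *: t))^*) - cint leb (fun t => (Pn 1 t)%:C * (g x)^*)).
  by rewrite (smoothedE x (en_gt0 n) gi gM) [X in _ - X]gE mulrBr.
rewrite (_ : (fun n => _) = (fun n => cd ^+ 2 * nc (cint leb (fun t => (Pn 1 t)%:C * (g (x + en n *: t))^*) - cint leb (fun t => (Pn 1 t)%:C * (g x)^*)))); last first.
  by apply/funext => n; rewrite sE ncM nc_real ger0_norm ?sqr_ge0.
rewrite -(mulr0 (cd ^+ 2)); apply: cvgMr.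
apply: (@dominated_cvgC _ _ _ leb _ _ (fun t => M * Pn 1 t)).
- by move=> n; apply: cL1_meas; apply: (cint_Pn_bounded x (en_gt0 n) (cL1_meas gi) gM).
- by apply: cmeasM; [exact: cmeas_Pn|side].
- apply: nearW => t; have ct : x + en n *: t @[n --> \oo] --> x.
    rewrite -[X in _ --> X]addr0 -(scale0r t); apply: cvgD; first exact: cvg_cst.
    by apply: cvgZr_tmp; exact: cvg_harmonic.
  have c1 := cvg_comp _ _ ct (cR x).
  have c2 := cvg_comp _ _ ct (cI x).
  under eq_fun do rewrite -mulrBr ncM nc_real (ger0_norm (Pn_ge0 _ _))// -conjcB nc_conj.
  rewrite -(mulr0 (Pn 1 t)); apply: cvgMr; apply/nc_cvg0P; split.
    by under eq_fun do rewrite ReD ReN; apply/subr_cvg0.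
  by under eq_fun do rewrite ImD ImN; apply/subr_cvg0.
- by apply: L1Z.
- move=> n t; rewrite ncM nc_real nc_conj (ger0_norm (Pn_ge0 _ _))// mulrC.
  by apply: ler_wpM2r; [exact: Pn_ge0|exact: gM].
Qed.

End fourier_nice.

(** * Extension of isometries by density *)

Section extension.
Context (R : realType) (V I : lmodType R[i]) (dot : V -> V -> R[i]).
Local Notation nsq := (sqnorm dot).
Hypothesis H : hilbert dot.
Let ip : semi_inner dot. by case: H. Qed.
Local Notation nrm x := (Num.sqrt (nsq x)).

Lemma tends_sqnorm_eq u x v w : tends dot u x -> tends dot v w ->
  (forall n, nsq (u n) = nsq (v n)) -> nsq x = nsq w.
by move=> ux vw e; apply/eqP; rewrite eq_le (tends_sqnorm_le ip ip ux vw)// (tends_sqnorm_le ip ip vw ux).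
Qed.

(** The isometry is given on an indexed family, not on a subspace of V, because the Fourier integral
    is defined on functions rather than on classes. By isometry the limit does not depend on the
    approximating sequence. *)
Lemma isometric_extension (P : I -> Prop) (i j : I -> V) :
  (forall a x y, P x -> P y -> P (a *: x + y)) ->
  (forall a x y, P x -> P y -> i (a *: x + y) = a *: i x + i y) ->
  (forall a x y, P x -> P y -> j (a *: x + y) = a *: j x + j y) ->
  (forall x, P x -> nsq (j x) = nsq (i x)) ->
  (forall v, closure_of dot [set i x | x in P] v) ->
  exists U : V -> V, [/\ lin U, forall v, nsq (U v) = nsq v &
    forall x, P x -> U (i x) = j x].
move=> Pl il jl iso dn.
have sub (h : I -> V) x y : (forall a x y, P x -> P y -> h (a *: x + y) = a *: h x + h y) ->
    P x -> P y -> h (-1 *: x + y) = h y - h x.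
  by move=> hl Px Py; rewrite hl// scaleN1r addrC.
have isoB x y : P x -> P y -> nsq (j x - j y) = nsq (i x - i y).
  by move=> Px Py; rewrite -(sub j)// -(sub i)// iso//; exact: Pl.
have ex v : exists s : (nat -> I) * V, [/\ forall n, P (s.1 n), tends dot (fun n => i (s.1 n)) v &
    tends dot (fun n => j (s.1 n)) s.2].
  have [u [uP uv]] := dn v.
  have uP' n : exists x, P x /\ i x = u n by have [x Px xu] := uP n; exists x.
  have [a ha] := choice uP'.
  have ie n : i (a n) = u n by case: (ha n).
  have aP n : P (a n) by case: (ha n).
  have [w hw] : exists w, tends dot (fun n => j (a n)) w.
    case: H => _ _; apply => e e0.
    have [N hN] := tends_cauchy ip uv e0; exists N => n m hn hm.
    by rewrite isoB// !ie; exact: hN.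
  exists (a, w); split => //=; by rewrite (_ : (fun n => _) = u)//; apply/funext.
have [s hs] := choice ex; pose U v := (s v).2.
have key v a : (forall n, P (a n)) -> tends dot (fun n => i (a n)) v -> tends dot (fun n => j (a n)) (U v).
  move=> aP ta; have [sP ts tj] := hs v.
  have tz : tends dot (fun n => i (a n) + -1 *: i ((s v).1 n)) (v + -1 *: v).
    by apply: (tendsD ip) => //; exact: (tendsZ ip).
  have tz' : tends dot (fun n => j (a n) - j ((s v).1 n)) 0.
    rewrite scaleN1r subrr in tz; move=> e e0; have [N hN] := tz e e0; exists N => n hn.
    by rewrite subr0 isoB// -[i _ - i _]subr0 -scaleN1r; exact: hN.
  have := tendsD ip tz' tj; rewrite add0r.
  by rewrite (_ : (fun n => _) = (fun n => j (a n)))//; apply/funext => n; rewrite subrK.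
exists U; split.
- move=> k u v; have [sP ts tj] := hs u; have [sP' ts' tj'] := hs v.
  apply: (@tends_unique _ _ _ H (fun n => j (k *: (s u).1 n + (s v).1 n))).
    apply: key; first by move=> n; exact: Pl.
    rewrite (_ : (fun n => _) = (fun n => k *: i ((s u).1 n) + i ((s v).1 n))).
      by apply: (tendsD ip) => //; exact: (tendsZ ip).
    by apply/funext => n; rewrite il.
  rewrite (_ : (fun n => _) = (fun n => k *: j ((s u).1 n) + j ((s v).1 n))).
    by apply: (tendsD ip) => //; exact: (tendsZ ip).
  by apply/funext => n; rewrite jl.
- move=> v; have [sP ts tj] := hs v; apply: (tends_sqnorm_eq tj ts) => n; exact: iso.
- move=> x Px; apply: (@tends_unique _ _ _ H (fun=> j x)); last exact: (tends_cst ip).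
  by apply: (key _ (fun=> x)) => //; exact: (tends_cst ip).
Qed.

End extension.

Section continuity.
Context (R : realType) (V : topologicalType).
Implicit Types f g : V -> R.

Lemma contD f g : continuous f -> continuous g -> continuous (fun x => f x + g x).
by move=> cf cg x; exact: continuousD (cf x) (cg x). Qed.

Lemma contN f : continuous f -> continuous (fun x => - f x).
by move=> cf x; exact: continuousN (cf x). Qed.

Lemma contM f g : continuous f -> continuous g -> continuous (fun x => f x * g x).
by move=> cf cg x; exact: continuousM (cf x) (cg x). Qed.

Lemma contZ (a : R) f : continuous f -> continuous (fun x => a * f x).
by move=> cf; apply: contM => //; side. Qed.

End continuity.

(** * Plancherel's theorem and the unitary Fourier transform *)

Section plancherel.
Context (R : realType) (d : nat).
Local Notation Rd := 'rV[R]_d.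
Local Notation leb := (leb R d).
Local Notation Hs := (Hspace R d).
Local Notation dot := (@Hdot R d).
Local Notation nsq := (sqnorm dot).
Implicit Types (f g : Rd -> R[i]) (x p : Rd) (u v w : Hs).

Lemma nice_sqint f : nice f -> sqint leb f.
move=> [cR cI [M fM] fi]; apply: (@sqint_le _ _ _ _ _ (fun x => M * nc (f x))).
- by side.
- by move=> x; rewrite ler_wpM2r ?nc_ge0.
- exact/L1Z/cint_nc.
Qed.

Lemma nice_lin (a : R[i]) f g : nice f -> nice g -> nice (fun x => a * f x + g x).
move=> [cR cI [M fM] fi] [cR' cI' [M' gM] gi]; split.
- rewrite (_ : Re \o _ = (fun x => Re a * Re (f x) - Im a * Im (f x) + Re (g x))).
    apply: contD => //; apply: contD; last (apply: contN); exact: contZ.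
  by apply/funext => y /=; rewrite ReD ReM.
- rewrite (_ : Im \o _ = (fun x => Re a * Im (f x) + Im a * Re (f x) + Im (g x))).
    by apply: contD => //; apply: contD; exact: contZ.
  by apply/funext => y /=; rewrite ImD ImM.
- exists (nc a * M + M') => x; apply: (le_trans (ncD _ _)); rewrite ncM.
  by apply: lerD => //; rewrite ler_wpM2l ?nc_ge0.
- by side.
Qed.

Lemma nice_conj f : nice f -> nice (fun x => (f x)^*).
move=> [cR cI [M fM] fi]; split.
- by rewrite (_ : Re \o _ = Re \o f)//; apply/funext => x /=; rewrite ReJ.
- rewrite (_ : Im \o _ = (fun x => - (Im (f x)))); first by move=> x; apply: continuousN; exact: cI x.
  by apply/funext => y /=; rewrite ImJ.
- by exists M => x; rewrite nc_conj.
- exact: cL1_conj.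
Qed.

Lemma csmooth_continuous f : csmooth f -> continuous (Re \o f : Rd -> R) /\ continuous (Im \o f : Rd -> R).
by move=> [sr si]; split; [case: (sr [::])|case: (si [::])]. Qed.

Lemma Pn1_weight x : 1 <= (1 + eucl2 x) ^+ d * Pn 1 x.
have -> : (1 + eucl2 x) ^+ d = \prod_(i < d) (1 + eucl2 x) by rewrite prodr_const card_ord.
rewrite /Pn -big_split /=.
apply: (@le_trans _ _ (\prod_(i < d) 1)); first by rewrite big1.
apply: ler_prod => i _; rewrite /= mulr1 mulrA ler_pdivlMr; last first.
  by side.
have := eucl2_ge0 x; have : x 0 i ^+ 2 <= eucl2 x.
  by rewrite /eucl2 /inner (bigD1 i)//= -expr2 lerDl sumr_ge0// => j _; rewrite sqr_ge0.
lra.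
Qed.

Lemma schwartz_nice f : schwartz f -> nice f.
move=> [sf bf]; have [cR cI] := csmooth_continuous sf; split => //.
  have [C hC] := bf 0%N [::]; exists C => x; have := hC x.
  by rewrite /schwartz_weight mul1r /cpartial /=; case: (f x).
have [C hC] := bf d [::].
apply: (@cL1_le _ _ _ _ _ (fun x => `|C| * Pn 1 x)).
- by split; apply: continuous_measurable_rV.
- move=> x; have h1 : (1 + eucl2 x) ^+ d * nc (f x) <= C.
    by have := hC x; rewrite /schwartz_weight /cpartial /=; case: (f x).
  have h2 := Pn1_weight x.
  have w0 : 0 < (1 + eucl2 x) ^+ d by rewrite exprn_gt0// ltr_pwDl// eucl2_ge0.
  rewrite -(ler_pM2l w0); apply: (le_trans h1); rewrite mulrCA.
  by apply: (le_trans (ler_norm _)); rewrite ler_peMr.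
- by apply: L1Z; case: (Pn1_int R d).
Qed.

Lemma smoothed_pairing f g : cL1 leb g -> nice f ->
  nc (cint leb (fun x => g x * smoothed f (en R n) x) -
      cint leb (fun x => g x * (f x)^*)) @[n --> \oo] --> (0 : R).
move=> gi nf; have [cR cI [M fM] fi] := nf.
apply: (@dominated_cvgC _ _ _ leb _ _ (fun x => M * nc (g x))) => [n||||n x].
- by apply: cmeasM; [side|apply/cmeas_fourier/cint_smoothed => //; exact: en_gt0].
- by side.
- apply: nearW => x; under eq_fun do rewrite -mulrBr ncM.
  by rewrite -(mulr0 (nc (g x))); apply: cvgMr; exact: smoothed_cvg.
- exact/L1Z/cint_nc.
- by rewrite ncM mulrC ler_wpM2r ?nc_ge0//; apply: smoothed_le => //; exact: en_gt0.
Qed.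

(** The integral of the Abel factor times |f^|^2 is a pairing of f with its Abel mean, hence tends
    to the integral of |f|^2. Fatou's lemma makes f^ square integrable, and dominated convergence
    then yields the equality. *)
Lemma plancherel f : nice f -> sqint leb (fourier f) /\
  \int[leb]_p nc (fourier f p) ^+ 2 = \int[leb]_x nc (f x) ^+ 2.
move=> nf; have [cR cI [M fM] fi] := nf.
have mF := cmeas_fourier fi.
pose A n := \int[leb]_p (En (en R n) p * nc (fourier f p) ^+ 2).
have iA n : L1 leb (fun p => En (en R n) p * nc (fourier f p) ^+ 2).
  have [h _] := cint_fourier_mul fi (cint_smoothed (en_gt0 R n) fi).
  apply: eq_integrable h => // p _; rewrite /comp; congr EFin.
  by rewrite mulrCA (mulrC (fourier f p)) mul_conjC ReZ.
have AE n : (A n)%:C = cint leb (fun x => f x * smoothed f (en R n) x).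
  rewrite -fourier_mul//; last by apply: cint_smoothed => //; exact: en_gt0.
  rewrite -cint_real; apply: eq_cint => p.
  by rewrite [RHS]mulrCA [in RHS](mulrC (fourier f p)) mul_conjC rmorphM.
have B : (\int[leb]_x nc (f x) ^+ 2)%:C = cint leb (fun x => f x * (f x)^*).
  by rewrite -cint_real; apply: eq_cint => x; rewrite mulrC mul_conjC.
have cA : A n @[n --> \oo] --> \int[leb]_x nc (f x) ^+ 2.
  have := smoothed_pairing fi nf; under eq_fun do rewrite -AE -B -rmorphB nc_real.
  by move/norm_cvg0P/subr_cvg0.
have cE p : En (en R n) p * nc (fourier f p) ^+ 2 @[n --> \oo] --> nc (fourier f p) ^+ 2.
  rewrite -[X in _ --> X]mul1r; apply: cvgMl.
  rewrite (_ : 1 = \prod_(i < d) 1); last by rewrite big1.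
  rewrite /En; elim: (index_enum _) => [|i r ih].
    rewrite big_nil; under eq_fun do rewrite big_nil; exact: cvg_cst.
  rewrite big_cons (_ : (fun n => _) = (fun n => expn (en R n) (p 0 i) * \prod_(i <- r) expn (en R n) (p 0 i))).
    apply: cvgM => //.
    have c1 : - `|p 0 i| * en R n @[n --> \oo] --> 0.
      by rewrite -(mulr0 (- `|p 0 i|)); apply: cvgMr; exact: cvg_harmonic.
    have c2 := @cvg_comp _ _ _ (fun n => - `|p 0 i| * en R n) (@expR R) _ _ _ c1 (@continuous_expR R 0).
    rewrite expR0 in c2; rewrite (_ : (fun n => _) = @expR R \o (fun n => - `|p 0 i| * en R n))//.
    by apply/funext => n; rewrite /expn /= mulNr mulrC.
  by apply/funext => n; rewrite big_cons.
have A0 n p : 0 <= En (en R n) p * nc (fourier f p) ^+ 2.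
  by rewrite mulr_ge0 ?sqr_ge0// ltW// En_gt0.
have mA n : mfun (fun p => En (en R n) p * nc (fourier f p) ^+ 2).
  exact: L1_meas (iA n).
have [b hb] : exists b, forall n, A n <= b.
  have [b [_ hb]] := cvg_seq_bounded (cvgP _ cA).
  by exists (b + 1) => n; apply: le_trans (ler_norm _) (hb _ _ n I); rewrite ltrDl.
have sF : sqint leb (fourier f).
  split => //; apply: ge0_L1 => [|p|]; [side|exact: sqr_ge0|].
  apply: (@le_lt_trans _ _ b%:E); last exact: ltry.
  apply: (fatou_bound mA A0 cE) => n.
  by rewrite -[leLHS]fineK ?(integrable_fin_num measurableT (iA n))// lee_fin hb.
split => //; apply: cvg_unique _ _ cA => //.
apply: (@dominated_cvgR _ _ _ leb _ _ (fun p => nc (fourier f p) ^+ 2)) => //.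
- by side.
- by apply: nearW => p; exact: cE.
- by case: sF.
- by move=> n p; rewrite ger0_norm// ler_piMl ?sqr_ge0// En_le1// ltW// en_gt0.
Qed.

Lemma fourier_lin (a : R[i]) f g p : cL1 leb f -> cL1 leb g ->
  fourier (fun x => a * f x + g x) p = a * fourier f p + fourier g p.
move=> fi gi; rewrite !fourierE mulrCA -mulrDr; congr (_ * _).
rewrite -cintZ; last exact: cint_cis.
rewrite -cintD; [|exact/cL1Z/cint_cis|exact: cint_cis].
by apply: eq_cint => x; ring.
Qed.

Lemma L2_of_lin (a : R[i]) f g : sqint leb f -> sqint leb g ->
  L2_of leb (fun x => a * f x + g x) = a *: L2_of leb f + L2_of leb g.
move=> hf hg; apply: L2_of_eq; first exact: sqint_lin.
apply: filterS (filterI (repr_lin a (L2_of leb f) (L2_of leb g)) (filterI (L2_of_ae hf) (L2_of_ae hg))).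
by move=> x [-> [-> ->]].
Qed.

Lemma Hdot_hilbert : hilbert dot. exact: L2_hilbert. Qed.
Let ip : semi_inner dot. by case: Hdot_hilbert. Qed.

(** A vector orthogonal to all these classes is orthogonal to the Schwartz functions, which
    separate. *)
Lemma nice_dense u : closure_of dot [set L2_of leb f | f in @nice R d] u.
have nice0 : nice (fun _ => 0 : R[i]).
  split; [exact: cst_continuous|exact: cst_continuous| |exact: cL10].
  by exists 0 => x; rewrite nc0.
apply: dense_of_orth; first exact: Hdot_hilbert.
  split.
    exists (fun _ => 0) => //; apply: L2_of_eq; first exact: sqint0.
    by have := reprZ 0 (0 : Hs); rewrite scale0r; apply: filterS => x ->; rewrite mul0r.
  move=> a _ _ [f nf <-] [g ng <-]; exists (fun x => a * f x + g x); first exact: nice_lin.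
  by rewrite L2_of_lin//; exact: nice_sqint.
move=> w hw; have [mw sw] := repr_sqint w.
have : {ae leb, forall p, repr w p = 0}.
  apply: schwartz_separates => // f sf; have nf := schwartz_nice sf.
  split; first by apply: sqint_mul; [side|exact: nice_sqint].
  have := hw (L2_of leb (fun x => (f x)^*)).
  rewrite /Hdot (@L2_dotE _ _ _ _ _ _ (fun x => (f x)^*) (repr w)) //; last 3 first.
  - by apply: cmeas_conj; case: nf => _ _ _ /cL1_meas.
  - exact/L2_of_ae/nice_sqint/nice_conj.
  - exact: nearW.
  move=> h; rewrite -[RHS]h; first by apply: eq_cint => x; rewrite cconjK mulrC.
  by exists (fun x => (f x)^*) => //; exact: nice_conj.
move=> h; apply/L2_eqP; have := reprZ 0 (0 : Hs); rewrite scale0r.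
by apply: filterS2 h => x -> ->; rewrite mul0r.
Qed.

Lemma fourier_L2_exists : exists U : Hs -> Hs, [/\ lin U,
  forall v, nsq (U v) = nsq v &
  forall f, nice f -> U (L2_of leb f) = L2_of leb (fourier f)].
have [|||||U [h1 h2 h3]] := @isometric_extension R Hs (Rd -> R[i])%type dot Hdot_hilbert
  (@nice R d) (L2_of leb) (fun f => L2_of leb (fourier f)).
- by move=> a f g; exact: nice_lin.
- by move=> a f g nf ng; apply: L2_of_lin; exact: nice_sqint.
- move=> a f g nf ng; rewrite -L2_of_lin; [|exact: (plancherel nf).1|exact: (plancherel ng).1].
  congr L2_of; apply/funext => p; apply: fourier_lin; first by case: nf.
  by case: ng.
- move=> f nf; have [sF e] := plancherel nf; have sf := nice_sqint nf.
  rewrite /Hdot (sqnorm_L2 sF.1 (L2_of_ae sF)) (sqnorm_L2 sf.1 (L2_of_ae sf)).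
  exact: e.
- exact: nice_dense.
by exists U.
Qed.

Definition Fou : Hs -> Hs := projT1 (cid fourier_L2_exists).
Lemma Fou_lin : lin Fou. by rewrite /Fou; case: cid => ? []. Qed.
Lemma Fou_sqnorm v : nsq (Fou v) = nsq v. by rewrite /Fou; case: cid => ? []. Qed.
Lemma Fou_nice f : nice f -> Fou (L2_of leb f) = L2_of leb (fourier f).
by rewrite /Fou; case: cid => ? [] ? ? /= h; exact: h. Qed.
Lemma Fou_dot u v : dot (Fou u) (Fou v) = dot u v.
exact: (polarize ip ip Fou_lin Fou_sqnorm). Qed.

Definition Hconj u : Hs := L2_of leb (fun x => (repr u x)^*).
Definition Hrefl u : Hs := L2_of leb (fun x => repr u (- x)).

Lemma Hconj_ae u : {ae leb, forall x, repr (Hconj u) x = (repr u x)^*}.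
exact/L2_of_ae/sqint_conj/repr_sqint. Qed.

Lemma sqint_refl f : sqint leb f -> sqint leb (fun x => f (- x)).
move=> [mf If].
have E : (fun x => 0 + (-1) *: x) = (fun x => - x) by apply/funext => x; rewrite add0r scaleN1r.
have mr := mfun_affine_rV (-1) (0 : Rd); rewrite E in mr.
split; first exact: (cmeas_comp mr).
have h := @leb_affineP R d (-1) 0 (ltr0_neq0 (ltrN10 R)).
rewrite E normrN normr1 invr1 expr1n in h.
exact: (Rintegrable_push mr ltr01 h If).
Qed.

Lemma ae_refl (P : Rd -> Prop) : {ae leb, forall x, P x} -> {ae leb, forall x, P (- x)}.
move=> /(@ae_affine R d (-1) 0 P (ltr0_neq0 (ltrN10 R))); apply: filterS => x.
by rewrite add0r scaleN1r.
Qed.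

Lemma cint_refl f : cL1 leb f ->
  cL1 leb (fun x => f (- x)) /\ cint leb (fun x => f (- x)) = cint leb f.
move=> fi; have [h1 h2] := @cint_affine R d (-1) 0 f (ltr0_neq0 (ltrN10 R)) fi.
have E : (fun x => f (0 + (-1) *: x)) = (fun x => f (- x)).
  by apply/funext => x; rewrite add0r scaleN1r.
by rewrite E in h1 h2; split => //; rewrite h2 normrN normr1 invr1 expr1n mul1r.
Qed.

Lemma Hrefl_ae u : {ae leb, forall x, repr (Hrefl u) x = repr u (- x)}.
exact/L2_of_ae/sqint_refl/repr_sqint. Qed.

Let mr u : cmeas (repr u). by case: (repr_sqint u). Qed.
Let mc u : cmeas (fun x => (repr u x)^*). by side. Qed.
Let mf u : cmeas (fun x => repr u (- x)). by case: (sqint_refl (repr_sqint u)). Qed.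
Let aer u : {ae leb, forall x, repr u x = repr u x}. exact: nearW. Qed.

Lemma Hconj_dot u v : dot (Hconj u) (Hconj v) = dot v u.
rewrite /Hdot (L2_dotE (mc u) (mc v) (Hconj_ae u) (Hconj_ae v)).
by apply: eq_cint => x; rewrite cconjK mulrC.
Qed.

Lemma Hconj_dotC u v : dot (Hconj u) v = dot (Hconj v) u.
rewrite /Hdot (L2_dotE (mc u) (mr v) (Hconj_ae u) (aer v)) (L2_dotE (mc v) (mr u) (Hconj_ae v) (aer u)).
by apply: eq_cint => x; rewrite !cconjK mulrC.
Qed.

Lemma HconjK u : Hconj (Hconj u) = u.
by apply/L2_eqP; apply: filterS2 (Hconj_ae (Hconj u)) (Hconj_ae u) => x -> ->; rewrite cconjK.
Qed.

Lemma Hconj_lin (a : R[i]) u v : Hconj (a *: u + v) = a^* *: Hconj u + Hconj v.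
apply/L2_eqP; apply: filterS (filterI (filterI (Hconj_ae (a *: u + v)) (repr_lin a u v))
  (filterI (repr_lin a^* (Hconj u) (Hconj v)) (filterI (Hconj_ae u) (Hconj_ae v)))).
by move=> x [[-> ->] [-> [-> ->]]]; rewrite conjcD conjcM.
Qed.

Lemma Hrefl_dot u v : dot (Hrefl u) v = dot u (Hrefl v).
rewrite /Hdot (L2_dotE (mf u) (mr v) (Hrefl_ae u) (aer v)) (L2_dotE (mr u) (mf v) (aer u) (Hrefl_ae v)).
have ci : cL1 leb (fun x => (repr u (- x))^* * repr v x).
  by apply: sqint_mul; [apply/sqint_conj/sqint_refl; exact: repr_sqint|exact: repr_sqint].
have [_ <-] := cint_refl ci.
by apply: eq_cint => x; rewrite opprK.
Qed.

Lemma HreflK u : Hrefl (Hrefl u) = u.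
by apply/L2_eqP; apply: filterS2 (Hrefl_ae (Hrefl u)) (ae_refl (Hrefl_ae u)) => x -> ->; rewrite opprK.
Qed.

Lemma Hrefl_lin : lin Hrefl.
move=> a u v; apply/L2_eqP; apply: filterS (filterI (filterI (Hrefl_ae (a *: u + v)) (ae_refl (repr_lin a u v)))
  (filterI (repr_lin a (Hrefl u) (Hrefl v)) (filterI (Hrefl_ae u) (Hrefl_ae v)))).
by move=> x [[-> ->] [-> [-> ->]]].
Qed.

Lemma Hconj_refl u : Hconj (Hrefl u) = Hrefl (Hconj u).
apply/L2_eqP; apply: filterS (filterI (filterI (Hconj_ae (Hrefl u)) (Hrefl_ae u))
  (filterI (Hrefl_ae (Hconj u)) (ae_refl (Hconj_ae u)))).
by move=> x [[-> ->] [-> ->]].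
Qed.

Lemma Hconj_sqnorm u : nsq (Hconj u) = nsq u.
by rewrite /sqnorm Hconj_dot. Qed.

Lemma Hrefl_sqnorm u : nsq (Hrefl u) = nsq u.
by rewrite /sqnorm Hrefl_dot HreflK. Qed.

Lemma HconjB u v : Hconj (u - v) = Hconj u - Hconj v.
by rewrite addrC -scaleN1r Hconj_lin conjcN cconj1 scaleN1r addrC.
Qed.

Lemma tends_Hconj (u_ : nat -> Hs) u : tends dot u_ u -> tends dot (fun n => Hconj (u_ n)) (Hconj u).
move=> h e e0; have [N hN] := h e e0; exists N => n hn.
by rewrite -HconjB Hconj_sqnorm; exact: hN.
Qed.

Lemma tends_isom (U : Hs -> Hs) (u_ : nat -> Hs) u : lin U -> (forall v, nsq (U v) = nsq v) ->
  tends dot u_ u -> tends dot (fun n => U (u_ n)) (U u).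
move=> Ul Ui h e e0; have [N hN] := h e e0; exists N => n hn.
by rewrite -(linB _ _ Ul) Ui; exact: hN.
Qed.

Lemma Fou_sym_nice f g : nice f -> nice g ->
  dot (Hconj (Fou (L2_of leb f))) (L2_of leb g) = dot (Hconj (L2_of leb f)) (Fou (L2_of leb g)).
move=> nf ng; rewrite !Fou_nice//.
have [sf _] := plancherel nf; have [sg _] := plancherel ng.
have sf0 := nice_sqint nf; have sg0 := nice_sqint ng.
rewrite /Hdot (@L2_dotE _ _ _ _ _ _ (fun p => (fourier f p)^*) g); last 4 first.
- by side.
- by case: sg0.
- by apply: filterS2 (Hconj_ae (L2_of leb (fourier f))) (L2_of_ae sf) => x -> ->.
- exact: L2_of_ae.
rewrite (@L2_dotE _ _ _ _ _ _ (fun p => (f p)^*) (fourier g)); last 4 first.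
- by side.
- by case: sg.
- by apply: filterS2 (Hconj_ae (L2_of leb f)) (L2_of_ae sf0) => x -> ->.
- exact: L2_of_ae.
have fi : cL1 leb f by case: nf.
have gi : cL1 leb g by case: ng.
transitivity (cint leb (fun p => fourier f p * g p)).
  by apply: eq_cint => p; rewrite cconjK.
by rewrite fourier_mul//; apply: eq_cint => p; rewrite cconjK.
Qed.

(** The multiplication formula, extended by density in one argument after the other. *)
Lemma Fou_sym u v : dot (Hconj (Fou u)) v = dot (Hconj u) (Fou v).
have h g u' : nice g -> dot (Hconj (Fou u')) (L2_of leb g) = dot (Hconj u') (Fou (L2_of leb g)).
  move=> ng; have [u_ [nu tu]] := nice_dense u'.
  rewrite Hconj_dotC (Hconj_dotC u').
  apply: (tends_dot_eq ip (tends_isom Fou_lin Fou_sqnorm tu) tu) => n.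
  rewrite Hconj_dotC -(Hconj_dotC (u_ n)); have [f nf <-] := nu n.
  exact: Fou_sym_nice.
have [v_ [nv tv]] := nice_dense v.
apply: (tends_dot_eq ip tv (tends_isom Fou_lin Fou_sqnorm tv)) => n.
by have [g ng <-] := nv n; exact: h.
Qed.

Lemma fourier_conj f p : cL1 leb f -> fourier (fun x => (f x)^*) p = (fourier f (- p))^*.
move=> fi; rewrite !fourierE (conjcM (fourier_cst R d)%:C) cconj_real; congr (_ * _).
rewrite -cint_conj; last exact: cint_cis.
by apply: eq_cint => x; rewrite conjcM -cisN (innerC x (- p)) innerNl (innerC p) opprK.
Qed.

Lemma Fou_conj u : Fou (Hconj u) = Hrefl (Hconj (Fou u)).
have [u_ [nu tu]] := nice_dense u.
have t2 := tends_isom Hrefl_lin Hrefl_sqnorm (tends_Hconj (tends_isom Fou_lin Fou_sqnorm tu)).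
apply: (tends_unique Hdot_hilbert (tends_isom Fou_lin Fou_sqnorm (tends_Hconj tu))).
rewrite (_ : (fun n => _) = (fun n => Hrefl (Hconj (Fou (u_ n)))))//.
apply/funext => n; have [f nf <-] := nu n; have sf := nice_sqint nf; have [sF _] := plancherel nf.
have -> : Hconj (L2_of leb f) = L2_of leb (fun x => (f x)^*).
  apply/esym/L2_of_eq; first side.
  by apply: filterS2 (Hconj_ae (L2_of leb f)) (L2_of_ae sf) => x -> ->.
have nf' := nice_conj nf; rewrite !Fou_nice//; apply: L2_of_eq; first exact: (plancherel nf').1.
apply: filterS (filterI (Hrefl_ae (Hconj (L2_of leb (fourier f)))) (filterI (ae_refl (Hconj_ae (L2_of leb (fourier f)))) (ae_refl (L2_of_ae sF)))).
by move=> x [-> [-> ->]]; rewrite fourier_conj//; case: nf.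
Qed.

(** The inverse transform: reflecting the function before the forward transform produces the kernel
    exp(i x p). *)
Definition Uinv u : Hs := Fou (Hrefl u).

Lemma Uinv_lin : lin Uinv. by move=> a u v; rewrite /Uinv Hrefl_lin Fou_lin. Qed.
Lemma Uinv_sqnorm u : nsq (Uinv u) = nsq u.
by rewrite /Uinv Fou_sqnorm Hrefl_sqnorm. Qed.
Lemma Uinv_dot u v : dot (Uinv u) (Uinv v) = dot u v.
exact: (polarize ip ip Uinv_lin Uinv_sqnorm). Qed.

(** Combines the bilinear symmetry with the behaviour under complex conjugation. An isometry whose
    adjoint is isometric is inverted by it on both sides, so surjectivity comes as a consequence. *)
Lemma Fou_adj u v : dot (Fou u) v = dot u (Uinv v).
have -> : Fou u = Hconj (Hconj (Fou u)) by rewrite HconjK.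
have -> : Hconj (Fou u) = Hrefl (Fou (Hconj u)) by rewrite Fou_conj HreflK.
by rewrite Hconj_refl Hrefl_dot Fou_sym HconjK.
Qed.

Lemma FouK u : Uinv (Fou u) = u.
apply/eqP; rewrite -subr_eq0; apply/eqP/(dot_nondeg Hdot_hilbert) => z.
by rewrite (dotBr ip) -Fou_adj Fou_dot subrr.
Qed.

Lemma UinvK u : Fou (Uinv u) = u.
apply/eqP; rewrite -subr_eq0; apply/eqP/(dot_nondeg Hdot_hilbert) => z.
by rewrite (dotBr ip) (dotC ip) Fou_adj Uinv_dot -(dotC ip) subrr.
Qed.

Lemma Fou_refl u : Hrefl (Fou u) = Fou (Hrefl u).
have h : Fou (Hrefl (Fou u)) = Fou (Fou (Hrefl u)) by rewrite -/(Uinv (Fou u)) -/(Uinv u) FouK UinvK.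
by rewrite -(FouK (Hrefl (Fou u))) h FouK.
Qed.

Lemma dist_fourier_L2 u : dist_fourier (dist_of_fun (repr u)) (repr (Fou u)).
split => // f sf; have nf := schwartz_nice sf; have sqf := nice_sqint nf.
split; first by apply: sqint_mul => //; exact: repr_sqint.
have [sF _] := plancherel nf.
have := Fou_sym u (L2_of leb f); rewrite Fou_nice//.
rewrite /Hdot (@L2_dotE _ _ _ _ _ _ (fun p => (repr (Fou u) p)^*) f); last 4 first.
- exact: mc.
- by case: sqf.
- exact: Hconj_ae.
- exact: L2_of_ae.
rewrite (@L2_dotE _ _ _ _ _ _ (fun p => (repr u p)^*) (fourier f)); last 4 first.
- exact: mc.
- by case: sF.
- exact: Hconj_ae.
- exact: L2_of_ae.
move=> h; rewrite /dist_of_fun; transitivity (cint leb (fun p => (repr u p)^*^* * fourier f p)).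
  by apply: eq_cint => p; rewrite cconjK.
by rewrite -h; apply: eq_cint => p; rewrite cconjK.
Qed.

Lemma dist_fourier_unique T f g : dist_fourier T f -> dist_fourier T g ->
  {ae leb, forall p, f p = g p}.
move=> [mf1 hf] [mg hg].
have : {ae leb, forall p, f p - g p = 0}.
  apply: schwartz_separates; first side.
  move=> h sh; have [i1 e1] := hf h sh; have [i2 e2] := hg h sh.
  split.
    by apply: (eq_cintegrable (cL1B i1 i2)) => p; rewrite mulrBl.
  transitivity (cint leb (fun p => f p * h p - g p * h p)).
    by apply: eq_cint => p; rewrite mulrBl.
  by rewrite cintB// -[cint leb (fun p => f p * h p)]e1 -[cint leb (fun p => g p * h p)]e2 subrr.
by apply: filterS => p /eqP; rewrite subr_eq0 => /eqP.
Qed.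

Lemma dist_fourier_ae T f g : dist_fourier T f -> cmeas g ->
  {ae leb, forall p, f p = g p} -> dist_fourier T g.
move=> [mf1 hf] mg fg; split => // h sh; have [i1 e1] := hf h sh.
have mh : cmeas h by case: (nice_sqint (schwartz_nice sh)).
have fgh : {ae leb, forall p, f p * h p = g p * h p} by apply: filterS fg => p ->.
split; first by apply: (ae_cintegrable _ fgh) => //; side.
by rewrite e1; apply: ae_eq_cint => //; side.
Qed.

End plancherel.

Ltac side_leaf12 := match goal with
  | _ => side_leaf7
  | |- semi_inner _ => exact: (Hdot_hilbert _ _).1
  | h : hilbert ?f |- semi_inner ?f => exact: h.1
  | |- hilbert _ => exact: Hdot_hilbert
  | |- cmeas (fourier _) => apply: cmeas_fourier; side
  | |- measurable_fun _ (fun _ => fun_of_matrix _ _ _) => exact: mfun_coord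
  | |- measurable_fun _ (fun _ => inner _ _) => exact: mfun_inner
  | |- continuous (fun _ => fun_of_matrix _ _ _) => exact: coord_continuous
  | |- continuous (fun _ => _ * _) => apply: contM; side
  | |- continuous (fun _ => _ + _) => apply: contD; side
  | |- continuous (fun _ => - _) => apply: contN; side
  | h : nice ?f |- cL1 _ ?f => case: h
  | h : nice ?f |- sqint _ ?f => exact: nice_sqint
  | h : schwartz ?f |- nice ?f => exact: schwartz_nice
  end.
Ltac side_leaf ::= side_leaf12.

(** * Sobolev regularity by difference quotients *)

Section regularity.
Context (R : realType) (d : nat).
Local Notation Rd := 'rV[R]_d.
Local Notation leb := (leb R d).
Implicit Types (f g : Rd -> R[i]) (x p : Rd).

Lemma derive_line (f : Rd -> R) (x v : Rd) (t : R) : derivable f (t *: v + x) v ->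
  is_derive t 1 (fun s : R => f (s *: v + x)) ('D_v f (t *: v + x)).
move=> df; have E : (fun h => h^-1 *: (((fun s => f (s *: v + x)) \o shift t) (h *: 1) - f (t *: v + x))) =
         (fun h => h^-1 *: ((f \o shift (t *: v + x)) (h *: v) - f (t *: v + x))).
  apply/funext => h /=; rewrite /shift /=; congr (_ *: (f _ - _)).
  by rewrite [h *: 1]mulr1 scalerDl addrA.
by split; rewrite /derivable /derive E.
Qed.

Lemma cis_sub1 (t : R) : nc (cis (t + t) - 1) ^+ 2 = 4 * sin t ^+ 2.
rewrite sqr_nc /cis /= oppr0 addr0 sinD cosD.
have c2 : cos t ^+ 2 = 1 - sin t ^+ 2 := cos2sin2 t.
rewrite -!expr2 (_ : sin t * cos t + cos t * sin t = 2 * (sin t * cos t)); last by ring.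
rewrite !exprMn c2; ring.
Qed.

Lemma sin_quotient_cvg (t : R) : sin (en R n * t) / en R n @[n --> \oo] --> t.
have h : is_derive (0 : R) 1 (fun s => sin (s * t)) (cos (0 * t) * t).
  have dx : is_derive (0 : R) 1 (fun s => s * t) t.
    rewrite (_ : (fun s => _) = (fun s => t * s + 0)); first exact: der_affine.
    by apply/funext => s; rewrite addr0 mulrC.
  exact: der_comp (is_derive_sin _) dx.
have /is_derive1_caratheodory [g [gE gc g0]] := h.
rewrite (_ : (fun n => _) = (fun n => g (en R n))).
  rewrite mul0r cos0 mul1r in g0; rewrite -[X in _ --> X]g0.
  by apply: (@cvg_comp _ _ _ (fun n => en R n) g _ _ _ _ gc); exact: cvg_harmonic.
apply/funext => n; have := gE (en R n); rewrite mul0r sin0 !subr0 => ->.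
by rewrite mulfK// gt_eqF// en_gt0.
Qed.

Lemma continuous_translate (f : Rd -> R) (a : Rd) : continuous f -> continuous (fun x => f (x + a)).
move=> cf x; apply: (@continuous_comp _ _ _ (fun y : Rd => y + a) f); last exact: cf.
have h : {for x, continuous (fun y : Rd => id y + cst a y)} by apply: continuousD; [move=> y; exact: cvg_id|exact: cst_continuous].
exact: h.
Qed.

Lemma fourier_shift f (a p : Rd) : cL1 leb f ->
  fourier (fun x => f (x + a)) p = cis (inner a p) * fourier f p.
move=> fi; have n1 : (1 : R) != 0 by exact: oner_neq0.
have [h1 h2] := cint_affine a n1 (cint_cis p fi).
rewrite normr1 invr1 expr1n mul1r in h2.
rewrite !fourierE mulrCA; congr (_ * _); rewrite -h2 -cintZ//.
apply: eq_cint => x; rewrite scale1r addrC innerDl opprD cisD [cis (- inner x p)]cisN.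
have e : cis (inner a p) * (cis (inner a p))^* = 1 by rewrite mulrC mul_conjC nc_cis expr1n.
rewrite [cis (- inner a p)]cisN [RHS](_ : _ = (cis (inner a p) * (cis (inner a p))^*) * (f (a + x) * (cis (inner x p))^*)); last by ring.
by rewrite e mul1r.
Qed.

(** The increment of f by h in direction i has a transform of modulus 2 |sin(h p_i / 2)| |f^|;
    Plancherel bounds it and Fatou's lemma lets h tend to 0. Difference quotients replace
    derivatives because the cut-off below is only Lipschitz. *)
Lemma fourier_coord_sqint f (G : Rd -> R) (i : 'I_d) : nice f ->
  L1 leb G ->
  (forall (h : R) x, 0 < h -> h <= 1 -> nc (f (x + h *: delta_mx 0 i) - f x) ^+ 2 <= h ^+ 2 * G x) ->
  sqint leb (fun p => (p 0 i)%:C * fourier f p) /\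
  \int[leb]_p (p 0 i ^+ 2 * nc (fourier f p) ^+ 2) <= \int[leb]_x G x.
move=> nf GI fG; have [cR cI [M fM] fi] := nf.
have mF := cmeas_fourier fi.
have mi : mfun (fun p => p 0 i) := mfun_coord i.
pose h n := 2 * en R n.
have mq n : mfun (fun p => sin (en R n * p 0 i) / en R n).
  apply: measurable_funM => //; apply: (measurableT_comp (f := @sin R)).
    by apply: continuous_measurable_fun; exact: continuous_sin.
  by side.
have shift_nice a : nice (fun x => f (x + a)).
  split.
  - by apply: (@continuous_translate (Re \o f)) => //.
  - by apply: (@continuous_translate (Im \o f)) => //.
  - by exists M.
  - have n1 : (1 : R) != 0 by exact: oner_neq0.
    have [h1 h2] := cint_affine a n1 fi.
    by apply: (eq_cintegrable h1) => x; rewrite scale1r addrC.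
(* The increment is h = 2 / (n + 1), at most 1 from n = 1 on, which is why the sequence is shifted
   by one below. *)
have key (n : nat) : (1 <= n)%N -> (\int[leb]_p ((sin (en R n * p 0 i) / en R n) ^+ 2 * nc (fourier f p) ^+ 2)%:E <= (\int[leb]_x G x)%:E)%E.
  move=> n1; have e0 := en_gt0 R n.
  have h1 : 2 * en R n <= 1.
    rewrite /en ler_pdivrMr ?ltr0n// mul1r ler_nat; lia.
  pose a : Rd := (2 * en R n) *: delta_mx 0 i.
  pose g x := -1 * f x + f (x + a).
  have ng : nice g by apply: nice_lin.
  have [sg ig] := plancherel ng.
  have gE p : fourier g p = (cis (2 * en R n * p 0 i) - 1) * fourier f p.
    rewrite fourier_lin//; last by case: (shift_nice a).
    rewrite fourier_shift// mulrBl mulN1r mul1r addrC; congr (cis _ * _ - _).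
    rewrite innerZl; congr (_ * _); rewrite /inner (bigD1 i)//= mxE !eqxx mul1r big1 ?addr0//.
    by move=> j ji; rewrite mxE (negbTE ji) andbF mul0r.
  have E p : (sin (en R n * p 0 i) / en R n) ^+ 2 * nc (fourier f p) ^+ 2 =
      ((2 * en R n) ^+ 2)^-1 * nc (fourier g p) ^+ 2.
    rewrite gE ncM [(nc _ * nc _) ^+ 2]exprMn (_ : 2 * en R n * p 0 i = en R n * p 0 i + en R n * p 0 i); last by ring.
    rewrite cis_sub1 expr_div_n; field; exact: lt0r_neq0.
  under eq_integral do rewrite E.
  have ii : L1 leb (fun p => ((2 * en R n) ^+ 2)^-1 * nc (fourier g p) ^+ 2).
    by apply: L1Z; case: sg.
  rewrite -[leLHS]fineK ?(integrable_fin_num measurableT ii)// lee_fin -/(Rintegral _ _ _).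
  rewrite RintZ ?ig; last by case: sg.
  have E2 : 0 < (2 * en R n) ^+ 2 by side.
  rewrite mulrC ler_pdivrMr// mulrC -RintZ//.
  apply: le_Rintegral => //.
  - by case: (nice_sqint ng).
  - exact: L1Z.
  - move=> x _; rewrite /g mulN1r addrC; apply: fG => //; side.
have fin : (\int[leb]_p (p 0 i ^+ 2 * nc (fourier f p) ^+ 2)%:E <= (\int[leb]_x G x)%:E)%E.
  apply: (@fatou_bound _ _ _ leb (fun n p => (sin (en R n.+1 * p 0 i) / en R n.+1) ^+ 2 * nc (fourier f p) ^+ 2)).
  - by side.
  - by side.
  - move=> p; apply: cvgMl; rewrite expr2; under eq_fun do rewrite expr2.
    have c := (@sin_quotient_cvg (p 0 i)).
    have c' : (fun n => sin (en R n.+1 * p 0 i) / en R n.+1) @ \oo --> p 0 i.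
      by rewrite (cvg_shiftS (fun n => sin (en R n * p 0 i) / en R n)).
    by apply: cvgM; exact: c'.
  - by move=> n; apply: key.
have mm : mfun (fun p => p 0 i ^+ 2 * nc (fourier f p) ^+ 2) by side.
have I : L1 leb (fun p => p 0 i ^+ 2 * nc (fourier f p) ^+ 2).
  by apply: ge0_L1 (le_lt_trans fin (ltry _)) => // p; side.
split.
  apply: (@sqint_le _ _ _ _ _ (fun p => p 0 i ^+ 2 * nc (fourier f p) ^+ 2)) => //.
    by side.
  by move=> p; rewrite ncM nc_real exprMn real_normK// num_real.
rewrite -lee_fin fineK//; exact: integrable_fin_num I.
Qed.

Lemma continuous_sumr (I : Type) (r : seq I) (P : pred I) (F : I -> Rd -> R) :
  (forall i, continuous (F i)) -> continuous (fun x => \sum_(i <- r | P i) F i x).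
move=> cF; elim: r => [|i r ih].
  by under eq_fun do rewrite big_nil; exact: cst_continuous.
under eq_fun do rewrite big_cons; case: (P i) => //.
exact: contD.
Qed.

Lemma eucl2_coord (x : Rd) i : x 0 i ^+ 2 <= eucl2 x.
by rewrite /eucl2 /inner (bigD1 i)//= -expr2 lerDl sumr_ge0// => j _; rewrite sqr_ge0. Qed.

Lemma Pn1_le (x : Rd) : Pn 1 x <= 2 ^+ d.
rewrite /Pn (_ : 2 ^+ d = \prod_(i < d) 2); last by rewrite prodr_const card_ord.
apply: ler_prod => i _; have p := sqr_ge0 (x 0 i).
have q : 0 < 1 + x 0 i ^+ 2 by rewrite ltr_pwDl.
by rewrite expr1n mulr1 divr_ge0 ?(ltW q)//= ler_pdivrMr// ler_peMr// lerDl.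
Qed.

(** Brings the decay at the intermediate point of the mean value theorem back to x. *)
Lemma weight_shift (x : Rd) i (c : R) : `|c| <= 1 ->
  1 + eucl2 x <= 4 * (1 + eucl2 (c *: delta_mx 0 i + x)).
move=> c1; have e : eucl2 (c *: delta_mx 0 i + x) = c ^+ 2 + 2 * c * x 0 i + eucl2 x.
  rewrite /eucl2 innerDl innerC innerDl [X in _ + X]innerC innerDl innerC !innerZl.
  have i1 y : inner (delta_mx 0 i) y = y 0 i.
    rewrite /inner (bigD1 i)//= mxE !eqxx mul1r big1 ?addr0// => j ji.
    by rewrite mxE (negbTE ji) mul0r.
  by rewrite !i1 !mxE !eqxx /=; ring.
rewrite e; have := eucl2_coord x i; have c2 : c ^+ 2 <= 1.
  by rewrite -(real_normK (num_real c)) expr_le1.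
have := sqr_ge0 (2 * c + x 0 i); rewrite !mulrDr => h1 h2.
have := eucl2_ge0 x; nra.
Qed.

Lemma partial_increment (u : Rd -> R) (i : 'I_d) (M h : R) (x : Rd) : smooth u ->
  (forall y, (1 + eucl2 y) ^+ d * `|partial [:: i] u y| <= M) -> 0 < h -> h <= 1 ->
  `|u (x + h *: delta_mx 0 i) - u x| <= h * (4 ^+ d * M * Pn 1 x).
move=> su hM h0 h1; pose e : Rd := delta_mx 0 i.
have du (t : R) : is_derive t 1 (fun s => u (s *: e + x)) ('D_e u (t *: e + x)).
  by apply: derive_line; have [_] := su [::]; apply.
have cu : {within `[0, h], continuous (fun s => u (s *: e + x))}.
  by apply: continuous_subspaceT => t; exact: der_continuous (du t).
have [c] := MVT h0 (fun t _ => du t) cu; rewrite /= scale0r add0r subr0 => /andP[c0 ch]; rewrite [x + _]addrC -/e => ->.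
rewrite normrM mulrC (gtr0_norm h0) (ler_pM2l h0).
have c1 : `|c| <= 1 by rewrite gtr0_norm// (ltW (lt_le_trans ch h1)).
have := hM (c *: e + x); rewrite [partial _ _ _]/=; set D := `| _ | => hD.
have D0 : 0 <= D by rewrite /D.
have hx : (1 + eucl2 x) ^+ d <= 4 ^+ d * (1 + eucl2 (c *: e + x)) ^+ d.
  by rewrite -exprMn lerXn2r ?nnegrE ?mulr_ge0 ?addr_ge0 ?eucl2_ge0//; exact: weight_shift.
apply: (@le_trans _ _ (D * ((1 + eucl2 x) ^+ d * Pn 1 x))); first by rewrite ler_peMr// Pn1_weight.
rewrite mulrA ler_wpM2r ?Pn_ge0//; apply: (@le_trans _ _ (D * (4 ^+ d * (1 + eucl2 (c *: e + x)) ^+ d))).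
  by rewrite ler_wpM2l.
by rewrite mulrCA ler_wpM2l// mulrC.
Qed.

(** The H^1 norm is controlled, linearly in M, by Schwartz seminorms with at most one derivative.
    This is the continuity that makes the distributions built from X tempered. *)
Lemma schwartz_sobolev : exists2 C : R, 0 <= C & forall f M, schwartz f ->
  (forall s x, (size s <= 1)%N -> schwartz_weight d s f x <= M) ->
  L1 leb (fun p => (1 + eucl2 p) * nc (fourier f p) ^+ 2) /\
  \int[leb]_p ((1 + eucl2 p) * nc (fourier f p) ^+ 2) <= C * M ^+ 2.
have [PI PE] := Pn1_int R d.
have P0 x : 0 <= Pn 1 x by exact: Pn_ge0.
pose K : R := 2 * 16 ^+ d * 2 ^+ d * (2 * pi) ^+ d.
have K0 : 0 <= K by rewrite !mulr_ge0 ?exprn_ge0 ?mulr_ge0 ?pi_ge0.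
exists (K + d%:R * K) => [|f M sf hM]; first by side.
have nf := schwartz_nice sf; have [cR cI _ fi] := nf; have [[sR sI] _] := sf.
have [sF eF] := plancherel nf.
have W0 (y : Rd) : 0 < (1 + eucl2 y) ^+ d by rewrite exprn_gt0// ltr_pwDl// eucl2_ge0.
have M0 : 0 <= M.
  apply: le_trans (hM [::] 0 _) => //; rewrite /schwartz_weight mulr_ge0 ?nc_ge0//.
  by side.
have g0 x : nc (f x) <= M * Pn 1 x.
  have := hM [::] x isT; rewrite /schwartz_weight /cpartial /= => h.
  have h' : (1 + eucl2 x) ^+ d * nc (f x) <= M by move: h; case: (f x).
  apply: (@le_trans _ _ (nc (f x) * ((1 + eucl2 x) ^+ d * Pn 1 x))); first by rewrite ler_peMr ?nc_ge0// Pn1_weight.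
  by rewrite mulrA ler_wpM2r// mulrC.
pose G x := M ^+ 2 * (2 * 16 ^+ d * 2 ^+ d) * Pn 1 x.
have GI : L1 leb G by exact: L1Z.
have GE : \int[leb]_x G x = K * M ^+ 2.
  by rewrite RintZ// PE /K; ring.
have P2 x : Pn 1 x ^+ 2 <= 2 ^+ d * Pn 1 x by rewrite expr2 ler_wpM2r// Pn1_le.
have one16 : 1 <= 16 ^+ d :> R by rewrite exprn_ege1// ler1n.
have e0 : \int[leb]_p nc (fourier f p) ^+ 2 <= K * M ^+ 2.
  rewrite eF -GE; apply: le_Rintegral => //; first by case: (nice_sqint nf).
  move=> x _; apply: (@le_trans _ _ ((M * Pn 1 x) ^+ 2)).
    by rewrite lerXn2r ?nnegrE ?nc_ge0// (le_trans (nc_ge0 _) (g0 x)).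
  rewrite exprMn /G -mulrA ler_wpM2l ?sqr_ge0//; apply: le_trans (P2 x) _.
  by rewrite ler_wpM2r// ler_peMl ?exprn_ge0//; nra.
have ei i := @fourier_coord_sqint f G i nf GI.
have {}ei i : sqint leb (fun p => (p 0 i)%:C * fourier f p) /\
  \int[leb]_p (p 0 i ^+ 2 * nc (fourier f p) ^+ 2) <= K * M ^+ 2.
  rewrite -GE; apply: ei => h x h0 h1.
  have b (u : Rd -> R) : smooth u -> (forall y, (1 + eucl2 y) ^+ d * `|partial [:: i] u y| <= M) ->
      (u (x + h *: delta_mx 0 i) - u x) ^+ 2 <= h ^+ 2 * (16 ^+ d * M ^+ 2 * (2 ^+ d * Pn 1 x)).
    move=> su hu; have := partial_increment x su hu h0 h1 => hb.
    rewrite -(real_normK (num_real (u _ - _))); apply: (@le_trans _ _ ((h * (4 ^+ d * M * Pn 1 x)) ^+ 2)).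
      by rewrite lerXn2r ?nnegrE// (le_trans _ hb).
    rewrite !exprMn ler_wpM2l ?sqr_ge0// -exprM mulnC exprM (_ : 4 ^+ 2 = 16); last by ring.
    by rewrite ler_wpM2l// mulr_ge0 ?sqr_ge0// exprn_ge0.
  have bR : (Re (f (x + h *: delta_mx 0 i)) - Re (f x)) ^+ 2 <= h ^+ 2 * (16 ^+ d * M ^+ 2 * (2 ^+ d * Pn 1 x)).
    apply: (b (Re \o f)) => // y; apply: le_trans (hM [:: i] y isT).
    by rewrite /schwartz_weight ler_wpM2l ?(ltW (W0 _))//; exact: nc_Re (cpartial [:: i] f y).
  have bI : (Im (f (x + h *: delta_mx 0 i)) - Im (f x)) ^+ 2 <= h ^+ 2 * (16 ^+ d * M ^+ 2 * (2 ^+ d * Pn 1 x)).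
    apply: (b (Im \o f)) => // y; apply: le_trans (hM [:: i] y isT).
    by rewrite /schwartz_weight ler_wpM2l ?(ltW (W0 _))//; exact: nc_Im (cpartial [:: i] f y).
  rewrite sqr_nc !ReD !ImD !ReN !ImN /G; apply: le_trans (lerD bR bI) _.
  apply/eqW; ring.
have i0 : L1 leb (fun p => nc (fourier f p) ^+ 2) by case: sF.
have ii i : L1 leb (fun p => p 0 i ^+ 2 * nc (fourier f p) ^+ 2).
  have [[_ h] _] := ei i; apply: eq_integrable h => // p _; rewrite /comp; congr EFin.
  by rewrite ncM nc_real exprMn real_normK// num_real.
have [TI TE] := Rintegral_sumR (index_enum 'I_d) ii.
have E : (fun p => (1 + eucl2 p) * nc (fourier f p) ^+ 2) =
    (fun p => nc (fourier f p) ^+ 2 + \sum_(i < d) p 0 i ^+ 2 * nc (fourier f p) ^+ 2).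
  by apply/funext => p; rewrite mulrDl mul1r -mulr_suml.
rewrite E; split; first exact: L1D i0 TI.
rewrite RintegralD// mulrDl -mulrA lerD// TE; apply: (le_trans (ler_sum _ (fun i _ => (ei i).2))).
by rewrite sumr_const card_ord mulr_natl.
Qed.

Lemma partial_zero (u : Rd -> R) s (x : Rd) : ~ closure [set y | u y != 0] x -> partial s u x = 0.
move=> hx; have op : open (~` closure [set y | u y != 0]) by apply: closed_openC; exact: closed_closure.
elim: s x hx => [|i s ih] x hx.
  by apply/eqP/negPn/negP => h; exact/hx/subset_closure.
rewrite [LHS]/=.
have h : {near x, partial s u =1 (fun=> 0)} by near=> y; apply: ih; near: y; exact: open_nbhs_nbhs.
by rewrite (near_eq_derive _ h) derive_cst.
Unshelve. all: by end_near.
Qed.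

Lemma test_schwartz (u : Rd -> R) : test_function u -> schwartz (fun x => (u x)%:C).
move=> [su cu _]; split; first by split; [exact: su|exact: smooth0].
move=> n s; pose K := closure [set y | u y != 0].
have cE x : cpartial s (fun x => (u x)%:C) x = (partial s u x)%:C.
  by rewrite /cpartial; congr Complex; exact: (congr1 (fun h : Rd -> R => h x) (partial0 R s)).
pose g x := (1 + eucl2 x) ^+ n * `|partial s u x|.
have cg : continuous g.
  apply: contM; last by move=> x; apply: continuous_comp; [exact: (su s).1|exact: norm_continuous].
  have ce : continuous (fun x => 1 + eucl2 x).
    apply: contD; first side.
    apply: (@continuous_sumr 'I_d (index_enum _) xpredT (fun i y => y 0 i * y 0 i)) => i.
    by side.
  elim: n {g} => [|n ih]; first by under eq_fun do rewrite expr0; exact: cst_continuous.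
  by under eq_fun do rewrite exprS; exact: contM.
have [C hC] : exists C : R, forall x, K x -> g x <= C.
  have [M [_ hM]] := compact_bounded (continuous_compact (continuous_subspaceT cg) cu).
  exists (M + 1) => x Kx; apply: le_trans (ler_norm _) _.
  by apply: (hM (M + 1)); [rewrite ltrDl|exists x].
exists (Num.max 0 C) => x; rewrite /schwartz_weight [cpartial _ _ _]cE nc_real.
have [/hC h|/partial_zero ->] := pselect (K x); first by rewrite le_max h orbT.
by rewrite normr0 mulr0 le_max lexx.
Qed.

End regularity.

#[local] Opaque fourier.

(** * The multipliers omega_m and their square roots *)

Section omega.
Context (R : realType) (d : nat).
Local Notation Rd := 'rV[R]_d.
Implicit Types (m : R) (p : Rd).

Definition omega m p : R := Num.sqrt (m ^+ 2 + eucl2 p).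
Definition omegaq m p : R := Num.sqrt (omega m p).

Lemma omega_arg_ge0 m p : 0 <= m ^+ 2 + eucl2 p.
by rewrite addr_ge0 ?sqr_ge0 ?eucl2_ge0. Qed.

Lemma omega_ge0 m p : 0 <= omega m p. exact: sqrtr_ge0. Qed.

Lemma omegaq_ge0 m p : 0 <= omegaq m p. exact: sqrtr_ge0. Qed.

Lemma omega_sqr m p : omega m p ^+ 2 = m ^+ 2 + eucl2 p.
by rewrite sqr_sqrtr// omega_arg_ge0. Qed.

Lemma omegaq_sqr m p : omegaq m p ^+ 2 = omega m p.
by rewrite sqr_sqrtr// omega_ge0. Qed.

Lemma powR_omegaq m p : (m ^+ 2 + eucl2 p) `^ (2^-1 / 2) = omegaq m p.
by rewrite powRrM !powR12_sqrt// ?omega_arg_ge0//. Qed.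

Lemma powR_omegaqN m p : (m ^+ 2 + eucl2 p) `^ (- 2^-1 / 2) = (omegaq m p)^-1.
by rewrite mulNr powRN powR_omegaq. Qed.

Lemma eucl2N p : eucl2 (- p) = eucl2 p.
by rewrite /eucl2 innerNl innerC innerNl opprK. Qed.

Lemma omegaN m p : omega m (- p) = omega m p.
by rewrite /omega eucl2N. Qed.

Lemma omegaqN m p : omegaq m (- p) = omegaq m p.
by rewrite /omegaq omegaN. Qed.

Lemma mfun_eucl2 : mfun (@eucl2 R d).
apply: continuous_measurable_rV.
apply: (@continuous_sumr R d 'I_d (index_enum _) xpredT (fun i y => y 0 i * y 0 i)) => i.
by side.
Qed.

Lemma mfun_omega m : mfun (omega m).
apply: (measurableT_comp (f := @Num.sqrt R)); first by apply: continuous_measurable_fun; exact: sqrt_continuous.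
by apply: measurable_funD => //; exact: mfun_eucl2.
Qed.

Lemma mfun_omegaq m : mfun (omegaq m).
apply: (measurableT_comp (f := @Num.sqrt R)); first by apply: continuous_measurable_fun; exact: sqrt_continuous.
exact: mfun_omega.
Qed.

Lemma omega1_ge1 p : 1 <= omega 1 p.
by rewrite -[leLHS]sqrtr1 ler_wsqrtr// expr1n lerDl eucl2_ge0. Qed.

Lemma omegaq1_ge1 p : 1 <= omegaq 1 p.
by rewrite -[leLHS]sqrtr1 ler_wsqrtr// omega1_ge1. Qed.

Lemma omegaq1_le p : omegaq 1 p <= omega 1 p.
by rewrite -omegaq_sqr ler_peMl ?omegaq_ge0 ?omegaq1_ge1. Qed.

Lemma omega1_le p : omega 1 p <= 1 + eucl2 p.
by have := omega_sqr 1 p; rewrite expr1n => <-; rewrite ler_peMl ?omega_ge0 ?omega1_ge1. Qed.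

End omega.

Ltac side_leaf14 := match goal with
  | _ => side_leaf12
  | |- is_true (0 <= eucl2 _) => exact: eucl2_ge0
  | |- is_true (0 <= omega _ _) => exact: omega_ge0
  | |- is_true (0 <= omegaq _ _) => exact: omegaq_ge0
  | |- measurable_fun _ (omega _) => exact: mfun_omega
  | |- measurable_fun _ (fun _ => omega _ _) => exact: mfun_omega
  | |- measurable_fun _ (omegaq _) => exact: mfun_omegaq
  | |- measurable_fun _ (fun _ => omegaq _ _) => exact: mfun_omegaq
  | |- measurable_fun _ (fun _ => eucl2 _) => exact: mfun_eucl2
  end.
Ltac side_leaf ::= side_leaf14.

(** * Closures of subspaces *)

Section closures.
Context (R : realType) (V : lmodType R[i]) (dot : V -> V -> R[i]).
Hypothesis H : hilbert dot.
Let ip : semi_inner dot. by case: H. Qed.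

Lemma closure_subspace (M : set V) : subspace M -> subspace (closure_of dot M).
move=> [M0 Ml]; split; first by exists (fun=> 0); split => //; exact: tends_cst.
move=> a x y [u [Mu ux]] [v [Mv vy]]; exists (fun n => a *: u n + v n); split => [n|]; first exact: Ml.
by apply: tendsD => //; exact: tendsZ.
Qed.

Lemma closure_closed (M : set V) : closed_for dot (closure_of dot M).
move=> u x Mu ux; apply: (closure_of_approx H) => e e0.
have e4 : 0 < e / 4 by side.
have [N hN] := ux _ e4; have [v [Mv vu]] := Mu N; have [K hK] := vu _ e4.
exists (v K); split => //; rewrite (_ : x - v K = (x - u N) + (u N - v K)); last by rewrite addrA subrK.
apply: (le_lt_trans (sqnormD_le ip _ _)).
have h1 := hN _ (leqnn N); have h2 := hK _ (leqnn K).
rewrite (sqnormBC ip) in h1; rewrite (sqnormBC ip) in h2.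
set A := sqnorm _ _ in h1 *; set B := sqnorm _ _ in h2 *; lra.
Qed.

Lemma closure_incl (M : set V) x : M x -> closure_of dot M x.
by move=> Mx; exists (fun=> x); split => //; exact: tends_cst. Qed.

Lemma closure_mono (M N : set V) (T : V -> V) : (forall u x, tends dot u x -> tends dot (T \o u) (T x)) ->
  (forall x, M x -> closure_of dot N (T x)) -> forall x, closure_of dot M x -> closure_of dot N (T x).
move=> Tt MN x [u [Mu ux]]; apply: (closure_closed (u := T \o u)); first by move=> n; exact: MN.
exact: Tt.
Qed.

End closures.

(** * Real Sobolev spaces of the ball in Fourier representation *)

Section sobolev_space.
Context (R : realType) (d : nat).
Local Notation Rd := 'rV[R]_d.
Local Notation leb := (leb R d).
Local Notation Hs := (Hspace R d).
Local Notation dot := (@Hdot R d).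
Implicit Types (f g : Rd -> R[i]) (x p : Rd) (u v a : Hs).

Let ip : semi_inner dot. by case: (Hdot_hilbert R d). Qed.

Definition testC f := test_function (Re \o f : Rd -> R) /\ test_function (Im \o f : Rd -> R).

(** Complex conjugation of functions seen on the Fourier side; its fixed points are the transforms
    of real objects. *)
Definition star u : Hs := Hrefl (Hconj u).

Lemma star_lin (c : R[i]) u v : star (c *: u + v) = c^* *: star u + star v.
by rewrite /star Hconj_lin Hrefl_lin. Qed.

Lemma starK u : star (star u) = u.
by rewrite /star Hconj_refl HreflK HconjK. Qed.

Lemma tends_star (u_ : nat -> Hs) u : tends dot u_ u -> tends dot (star \o u_) (star u).
move=> h; apply: (tends_isom (U := @Hrefl R d) (u_ := fun n => Hconj (u_ n))).
- exact: Hrefl_lin.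
- exact: Hrefl_sqnorm.
- exact: tends_Hconj.
Qed.

Lemma star_ae u : {ae leb, forall p, repr (star u) p = (repr u (- p))^*}.
have h2 := ae_refl (Hconj_ae u).
by apply: filterS2 (Hrefl_ae (Hconj u)) h2 => p -> ->.
Qed.

Lemma smooth_linear (k : R) (f g : Rd -> R) : smooth f -> smooth g ->
  smooth (fun x => k * f x + g x) /\
  forall s x, partial s (fun x => k * f x + g x) x = k * partial s f x + partial s g x.
move=> sf sg.
have E s : partial s (fun x => k * f x + g x) = (fun x => k * partial s f x + partial s g x).
  elim: s => //= i s ->; apply/funext => x.
  have df : is_derive x (delta_mx 0 i) (partial s f) ('D_(delta_mx 0 i) (partial s f) x).
    by apply/derivableP; exact: (sf s).2.
  have dg : is_derive x (delta_mx 0 i) (partial s g) ('D_(delta_mx 0 i) (partial s g) x).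
    by apply/derivableP; exact: (sg s).2.
  have := derD (derZ k df) dg; case=> _; exact.
split => [s|s x]; last by rewrite E.
rewrite E; split; first by apply: contD; [apply: contZ|]; [exact: (sf s).1|exact: (sg s).1].
move=> i x.
have df : is_derive x (delta_mx 0 i) (partial s f) ('D_(delta_mx 0 i) (partial s f) x).
  by apply/derivableP; exact: (sf s).2.
have dg : is_derive x (delta_mx 0 i) (partial s g) ('D_(delta_mx 0 i) (partial s g) x).
  by apply/derivableP; exact: (sg s).2.
by [].
Qed.

Lemma test_linear (k : R) (f g : Rd -> R) : test_function f -> test_function g ->
  test_function (fun x => k * f x + g x).
move=> [sf cf Bf] [sg cg Bg].
have sub : closure [set x | k * f x + g x != 0] `<=` closure [set x | f x != 0] `|` closure [set x | g x != 0].
  rewrite -closureU; apply: closure_subset => x /= h.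
  have [f0|f0] := eqVneq (f x) 0; last by left.
  by right; move: h; rewrite f0 mulr0 add0r.
split; first exact: (smooth_linear k sf sg).1.
  apply: subclosed_compact sub; [exact: closed_closure|exact: compactU].
by move=> x /sub[/Bf|/Bg].
Qed.

Lemma test0 : test_function (fun _ : Rd => 0 : R).
have E : [set x : Rd | (0 : R) != 0] = set0 by apply/seteqP; split => x //=; rewrite eqxx.
by split; rewrite ?E ?closure0//; [exact: smooth0|exact: compact0].
Qed.

Lemma testC_lin (k : R[i]) f g : testC f -> testC g -> testC (fun x => k * f x + g x).
move=> [fR fI] [gR gI]; split.
- have := test_linear (Re k) fR (test_linear (- Im k) fI gR); congr test_function.
  by apply/funext => x /=; rewrite ReD ReM mulNr addrA.
- have := test_linear (Re k) fI (test_linear (Im k) fR gI); congr test_function.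
  by apply/funext => x /=; rewrite ImD ImM addrA.
Qed.

Lemma testC_real (f : Rd -> R) : test_function f -> testC (fun x => (f x)%:C).
by move=> tf; split => //; exact: test0. Qed.

Lemma testC_conj f : testC f -> testC (fun x => (f x)^*).
move=> [fR fI]; split.
- by move: fR; congr test_function; apply/funext => x /=; rewrite ReJ.
- have := test_linear (-1) fI test0; congr test_function.
  by apply/funext => x /=; rewrite ImJ addr0 mulN1r.
Qed.

Lemma testC_schwartz f : testC f -> schwartz f.
move=> [fR fI]; split; first by split; [case: fR|case: fI].
have [_ bR] := test_schwartz fR; have [_ bI] := test_schwartz fI.
move=> k s; have [C hC] := bR k s; have [D hD] := bI k s; exists (C + D) => x.
have := hC x; have := hD x; rewrite /schwartz_weight.
have cE (u : Rd -> R) : cpartial s (fun x => (u x)%:C) x = (partial s u x)%:C.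
  by rewrite /cpartial; congr Complex; exact: (congr1 (fun h : Rd -> R => h x) (partial0 R s)).
rewrite !cE !nc_real => h1 h2; apply: le_trans (lerD h2 h1).
rewrite -mulrDr ler_wpM2l ?exprn_ge0 ?addr_ge0 ?eucl2_ge0//; exact: nc_le_ReIm (cpartial s f x).
Qed.

Lemma schwartz_weight_sqint f : schwartz f -> sqint leb (fun p => (1 + eucl2 p)%:C * f p).
move=> sf; have [_ bf] := sf; have [C hC] := bf d.+1 [::]; have [PI _] := Pn1_int R d.
apply: (@sqint_le _ _ _ _ _ (fun x => C ^+ 2 * 2 ^+ d * Pn 1 x)).
- apply: cmeasM; last by case: (nice_sqint (schwartz_nice sf)).
  by apply/cmeas_real/measurable_funD => //; exact: mfun_eucl2.
- move=> x; have := hC x; rewrite /schwartz_weight (_ : cpartial [::] f x = f x); last first.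
    by rewrite /cpartial /=; case: (f x).
  rewrite exprSr -mulrA => h.
  have B0 : 0 <= 1 + eucl2 x by side.
  have h' : (1 + eucl2 x) * nc (f x) <= C * Pn 1 x.
    have W0 : 0 < (1 + eucl2 x) ^+ d by side.
    rewrite -(ler_pM2l W0); apply: (le_trans h); rewrite mulrCA ler_peMr ?Pn1_weight//.
    by apply: le_trans h; side.
  rewrite ncM nc_real (ger0_norm B0); apply: (@le_trans _ _ ((C * Pn 1 x) ^+ 2)).
    have g0 := mulr_ge0 B0 (nc_ge0 (f x)).
    by rewrite lerXn2r//; exact: le_trans h'.
  by rewrite exprMn -[leRHS]mulrA ler_wpM2l ?sqr_ge0// ler_wpM2r ?Pn1_le ?Pn_ge0.
- exact: L1Z.
Qed.

Section weight.
(** Treats the orders 1/2 and -1/2 at once: w is the multiplier (1 + |p|^2)^(s/2), and the estimates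
    rest on w and 1/w being at most omega_1. *)
Variables (s : R) (w : Rd -> R).
Hypothesis mw : mfun w.
Hypothesis mwV' : mfun (fun p => (w p)^-1).
Hypothesis wN : forall p, w (- p) = w p.
Hypothesis w0 : forall p, 0 < w p.
Hypothesis w_le : forall p, w p <= omega 1 p.
Hypothesis wV_le : forall p, (w p)^-1 <= omega 1 p.
Hypothesis ws : forall p, (1 + eucl2 p) `^ s = w p ^+ 2.

Definition wF f : Hs := L2_of leb (fun p => (w p)%:C * fourier f p).

(** The complexification of H^s_R(B), carried isometrically into L^2 by f |-> w f^; its real form is
    the fixed set of [star]. *)
Definition Xset : set Hs := closure_of dot [set wF f | f in testC].

Lemma w_schwartz (h : Rd -> R) f : mfun h -> (forall p, 0 <= h p) ->
  (forall p, h p <= omega 1 p) -> schwartz f -> sqint leb (fun p => (h p)%:C * fourier f p).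
move=> mh h0 h_le sf; have [C _ hC] := schwartz_sobolev R d; have [_ bf] := sf.
have [_ _ _ fi] := (schwartz_nice sf).
have [M hM] : exists M, forall t x, (size t <= 1)%N -> schwartz_weight d t f x <= M.
  have [B hB] := choice (bf d).
  exists (`|B [::]| + \sum_(i < d) `|B [:: i]|) => t x ht.
  apply: (le_trans (hB t x)); apply: (le_trans (ler_norm _)).
  case: t ht => [|i [|]]//= _; first by rewrite lerDl sumr_ge0.
  by rewrite (bigD1 i)//= addrCA lerDl addr_ge0// sumr_ge0.
have [I _] := hC f M sf hM.
apply: (@sqint_le _ _ _ _ _ (fun p => (1 + eucl2 p) * nc (fourier f p) ^+ 2)) => //.
- by side.
- move=> p; rewrite ncM nc_real exprMn ger0_norm// ler_wpM2r ?sqr_ge0//.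
  have := omega_sqr 1 p; rewrite expr1n => <-.
  by rewrite lerXn2r ?nnegrE//// omega_ge0.
Qed.

Lemma wF_sqint f : schwartz f -> sqint leb (fun p => (w p)%:C * fourier f p).
by apply: w_schwartz => // p; side. Qed.

Lemma wV_sqint f : schwartz f -> sqint leb (fun p => (w p)^-1%:C * fourier f p).
by apply: w_schwartz => // p; side.
Qed.

Lemma wF_lin (k : R[i]) f g : schwartz f -> schwartz g ->
  wF (fun x => k * f x + g x) = k *: wF f + wF g.
move=> sf sg; rewrite /wF -L2_of_lin; [|exact: wF_sqint|exact: wF_sqint].
congr L2_of; apply/funext => p; have [_ _ _ fi] := schwartz_nice sf; have [_ _ _ gi] := schwartz_nice sg.
by rewrite fourier_lin//; ring.
Qed.

Lemma wF0 : wF (fun=> 0) = 0.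
have s0 := testC_schwartz (testC_real test0).
have := wF_lin (-1) s0 s0; rewrite scaleN1r addNr => <-; congr wF.
by apply/funext => x; rewrite mulr0 addr0.
Qed.

Lemma wFZ (k : R[i]) f : schwartz f -> wF (fun x => k * f x) = k *: wF f.
move=> sf; rewrite -[RHS]addr0 -wF0 -(wF_lin _ sf (testC_schwartz (testC_real test0))).
by congr wF; apply/funext => x; rewrite addr0.
Qed.

Lemma Xset_subspace : subspace Xset.
apply: closure_subspace => //; first exact: Hdot_hilbert.
split.
  by exists (fun=> 0); [exact: testC_real test0|exact: wF0].
move=> k _ _ [f tf <-] [g tg <-]; exists (fun x => k * f x + g x); first exact: testC_lin.
by rewrite wF_lin//; exact: testC_schwartz.
Qed.

Lemma Xset_closed : closed_for dot Xset.
exact/closure_closed/Hdot_hilbert. Qed.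

Lemma star_wF f : testC f -> star (wF f) = wF (fun x => (f x)^*).
move=> tf; have sf := testC_schwartz tf; have [_ _ _ fi] := schwartz_nice sf.
have sc := testC_schwartz (testC_conj tf).
apply/esym/L2_of_eq; first exact: wF_sqint.
have h2 := ae_refl (L2_of_ae (wF_sqint sf)).
apply: filterS2 (star_ae (wF f)) h2 => p -> ->; rewrite fourier_conj// conjcM cconj_real wN.
by [].
Qed.

Lemma Xset_star a : Xset a -> Xset (star a).
apply: (closure_mono (Hdot_hilbert R d)); first exact: tends_star.
move=> _ [f tf <-]; rewrite star_wF//; apply: closure_incl; first exact: Hdot_hilbert.
by exists (fun x => (f x)^*) => //; exact: testC_conj.
Qed.

(** The real projection (1 + star)/2 is continuous and maps w f^ to w (Re f)^, so it turns an
    approximating sequence into one from real test functions. *)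
Lemma Xset_real a : Xset a -> star a = a ->
  closure_of dot [set wF (fun x => (f x)%:C) | f in @test_function R d] a.
move=> Xa sa; pose T v := (2^-1 : R)%:C *: (v + star v).
have Ta : T a = a.
  rewrite /T [star a]sa scalerDr -scalerDl -rmorphD (_ : 2^-1 + 2^-1 = 1) ?scale1r//.
  by field.
rewrite -[X in closure_of _ _ X]Ta; apply: (closure_mono (Hdot_hilbert R d)) Xa => //.
  by move=> u v h; apply: tendsZ => //; apply: tendsD => //; exact: tends_star.
move=> _ [f tf <-]; apply: closure_incl; first exact: Hdot_hilbert.
exists (Re \o f); first by case: tf.
have s2 := testC_schwartz (testC_conj tf).
rewrite /T star_wF// scalerDr -(wFZ _ (testC_schwartz tf)) addrC -wF_lin//; last first.
  by move: (testC_schwartz (testC_lin (2^-1)%:C tf (testC_real test0))); under eq_fun do rewrite addr0.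
congr wF; apply/funext => x; apply: complex_eqP => /=.
  by rewrite ReD !ReZ ReJ -mulrDl; field.
by rewrite ImD !ImZ ImJ; ring.
Qed.

Lemma sobolev_sqnormE (v : Rd -> R[i]) :
  sobolev_sqnorm s v = (\int[leb]_p (nc ((w p)%:C * v p) ^+ 2)%:E)%E.
apply: eq_integral => p _; rewrite ws ncM nc_real exprMn real_normK//.
exact: num_real.
Qed.

(** The distribution with Fourier transform a / w: this function is paired with the inverse
    transform of the argument. *)
Definition dist_of a : distribution R d :=
  fun phi => cint leb (fun p => repr a p * (w p)^-1%:C * repr (Uinv (L2_of leb phi)) p).

Let mr a : cmeas (repr a). by case: (repr_sqint a). Qed.

Let mwV : mfun (fun p => (w p)^-1).
exact: mwV'. Qed.

Let mU phi : cmeas (repr (Uinv (L2_of leb phi))). exact: mr. Qed.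

Lemma dist_of_schwartz a phi : schwartz phi ->
  sqint leb (fun p => (w p)^-1%:C * fourier phi (- p)) /\
  dist_of a phi = cint leb (fun p => repr a p * ((w p)^-1%:C * fourier phi (- p))).
move=> sp; have nf := schwartz_nice sp; have sV := wV_sqint sp.
have sN : sqint leb (fun p => (w p)^-1%:C * fourier phi (- p)).
  by have := sqint_refl sV; under eq_fun do rewrite wN.
split => //; apply: ae_eq_cint.
- by side.
- by side.
- have := Hrefl_ae (L2_of leb (fourier phi)); rewrite -Fou_nice// Fou_refl -/(Uinv _).
  have [sF _] := plancherel nf; have := ae_refl (L2_of_ae sF); rewrite -Fou_nice//.
  by apply: filterS2 => p h1 h2; rewrite h2 h1 mulrA.
Qed.

Lemma dist_of_fourier a f : schwartz f -> cL1 leb (fun p => repr a p * (w p)^-1%:C * f p) /\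
   dist_of a (fourier f) = cint leb (fun p => repr a p * (w p)^-1%:C * f p).
move=> sf; have nf := schwartz_nice sf.
have sV : sqint leb (fun p => (w p)^-1%:C * f p).
  have [mf If] := schwartz_weight_sqint sf.
  apply: sqint_le If => [|p].
    by apply: cmeasM; [side|case: (nice_sqint nf)].
  rewrite !ncM !exprMn ler_wpM2r ?sqr_ge0// !nc_real !ger0_norm ?invr_ge0 ?(ltW (w0 _)) ?addr_ge0 ?eucl2_ge0//.
  rewrite lerXn2r ?nnegrE ?invr_ge0 ?(ltW (w0 _)) ?addr_ge0 ?eucl2_ge0//.
  exact: le_trans (wV_le p) (omega1_le p).
split.
  by apply: eq_cintegrable (sqint_mul (repr_sqint a) sV) _ => p; rewrite mulrA.
apply: ae_eq_cint.
- by side.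
- by apply: cmeasM; [side|case: (nice_sqint nf)].
- rewrite -(Fou_nice nf) FouK.
  by apply: filterS (L2_of_ae (nice_sqint nf)) => p ->.
Qed.

Lemma dist_of_le a phi (C : R) : schwartz phi ->
  \int[leb]_p ((1 + eucl2 p) * nc (fourier phi p) ^+ 2) <= C ->
  L1 leb (fun p => (1 + eucl2 p) * nc (fourier phi p) ^+ 2) ->
  nc (dist_of a phi) ^+ 2 <= sqnorm dot a * C.
move=> sp hC I; have [sN ->] := dist_of_schwartz a sp.
have -> : cint leb (fun p => repr a p * ((w p)^-1%:C * fourier phi (- p))) =
   dot (Hconj a) (L2_of leb (fun p => (w p)^-1%:C * fourier phi (- p))).
  rewrite /Hdot (@L2_dotE _ _ _ _ _ _ (fun p => (repr a p)^*) (fun p => (w p)^-1%:C * fourier phi (- p))).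
  - by apply: eq_cint => p; rewrite cconjK.
  - by side.
  - by case: sN.
  - exact: Hconj_ae.
  - exact: L2_of_ae.
apply: le_trans (cauchy_schwarz ip _ _) _; rewrite Hconj_sqnorm ler_wpM2l ?(sqnorm_ge0 ip)//.
have sV := wV_sqint sp.
have -> : L2_of leb (fun p => (w p)^-1%:C * fourier phi (- p)) = Hrefl (L2_of leb (fun p => (w p)^-1%:C * fourier phi p)).
  apply: L2_of_eq => //; have := Hrefl_ae (L2_of leb (fun p => (w p)^-1%:C * fourier phi p)).
  by have := ae_refl (L2_of_ae sV); apply: filterS2 => p -> ->; rewrite wN.
rewrite Hrefl_sqnorm (sqnorm_L2 sV.1 (L2_of_ae sV)); apply: le_trans hC.
apply: le_Rintegral => //; first by case: sV.
move=> p _; rewrite ncM exprMn ler_wpM2r ?sqr_ge0// nc_real ger0_norm ?invr_ge0 ?(ltW (w0 _))//.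
have := omega_sqr 1 p; rewrite expr1n => <-.
by rewrite lerXn2r ?nnegrE ?invr_ge0 ?omega_ge0 ?(ltW (w0 _)).
Qed.

Lemma cint_star_real a (G : Rd -> R[i]) : star a = a -> cL1 leb (fun p => repr a p * G p) ->
  (forall p, G (- p) = (G p)^*) -> Im (cint leb (fun p => repr a p * G p)) = 0.
move=> sa FI GN; have [I2 E2] := cint_refl FI.
have h : (cint leb (fun p => repr a p * G p))^* = cint leb (fun p => repr a p * G p).
  rewrite -E2 -cint_conj//; apply/esym; rewrite E2; apply: ae_eq_cint.
  - by side.
  - by side.
  - by have := star_ae a; rewrite sa; apply: filterS => p ->; rewrite conjcM GN cconjK.
have := congr1 (fun z : R[i] => Im z) h; rewrite ImJ => /eqP.
by rewrite eq_sym -addr_eq0 -mulr2n mulrn_eq0 /= => /eqP.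
Qed.

Lemma dist_of_real a : star a = a -> real_distribution (dist_of a).
move=> sa phi sp rp; have [_ _ _ fi] := (schwartz_nice sp).
have [sN ->] := dist_of_schwartz a sp.
apply: cint_star_real => //; first exact: sqint_mul (repr_sqint a) sN.
have ee : (fun x => (phi x)^*) = phi.
  by apply/funext => x; apply: complex_eqP; rewrite ?ReJ ?ImJ ?rp ?oppr0.
move=> p; have := fourier_conj (- p) fi; rewrite ee => e.
by rewrite conjcM cconj_real wN e cconjK.
Qed.

Lemma tempered_dist_of a : tempered (dist_of a).
split.
  move=> k f g sf sg; have ng := schwartz_nice sg.
  have Ff := nice_sqint (schwartz_nice sf); have Fg := nice_sqint ng.
  have [iA _] := sqint_refl Ff.
  have si phi : schwartz phi -> cL1 leb (fun p => repr a p * (w p)^-1%:C * repr (Uinv (L2_of leb phi)) p).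
    move=> sp; have [sN _] := dist_of_schwartz a sp; have np := schwartz_nice sp.
    have I := sqint_mul (repr_sqint a) sN; apply: ae_cintegrable I.
      by side.
    have := Hrefl_ae (L2_of leb (fourier phi)); rewrite -Fou_nice// Fou_refl -/(Uinv _).
    have [sF _] := plancherel np; have := ae_refl (L2_of_ae sF); rewrite -Fou_nice//.
    by apply: filterS2 => p h1 h2; rewrite h2 h1 mulrA.
  rewrite /dist_of; have -> : L2_of leb (k *: f + g) = k *: L2_of leb f + L2_of leb g by rewrite -L2_of_lin.
  rewrite Uinv_lin -cintZ; last exact: si.
  rewrite -cintD; [|exact/cL1Z/si|exact: si].
  apply: ae_eq_cint.
  - by side.
  - by side.
  - by apply: filterS (repr_lin k (Uinv (L2_of leb f)) (Uinv (L2_of leb g))) => p ->; ring.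
have [C C0 hC] := schwartz_sobolev R d.
exists d, 1%N, (Num.sqrt (sqnorm dot a * C)) => f M sf hM.
have M0 : 0 <= M.
  apply: le_trans (hM [::] 0 _) => //; rewrite /schwartz_weight mulr_ge0 ?nc_ge0//.
  by side.
have [I hI] := hC f M sf (fun s x h => hM s x h).
rewrite -(ger0_norm M0) -sqrtr_sqr -sqrtrM ?mulr_ge0 ?(sqnorm_ge0 ip)//.
have := dist_of_le a sf hI I => h.
rewrite -[leLHS]ger0_norm ?nc_ge0// -sqrtr_sqr ler_wsqrtr//.
by rewrite -mulrA.
Qed.

Lemma dist_fourier_dist_of a : dist_fourier (dist_of a) (fun p => repr a p * (w p)^-1%:C).
split; first by side.
by move=> f sf; exact: dist_of_fourier.
Qed.

Lemma dist_fourier_sub T (v : Rd -> R[i]) (f : Rd -> R) : dist_fourier T v -> test_function f ->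
  dist_fourier (fun g => T g - dist_of_fun (fun x => (f x)%:C) g)
    (fun p => v p - fourier (fun x => (f x)%:C) p).
move=> [mv hv] tf; have [_ _ _ fi] := schwartz_nice (testC_schwartz (testC_real tf)).
split; first by side.
move=> g sg; have [_ _ _ gi] := schwartz_nice sg; have [i1 e1] := hv g sg.
have i2 := cint_fourier_mul fi gi.
split; first by apply: eq_cintegrable (cL1B i1 i2) _ => p; rewrite mulrBl.
rewrite e1 /dist_of_fun -fourier_mul// -cintB//.
by apply: eq_cint => p; rewrite mulrBl.
Qed.

(** Sobolev distances to test functions become distances in L^2, which carries approximations from
    one side to the other in both directions. *)
Lemma sqnorm_wF_sub a (v : Rd -> R[i]) f : cmeas v -> {ae leb, forall p, repr a p = (w p)%:C * v p} ->
  schwartz f -> (sqnorm dot (a - wF f))%:E = sobolev_sqnorm s (fun p => v p - fourier f p).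
move=> mv av sf; have [_ _ _ fi] := schwartz_nice sf.
rewrite sobolev_sqnormE; apply: sqnorm_L2E.
  by side.
have h2 := reprB a (wF f).
by near=> p; rewrite (near h2 p)// (near (L2_of_ae (wF_sqint sf)) p)// (near av p)// mulrBr.
Unshelve. all: by end_near.
Qed.

(** One half of the identification of H^s_R(B) with the fixed points of [star] in [Xset];
    [sobolev_ball_Xset] is the other half. *)
Lemma sobolev_ball_dist_of a : Xset a -> star a = a -> sobolev_ball s (dist_of a).
move=> Xa sa; have df := dist_fourier_dist_of a.
have wV p : (w p)%:C * (repr a p * (w p)^-1%:C) = repr a p.
  by rewrite mulrCA -rmorphM mulfV ?mulr1// gt_eqF.
split.
  split; [exact: tempered_dist_of|exact: dist_of_real|].
  exists (fun p => repr a p * (w p)^-1%:C); split => //.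
  rewrite sobolev_sqnormE; under eq_integral do rewrite wV.
  by rewrite -(@sqnorm_L2E _ _ _ leb a (repr a))// ?ltry//; exact: nearW.
move=> e e0; have [u [hu ua]] := Xset_real Xa sa.
have [N hN] := ua _ e0; have [f tf fu] := hu N.
exists f; split => //; exists (fun p => repr a p * (w p)^-1%:C - fourier (fun x => (f x)%:C) p).
split; first exact: dist_fourier_sub.
rewrite -(@sqnorm_wF_sub a); last 3 first.
- by case: df.
- by apply: nearW => p; rewrite wV.
- exact: testC_schwartz (testC_real tf).
by rewrite fu (sqnormBC ip); exact: hN.
Qed.

Lemma ae_sqint (f g : Rd -> R[i]) : cmeas g -> {ae leb, forall x, f x = g x} ->
  sqint leb f -> sqint leb g.
move=> mg fg [mf If]; split => //.
have [h _] : cL1 leb (fun x => (nc (g x) ^+ 2)%:C).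
  apply: (@ae_cintegrable _ _ _ leb (fun x => (nc (f x) ^+ 2)%:C)).
  - by side.
  - by apply: filterS fg => x ->.
  - by split => //; exact: integrable0.
by [].
Qed.

(** Two functions representing the transform of T agree almost everywhere, so finiteness of the norm
    passes to v. Fixedness under [star] is inherited from the real test functions that approximate
    T. *)
Lemma sobolev_ball_Xset T (v : Rd -> R[i]) : sobolev_ball s T -> dist_fourier T v ->
  [/\ sqint leb (fun p => (w p)%:C * v p), Xset (L2_of leb (fun p => (w p)%:C * v p))
    & star (L2_of leb (fun p => (w p)%:C * v p)) = L2_of leb (fun p => (w p)%:C * v p)].
move=> [[_ _ [v0 [df0 fin]]] app] df; have [mv _] := df; have [mv0 _] := df0.
have mW (u : Rd -> R[i]) : cmeas u -> cmeas (fun p => (w p)%:C * u p) by side.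
have s0 : sqint leb (fun p => (w p)%:C * v0 p).
  split; first exact: mW.
  apply/integrableP; split; first by side.
  by under eq_integral do rewrite /= ger0_norm ?sqr_ge0//; rewrite -sobolev_sqnormE.
have sv : sqint leb (fun p => (w p)%:C * v p).
  by apply: ae_sqint s0; [exact: mW|apply: filterS (dist_fourier_unique df0 df) => p ->].
set a := L2_of _ _.
have ca : closure_of dot [set wF (fun x => (f x)%:C) | f in @test_function R d] a.
  apply: (closure_of_approx (Hdot_hilbert R d)) => e e0.
  have [f [tf [v' [df' lt']]]] := app e e0.
  exists (wF (fun x => (f x)%:C)); split; first by exists f.
  rewrite -lte_fin (@sqnorm_wF_sub a v)//; last 2 first.
  - exact: L2_of_ae.
  - exact: testC_schwartz (testC_real tf).
  apply: le_lt_trans lt'; rewrite !sobolev_sqnormE le_eqVlt; apply/orP; left; apply/eqP.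
  have [mv' _] := df'; have [ms _] := dist_fourier_sub df tf.
  apply: ae_eq_integral => //.
  - by side.
  - by side.
  - by apply: filterS (dist_fourier_unique (dist_fourier_sub df tf) df') => p -> _.
split => //.
  have [u [hu ua]] := ca; exists u; split => // n; have [f tf <-] := hu n.
  by exists (fun x => (f x)%:C) => //; exact: testC_real.
have [u [hu ua]] := ca; apply: (tends_unique (Hdot_hilbert R d) (u := u)) => //.
suff E : star \o u = u by have := tends_star ua; rewrite E.
apply/funext => n; rewrite /comp.
have [f tf <-] := hu n; rewrite star_wF; last exact: testC_real.
by congr wF; apply/funext => x; rewrite cconj_real.
Qed.

End weight.
End sobolev_space.

(** * A Lipschitz cut-off function equal to 1 on the ball *)

Section cutoff.
Context (R : realType) (d : nat).
Local Notation Rd := 'rV[R]_d.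
Local Notation leb := (leb R d).
Implicit Types (x p q : Rd).

(** Piecewise linear, 1 on [-1, 1] and 0 outside [-2, 2]. Lipschitz regularity gives one square
    integrable derivative, which is what the evaluation kernel requires. *)
Definition clamp (t : R) : R := Num.max 0 (Num.min 1 (2 - `|t|)).

Lemma clamp_ge0 t : 0 <= clamp t. by rewrite /clamp le_max lexx. Qed.

Lemma clamp_le1 t : clamp t <= 1.
by rewrite /clamp ge_max ler01 ge_min lexx. Qed.

Lemma clamp_eq1 t : `|t| <= 1 -> clamp t = 1.
move=> h; rewrite /clamp; have -> : Num.min 1 (2 - `|t|) = 1 by apply/min_idPl; lra.
by apply/max_idPr.
Qed.

Lemma clamp_eq0 t : 2 <= `|t| -> clamp t = 0.
move=> h; rewrite /clamp; apply/max_idPl; rewrite ge_min; apply/orP; right; lra.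
Qed.

Lemma clamp_lip s t : `|clamp s - clamp t| <= `|s - t|.
have := ler_dist_dist s t; rewrite /clamp; set a := `|s|; set b := `|t|; set D := `|s - t|.
rewrite !ler_norml /Num.max /Num.min => /andP[h1 h2].
repeat case: ifPn; rewrite -?leNgt => *; apply/andP; split; lra.
Qed.

Lemma clamp_continuous : continuous clamp.
move=> t; apply/cvgrPdist_le => /= e e0; near=> s.
apply: (le_trans (clamp_lip t s)); near: s.
by apply: (cvgr_dist_le id t); [exact: cvg_id|].
Unshelve. all: by end_near.
Qed.

Let l1 (t : R) : 0 < 1 + t ^+ 2.
by side. Qed.

Lemma clamp_decay t : clamp t <= 5 * (2 / (1 + t ^+ 2)).
have [h|h] := leP 2 `|t|; first by rewrite clamp_eq0// !mulr_ge0// invr_ge0 ltW.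
apply: (le_trans (clamp_le1 t)); rewrite mulrA ler_pdivlMr//.
have : t ^+ 2 <= 2 ^+ 2 by rewrite -(real_normK (num_real t)) lerXn2r ?nnegrE// ltW.
nra.
Qed.

(** The factor 5 makes 5 . 2 / (1 + t^2) at least 1 for |t| <= 3; beyond, both values vanish because
    h <= 1. *)
Lemma clamp_increment (t h : R) : 0 < h -> h <= 1 ->
  `|clamp (t + h) - clamp t| <= h * (5 * (2 / (1 + t ^+ 2))).
move=> h0 h1; have [h3|h3] := leP 3 `|t|.
  have t2 : 2 <= `|t| by lra.
  have th : 2 <= `|t + h|.
    have := ler_normB (t + h) h; rewrite addrK (gtr0_norm h0); lra.
  by rewrite !clamp_eq0// subrr normr0 !mulr_ge0 ?(ltW h0)// invr_ge0 ltW.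
apply: (le_trans (clamp_lip _ _)); rewrite addrAC subrr add0r (gtr0_norm h0).
rewrite -[leLHS]mulr1 ler_wpM2l ?(ltW h0)// mulrA ler_pdivlMr//.
have : t ^+ 2 <= 3 ^+ 2 by rewrite -(real_normK (num_real t)) lerXn2r ?nnegrE// ltW.
nra.
Qed.

Definition cutoff x : R := \prod_(i < d) clamp (x 0 i).

Lemma cutoff_eq1 x : eucl2 x < 1 -> cutoff x = 1.
move=> h; rewrite /cutoff big1// => i _; apply: clamp_eq1.
rewrite -(@ler_pXn2r _ 2) ?nnegrE// expr1n real_normK ?num_real//.
exact: le_trans (eucl2_coord x i) (ltW h).
Qed.

Lemma Pn1E x : Pn 1 x = \prod_(i < d) (2 / (1 + x 0 i ^+ 2)).
by apply: eq_bigr => i _; rewrite mulr1 expr1n. Qed.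

Lemma cutoff_le x : cutoff x <= 5 ^+ d * Pn 1 x.
rewrite Pn1E (_ : 5 ^+ d = \prod_(i < d) 5); last by rewrite prodr_const card_ord.
rewrite -big_split /=; apply: ler_prod => i _; by rewrite clamp_ge0 clamp_decay.
Qed.

Lemma cutoff_increment x i (h : R) : 0 < h -> h <= 1 ->
  `|cutoff (x + h *: delta_mx 0 i) - cutoff x| <= h * (5 ^+ d * Pn 1 x).
move=> h0 h1; rewrite /cutoff (bigD1 i)//= [in X in _ - X](bigD1 i)//=.
have -> : \prod_(j < d | j != i) clamp ((x + h *: delta_mx 0 i) 0 j) = \prod_(j < d | j != i) clamp (x 0 j).
  by apply: eq_bigr => j ji; rewrite !mxE (negbTE ji) mulr0 addr0.
rewrite -mulrBl !mxE !eqxx mulr1 normrM.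
have P0 : 0 <= \prod_(j < d | j != i) clamp (x 0 j) by apply: prodr_ge0 => j _; exact: clamp_ge0.
rewrite (ger0_norm P0); apply: (le_trans (ler_wpM2r P0 (clamp_increment _ h0 h1))).
rewrite -[leLHS]mulrA ler_wpM2l ?(ltW h0)//.
rewrite Pn1E (_ : 5 ^+ d = \prod_(i < d) 5); last by rewrite prodr_const card_ord.
rewrite -big_split /= [leRHS](bigD1 i)//= ler_wpM2l//.
  by side.
by apply: ler_prod => j _; rewrite clamp_ge0 clamp_decay.
Qed.

Lemma cutoff_nice : nice (fun x => (cutoff x)%:C).
have c : continuous cutoff.
  apply: (@continuous_prodr R d 'I_d (index_enum _) xpredT (fun i x => clamp (x 0 i))) => i x.
  by apply: (@continuous_comp _ _ _ (fun x => x 0 i) clamp); [exact: coord_continuous|exact: clamp_continuous].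
have c0 x : 0 <= cutoff x by apply: prodr_ge0 => j _; exact: clamp_ge0.
split => //; first by exact: cst_continuous.
  exists 1 => x; rewrite nc_real ger0_norm//.
  apply: (@le_trans _ _ (\prod_(i < d) 1)); last by rewrite big1.
  by apply: ler_prod => i _; rewrite clamp_ge0 clamp_le1.
apply: (@cL1_le _ _ _ leb _ (fun x => 5 ^+ d * Pn 1 x)).
- by apply: cmeas_real; exact: continuous_measurable_rV.
- by move=> x; rewrite nc_real ger0_norm// cutoff_le.
- by apply: L1Z; case: (Pn1_int R d).
Qed.

Lemma cutoff_sobolev : leb.-integrable setT (EFin \o (fun p => (1 + eucl2 p) * nc (fourier (fun x => (cutoff x)%:C) p) ^+ 2)).
have nf := cutoff_nice; have [[_ I0] _] := plancherel nf; have [PI _] := Pn1_int R d.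
pose G x := 25 ^+ d * 2 ^+ d * Pn 1 x.
have ii i : L1 leb (fun p => p 0 i ^+ 2 * nc (fourier (fun x => (cutoff x)%:C) p) ^+ 2).
  have [||[_ h] _] := @fourier_coord_sqint R d (fun x => (cutoff x)%:C) G i nf.
  - exact: L1Z.
  - move=> h x h0 h1; rewrite -rmorphB nc_real real_normK ?num_real//.
    rewrite -(real_normK (num_real (_ - _))); apply: (@le_trans _ _ ((h * (5 ^+ d * Pn 1 x)) ^+ 2)).
      by rewrite lerXn2r ?nnegrE ?mulr_ge0 ?Pn_ge0 ?(ltW h0)// cutoff_increment.
    rewrite !exprMn ler_wpM2l ?sqr_ge0// -exprM mulnC exprM (_ : 5 ^+ 2 = 25); last by ring.
    by rewrite /G -mulrA ler_wpM2l// ler_wpM2r ?Pn_ge0 ?Pn1_le.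
  apply: eq_integrable h => // p _; rewrite /comp; congr EFin.
  by rewrite ncM nc_real exprMn real_normK// num_real.
rewrite (_ : (fun p => _) = (fun p => nc (fourier (fun x => (cutoff x)%:C) p) ^+ 2 +
    \sum_(i <- index_enum 'I_d) p 0 i ^+ 2 * nc (fourier (fun x => (cutoff x)%:C) p) ^+ 2)).
  apply: L1D => //; elim: (index_enum _) => [|i r ih].
    by under eq_fun do rewrite big_nil; exact: integrable0.
  by under eq_fun do rewrite big_cons; exact: L1D.
apply/funext => p; rewrite mulrDl mul1r -mulr_suml; congr (_ + _ * _).
Qed.

End cutoff.

(** * Point evaluation on the Sobolev spaces of the ball *)

Section evaluation.
Context (R : realType) (d : nat).
Local Notation Rd := 'rV[R]_d.
Local Notation leb := (leb R d).
Local Notation Hs := (Hspace R d).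
Local Notation dot := (@Hdot R d).
Implicit Types (x p q : Rd) (a : Hs).

Let ip : semi_inner dot. by case: (Hdot_hilbert R d). Qed.

Variables (w : Rd -> R).
Hypothesis mw : mfun w.
Hypothesis mwV : mfun (fun p => (w p)^-1).
Hypothesis w0 : forall p, 0 < w p.
Hypothesis w_le : forall p, w p <= omega 1 p.
Hypothesis peetre : forall p q, (w p / w q) ^+ 2 <= 2 * (1 + eucl2 (q - p)).

Local Notation cd := (fourier_cst R d).

(** The inequality [peetre] trades the quotient w p / w q for the weight 1 + |q - p|^2, after which
    translation invariance removes p: the bound is uniform in p. *)
Lemma translate_weight (k : R) (g : Rd -> R[i]) p : cmeas g ->
  L1 leb (fun q => (1 + eucl2 q) * nc (g q) ^+ 2) ->
  sqint leb (fun q => (k * (w p / w q))%:C * g (q - p)) /\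
  \int[leb]_q nc ((k * (w p / w q))%:C * g (q - p)) ^+ 2 <=
    2 * k ^+ 2 * \int[leb]_q ((1 + eucl2 q) * nc (g q) ^+ 2).
move=> mg I; have n1 : (1 : R) != 0 by exact: oner_neq0.
pose G q := (1 + eucl2 q) * nc (g q) ^+ 2.
have IC : cL1 leb (fun q => (G q)%:C) by split => //; exact: integrable0.
have [[I' _] E] := cint_affine (- p) n1 IC.
have t (h : Rd -> R) : (fun q => h (- p + 1 *: q)) = (fun q => h (q - p)).
  by apply/funext => q; rewrite scale1r addrC.
have {}E : \int[leb]_q G (q - p) = \int[leb]_q G q.
  by move: E; rewrite normr1 invr1 expr1n mul1r !cint_real t => -[].
have {}I' : L1 leb (fun q => G (q - p)) by rewrite -t.
have le q : nc ((k * (w p / w q))%:C * g (q - p)) ^+ 2 <= 2 * k ^+ 2 * G (q - p).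
  rewrite ncM nc_real [(_ * nc _) ^+ 2]exprMn real_normK ?num_real// [(k * _) ^+ 2]exprMn.
  rewrite (_ : 2 * k ^+ 2 * _ = k ^+ 2 * (2 * (1 + eucl2 (q - p))) * nc (g (q - p)) ^+ 2); last first.
    by rewrite /G; ring.
  by rewrite ler_wpM2r ?sqr_ge0// ler_wpM2l ?sqr_ge0.
have mF : cmeas (fun q => (k * (w p / w q))%:C * g (q - p)).
  apply: cmeasM.
    by side.
  have := cmeas_comp (@mfun_affine_rV R d 1 (- p)) mg; congr cmeas.
  by apply/funext => q; rewrite /comp scale1r addrC.
have I2 := L1Z (2 * k ^+ 2) I'.
have sF := sqint_le mF le I2.
split => //; rewrite -E -RintZ//; apply: le_Rintegral => //.
by case: sF.
Qed.

Definition cutoff_hat : Rd -> R[i] := fourier (fun x => (cutoff x)%:C).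
(** Kernel of point evaluation: f = chi f for f supported in the ball and chi the cut-off, so f^ is
    up to a constant the convolution of chi^ and f^, and w(p) f^(p) is a scalar product with w
    f^. *)
Definition eval_fun p q : R[i] := (cd * (w p / w q))%:C * cutoff_hat (q - p).
Definition eval_at p : Hs := L2_of leb (eval_fun p).
Local Notation chi := cutoff_hat.

Lemma eval_fun_sqint p : sqint leb (eval_fun p) /\
  \int[leb]_q nc (eval_fun p q) ^+ 2 <=
    2 * cd ^+ 2 * \int[leb]_q ((1 + eucl2 q) * nc (chi q) ^+ 2).
apply: translate_weight; last exact: cutoff_sobolev.
by apply: cmeas_fourier; case: (cutoff_nice R d).
Qed.

Lemma cutoff_hatE q : cutoff_hat q = fourier (fun x => (cutoff x)%:C) q. by []. Qed.

#[local] Opaque cutoff_hat.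

Lemma eval_wF f p : testC f -> (w p)%:C * fourier f p = dot (eval_at p) (wF w f).
move=> tf; have sf := testC_schwartz tf; have nf := schwartz_nice sf; have [_ _ _ fi] := nf.
have nc_ := cutoff_nice R d; have [_ _ _ ci] := nc_.
pose e x : R[i] := (cutoff x)%:C * cis (inner x p).
have ne : nice e.
  have [c1 c2 [M hM] _] := nc_.
  have cc : continuous (fun x => inner x p).
    apply: (@continuous_sumr R d 'I_d (index_enum _) xpredT (fun i y => y 0 i * p 0 i)) => i.
    by side.
  split.
  - rewrite (_ : Re \o e = (fun x => cutoff x * cos (inner x p))).
      apply: contM => // x; apply: (@continuous_comp _ _ _ (fun x => inner x p) (@cos R)); first exact: cc.
      exact: continuous_cos.
    by apply/funext => x; rewrite /e /comp ReZ.
  - rewrite (_ : Im \o e = (fun x => cutoff x * sin (inner x p))).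
      apply: contM => // x; apply: (@continuous_comp _ _ _ (fun x => inner x p) (@sin R)); first exact: cc.
      exact: continuous_sin.
    by apply/funext => x; rewrite /e /comp ImZ.
  - by exists M => x; rewrite ncM nc_cis mulr1.
  - apply: eq_cintegrable (@cL1_bound _ _ _ leb _ (fun x => cis (inner x p)) 1 ci _ _) _.
    + exact: cmeas_cis_inner.
    + by move=> x; rewrite nc_cis.
    + by move=> x; rewrite mulrC.
(* The cut-off is 1 wherever f does not vanish, so it can be inserted into the Fourier integral at
   p. *)
have e1 : fourier f p = cd%:C * dot (L2_of leb e) (L2_of leb f).
  rewrite fourierE; congr (_ * _); rewrite [dot _ _]L2_dot_of; [|side|side].
  apply: eq_cint => x; rewrite /e conjcM cconj_real -cisN.
  have [f0|f0] := eqVneq (f x) 0; first by rewrite f0 mul0r mulr0.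
  suff -> : cutoff x = 1 by rewrite mul1r mulrC.
  apply: cutoff_eq1; have [[_ _ bR] [_ _ bI]] := tf.
  have [fR|fR] := eqVneq (Re (f x)) 0; last by apply/bR/subset_closure.
  apply/bI/subset_closure => /=; apply: contra_neq f0 => fI.
  exact: complex_eqP.
have eF q : fourier e q = chi (q - p).
  rewrite cutoff_hatE !fourierE; congr (_ * _); apply: eq_cint => x; rewrite /e -mulrA -cisD; congr (_ * cis _).
  by rewrite (innerC x (q - p)) innerDl innerNl (innerC x p) (innerC x q); ring.
have [sE _] := eval_fun_sqint p; have sW := @wF_sqint R d w mw w0 w_le f sf.
rewrite e1 -(Fou_dot (L2_of leb e)) !Fou_nice//.
rewrite [dot (eval_at p) _]L2_dot_of// [dot _ _]L2_dot_of; [|exact: (plancherel ne).1|exact: (plancherel nf).1].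
rewrite mulrA -rmorphM -cintZ.
  apply: eq_cint => q; rewrite eF /eval_fun conjcM cconj_real.
  rewrite (_ : _ * _ * ((w q)%:C * _) = (cd * (w p / w q))%:C * (w q)%:C * ((chi (q - p))^* * fourier f q)); last by ring.
  congr (_ * _); rewrite -rmorphM; congr (_%:C).
  by rewrite mulrC -mulrA divfK// gt_eqF.
by apply: sqint_mul; [apply: sqint_conj; exact: (plancherel ne).1|exact: (plancherel nf).1].
Qed.

Lemma eval_bound : exists2 C : R, 0 <= C & forall p, sqnorm dot (eval_at p) <= C.
exists (2 * cd ^+ 2 * \int[leb]_q ((1 + eucl2 q) * nc (chi q) ^+ 2)).
  by side.
move=> p; have [sE le] := eval_fun_sqint p; apply: le_trans le.
by rewrite (sqnorm_L2 sE.1 (L2_of_ae sE)).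
Qed.

(** For transforms of test functions the identity is [eval_wF]. Along a sequence converging to a the
    scalar products converge at every p and the functions in L^2; Fatou's lemma shows that both
    limits agree almost everywhere. *)
Lemma eval_ae a : Xset w a -> {ae leb, forall p, repr a p = dot (eval_at p) a}.
move=> [u [hu ua]].
have mu n : cmeas (fun p => dot (eval_at p) (u n)).
  have [f tf <-] := hu n; under eq_fun do rewrite -eval_wF//.
  by apply: cmeasM; [side|apply: cmeas_fourier; case: (schwartz_nice (testC_schwartz tf))].
have ma : cmeas (repr a) by case: (repr_sqint a).
have cv p : nc (dot (eval_at p) (u n) - dot (eval_at p) a) @[n --> \oo] --> 0.
  apply/cvgrPdist_lt => e e0.
  have k0 := sqnorm_ge0 ip (eval_at p).
  have c0 : 0 < sqnorm dot (eval_at p) + 1 by side.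
  have [N hN] := ua (e ^+ 2 / (sqnorm dot (eval_at p) + 1)) (divr_gt0 (exprn_gt0 _ e0) c0).
  have key n : (N <= n)%N -> nc (dot (eval_at p) (u n) - dot (eval_at p) a) < e.
    move=> Nn; rewrite -(@ltr_pXn2r _ 2) ?nnegrE ?nc_ge0 ?(ltW e0)//.
    rewrite -(dotBr ip); apply: (le_lt_trans (cauchy_schwarz ip _ _)).
    have := hN n Nn; rewrite ltr_pdivlMr// mulrC; apply: le_lt_trans.
    by rewrite ler_wpM2r ?(sqnorm_ge0 ip)// lerDl.
  exists N => // n Nn; have := key n Nn.
  by rewrite /mkset -[X in X < e -> _]ger0_norm ?nc_ge0// sub0r normrN.
have cRI p : Re (dot (eval_at p) (u n)) @[n --> \oo] --> Re (dot (eval_at p) a) /\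
             Im (dot (eval_at p) (u n)) @[n --> \oo] --> Im (dot (eval_at p) a).
  have /nc_cvg0P[h1 h2] := cv p.
  by split; apply/subr_cvg0; [move: h1|move: h2]; under eq_fun do rewrite ?ReD ?ImD ?ReN ?ImN.
have md : cmeas (fun p => dot (eval_at p) a).
  split.
  - apply: (@measurable_fun_cvg _ _ _ _ (fun n p => Re (dot (eval_at p) (u n)))) => // [n|p _].
      by case: (mu n).
    by case: (cRI p).
  - apply: (@measurable_fun_cvg _ _ _ _ (fun n p => Im (dot (eval_at p) (u n)))) => // [n|p _].
      by case: (mu n).
    by case: (cRI p).
have small e : 0 < e -> (\int[leb]_p (nc (dot (eval_at p) a - repr a p) ^+ 2)%:E <= e%:E)%E.
  move=> e0; have [N hN] := ua e e0.
  apply: (@fatou_bound _ _ _ leb (fun n p => nc (dot (eval_at p) (u (n + N)%N) - repr a p) ^+ 2)).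
  - by side.
  - by side.
  - move=> p; have [h1 h2] := cRI p.
    apply: (@nc_cvg R (fun n => dot (eval_at p) (u (n + N)%N))).
      by rewrite (cvg_shiftn N (fun n => Re (dot (eval_at p) (u n)))).
    by rewrite (cvg_shiftn N (fun n => Im (dot (eval_at p) (u n)))).
  - move=> n; have := hN (n + N)%N (leq_addl _ _); rewrite -lte_fin => /ltW; apply: le_trans.
    rewrite (@sqnorm_L2E _ _ _ leb _ (fun p => dot (eval_at p) (u (n + N)%N) - repr a p))//.
      by side.
    have [f tf fu] := hu (n + N)%N.
    have h2 := L2_of_ae (@wF_sqint R d w mw w0 w_le f (testC_schwartz tf)).
    apply: filterS2 (reprB (u (n + N)%N) a) h2 => p ->; rewrite -fu => ->.
    by rewrite -eval_wF.
have z : (\int[leb]_p `|(nc (dot (eval_at p) a - repr a p) ^+ 2)%:E| = 0)%E.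
  under eq_integral do rewrite /= ger0_norm ?sqr_ge0//.
  apply/eqP; rewrite eq_le integral_ge0 ?andbT; last by side.
  by apply/lee_addgt0Pr => e e0; rewrite add0e; exact: small.
have : ae_eq leb setT (EFin \o (fun p => nc (dot (eval_at p) a - repr a p) ^+ 2)) (cst 0%E).
  apply/ae_eq_integral_abs => //.
  by side.
apply: filterS => p /(_ I) /= [] /eqP; rewrite sqrf_eq0 => /eqP /nc_eq0 /eqP.
by rewrite subr_eq0 => /eqP.
Qed.

End evaluation.

Lemma real_complexM (R : realType) (a b : R) : (a * b)%:C = a%:C * b%:C :> R[i].
exact: rmorphM. Qed.

(** * Taylor's formula with a bound on the remainder *)

Section taylor.
Context (R : realType).
Implicit Types (g : nat -> R -> R).

Lemma der_exp n (t : R) : is_derive t 1 (fun y : R => y ^+ n.+1) (n.+1%:R * t ^+ n).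
elim: n => [|n ih].
  by rewrite expr0 mulr1; exact: is_derive_id.
under eq_fun do rewrite exprS.
apply: (is_derive_eq (derM (is_derive_id t 1) ih)).
by rewrite mulr1 mulrCA -exprS -[in RHS]natr1 mulrDl mul1r.
Qed.

Lemma der_pow n (t : R) :
  is_derive t 1 (fun y : R => y ^+ n.+1 / n.+1`!%:R) (t ^+ n / n`!%:R).
under eq_fun do rewrite mulrC.
apply: (is_derive_eq (derZ (n.+1`!%:R)^-1 (der_exp n t))); rewrite factS natrM.
have n0 : n`!%:R != 0 :> R by side.
by field; rewrite n0 addrC natr1 pnatr_eq0.
Qed.

(** The function M t^(n+1) / (n+1)! - s f(t) has a nonnegative derivative for s = 1 and s = -1, so
    the mean value theorem makes it nonnegative. *)
Lemma derive_le_norm (f df : R -> R) (M : R) (n : nat) (h : R) :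
  (forall t : R, is_derive t 1 f (df t)) -> f 0 = 0 -> 0 <= h ->
  (forall t, 0 <= t -> `|df t| <= M * (t ^+ n / n`!%:R)) ->
  `|f h| <= M * (h ^+ n.+1 / n.+1`!%:R).
move=> hf f0 h0 hdf; have [->|hn0] := eqVneq h 0.
  by rewrite f0 normr0 expr0n /= mul0r mulr0.
have hp : 0 < h by rewrite lt_neqAle eq_sym hn0.
have dp t := derZ M (der_pow n t).
have sgn s : s ^+ 2 = 1 -> s * f h <= M * (h ^+ n.+1 / n.+1`!%:R).
  move=> s2; pose F t := M * (t ^+ n.+1 / n.+1`!%:R) + - (s * f t).
  have dF (t : R) : is_derive t 1 F (M * (t ^+ n / n`!%:R) + - (s * df t)) := derD (dp t) (derN (derZ s (hf t))).
  have cF : {within `[0, h], continuous F} by apply: continuous_subspaceT => t; exact: der_continuous (dF t).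
  have [c] := MVT hp (fun t _ => dF t) cF; rewrite in_itv /= => /andP[c0 ch] e.
  have : 0 <= F h - F 0.
    rewrite e subr0 mulr_ge0 ?(ltW hp)// subr_ge0; apply: le_trans (hdf c (ltW c0)).
    apply: le_trans (ler_norm _) _; rewrite normrM (_ : `|s| = 1) ?mul1r//.
    by apply/eqP; rewrite -(@eqrXn2 _ 2)// expr1n real_normK ?num_real// s2.
  by rewrite /F f0 mulr0 expr0n /= mul0r mulr0 oppr0 addr0 subr0 subr_ge0.
rewrite ler_norml; apply/andP; split.
  by rewrite lerNl -mulN1r sgn// sqrrN expr1n.
by rewrite -[leLHS]mul1r sgn// expr1n.
Qed.

Definition taylor g n (t h : R) : R := \sum_(k < n) h ^+ k / k`!%:R * g k t.

Lemma taylor_derive g (n : nat) (t h : R) :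
  is_derive h 1 (taylor g n.+1 t) (taylor (fun k => g k.+1) n t h).
elim: n => [|n ih].
  rewrite /taylor big_ord0; under eq_fun do rewrite big_ord1 expr0 fact0 divr1 mul1r; exact: is_derive_cst.
rewrite {2}/taylor big_ord_recr /= -/(taylor (fun k => g k.+1) n t h).
rewrite (_ : taylor g n.+2 t = (fun y => taylor g n.+1 t y + g n.+1 t * (y ^+ n.+1 / n.+1`!%:R))); last first.
  by apply/funext => y; rewrite {1}/taylor big_ord_recr /= -/(taylor g n.+1 t y) [g _ _ * _]mulrC.
by rewrite [_ / _ * _]mulrC; exact: derD ih (derZ (g n.+1 t) (der_pow n h)).
Qed.

Lemma taylor_bound n : forall g (M : R) (t h : R), dseq g ->
  (forall x, `|g n x| <= M) -> 0 <= h ->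
  `|g 0%N (t + h) - taylor g n t h| <= M * (h ^+ n / n`!%:R).
elim: n => [|n ih] g M t h dg gM h0.
  by rewrite /taylor big_ord0 subr0 expr0 fact0 divr1 mulr1.
apply: (@derive_le_norm (fun h => g 0%N (t + h) - taylor g n.+1 t h)
  (fun h => g 1%N (t + h) - taylor (fun k => g k.+1) n t h)) => //.
- move=> y; apply: derD; last exact/derN/taylor_derive.
  rewrite (_ : (fun y => _) = (fun y => g 0%N (1 * y + t))); last by apply/funext => z; rewrite mul1r addrC.
  by apply: (is_derive_eq (@der_comp R (g 0%N) (fun z => 1 * z + t) y _ _ (dg 0%N (1 * y + t)) (der_affine 1 t y))); rewrite mulr1 mul1r addrC.
- rewrite addr0 /taylor big_ord_recl big1 => [|i _].
    by rewrite expr0 fact0 divr1 mul1r addr0 subrr.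
  by rewrite expr0n /= mul0r mul0r.
- move=> y y0; apply: ih => // k x; exact: dg.
Qed.

End taylor.

(** * Derivatives of phases and factorial estimates *)

Section phase.
Context (R : realType).

(** The j-th derivative of t |-> cos(t s + phi), written with a phase shift so that all orders have
    the same form. *)
Definition phase (phi : R) (s : R) (j : nat) (t : R) : R := s ^+ j * cos (t * s + phi + j%:R * (pi / 2)).

Lemma dseq_phase phi s : dseq (phase phi s).
move=> n x; rewrite /phase.
have da : is_derive x 1 (fun t => t * s + phi + n%:R * (pi / 2)) s.
  rewrite (_ : (fun t => _) = (fun t => s * t + (phi + n%:R * (pi / 2)))); first exact: der_affine.
  by apply/funext => t; rewrite mulrC addrA.
apply: (is_derive_eq (derZ (s ^+ n) (der_comp (is_derive_cos _) da))).
rewrite exprSr -mulrA; congr (_ * _); rewrite mulrC; congr (_ * _).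
rewrite (_ : n.+1%:R * (pi / 2) = n%:R * (pi / 2) + pi / 2); last by rewrite -natr1 mulrDl mul1r.
by rewrite addrA cosDpihalf.
Qed.

Lemma phase_le phi s j t : `|phase phi s j t| <= `|s| ^+ j.
by rewrite /phase normrM normrX ler_piMr ?exprn_ge0// cos_max. Qed.

Lemma bin_le_exp2 n m : ('C(n, m) <= 2 ^ n)%N.
elim: n m => [|n ih] [|m] //; first by rewrite bin0 expn_gt0.
by rewrite binS expnS mul2n -addnn leq_add.
Qed.

Lemma fact_add_le j n : ((j + n)`! <= 2 ^ (j + n) * (j`! * n`!))%N.
by rewrite -(@bin_fact (j + n) j) ?leq_addr// addKn leq_mul2r bin_le_exp2 orbT.
Qed.

(** Turns the squared factorials in the moments of S into plain factorials in the moments of sqrt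
    S. *)
Lemma fact_uphalf n : ((uphalf n)`! ^ 2 <= 2 ^ n * n`!)%N.
have h k : (k`! ^ 2 <= (k + k)`!)%N.
  by rewrite -(@bin_fact (k + k) k) ?leq_addr// addKn -mulnn leq_pmull// bin_gt0 leq_addr.
apply: (leq_trans (h _)); apply: (@leq_trans (n.+1)`!).
  by apply: leq_fact; rewrite addnn uphalfE -{2}(odd_double_half n.+1) leq_addl.
by rewrite factS leq_mul2r ltn_expl ?orbT.
Qed.

Lemma geometric_zero (a K : R) : 0 <= a -> (forall n : nat, a <= K * 2^-1 ^+ n) -> a = 0.
move=> a0 h; apply/eqP; rewrite eq_le a0 andbT leNgt; apply/negP => ap.
have K0 : 0 <= K by have := h 0%N; rewrite expr0 mulr1; exact: le_trans.
have := truncnS_gt (K / a); set n := _.+1; rewrite ltr_pdivrMr// ltNge => /negP; apply.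
have := h n; rewrite exprVn ler_pdivlMr ?exprn_gt0// mulrC; apply: le_trans.
rewrite ler_wpM2r// -natrX ler_nat; exact: ltnW (ltn_expl _ _).
Qed.

Lemma cos_sin_natpi k : cos (k%:R * pi : R) = (-1) ^+ k /\ sin (k%:R * pi : R) = 0.
elim: k => [|k [ih1 ih2]]; first by rewrite mul0r cos0 sin0.
by rewrite -natr1 mulrDl mul1r cosDpi sinDpi ih1 ih2 exprS mulN1r oppr0.
Qed.

Lemma cos_half_pi j : cos (j%:R * (pi / 2) : R) = if odd j then 0 else (-1) ^+ j./2.
have [c s] := cos_sin_natpi j./2.
have e : (j./2.*2)%:R * (pi / 2) = j./2%:R * pi :> R.
  by rewrite -muln2 natrM; field.
rewrite -{1}(odd_double_half j); case: ifP => oj; rewrite natrD mulrDl e.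
  by rewrite mul1r addrC cosDpihalf s oppr0.
by rewrite mul0r add0r c.
Qed.

(** Squeezed between exp(-x) and exp(-x / (1 + x/(n+1))); both bounds come from exp y >= 1 + y. *)
Lemma cvg_compound (x : R) : 0 <= x ->
  (1 + n.+1%:R^-1 * x)^-1 ^+ n.+1 @[n --> \oo] --> expR (- x).
move=> x0; pose e n : R := n.+1%:R^-1.
have e0 n : 0 < e n by rewrite invr_gt0.
have ex0 n : 0 < 1 + e n * x by side.
have c1 : expR (- (x / (1 + e n * x))) @[n --> \oo] --> expR (- x).
  have c : - (x / (1 + e n * x)) @[n --> \oo] --> - x.
    rewrite -[X in _ --> - X](divr1 x); apply: cvgN; apply: cvgMr; apply: cvgV; first exact: oner_neq0.
    rewrite -[X in _ --> X]addr0 -(mul0r x); apply: cvgD; first exact: cvg_cst.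
    by apply: cvgMl; exact: cvg_harmonic.
  exact: @cvg_comp _ _ _ _ (@expR R) _ _ _ c (@continuous_expR R _).
apply: squeeze_cvgr _ (cvg_cst _) c1; apply: nearW => n; rewrite -/(e n); apply/andP; split.
  rewrite exprVn expRN lef_pV2 ?posrE ?expR_gt0 ?exprn_gt0 ?ex0//.
  rewrite (_ : expR x = expR (e n * x) ^+ n.+1).
    by rewrite lerXn2r ?nnegrE ?expR_ge0 ?(ltW (ex0 n))// expR_ge1Dx.
  by rewrite -expRM_natl mulrA /e mulfV ?mul1r// pnatr_eq0.
rewrite [leRHS](_ : _ = expR (- (e n * x / (1 + e n * x))) ^+ n.+1); last first.
  rewrite -expRM_natl; congr expR; rewrite mulrN; congr (- _).
  by rewrite mulrA mulrA /e mulfV ?mul1r// pnatr_eq0.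
rewrite lerXn2r ?nnegrE ?expR_ge0 ?invr_ge0 ?(ltW (ex0 n))//.
apply: le_trans (expR_ge1Dx _); apply/eqW.
by field; rewrite gt_eqF.
Qed.

End phase.

(** * Determinacy of the Stieltjes moment problem *)

Section determinacy.
Context dT (T : measurableType dT) (R : realType) (mu : {sigma_finite_measure set T -> \bar R}).
Implicit Types (nu : T -> R[i]) (s W : T -> R).

(** Absolute moments of size C A^n n! make the integral analytic in t with a radius independent of
    t: the vanishing of all derivatives passes from u to u + h as soon as 4 A h <= 1, and finitely
    many such steps reach t. *)
Lemma phase_step nu s (C A phi : R) : cmeas nu -> mfun s -> 0 <= C -> 0 <= A ->
  (forall n, L1 mu (fun x => nc (nu x) * `|s x| ^+ n) /\
     \int[mu]_x (nc (nu x) * `|s x| ^+ n) <= C * A ^+ n * n`!%:R) ->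
  (forall j, cint mu (fun x => nu x * (phase phi (s x) j 0)%:C) = 0) ->
  forall t, 0 <= t -> cint mu (fun x => nu x * (cos (t * s x + phi))%:C) = 0.
move=> mnu ms C0 A0 bd z0 t t0.
have mph j u : mfun (fun x => phase phi (s x) j u).
  apply: measurable_funM; first side.
  apply: (measurableT_comp (f := @cos R)); first by apply: continuous_measurable_fun; exact: continuous_cos.
  by side.
have iph j u : cL1 mu (fun x => nu x * (phase phi (s x) j u)%:C).
  apply: (@cL1_le _ _ _ mu _ (fun x => nc (nu x) * `|s x| ^+ j)); last by case: (bd j).
    by side.
  by move=> x; rewrite ncM nc_real ler_wpM2l ?nc_ge0// phase_le.
pose F j u := cint mu (fun x => nu x * (phase phi (s x) j u)%:C).
have step u h : 0 <= h -> 4 * A * h <= 1 -> (forall j, F j u = 0) -> forall j, F j (u + h) = 0.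
  move=> h0 hA Fu j; apply: nc_eq0.
  (* For every n the Taylor remainder of order n is at most a constant times (2 A h)^n, hence times
     2^(-n). *)
  apply: (@geometric_zero R _ (C * (2 * A) ^+ j * j`!%:R)) => [|n]; first side.
  pose g x k := phase phi (s x) (j + k).
  have dg x : dseq (g x) by move=> k y; rewrite /g addnS; exact: dseq_phase.
  have tE x : nu x * (taylor (g x) n u h)%:C = \sum_(k < n) (h ^+ k / k`!%:R)%:C * (nu x * (phase phi (s x) (j + k) u)%:C).
    by rewrite /taylor rmorph_sum mulr_sumr; apply: eq_bigr => k _; rewrite rmorphM mulrCA.
  have it : cL1 mu (fun x => nu x * (taylor (g x) n u h)%:C).
    apply: eq_cintegrable (cL1_sum (index_enum 'I_n) _) (fun x => esym (tE x)) => k.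
    by side.
  have t0' : cint mu (fun x => nu x * (taylor (g x) n u h)%:C) = 0.
    rewrite (eq_cint _ tE) cint_sum => [|k]; last side.
    by apply: big1 => k _; rewrite cintZ//; have := Fu (j + k)%N; rewrite /F => ->; rewrite mulr0.
  have dif x : nu x * (phase phi (s x) j (u + h))%:C - nu x * (taylor (g x) n u h)%:C =
      nu x * (g x 0%N (u + h) - taylor (g x) n u h)%:C.
    by rewrite -mulrBr -rmorphB /g addn0.
  have E : F j (u + h) = cint mu (fun x => nu x * (g x 0%N (u + h) - taylor (g x) n u h)%:C).
    by rewrite -[LHS]subr0 -t0' -cintB//; apply: eq_cint.
  have I : cL1 mu (fun x => nu x * (g x 0%N (u + h) - taylor (g x) n u h)%:C).
    exact: eq_cintegrable (cL1B (iph j (u + h)) it) dif.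
  have [bI bE] := bd (j + n)%N.
  rewrite E; apply: (le_trans (le_nc_cint I)).
  apply: (@le_trans _ _ (\int[mu]_x (h ^+ n / n`!%:R * (nc (nu x) * `|s x| ^+ (j + n))))).
    apply: le_Rintegral => //; [exact: cint_nc|exact: L1Z|move=> x _].
    rewrite ncM nc_real [leRHS]mulrCA ler_wpM2l ?nc_ge0// mulrC.
    by apply: taylor_bound => // y; exact: phase_le.
  rewrite RintZ//; apply: (@le_trans _ _ (h ^+ n / n`!%:R * (C * A ^+ (j + n) * (2 ^+ (j + n) * (j`!%:R * n`!%:R))))).
    rewrite ler_wpM2l ?divr_ge0 ?exprn_ge0//; apply: (le_trans bE).
    rewrite ler_wpM2l ?mulr_ge0 ?exprn_ge0// -natrX -!natrM ler_nat; exact: fact_add_le.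
  have n0 : n`!%:R != 0 :> R by side.
  rewrite (_ : h ^+ n / _ * _ = C * (2 * A) ^+ j * j`!%:R * (2 * A * h) ^+ n); last first.
    by rewrite !exprMn !exprD; field.
  rewrite ler_wpM2l ?mulr_ge0 ?exprn_ge0 ?mulr_ge0// lerXn2r ?nnegrE ?mulr_ge0//.
  lra.
have [N hN] : exists N : nat, 4 * A * (t / N.+1%:R) <= 1.
  exists (Num.truncn (4 * A * t)); rewrite mulrA ler_pdivrMr ?ltr0n// mul1r.
  exact: ltW (truncnS_gt _).
have it k j : F j (k%:R * (t / N.+1%:R)) = 0.
  elim: k j => [|k ih] j; first by rewrite mul0r; exact: z0.
  by rewrite -natr1 mulrDl mul1r; apply: step => //; side.
have := it N.+1 0%N; rewrite mulrC divfK ?pnatr_eq0// => <-.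
by apply: eq_cint => x; rewrite /phase expr0 mul1r mul0r addr0.
Qed.

(** Moments of size n!^2 are what Gevrey bumps produce, and on the half-line this growth still
    leaves the moment problem determinate. *)
Definition gevrey nu W := cmeas nu /\ exists C A : R, [/\ 0 <= C, 0 <= A &
  forall n, L1 mu (fun x => nc (nu x) * W x ^+ n) /\
     \int[mu]_x (nc (nu x) * W x ^+ n) <= C * A ^+ n * n`!%:R ^+ 2].

Lemma gevrey_const (C A : R) n m : 0 <= C -> 0 <= A ->
  C * A ^+ (n + m) * (n + m)`!%:R ^+ 2 <=
  C * (2 * (2 * A)) ^+ m * m`!%:R ^+ 2 * ((2 * (2 * A)) ^+ n * n`!%:R ^+ 2).
move=> C0 A0.
rewrite [leRHS](_ : _ = C * A ^+ (n + m) * (2 ^+ (n + m) * (n`!%:R * m`!%:R)) ^+ 2); last first.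
  by rewrite ![(2 * _) ^+ _]exprMn !exprD; ring.
rewrite ler_wpM2l ?mulr_ge0 ?exprn_ge0// lerXn2r ?nnegrE ?mulr_ge0 ?exprn_ge0//.
by rewrite -natrX -!natrM ler_nat fact_add_le.
Qed.

Lemma gevrey_scale nu W (c : R) : 0 <= c -> gevrey nu W -> gevrey nu (fun x => c * W x).
move=> c0 [mnu [C [A [C0 A0 bd]]]]; split => //; exists C, (c * A); split => // [|n]; first side.
have [I E] := bd n; have e x : nc (nu x) * (c * W x) ^+ n = c ^+ n * (nc (nu x) * W x ^+ n).
  by rewrite exprMn mulrCA.
under [X in EFin \o X]eq_fun do rewrite e; under eq_Rintegral do rewrite e.
split; first exact: L1Z.
rewrite RintZ// exprMn.
rewrite (_ : C * (c ^+ n * A ^+ n) * n`!%:R ^+ 2 = c ^+ n * (C * A ^+ n * n`!%:R ^+ 2)); last by ring.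
by rewrite ler_wpM2l; side.
Qed.

Lemma gevrey_mul nu W (g : T -> R[i]) (K : R) m : mfun W -> (forall x, 0 <= W x) ->
  0 <= K -> cmeas g -> (forall x, nc (g x) <= K * W x ^+ m) -> gevrey nu W ->
  gevrey (fun x => nu x * g x) W.
move=> mW W0 K0 mg gK [mnu [C [A [C0 A0 bd]]]]; split; first side.
exists (K * (C * (2 * (2 * A)) ^+ m * m`!%:R ^+ 2)), (2 * (2 * A)); split => [||n].
- by side.
- by side.
have [bI bE] := bd (n + m)%N.
have le x : nc (nu x * g x) * W x ^+ n <= K * (nc (nu x) * W x ^+ (n + m)).
  rewrite ncM exprD (_ : K * _ = nc (nu x) * (K * W x ^+ m) * W x ^+ n); last by ring.
  by rewrite ler_wpM2r ?exprn_ge0// ler_wpM2l ?nc_ge0.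
have I : L1 mu (fun x => nc (nu x * g x) * W x ^+ n).
  apply: le_L1 (L1Z K bI) => [|x].
    by side.
  by rewrite ger0_norm// mulr_ge0; side.
split => //; apply: (@le_trans _ _ (K * (C * A ^+ (n + m) * (n + m)`!%:R ^+ 2))).
  apply: le_trans (ler_wpM2l K0 bE); rewrite -RintZ//; apply: le_Rintegral => //; exact: L1Z.
rewrite [leRHS](_ : _ = K * (C * (2 * (2 * A)) ^+ m * m`!%:R ^+ 2 * ((2 * (2 * A)) ^+ n * n`!%:R ^+ 2))); last by ring.
by rewrite ler_wpM2l// gevrey_const.
Qed.

Variables (W : T -> R) (S : T -> R).
Hypothesis mW : mfun W.
Hypothesis W1 : forall x, 1 <= W x.
Hypothesis mS : mfun S.
Hypothesis S0 : forall x, 0 <= S x.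
Hypothesis SW : forall x, S x <= W x.

Let W0 x : 0 <= W x. exact: le_trans (W1 x). Qed.

Let mq : mfun (fun x => Num.sqrt (S x)).
by apply: (measurableT_comp (f := @Num.sqrt R)) => //; apply: continuous_measurable_fun; exact: sqrt_continuous. Qed.

Let mcosq t : mfun (fun x => cos (t * Num.sqrt (S x))).
apply: (measurableT_comp (f := @cos R)); first by apply: continuous_measurable_fun; exact: continuous_cos.
by side.
Qed.

(** The moments of sqrt S have size n!, and the derivatives of the cosine integral at 0 are moments
    of S up to sign in even order and 0 in odd order: only integer powers of S occur. *)
Lemma stieltjes_cos nu t : gevrey nu W -> (forall k, cint mu (fun x => nu x * (S x ^+ k)%:C) = 0) ->
  0 <= t -> cint mu (fun x => nu x * (cos (t * Num.sqrt (S x)))%:C) = 0.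
move=> [mnu [C [A [C0 A0 bd]]]] z t0.
have E x : cos (t * Num.sqrt (S x)) = cos (t * Num.sqrt (S x) + 0) by rewrite addr0.
under eq_cint do rewrite E.
apply: (@phase_step nu (fun x => Num.sqrt (S x)) C (2 * (1 + A))) => //.
- by side.
- move=> n; have [bI bE] := bd (uphalf n).
  have le x : nc (nu x) * `|Num.sqrt (S x)| ^+ n <= nc (nu x) * W x ^+ uphalf n.
    rewrite ler_wpM2l ?nc_ge0// ger0_norm ?sqrtr_ge0//.
    have q1 : Num.sqrt (S x) <= W x.
      rewrite -(@ler_pXn2r _ 2) ?nnegrE ?sqrtr_ge0// sqr_sqrtr// (le_trans (SW x))// expr2.
      by rewrite ler_peMr.
    rewrite -{1}(odd_double_half n) -muln2 mulnC exprD exprM sqr_sqrtr// uphalf_half exprD.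
    apply: ler_pM; rewrite ?exprn_ge0 ?sqrtr_ge0//; first by rewrite lerXn2r ?nnegrE ?sqrtr_ge0.
    by rewrite lerXn2r ?nnegrE.
  have I : L1 mu (fun x => nc (nu x) * `|Num.sqrt (S x)| ^+ n).
    apply: le_L1 bI => [|x]; last by rewrite ger0_norm// mulr_ge0; side.
    apply: measurable_funM; first side.
    by apply/measurable_funX/measurableT_comp.
  split => //; apply: (@le_trans _ _ (C * A ^+ uphalf n * (uphalf n)`!%:R ^+ 2)).
    by apply: le_trans bE; apply: le_Rintegral.
  rewrite exprMn -!mulrA ler_wpM2l//.
  rewrite (_ : 2 ^+ n * ((1 + A) ^+ n * n`!%:R) = (1 + A) ^+ n * (2 ^+ n * n`!%:R)); last by ring.
  apply: ler_pM; rewrite ?exprn_ge0//.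
    apply: (@le_trans _ _ ((1 + A) ^+ uphalf n)).
      by rewrite lerXn2r ?nnegrE ?addr_ge0// lerDr.
    by rewrite ler_weXn2l ?lerDl// uphalf_half -[leqRHS]odd_double_half leq_add2l -addnn leq_addr.
  by rewrite -!natrX -natrM ler_nat fact_uphalf.
move=> j; rewrite /phase.
under eq_fun do rewrite mul0r !add0r real_complexM mulrA mulrC.
rewrite cos_half_pi; case: ifPn => oj; first by under eq_cint do rewrite mul0r; exact: cint0.
rewrite (_ : (fun x => _) = (fun x => ((-1) ^+ j./2)%:C * (nu x * (S x ^+ j./2)%:C))); last first.
  by apply/funext => x; rewrite -{2}(odd_double_half j) (negbTE oj) add0n -muln2 mulnC exprM sqr_sqrtr.
rewrite cintZ ?z ?mulr0//.
have [bI _] := bd j./2; apply: cL1_le _ _ bI.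
  by side.
by move=> x; rewrite ncM nc_real ler_wpM2l ?nc_ge0// ger0_norm ?exprn_ge0// lerXn2r ?nnegrE.
Qed.

Lemma gevrey_integrable nu : gevrey nu W -> cL1 mu nu.
move=> [mnu [C [A [_ _ bd]]]]; apply/cL1P; split => //.
have [h _] := bd 0%N; apply: eq_integrable h => // x _.
by rewrite /comp expr0 mulr1.
Qed.

(** Up to a constant, 1 / (1 + r S) is the integral over y of exp(-e |y|) cos(y sqrt S) with e^2 =
    1/r; Fubini's theorem reduces the claim to the vanishing cosine integrals. *)
Lemma stieltjes_resolvent nu r : gevrey nu W -> (forall k, cint mu (fun x => nu x * (S x ^+ k)%:C) = 0) ->
  0 < r -> cint mu (fun x => nu x * ((1 + r * S x)^-1)%:C) = 0.
move=> gn z r0; have inu := gevrey_integrable gn; have mnu := cL1_meas inu.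
pose e : R := Num.sqrt r^-1.
have e0 : 0 < e by rewrite sqrtr_gt0 invr_gt0.
have e2 : e ^+ 2 = r^-1 by rewrite sqr_sqrtr// invr_ge0 ltW.
have iex : cL1 (@lebesgue_measure R) (fun p => (expn e p)%:C).
  by split; [exact: L1_expn|exact: integrable0].
pose f (z : T * R) := nu z.1 * (expn e z.2 * cos (Num.sqrt (S z.1) * z.2))%:C.
have If : cL1 (mu \x @lebesgue_measure R)%E f.
  have h := cL1_prod_mul inu iex.
  have mc : cmeas (fun z : T * R => (cos (Num.sqrt (S z.1) * z.2))%:C).
    apply: cmeas_real; apply: (measurableT_comp (f := @cos R)); first by apply: continuous_measurable_fun; exact: continuous_cos.
    apply: measurable_funM; last side.
    exact: (measurableT_comp (f := fun x => Num.sqrt (S x))).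
  apply: eq_cintegrable (@cL1_bound _ _ _ _ _ _ 1 h mc _) _ => [y|y].
    by rewrite nc_real cos_max.
  by rewrite /f rmorphM mulrC mulrA.
have R0 : cint (@lebesgue_measure R) (fun y => cint mu (fun x => f (x, y))) = 0.
  rewrite (_ : (fun y => _) = (fun _ => 0)) ?cint0//; apply/funext => y.
  rewrite (_ : (fun x => _) = (fun x => (expn e y)%:C * (nu x * (cos (`|y| * Num.sqrt (S x)))%:C))); last first.
    apply/funext => x; rewrite /f /= rmorphM mulrCA; congr (_ * (_ * (_)%:C)).
    by rewrite -[LHS]cos_norm normrM (ger0_norm (sqrtr_ge0 _)) mulrC.
  rewrite cintZ ?stieltjes_cos ?mulr0//.
  apply: eq_cintegrable (@cL1_bound _ _ _ mu _ (fun x => (cos (`|y| * Num.sqrt (S x)))%:C) 1 inu _ _) _.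
  - by side.
  - by move=> x; rewrite nc_real cos_max.
  - by move=> x; rewrite mulrC.
have L x : cint (@lebesgue_measure R) (fun y => f (x, y)) = (2 * e / (e ^+ 2 + S x))%:C * nu x.
  have I : cL1 (@lebesgue_measure R) (fun y => (expn e y * cos (Num.sqrt (S x) * y))%:C).
    by split; [exact: L1_expn_cos|exact: integrable0].
  rewrite mulrC -[X in (2 * e / (_ + X))](sqr_sqrtr (S0 x)) -Rint_expn_cos// -cint_real -cintZ//.
have E x : nu x * ((1 + r * S x)^-1)%:C = (e / 2)%:C * ((2 * e / (e ^+ 2 + S x))%:C * nu x).
  rewrite mulrA -rmorphM mulrC; congr (_%:C * _).
  rewrite (_ : e / 2 * (2 * e / (e ^+ 2 + S x)) = e ^+ 2 / (e ^+ 2 + S x)); last first.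
    have : e ^+ 2 + S x != 0 by side.
    by move=> h; field.
  rewrite e2; have q : 1 + r * S x != 0 by side.
  have q2 : r^-1 + S x = r^-1 * (1 + r * S x) by rewrite mulrDr mulr1 mulKf// gt_eqF.
  by rewrite q2 invfM mulrA mulfV ?mul1r// invr_eq0 gt_eqF.
rewrite (eq_cint _ E) cintZ.
  rewrite (_ : cint mu _ = 0) ?mulr0// -R0 -(cint_fubini If).
  by apply: eq_cint => x; rewrite L.
apply: (@cL1_bound _ _ _ mu _ (fun x => (2 * e / (e ^+ 2 + S x))%:C) (2 * e / e ^+ 2)) => //.
  by side.
move=> x; rewrite nc_real ger0_norm ?mulr_ge0 ?(ltW e0) ?invr_ge0 ?addr_ge0 ?sqr_ge0//.
by rewrite ler_wpM2l ?mulr_ge0 ?(ltW e0)// lef_pV2 ?posrE ?exprn_gt0 ?ltr_pwDl ?exprn_gt0// lerDl.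
Qed.

(** The vanishing of all moments survives multiplication by (1 + r S)^(-1), hence by its powers, and
    (1 + S/n)^(-n) tends to exp(-S). *)
Lemma stieltjes_exp nu : gevrey nu W -> (forall k, cint mu (fun x => nu x * (S x ^+ k)%:C) = 0) ->
  cint mu (fun x => nu x * (expR (- S x))%:C) = 0.
move=> gn z.
have mr r : 0 < r -> mfun (fun x => (1 + r * S x)^-1) by side.
pose q r x : R[i] := ((1 + r * S x)^-1)%:C.
have q1 r x : 0 <= r -> 0 <= (1 + r * S x)^-1 <= 1.
  move=> r0; have h : 0 <= r * S x by side.
  by rewrite invr_ge0 addr_ge0//= invf_le1 ?lerDl// ltr_pwDl.
have mX r n : 0 < r -> cmeas (fun x => q r x ^+ n).
  by move=> r0; under eq_fun do rewrite -rmorphXn; apply: cmeas_real; side.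
have ind r n : 0 < r -> gevrey (fun x => nu x * q r x ^+ n) W /\
    forall k, cint mu (fun x => nu x * q r x ^+ n * (S x ^+ k)%:C) = 0.
  move=> r0; split.
    apply: (@gevrey_mul _ _ _ 1 0) => //; [exact: mX|move=> x].
    rewrite expr0 mulr1 -rmorphXn nc_real; have /andP[a b] := q1 r x (ltW r0).
    by rewrite ger0_norm ?exprn_ge0// exprn_ile1.
  elim: n => [|n ih] k; first by rewrite -[RHS](z k); apply: eq_cint => x; rewrite expr0 mulr1.
  have G : gevrey (fun x => nu x * q r x ^+ n) W.
    apply: (@gevrey_mul _ _ _ 1 0) => //; [exact: mX|move=> x].
    rewrite expr0 mulr1 -rmorphXn nc_real; have /andP[a b] := q1 r x (ltW r0).
    by rewrite ger0_norm ?exprn_ge0// exprn_ile1.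
  have G2 : gevrey (fun x => nu x * q r x ^+ n * (S x ^+ k)%:C) W.
    apply: (@gevrey_mul _ _ _ 1 k) => //.
      by side.
    by move=> x; rewrite mul1r nc_real ger0_norm ?exprn_ge0// lerXn2r ?nnegrE.
  rewrite -[RHS](stieltjes_resolvent (r := r) G2) => [|j|//].
    by apply: eq_cint => x; rewrite exprSr -/(q r x); ring.
  rewrite -[RHS](ih (k + j)%N); apply: eq_cint => x.
  by rewrite exprD rmorphM mulrA.
have inu := gevrey_integrable gn; have mnu := cL1_meas inu.
pose f n x := nu x * q n.+1%:R^-1 x ^+ n.+1.
have f0 n : cint mu (f n) = 0.
  have [_ h] := ind n.+1%:R^-1 n.+1 (en_gt0 R n).
  by rewrite -[RHS](h 0%N); apply: eq_cint => x; rewrite expr0 mulr1.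
have me : mfun (fun x => expR (- S x)).
  apply: (measurableT_comp (f := @expR R)); first by side.
  by side.
have := @dominated_cvgC _ _ _ mu f (fun x => nu x * (expR (- S x))%:C) (fun x => nc (nu x)).
move=> D; have {D} : nc (cint mu (f n) - cint mu (fun x => nu x * (expR (- S x))%:C)) @[n --> \oo] --> 0.
apply: D.
- by move=> n; apply: cmeasM => //; apply: mX; side.
- by side.
- apply: nearW => x; under eq_fun do rewrite /f -mulrBr -rmorphXn -rmorphB ncM nc_real.
  rewrite -(mulr0 (nc (nu x))) -(normr0 R); apply: cvgMr; apply: cvg_norm.
  by apply/subr_cvg0; exact: cvg_compound.
- exact: cint_nc.
- move=> n x; rewrite /f ncM ler_piMr ?nc_ge0// -rmorphXn nc_real.
  have /andP[a b] := q1 n.+1%:R^-1 x (ltW (en_gt0 R n)).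
  by rewrite ger0_norm ?exprn_ge0// exprn_ile1.
under eq_fun do rewrite f0 sub0r ncN.
by move=> h; apply: nc_eq0; apply: cvg_unique _ (cvg_cst _) h.
Qed.

End determinacy.

(** * Fourier transforms of one-variable bumps *)

Section bump_transform.
Context (R : realType).
Local Notation mu := (@lebesgue_measure R).
Implicit Types (g : nat -> R -> R) (M t x : R).

Lemma ftc_compact (F f : R -> R) M : (forall x, is_derive x 1 F (f x)) -> continuous f ->
  (forall x, M < `|x| -> F x = 0) -> (forall x, M < `|x| -> f x = 0) ->
  (\int[mu]_x (f x)%:E = 0)%E.
move=> dF cf F0 f0; pose b := `|M| + 1.
have Mb x : b <= `|x| -> M < `|x|.
  move=> h; apply: lt_le_trans h; rewrite /b; apply: le_lt_trans (ler_norm M) _.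
  by rewrite ltrDl.
have b0 : 0 < b by rewrite ltr_wpDl.
have nb : `|- b| = b by rewrite normrN gtr0_norm.
have -> : (\int[mu]_x (f x)%:E = \int[mu]_(x in `[(- b)%R, b]) (f x)%:E)%E.
  rewrite [RHS]integral_mkcond; apply: eq_integral => x _; rewrite patchE.
  case: ifPn => // /negP h; congr (_%:E); apply/f0/Mb; rewrite leNgt; apply/negP => h2; apply: h.
  by rewrite inE /= in_itv /= -ler_norml ltW.
rewrite (@continuous_FTC2 _ f F)//.
- by rewrite !F0 ?subee//; apply: Mb; rewrite ?nb ?gtr0_norm.
- by rewrite (lt_trans _ b0)// oppr_lt0.
- exact: continuous_subspaceT.
- split.
  + by [].
  + by apply: cvg_at_right_filter; exact: der_continuous (dF _).
  + by apply: cvg_at_left_filter; exact: der_continuous (dF _).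
- by move=> x _; rewrite derive1E; have [_ ->] := dF x.
Qed.

Lemma cauchy_majorant (f : R -> R) (M C : R) : (forall x, `|f x| <= C) -> (forall x, M < `|x| -> f x = 0) ->
  forall x, `|f x| <= C * ((1 + M ^+ 2) / 2) * (2 / (1 + x ^+ 2)).
move=> fC f0 x; have C0 : 0 <= C := le_trans (normr_ge0 _) (fC 0).
have q0 (y : R) : 0 < 1 + y ^+ 2 by side.
have [h|h] := ltP M `|x|.
  by rewrite f0// normr0; side.
apply: (le_trans (fC x)); rewrite -mulrA ler_peMr// mulrA divfK// ler_pdivlMr// mul1r lerD2l.
by rewrite -(real_normK (num_real x)) lerXn2r ?nnegrE// (le_trans _ h).
Qed.

Section one.
Variables (g : nat -> R -> R) (M : R).
Hypothesis dg : dseq g.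
Hypothesis g0 : forall x, M < `|x| -> g 0%N x = 0.

Let gs n x : M < `|x| -> g n x = 0. exact: dseq_support. Qed.
Let cg n : continuous (g n). by move=> x; exact: dseq_continuous. Qed.

Definition bump_hat n t : R[i] := cint mu (fun x => (g n x)%:C * cis (- (x * t))).

Lemma dseq_integrable n : L1 mu (g n).
have [C C0 gC] := dseq_bounded dg g0 n.
apply: (@le_L1 _ _ _ mu (g n) (fun x => C * ((1 + M ^+ 2) / 2) * (2 / (1 + x ^+ 2)))).
- exact: continuous_measurable_fun.
- by move=> x; exact: (cauchy_majorant gC (@gs n)).
exact/L1Z/L1_cauchy.
Qed.

Lemma cL1_bump n t : cL1 mu (fun x => (g n x)%:C * cis (- (x * t))).
have I : cL1 mu (fun x => (g n x)%:C) by split; [exact: dseq_integrable|exact: integrable0].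
apply: eq_cintegrable (@cL1_bound _ _ _ mu _ (fun x => cis (- (x * t))) 1 I _ _) _ => [|x|x].
- by apply: cmeas_cis; side.
- by rewrite nc_cis.
- by rewrite mulrC.
Qed.

(** Integration by parts, done separately for cosine and sine; compact support leaves no boundary
    terms. *)
Lemma bump_hatS n t : bump_hat n.+1 t = 'i * t%:C * bump_hat n t.
have da x : is_derive x 1 (fun x => x * t) t.
  rewrite (_ : (fun x => _) = (fun x => t * x + 0)); first exact: der_affine.
  by apply/funext => y; rewrite addr0 mulrC.
have dC x := der_comp (is_derive_cos _) (da x).
have dS x := der_comp (is_derive_sin _) (da x).
have cC : continuous (fun x => cos (x * t)) by move=> x; exact: der_continuous (dC x).
have cS : continuous (fun x => sin (x * t)) by move=> x; exact: der_continuous (dS x).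
have ic k : L1 mu (fun x => g k x * cos (x * t)).
  have [h _] := cL1_bump k t; apply: eq_integrable h => // x _.
  by rewrite /comp ReZ /= cosN.
have is_ k : L1 mu (fun x => g k x * sin (x * t)).
  have [_ h] := cL1_bump k (- t); apply: eq_integrable h => // x _.
  by rewrite /comp ImZ /= mulrN opprK.
have zc : \int[mu]_x (g n.+1 x * cos (x * t)) = t * \int[mu]_x (g n x * sin (x * t)).
  have z : (\int[mu]_x (g n x * (- sin (x * t) * t) + cos (x * t) * g n.+1 x)%:E = 0)%E.
    apply: (@ftc_compact (fun x => g n x * cos (x * t)) _ M).
    - by move=> x; exact: derM (dg n x) (dC x).
    - by side.
    - by move=> x h; rewrite gs// mul0r.
    - by move=> x h; rewrite !gs// mul0r mulr0 addr0.
  rewrite -RintZ//; apply/eqP; rewrite -subr_eq0 -RintegralB//; last exact: L1Z.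
  rewrite /Rintegral (_ : (fun x => _) = (fun x => (g n x * (- sin (x * t) * t) + cos (x * t) * g n.+1 x)%:E)).
    by rewrite z.
  by apply/funext => x; congr (_%:E); ring.
have zs : \int[mu]_x (g n.+1 x * sin (x * t)) = - (t * \int[mu]_x (g n x * cos (x * t))).
  have z : (\int[mu]_x (g n x * (cos (x * t) * t) + sin (x * t) * g n.+1 x)%:E = 0)%E.
    apply: (@ftc_compact (fun x => g n x * sin (x * t)) _ M).
    - by move=> x; exact: derM (dg n x) (dS x).
    - by side.
    - by move=> x h; rewrite gs// mul0r.
    - by move=> x h; rewrite !gs// mul0r mulr0 addr0.
  rewrite -RintZ//; apply/eqP; rewrite -subr_eq0 opprK -RintegralD//; last exact: L1Z.
  rewrite /Rintegral (_ : (fun x => _) = (fun x => (g n x * (cos (x * t) * t) + sin (x * t) * g n.+1 x)%:E)).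
    by rewrite z.
  by apply/funext => x; congr (_%:E); ring.
have E k : bump_hat k t = (\int[mu]_x (g k x * cos (x * t))) +i* (- \int[mu]_x (g k x * sin (x * t))).
  rewrite /bump_hat /cint; congr Complex.
    by apply: eq_Rintegral => x _; rewrite ReZ /= cosN.
  rewrite -mulN1r -RintZ//; apply: eq_Rintegral => x _.
  by rewrite ImZ /= sinN mulrN mulN1r.
rewrite !E zc zs; apply: complex_eqP; rewrite /=; ring.
Qed.

Lemma bump_hat_pow n t : bump_hat n t = ('i * t%:C) ^+ n * bump_hat 0 t.
elim: n => [|n ih]; first by rewrite mul1r.
by rewrite bump_hatS ih exprS mulrA.
Qed.

Lemma bump_hat_le n t (C : R) : (forall x, `|g n x| <= C) ->
  `|t| ^+ n * nc (bump_hat 0 t) <= C * ((1 + M ^+ 2) * pi).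
move=> gC; have -> : `|t| ^+ n * nc (bump_hat 0 t) = nc (bump_hat n t).
  rewrite [bump_hat n t]bump_hat_pow ncM ncX ncM nc_real (_ : nc 'i = 1); last first.
    by rewrite ncE /= !expr2 mul0r mulr1 add0r sqrtr1.
  by rewrite mul1r.
apply: (le_trans (le_nc_cint (cL1_bump n t))).
have I := L1_cauchy R.
apply: (@le_trans _ _ (\int[mu]_x (C * ((1 + M ^+ 2) / 2) * (2 / (1 + x ^+ 2))))).
  apply: le_Rintegral => //; [exact: cint_nc (cL1_bump n t)|exact: L1Z|move=> x _].
  by rewrite ncM nc_cis mulr1 nc_real; exact: cauchy_majorant (gs n) _.
by rewrite RintZ// Rint_cauchy; apply/eqW; field.
Qed.

End one.

Lemma cos_ge_half (u : R) : `|u| <= 1 -> 2^-1 <= cos u.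
move=> h; rewrite -cos_norm.
have := @taylor_bound R 2 (phase 0 1) 1 0 `|u| (dseq_phase 0 1) _ (normr_ge0 u).
rewrite /taylor big_ord_recl big_ord1 /= /phase !expr1n !mul1r !mulr1 !addr0 !add0r mul0r cos0 cos_pihalf.
rewrite addr0 mulr0 addr0 invr1 mulr1 => H.
have : `|cos `|u| - 1| <= `|u| ^+ 2 / 2`!%:R by apply: H => x; rewrite mul1r cos_max.
rewrite ler_norml => /andP[h1 _]; have : `|u| ^+ 2 <= 1 by rewrite exprn_ile1.
rewrite (_ : 2`! = 2)%N// in h1 *; lra.
Qed.

Definition bump_at (c e : R) := bumpf (c - e) (c + e) 0.

Lemma bump_at_support c e x : `|c| + `|e| < `|x| -> bump_at c e 0 x = 0.
move=> h; apply: bump_eq0; have := ler_norm x; have := ler_norm (- x); rewrite normrN => h1 h2.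
have := ler_norm c; have := ler_norm (- c); have := ler_norm e; have := ler_norm (- e); rewrite !normrN => h3 h4 h5 h6.
have [x0|x0] := leP 0 x.
  by rewrite (ger0_norm x0) in h; apply/orP; right; lra.
by rewrite (ltr0_norm x0) in h; apply/orP; left; lra.
Qed.

(** After multiplication by exp(i c t) the real part is the integral of g(x) cos((c - x) t), and the
    cosine is at least 1/2 on the support when e |t| <= 1. *)
Lemma bump_hat_neq0 c e t : 0 < e -> `|t| * e <= 1 -> bump_hat (bump_at c e) 0 t != 0.
move=> e0 te; pose g := bump_at c e.
have dg : dseq g := dseq_bump _ _ _.
have I := cL1_bump dg (@bump_at_support c e) 0 t.
pose f x := g 0%N x * cos ((c - x) * t).
have fE : cis (c * t) * bump_hat g 0 t = cint mu (fun x => (g 0%N x)%:C * cis ((c - x) * t)).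
  rewrite /bump_hat -cintZ//; apply: eq_cint => x; rewrite mulrCA -cisD; congr (_ * cis _); ring.
have f_ge x : 2^-1 * g 0%N x <= f x.
  rewrite /f mulrC; have [h|h] := boolP ((x <= c - e) || (c + e <= x)).
    by rewrite /g /bump_at bump_eq0// !mul0r.
  rewrite ler_wpM2l ?bump_ge0//; apply: cos_ge_half; rewrite normrM mulrC.
  apply: le_trans te; rewrite ler_wpM2l//; move: h; rewrite negb_or -!ltNge => /andP[h1 h2].
  by rewrite ler_norml; apply/andP; split; lra.
have iF : L1 mu f.
  have [h _] : cL1 mu (fun x => (g 0%N x)%:C * cis ((c - x) * t)).
    apply: eq_cintegrable (cL1Z (cis (c * t)) I) _ => x.
    by rewrite mulrCA -cisD; congr (_ * cis _); ring.
  by apply: eq_integrable h => // x _; rewrite /comp ReZ.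
apply/eqP => B0; move: fE; rewrite B0 mulr0 => /(congr1 (fun z : R[i] => Re z)) /= z.
have {}z : (\int[mu]_x (f x)%:E = 0)%E.
  rewrite -[LHS]fineK ?integrable_fin_num//; congr (_%:E); rewrite [RHS]z.
  by apply: eq_Rintegral => x _; rewrite mul0r subr0.
have f0 x : 0 <= f x by apply: le_trans (f_ge x); rewrite mulr_ge0// bump_ge0.
pose k : R := 2^-1 * (psi 0 (e / 2) * psi 0 (e / 2)).
have k0 : 0 < k by rewrite !mulr_gt0 ?psi0_gt0 ?divr_gt0.
have lower x : x \in `[c - e / 2, c + e / 2] -> k <= f x.
  rewrite in_itv /= => /andP[h1 h2]; apply: le_trans (f_ge x).
  rewrite /k ler_wpM2l// /g /bump_at bumpE.
  by apply: ler_pM; rewrite ?psi0_ge0// psi0_mono//; lra.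
have mf : mfun (EFin \o f) by case/integrableP : iF.
have : (k%:E * mu `[(c - e / 2)%R, (c + e / 2)%R] <= 0)%E.
  rewrite -z -integral_cst//.
  apply: (@le_trans _ _ (\int[mu]_(x in `[(c - e / 2)%R, (c + e / 2)%R]) (f x)%:E)%E).
    apply: ge0_le_integral => //.
    - by move=> x _; rewrite lee_fin ltW.
    - exact: measurable_funTS.
  by apply: ge0_subset_integral => // x _; rewrite lee_fin.
rewrite lebesgue_measure_itv /= lte_fin ifT; last by rewrite -subr_gt0; lra.
rewrite -EFinD -EFinM lee_fin leNgt => /negP; apply.
by rewrite mulr_gt0//; lra.
Qed.

End bump_transform.

(** * Uniqueness from Fourier data in a small ball *)

Section uniqueness.
Context (R : realType) (d : nat).
Local Notation Rd := 'rV[R]_d.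
Local Notation leb := (leb R d).
Local Notation cd := (fourier_cst R d).
Implicit Types (x p y : Rd) (k : 'I_d -> nat).

(** A pairing of g with an Abel mean is a pairing of g^, hence 0; by convergence of the Abel means g
    is orthogonal to every Schwartz function. *)
Lemma fourier_eq0 (g : Rd -> R[i]) : cL1 leb g -> (forall p, fourier g p = 0) ->
  {ae leb, forall p, g p = 0}.
move=> gi g0; apply: schwartz_separates; first side.
move=> f sf; have nf := schwartz_nice sf; have nc_ := nice_conj nf.
have [cR cI [M fM] fi] := nc_.
have I : cL1 leb (fun p => g p * f p).
  have [M' hM'] : exists M : R, forall x, nc (f x) <= M by case: nf.
  apply: eq_cintegrable (@cL1_bound _ _ _ leb _ f M' gi _ hM') _ => [|x]; last by rewrite mulrC.
  by case: (nice_sqint nf).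
split => //; pose F n x := g x * smoothed (fun x => (f x)^*) (en R n) x.
have z n : cint leb (F n) = 0.
  have h := cint_smoothed (en_gt0 R n) fi; rewrite /F /smoothed -fourier_mul//.
  by rewrite -[RHS](cint0 leb); apply: eq_cint => p; rewrite g0 mul0r.
have D := smoothed_pairing gi nc_.
move: D; under eq_fun do rewrite z sub0r ncN.
move=> h; rewrite -[LHS](eq_cint _ (fun x => congr1 (fun w => g x * w) (cconjK (f x)))).
by apply: nc_eq0; apply: cvg_unique _ (cvg_cst _) h.
Qed.

(** Derivatives of multi-index k of a bump around x0. Their transforms are monomials times one fixed
    function, so that testing v against all of them yields all moments of v times that function. *)
Definition localized (x0 : Rd) (e : R) k x : R := prodf (fun i => bump_at (x0 0 i) e) k x.
Definition local_hat (x0 : Rd) (e : R) p : R[i] := \prod_(i < d) bump_hat (bump_at (x0 0 i) e) 0 (p 0 i).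
Definition monom k p : R := \prod_(i < d) p 0 i ^+ k i.

Let db c e : dseq (@bump_at R c e) := dseq_bump _ _ _.

Lemma fourier_localized x0 e k p :
  fourier (fun x => (localized x0 e k x)%:C) p =
  (cd%:C * \prod_(i < d) 'i ^+ k i) * ((monom k p)%:C * local_hat x0 e p).
pose F i t : R[i] := (bump_at (x0 0 i) e (k i) t)%:C * cis (- (t * p 0 i)).
have FI i : cL1 (@lebesgue_measure R) (F i).
  by apply: (cL1_bump (db _ _) (@bump_at_support R (x0 0 i) e)).
have [_ E] := cint_prodf FI.
rewrite fourierE -mulrA; congr (_ * _).
transitivity (cint leb (fun x => \prod_(i < d) F i (x 0 i))).
  apply: eq_cint => x; rewrite /localized /prodf rmorph_prod /F big_split /=; congr (_ * _).
  by rewrite -cis_sum sumrN.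
rewrite E /monom rmorph_prod /local_hat -!big_split /=; apply: eq_bigr => i _.
rewrite -/(bump_hat (bump_at (x0 0 i) e) (k i) (p 0 i)) (bump_hat_pow (db _ _) (@bump_at_support R (x0 0 i) e)).
by rewrite exprMn rmorphXn mulrA.
Qed.

Definition height p : R := 1 + \sum_(i < d) `|p 0 i|.

Lemma height_ge1 p : 1 <= height p.
by rewrite /height lerDl sumr_ge0. Qed.

Lemma coord_le_height p i : `|p 0 i| <= height p.
by rewrite /height (bigD1 i)//= addrCA lerDl addr_ge0// sumr_ge0. Qed.

Lemma mfun_height : mfun height.
apply: continuous_measurable_rV; apply: contD; first side.
apply: (@continuous_sumr R d 'I_d (index_enum _) xpredT (fun i y => `|y 0 i|)) => i x.
apply: (@continuous_comp _ _ _ (fun x => x 0 i) (fun t => `|t|)); first exact: coord_continuous.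
exact: norm_continuous.
Qed.

Lemma eucl2_le_height p : 1 + eucl2 p <= height p ^+ 2.
rewrite /height; set s := \sum_(i < d) _; have s0 : 0 <= s by rewrite sumr_ge0.
suff : eucl2 p <= s ^+ 2 by move=> h; nra.
rewrite expr2 {1}/s mulr_suml /eucl2 /inner; apply: ler_sum => i _.
rewrite -expr2 -(real_normK (num_real (p 0 i))) ler_wpM2l//.
by rewrite /s (bigD1 i)//= lerDl sumr_ge0.
Qed.

(** Powers of the height reduce to powers of single coordinates, so that only one factor of a
    product has to supply the decay. *)
Lemma height_pow p n : height p ^+ n <= d.+1%:R ^+ n * (1 + \sum_(i < d) `|p 0 i| ^+ n).
pose M := \big[Num.max/1]_(i < d) `|p 0 i|.
have M1 : 1 <= M by rewrite /M; elim/big_rec: _ => // i x _ h; rewrite le_max h orbT.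
have Mi i : `|p 0 i| <= M by apply: le_bigmax.
have h : height p <= d.+1%:R * M.
  rewrite -natr1 mulrDl mul1r addrC; apply: lerD => //.
  apply: (@le_trans _ _ (\sum_(i < d) M)); first by apply: ler_sum.
  by rewrite sumr_const card_ord mulr_natl.
apply: (@le_trans _ _ ((d.+1%:R * M) ^+ n)).
  have h0 := le_trans ler01 (height_ge1 p); have M0 := le_trans ler01 M1.
  by rewrite lerXn2r ?nnegrE ?mulr_ge0.
rewrite exprMn ler_wpM2l//.
have S0 : 0 <= \sum_(i < d) `|p 0 i| ^+ n by side.
rewrite /M; elim/big_ind: _ => [|x y hx hy|i _].
- by rewrite expr1n lerDl.
- by rewrite /Num.max; case: ifP.
- by rewrite (bigD1 i)//= addrCA lerDl addr_ge0// sumr_ge0// => j _; side.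
Qed.

Lemma prod_le_at (B K : 'I_d -> R) i (a c : R) : (forall j, 0 <= B j <= K j) -> 0 <= a -> 0 <= c ->
  B i * a <= c * K i -> \prod_(j < d) B j * a <= \prod_(j < d) K j * c.
move=> h a0 c0 hi; rewrite (bigD1 i)//= [in leRHS](bigD1 i)//= mulrAC [leRHS]mulrAC [K i * c]mulrC.
apply: ler_pM => //.
- by rewrite mulr_ge0//; case/andP: (h i).
- by apply: prodr_ge0 => j _; case/andP: (h j).
- by apply: ler_prod => j _; exact: h.
Qed.

Lemma local_hat_bound x0 e : exists C A : R, [/\ 0 <= C, 0 <= A &
  forall n p, nc (local_hat x0 e p) * height p ^+ n <= C * A ^+ n * n`!%:R ^+ 2].
pose K i : R := (1 + (`|x0 0 i| + `|e|) ^+ 2) * pi.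
have K0 i : 0 <= K i by rewrite mulr_ge0 ?pi_ge0////.
pose L : R := \prod_(i < d) K i.
have L0 : 0 <= L by rewrite prodr_ge0.
have b i n p : `|p 0 i| ^+ n * nc (bump_hat (bump_at (x0 0 i) e) 0 (p 0 i)) <= 16 ^+ n * n`!%:R ^+ 2 * K i.
  apply: (bump_hat_le (db _ _) (@bump_at_support R (x0 0 i) e)) => x; exact: bump_le.
have b0 i p : nc (bump_hat (bump_at (x0 0 i) e) 0 (p 0 i)) <= K i.
  by have := b i 0%N p; rewrite mul1r mul1r expr1n mul1r.
have ncE p : nc (local_hat x0 e p) = \prod_(i < d) nc (bump_hat (bump_at (x0 0 i) e) 0 (p 0 i)).
  rewrite /local_hat; elim/big_rec2: _ => [|i x y _ <-]; first by rewrite nc1.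
  by rewrite ncM.
exists (L * (1 + d%:R)), (d.+1%:R * 16); split => [||n p].
- by side.
- by [].
have F1 : 1 <= n`!%:R :> R by rewrite ler1n fact_gt0.
have Fn : 1 <= 16 ^+ n * n`!%:R ^+ 2 :> R by rewrite mulr_ege1 ?exprn_ege1// ler1n.
have P0 : nc (local_hat x0 e p) <= L.
  by rewrite ncE; apply: ler_prod => i _; side.
have Pi i : nc (local_hat x0 e p) * `|p 0 i| ^+ n <= L * (16 ^+ n * n`!%:R ^+ 2).
  rewrite ncE; apply: (prod_le_at (i := i)) => [j|||]; rewrite//.
    by side.
  by rewrite mulrC; exact: b.
apply: (@le_trans _ _ (nc (local_hat x0 e p) * (d.+1%:R ^+ n * (1 + \sum_(i < d) `|p 0 i| ^+ n)))).
  by rewrite ler_wpM2l ?nc_ge0// height_pow.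
rewrite mulrCA exprMn (_ : _ * _ * n`!%:R ^+ 2 = d.+1%:R ^+ n * (L * (16 ^+ n * n`!%:R ^+ 2) * (1 + d%:R))); last by ring.
rewrite ler_wpM2l// !mulrDr !mulr1 mulr_sumr; apply: lerD.
  by apply: (le_trans P0); rewrite ler_peMr.
apply: (@le_trans _ _ (\sum_(i < d) L * (16 ^+ n * n`!%:R ^+ 2))); first by apply: ler_sum.
by rewrite sumr_const card_ord mulr_natr.
Qed.

Lemma local_hat_neq0 x0 e p : 0 < e -> (forall i, `|p 0 i| * e <= 1) -> local_hat x0 e p != 0.
by move=> e0 h; apply/prodf_neq0 => i _; apply: bump_hat_neq0. Qed.

Lemma cmeas_local_hat x0 e : cmeas (local_hat x0 e).
pose M : R := \sum_(i < d) (`|x0 0 i| + `|e|).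
have sup i (y : R) : M < `|y| -> bump_at (x0 0 i) e 0 y = 0.
  move=> h; apply: bump_at_support; apply: le_lt_trans h.
  by rewrite /M (bigD1 i)//= lerDl sumr_ge0// => j _; side.
have sl : schwartz (fun x => (localized x0 e (fun=> 0%N) x)%:C) by apply: (@schwartz_prodf R d (fun i => bump_at (x0 0 i) e) (fun=> 0%N) M).
have [_ _ _ li] := schwartz_nice sl.
have := cmeasZ (cd^-1)%:C (cmeas_fourier li); congr cmeas; apply/funext => p.
rewrite fourier_localized (_ : \prod_(i < d) _ = 1) ?mulr1; last by apply: big1 => i _; rewrite expr0.
rewrite (_ : monom _ p = 1); last by rewrite /monom big1// => i _; rewrite expr0.
by rewrite mulrA -rmorphM mulVf ?mul1r// gt_eqF// fourier_cst_gt0.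
Qed.

Lemma mfun_innerr y : mfun (inner y).
by rewrite (_ : inner y = (fun p => inner p y)); [side|apply/funext => p; exact: innerC]. Qed.

Lemma real_factor_integrable nu (q : Rd -> R) (K : R) a : gevrey leb nu height ->
  mfun q -> 0 <= K -> (forall p, `|q p| <= K * height p ^+ a) ->
  gevrey leb (fun p => nu p * (q p)%:C) height /\ cL1 leb (fun p => nu p * (q p)%:C).
move=> gn mq K0 qK.
have h0 p : 0 <= height p := le_trans ler01 (height_ge1 p).
have G : gevrey leb (fun p => nu p * (q p)%:C) height.
  apply: (@gevrey_mul _ _ _ leb nu height (fun p => (q p)%:C) K a) => //; first exact: mfun_height.
    by side.
  by move=> p; rewrite nc_real.
by split => //; exact: gevrey_integrable G.
Qed.

Lemma mfun_monom k : mfun (monom k).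
apply: continuous_measurable_rV.
apply: (@continuous_prodr R d 'I_d (index_enum _) xpredT (fun i x => x 0 i ^+ k i)) => i.
elim: (k i) => [|n ih]; first by under eq_fun do rewrite expr0; exact: cst_continuous.
by under eq_fun do rewrite exprS; apply: contM => //; side.
Qed.

Lemma monom_le k p : `|monom k p| <= height p ^+ (\sum_(i < d) k i).
rewrite /monom normr_prod -prodrXr; apply: ler_prod => i _.
rewrite normr_ge0 normrX lerXn2r// ?coord_le_height//.
exact: le_trans (height_ge1 p).
Qed.

Lemma monom_incr k i n p : monom (fun j => k j + (j == i) * n)%N p = p 0 i ^+ n * monom k p.
rewrite /monom (bigD1 i)//= [in RHS](bigD1 i)//= eqxx mul1n exprD mulrA [_ ^+ n * _]mulrC.
congr (_ * _); apply: eq_bigr => j /negbTE ji; by rewrite ji addn0.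
Qed.

Lemma omega_le_height m p : 0 <= m -> omega m p <= (1 + m) * height p.
move=> m0; rewrite -(@ler_pXn2r _ 2) ?nnegrE ?omega_ge0//; last first.
  have h0 := le_trans ler01 (height_ge1 p); by side.
rewrite omega_sqr; have := eucl2_le_height p; have := eucl2_ge0 p.
nra.
Qed.

Lemma coord_le_omega m p i : `|p 0 i| <= omega m p.
rewrite -(@ler_pXn2r _ 2) ?nnegrE ?omega_ge0// omega_sqr real_normK ?num_real//.
by rewrite (le_trans (eucl2_coord p i))// lerDr sqr_ge0.
Qed.

Lemma inner_le_omega m y p : `|inner y p| <= (\sum_(i < d) `|y 0 i|) * omega m p.
rewrite mulr_suml /inner; apply: (le_trans (ler_norm_sum _ _ _)); apply: ler_sum => i _.
by rewrite normrM ler_wpM2l// coord_le_omega.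
Qed.

Section moments.
Variables (nu : Rd -> R[i]) (m : R).
Hypothesis m0 : 0 <= m.
Hypothesis gnu : gevrey leb nu height.
Hypothesis z0 : forall k, cint leb (fun p => nu p * (monom k p)%:C) = 0.
Hypothesis z1 : forall k, cint leb (fun p => nu p * (monom k p * omega m p)%:C) = 0.

Let term k l y n p : R := monom k p * omega m p ^+ l * inner y p ^+ n.

Let mterm k l y n : mfun (term k l y n).
apply: measurable_funM; last by apply: measurable_funX; exact: mfun_innerr.
by apply: measurable_funM; [exact: mfun_monom|side].
Qed.

Let iterm k l y n : gevrey leb (fun p => nu p * (term k l y n p)%:C) height /\
  cL1 leb (fun p => nu p * (term k l y n p)%:C).
pose Y := \sum_(i < d) `|y 0 i|; have Y0 : 0 <= Y by rewrite sumr_ge0.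
apply: (@real_factor_integrable nu _ ((1 + m) ^+ l * (Y * (1 + m)) ^+ n) (\sum_(i < d) k i + l + n)) => //.
  by side.
move=> p; rewrite /term !normrM !normrX !exprD (ger0_norm (omega_ge0 m p)).
have h0 : 0 <= height p := le_trans ler01 (height_ge1 p).
have W := omega_le_height p m0; have M := monom_le k p.
have I : `|inner y p| <= Y * (1 + m) * height p.
  by apply: (le_trans (inner_le_omega m y p)); rewrite -mulrA ler_wpM2l.
rewrite (_ : _ * _ * (_ * _ * _) = height p ^+ (\sum_(i < d) k i) * ((1 + m) * height p) ^+ l * (Y * (1 + m) * height p) ^+ n); last first.
  by rewrite [((1 + m) * height p) ^+ l]exprMn [(Y * (1 + m) * height p) ^+ n]exprMn; ring.
have q0 : 0 <= (1 + m) * height p by side.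
have q1 : 0 <= Y * (1 + m) * height p by side.
apply: ler_pM; rewrite ?mulr_ge0 ?exprn_ge0 ?omega_ge0//; last by rewrite lerXn2r; side.
by apply: ler_pM; rewrite ?exprn_ge0 ?omega_ge0// lerXn2r ?nnegrE ?omega_ge0.
Qed.

(** The square of omega_m is a polynomial, so the powers 0 and 1 of omega_m imply the vanishing for
    all powers. *)
Let z2 l : forall k, cint leb (fun p => nu p * (monom k p * omega m p ^+ l)%:C) = 0.
have T k j p : nu p * (monom k p * omega m p ^+ j)%:C = nu p * (term k j 0 0 p)%:C.
  by rewrite /term mulr1.
have I k j : cL1 leb (fun p => nu p * (monom k p * omega m p ^+ j)%:C).
  by apply: eq_cintegrable (iterm k j 0 0).2 _ => p; rewrite T.
elim/ltn_ind: l => [[|[|l]]] ih k.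
- by rewrite -[RHS](z0 k); apply: eq_cint => p; rewrite mulr1.
- by [].
have E p : nu p * (monom k p * omega m p ^+ l.+2)%:C =
    (m ^+ 2)%:C * (nu p * (monom k p * omega m p ^+ l)%:C) +
    \sum_(i < d) nu p * (monom (fun j => k j + (j == i) * 2)%N p * omega m p ^+ l)%:C.
  transitivity (nu p * (m ^+ 2 * (monom k p * omega m p ^+ l) +
    \sum_(i < d) monom (fun j => k j + (j == i) * 2)%N p * omega m p ^+ l)%:C).
    congr (_ * _%:C); under eq_bigr do rewrite monom_incr.
    rewrite -addn2 exprD omega_sqr -!mulr_suml /eucl2 /inner.
    by ring.
  by rewrite rmorphD rmorph_sum mulrDr mulr_sumr; congr (_ + _); ring.
rewrite (eq_cint _ E) cintD; last 2 first.
- by side.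
- by apply: cL1_sum.
by rewrite cintZ// cint_sum// ih// mulr0 add0r big1// => i _; rewrite ih.
Qed.

Let z3 y n : forall k l, cint leb (fun p => nu p * (term k l y n p)%:C) = 0.
elim: n => [|n ih] k l.
  by rewrite -[RHS](z2 l k); apply: eq_cint => p; rewrite /term mulr1.
have E p : nu p * (term k l y n.+1 p)%:C =
    \sum_(i < d) (y 0 i)%:C * (nu p * (term (fun j => k j + (j == i) * 1)%N l y n p)%:C).
  under eq_bigr do rewrite mulrCA -rmorphM.
  rewrite -mulr_sumr -rmorph_sum; congr (_ * _%:C); rewrite /term exprS.
  rewrite {1}/inner mulrCA mulr_suml; apply: eq_bigr => i _.
  by rewrite monom_incr; ring.
rewrite (eq_cint _ E) cint_sum => [|i]; last by apply: cL1Z; exact: (iterm _ l y n).2.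
by rewrite big1// => i _; rewrite cintZ ?ih ?mulr0//; exact: (iterm _ l y n).2.
Qed.

(** For fixed y and n the density nu <y, p>^n has vanishing moments in omega_m, so its integral
    against exp(-omega_m) is 0. The factor exp(-omega_m) lowers the growth of the moments in <y, p>
    to n!, and the problem in d variables becomes the vanishing of the Fourier transform of nu
    exp(-omega_m). *)
Lemma moments_eq0 : {ae leb, forall p, nu p = 0}.
have inu := gevrey_integrable gnu.
have mnu := cL1_meas inu; pose ne p := nu p * (expR (- omega m p))%:C.
have meo : mfun (fun p => expR (- omega m p)).
  apply: measurableT_comp => //; side.
have e1 p : `|expR (- omega m p)| <= 1 by rewrite ger0_norm ?expR_ge0// expR_le1 oppr_le0 omega_ge0.
have mu' : cmeas ne by apply: cmeasM => //; side.
have iu : cL1 leb ne.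
  apply: cL1_le (cint_nc inu) => // p.
  by rewrite /ne ncM nc_real ler_piMr; side.
have q0 p : 0 < 1 + m by rewrite ltr_pwDl.
have zexp y n : cint leb (fun p => nu p * (inner y p ^+ n)%:C * (expR (- omega m p))%:C) = 0.
  have [G _] := iterm (fun=> 0%N) 0 y n.
  have E p : term (fun=> 0%N) 0 y n p = inner y p ^+ n.
    by rewrite /term expr0 mulr1 /monom big1 ?mul1r// => i _; rewrite expr0.
  pose W p := (1 + m) * height p.
  have GW : gevrey leb (fun p => nu p * (inner y p ^+ n)%:C) W.
    have e : 0 <= 1 + m by side.
    apply: gevrey_scale e _; move: G; congr gevrey; apply/funext => p; by rewrite E.
  apply: (@stieltjes_exp _ _ _ leb W (omega m)) => //.
  - by apply: measurable_funM => //; exact: mfun_height.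
  - move=> p; apply: le_trans (height_ge1 p) _; rewrite /W ler_peMl ?lerDl//.
    exact: le_trans ler01 (height_ge1 p).
  - by side.
  - by side.
  - by move=> p; exact: omega_le_height.
  - move=> k; rewrite -[RHS](z3 y n (fun=> 0%N) k); apply: eq_cint => p.
    rewrite /term -mulrA -rmorphM /monom big1 ?mul1r; last by move=> i _; rewrite expr0.
    by rewrite mulrC [in RHS]mulrC; congr (_ * _); rewrite mulrC.
have zcos y phi : cint leb (fun p => ne p * (cos (1 * inner y p + phi))%:C) = 0.
  pose Y := \sum_(i < d) `|y 0 i|; have Y0 : 0 <= Y by rewrite sumr_ge0.
  have ms := mfun_innerr.
  apply: (@phase_step _ _ _ leb ne (fun p => inner y p) (\int[leb]_p nc (nu p)) Y) => //.
  - by side.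
  - move=> n.
    have le p : nc (ne p) * `|inner y p| ^+ n <= Y ^+ n * n`!%:R * nc (nu p).
      rewrite /ne ncM nc_real ger0_norm ?expR_ge0// -mulrA [leRHS]mulrC ler_wpM2l ?nc_ge0//.
      apply: (@le_trans _ _ (expR (- omega m p) * (Y * omega m p) ^+ n)).
        by rewrite ler_wpM2l ?expR_ge0// lerXn2r ?nnegrE ?mulr_ge0 ?omega_ge0// inner_le_omega.
      rewrite exprMn mulrCA ler_wpM2l ?exprn_ge0// expRN mulrC ler_pdivrMr ?expR_gt0//.
      exact: expR_ge_pow (omega_ge0 m p).
    have I2 := L1Z (Y ^+ n * n`!%:R) (cint_nc inu).
    have I : L1 leb (fun p => nc (ne p) * `|inner y p| ^+ n).
      apply: le_L1 I2 => [|p]; last by rewrite ger0_norm// mulr_ge0; side.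
      apply: measurable_funM; first side.
      by apply/measurable_funX/measurableT_comp.
    split => //; rewrite (_ : _ * Y ^+ n * _ = \int[leb]_p (Y ^+ n * n`!%:R * nc (nu p))).
      exact: le_Rintegral.
    by rewrite RintZ ?(cint_nc inu)//; ring.
  - move=> j; rewrite -[RHS](mulr0 (cos (phi + j%:R * (pi / 2)))%:C) -(zexp y j) -cintZ.
      apply: eq_cint => p; rewrite /ne /phase mul0r add0r !rmorphM.
      by rewrite [RHS]mulrCA mulrA mulrACA; ring.
    apply: eq_cintegrable (@cL1_bound _ _ _ leb (fun p => nu p * (term (fun=> 0%N) 0 y j p)%:C) (fun p => (expR (- omega m p))%:C) 1 (iterm _ _ y j).2 _ _) _ => [|p|p].
    + by side.
    + by rewrite nc_real.
    + rewrite /term expr0 mulr1 /monom big1 ?mul1r 1?mulrC// => i _; by rewrite expr0.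
have ft0 y : fourier ne y = 0.
  rewrite fourierE (_ : cint _ _ = 0) ?mulr0//.
  have mI (h : Rd -> R) : mfun h -> cL1 leb (fun p => ne p * (cos (h p))%:C).
    move=> mh; apply: eq_cintegrable (@cL1_bound _ _ _ leb _ (fun p => (cos (h p))%:C) 1 iu _ _) _ => [|p|p].
    - apply: cmeas_real; apply: (measurableT_comp (f := @cos R)) => //.
      by apply: continuous_measurable_fun; exact: continuous_cos.
    - by rewrite nc_real cos_max.
    - by rewrite mulrC.
  have ms := mfun_innerr.
  have E p : ne p * cis (- inner p y) =
      ne p * (cos (1 * inner y p + 0))%:C +
      (- 'i) * (ne p * (cos (1 * inner y p + - (pi / 2)))%:C).
    rewrite mulrCA -mulrDr; congr (_ * _); rewrite !mul1r addr0 cosBpihalf innerC.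
    by apply: complex_eqP; rewrite /cis /= ?cosN ?sinN; ring.
  rewrite (eq_cint _ E) cintD; last 2 first.
  - by apply: mI; side.
  - by apply/cL1Z/mI; side.
  rewrite cintZ; last by apply: mI; side.
  by rewrite !zcos mulr0 addr0.
have := fourier_eq0 iu ft0; apply: filterS => p /eqP.
rewrite mulf_eq0 => /orP[/eqP//|/eqP h].
have h' : expR (- omega m p) = 0 := congr1 (fun z : R[i] => Re z) h.
by have := expR_gt0 (- omega m p); rewrite h' ltxx.
Qed.

End moments.

(** This is anti-locality of omega_m: if the Fourier transforms of v and of omega_m v both vanish
    near x0, then v = 0. For each width e the product of v with the transform of the bump has
    moments of Gevrey size and vanishes; shrinking e removes the zeros of that transform. *)
Theorem local_transform_unique (v : Rd -> R[i]) N m (x0 : Rd) (r : R) : cmeas v ->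
  L1 leb (fun p => nc (v p) / (1 + eucl2 p) ^+ N) -> 0 <= m -> 0 < r ->
  (forall e k, 0 < e -> e <= r ->
    cint leb (fun p => v p * fourier (fun x => (localized x0 e k x)%:C) p) = 0 /\
    cint leb (fun p => v p * ((omega m p)%:C * fourier (fun x => (localized x0 e k x)%:C) p)) = 0) ->
  {ae leb, forall p, v p = 0}.
move=> mv Iv m0 r0 hv.
have step e : 0 < e -> e <= r -> {ae leb, forall p, v p * local_hat x0 e p = 0}.
  move=> e0 er; have [C [A [C0 A0 bd]]] := local_hat_bound x0 e.
  have h0 p : 0 <= height p := le_trans ler01 (height_ge1 p).
  have w0 p : 0 < (1 + eucl2 p) ^+ N by side.
  have mnu : cmeas (fun p => v p * local_hat x0 e p) by apply: cmeasM => //; exact: cmeas_local_hat.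
  have gn : gevrey leb (fun p => v p * local_hat x0 e p) height.
    split => //; pose I0 := \int[leb]_p (nc (v p) / (1 + eucl2 p) ^+ N).
    have I00 : 0 <= I0 by apply: Rintegral_ge0 => p _; side.
    exists (C * (2 * (2 * A)) ^+ N.*2 * (N.*2)`!%:R ^+ 2 * I0), (2 * (2 * A)); split => [||n].
    - by side.
    - by side.
    pose D := C * A ^+ (n + N.*2) * (n + N.*2)`!%:R ^+ 2.
    have le p : nc (v p * local_hat x0 e p) * height p ^+ n <= D * (nc (v p) / (1 + eucl2 p) ^+ N).
      rewrite ncM -mulrA [leRHS]mulrCA ler_wpM2l ?nc_ge0// ler_pdivlMr//.
      apply: le_trans (bd (n + N.*2)%N p); rewrite exprD mulrA ler_wpM2l ?mulr_ge0 ?nc_ge0 ?exprn_ge0//.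
      have q1 : 0 <= 1 + eucl2 p by side.
      have q2 : 0 <= height p ^+ 2 by side.
      by rewrite -muln2 mulnC exprM lerXn2r ?nnegrE// eucl2_le_height.
    have I2 := L1Z D Iv.
    have I : L1 leb (fun p => nc (v p * local_hat x0 e p) * height p ^+ n).
      apply: le_L1 I2 => [|p]; last by rewrite ger0_norm// mulr_ge0; side.
      apply: measurable_funM; first side.
      by apply: measurable_funX; exact: mfun_height.
    split => //; apply: (@le_trans _ _ (D * I0)).
      by rewrite -RintZ//; exact: le_Rintegral.
    rewrite (_ : _ * I0 * _ * _ = C * (2 * (2 * A)) ^+ N.*2 * (N.*2)`!%:R ^+ 2 * ((2 * (2 * A)) ^+ n * n`!%:R ^+ 2) * I0); last by ring.
    by rewrite ler_wpM2r//; exact: gevrey_const.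
  have c0 k : cd%:C * \prod_(i < d) 'i ^+ k i != 0.
    rewrite mulf_neq0//.
      apply/eqP => /(congr1 (fun z : R[i] => Re z)) /= /eqP; rewrite gt_eqF//; exact: fourier_cst_gt0.
    apply/prodf_neq0 => i _; apply: expf_neq0.
    by apply/eqP => /(congr1 (fun z : R[i] => Im z)) /= /eqP; rewrite oner_eq0.
  have iM k (q : Rd -> R) a : mfun q -> (forall p, `|q p| <= (1 + m) * height p ^+ a) ->
      cL1 leb (fun p => v p * local_hat x0 e p * (monom k p * q p)%:C).
    move=> mq qa; apply: (@real_factor_integrable _ _ (1 + m) (\sum_(i < d) k i + a) gn _ _ _).2 => [||p].
    - by apply: measurable_funM => //; exact: mfun_monom.
    - by side.
    - rewrite normrM exprD mulrCA; apply: ler_pM => //; exact: monom_le.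
  apply: (moments_eq0 m0 gn) => k; have [h1 h2] := hv e k e0 er; apply: (mulfI (c0 k)); rewrite mulr0 -cintZ.
  - rewrite -[RHS]h1; apply: eq_cint => p; rewrite fourier_localized; ring.
  - apply: eq_cintegrable (iM k (fun=> 1) 0%N _ _) _ => [|p|p]; rewrite ?mulr1//.
    by rewrite normr1 ?expr0 ?mulr1 lerDl.
  - rewrite -[RHS]h2; apply: eq_cint => p; rewrite fourier_localized real_complexM; ring.
  - apply: (iM _ _ 1%N); first side.
    by move=> p; rewrite expr1 ger0_norm ?omega_ge0//; exact: omega_le_height.
have : {ae leb, forall p, forall n, v p * local_hat x0 (r / n.+1%:R) p = 0}.
  apply: ae_foralln => n; apply: step; first by side.
  by rewrite ler_pdivrMr ?ltr0n// ler_peMr ?(ltW r0)// ler1n.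
apply: filterS => p h.
(* Chosen for the given p so that the width e = r / (n + 1) satisfies |p_i| e <= 1 for all i, where
   the transform of the bump is nonzero. *)
pose n := Num.truncn (r * (\sum_(i < d) `|p 0 i|)).
have q : local_hat x0 (r / n.+1%:R) p != 0.
  apply: local_hat_neq0 => [|i]; first by side.
  rewrite mulrA ler_pdivrMr ?ltr0n// mul1r; apply: le_trans (ltW (truncnS_gt _)).
  by rewrite mulrC ler_wpM2l ?(ltW r0)// (bigD1 i)//= lerDl sumr_ge0.
by have := h n => /eqP; rewrite mulf_eq0 (negbTE q) orbF => /eqP.
Qed.

End uniqueness.

(** * An integrable function on the half-line *)

Section line_majorant.
Context (R : realType).
Local Notation mu := (@lebesgue_measure R).

Definition root4 (t : R) : R := Num.sqrt (Num.sqrt t).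

(** Of order t^(-3/4) at 0 and t^(-5/4) at infinity. In the variable r = t^(1/4), ell(t) dt is 4 dr
    / (1 + r)^2, whence the primitive [ell_prim]. For t <= 0 the conventions on roots and inverses
    give 0. *)
Definition ell (t : R) : R := (root4 t ^+ 3 * (1 + root4 t) ^+ 2)^-1.

Lemma root4_ge0 t : 0 <= root4 t. exact: sqrtr_ge0. Qed.

Lemma root4_gt0 t : 0 < t -> 0 < root4 t. by move=> t0; rewrite !sqrtr_gt0. Qed.

Lemma ell_ge0 t : 0 <= ell t.
by rewrite invr_ge0 mulr_ge0 ?exprn_ge0 ?addr_ge0 ?root4_ge0. Qed.

Lemma ell_neg t : t <= 0 -> ell t = 0.
by move=> t0; rewrite /ell /root4 (ler0_sqrtr t0) sqrtr0 expr0n /= mul0r invr0.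
Qed.

Lemma continuous_root4 : continuous root4.
by move=> t; apply: continuous_comp; exact: sqrt_continuous. Qed.

Lemma mfun_root4 : mfun root4.
exact: continuous_measurable_fun continuous_root4. Qed.

Lemma mfun_ell : mfun ell.
apply: mfun_funV.
apply: measurable_funM; apply: measurable_funX; first exact: mfun_root4.
by apply: measurable_funD => //; exact: mfun_root4.
Qed.

Definition ell_prim (t : R) : R := 4 * (1 - (1 + root4 t)^-1).

Lemma ell_primP (t : R) : 0 < t -> is_derive t 1 ell_prim (ell t).
move=> t0; have s0 : 0 < Num.sqrt t by side.
have d2 := is_derive1_sqrt s0.
have d3 : is_derive t 1 root4 ((2 * Num.sqrt (Num.sqrt t))^-1 * (2 * Num.sqrt t)^-1) := der_comp d2 (is_derive1_sqrt t0).
have q0 : 1 + root4 t != 0 by rewrite gt_eqF// ltr_pwDl// root4_ge0.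
have d5 := is_deriveV (f := fun y => cst 1 y + root4 y) q0 (derD (is_derive_cst (1 : R) t 1) d3).
apply: (is_derive_eq (derZ 4 (derD (is_derive_cst (1 : R) t 1) (derN d5)))); rewrite /GRing.scale /= /ell -/(root4 t).
have -> : Num.sqrt t = root4 t ^+ 2 by rewrite sqr_sqrtr//.
have r0 : root4 t != 0 by rewrite gt_eqF// root4_gt0.
by field; rewrite r0 q0.
Qed.

(** The integral over [1/(n+2), n+2] is an increment of the primitive, at most 4; Fatou's lemma
    exhausts the half-line without touching the singularity at 0. *)
Lemma L1_ell : L1 mu ell.
pose e n : R := n.+2%:R^-1.
have e0 n : 0 < e n by rewrite invr_gt0.
have en_lt n : e n < n.+2%:R by rewrite (@lt_trans _ _ 1)// ?ltr1n// invf_lt1 ?ltr1n.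
pose f n t : R := ell t * \1_(`[e n, n.+2%:R]%classic) t.
have fi n : (\int[mu]_t (f n t)%:E <= 4%:E)%E.
  have -> : (\int[mu]_t (f n t)%:E = \int[mu]_(t in `[e n, n.+2%:R]) (ell t)%:E)%E.
    rewrite [RHS]integral_mkcond; apply: eq_integral => t _; rewrite patchE /f indicE.
    by case: ifP => _; rewrite ?mulr1 ?mulr0.
  have pos t : t \in `[e n, n.+2%:R] -> 0 < t by rewrite in_itv /= => /andP[h _]; exact: lt_le_trans h.
  have cF t : t \in `[e n, n.+2%:R] -> {for t, continuous ell_prim}.
    by move=> /pos /ell_primP; exact: der_continuous.
  rewrite (@continuous_FTC2 _ ell ell_prim)//.
  - rewrite -EFinB lee_fin /ell_prim.
    have h1 : 0 <= (1 + root4 (n.+2%:R : R))^-1 by rewrite invr_ge0 addr_ge0 ?root4_ge0.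
    have h2 : (1 + root4 (e n))^-1 <= 1 by rewrite invf_le1 ?lerDl ?root4_ge0// ltr_pwDl ?root4_ge0.
    lra.
  - apply: continuous_in_subspaceT => t; rewrite inE /= => /pos t0.
    apply: cvgV.
      by rewrite gt_eqF// mulr_gt0 ?exprn_gt0 ?root4_gt0// ltr_pwDl// root4_ge0.
    have cr : root4 x @[x --> t] --> root4 t by apply: continuous_root4.
    rewrite expr2 exprS expr2; under eq_fun do rewrite expr2 exprS expr2.
    have cr1 : 1 + root4 x @[x --> t] --> 1 + root4 t by apply: cvgD => //; exact: cvg_cst.
    by apply: cvgM; apply: cvgM => //; exact: cvgM.
  - split.
    + by move=> t; rewrite in_itv /= => /andP[h _]; case: (ell_primP (lt_trans (e0 n) h)).
    + by apply/cvg_at_right_filter/cF; rewrite in_itv /= lexx ltW.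
    + by apply/cvg_at_left_filter/cF; rewrite in_itv /= lexx ltW.
  - move=> t; rewrite in_itv /= => /andP[h _]; rewrite derive1E.
    by have [_ ->] := ell_primP (lt_trans (e0 n) h).
have mf n : mfun (f n).
  by apply: measurable_funM; [exact: mfun_ell|side].
have F : (\int[mu]_t (ell t)%:E <= 4%:E)%E.
  apply: (@fatou_bound _ _ _ mu f ell 4) => // [n t|t].
    by rewrite mulr_ge0 ?ell_ge0.
  have [t0|t0] := leP t 0.
    rewrite (_ : (fun n => f n t) = cst (ell t)); first exact: cvg_cst.
    by apply/funext => n; rewrite /f ell_neg// mul0r.
  apply: cvg_near_cst; near=> n; rewrite /f indicE mem_set ?mulr1//= in_itv /=; apply/andP; split.
    rewrite /e -[leRHS]invrK lef_pV2 ?posrE ?invr_gt0//; near: n.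
    exists (Num.truncn t^-1) => // k /= hk; apply: ltW; apply: lt_le_trans (truncnS_gt _) _.
    rewrite ler_nat ltnS; exact: leqW hk.
  near: n; exists (Num.truncn t) => // k /= hk; apply: ltW; apply: lt_le_trans (truncnS_gt _) _.
  rewrite ler_nat ltnS; exact: leqW hk.
apply/integrableP; split; first by apply/measurable_EFinP; exact: mfun_ell.
under eq_integral do rewrite /= ger0_norm ?ell_ge0//.
by apply: (le_lt_trans F); rewrite ltry.
Unshelve. all: by end_near. Qed.

Lemma L1_ell_norm : L1 mu (fun t => ell `|t|).
have n1 : (-1 : R) != 0 by [].
have p1 : 0 < (`|-1 : R|^-1) by rewrite invr_gt0 normr_gt0.
apply: le_L1 (L1D L1_ell (Rintegrable_push (mfun_affine (-1) 0) p1 (fun A mA => lebesgue_affine 0 n1 mA) L1_ell)) => [|t].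
  by apply: measurableT_comp; [exact: mfun_ell|side].
rewrite (ger0_norm (ell_ge0 _)); have [t0|t0] := leP 0 t.
  by rewrite (ger0_norm t0) /= lerDl ell_ge0.
by rewrite (ltr0_norm t0) /= add0r mulN1r lerDr ell_ge0.
Qed.

End line_majorant.

(** * Comparison of the weights with a product majorant *)

Section majorant.
Context (R : realType) (d : nat).
Hypothesis hd : d = 2%N \/ d = 3%N.
Local Notation Rd := 'rV[R]_d.
Local Notation leb := (leb R d).
Implicit Types (p : Rd).

(** The product form makes integrability a matter of one variable. 64 = 4^3 absorbs the factors (1 +
    r)^2 <= 4 max(1, r^2) of at most three coordinates in the lower bounds of [majorantP]. *)
Definition majorant p : R := 64 * \prod_(i < d) ell `|p 0 i|.

Lemma majorant_ge0 p : 0 <= majorant p.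
by rewrite mulr_ge0// prodr_ge0// => i _; exact: ell_ge0. Qed.

Lemma L1_majorant : L1 leb majorant.
apply: L1Z.
by have [h _] := @Rint_prodf R d (fun _ t => ell `|t|) (fun _ => L1_ell_norm R).
Qed.

(** As [ell] decreases on the positive axis and |p_i| <= |p|, the product is at least (r^3 (1 +
    r)^2)^(-d) with r = |p|^(1/4). Comparing powers of r requires 3 d >= 6 near 0 and 5 d <= 16 at
    infinity, that is d = 2 or d = 3. *)
Lemma majorantP : {ae leb, forall p, [/\ 0 < omega 0 p,
  omega 0 p <= 1 -> 1 <= majorant p * (omega 0 p * Num.sqrt (omega 0 p)) &
  1 <= omega 0 p -> 1 <= majorant p * omega 0 p ^+ 4]}.
(* [ell] is 0 at 0, so the points with a vanishing coordinate are discarded. *)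
have h : {ae leb, forall p i, p 0 i != 0}.
  have h n : {ae leb, forall p, forall i : 'I_d, val i = n -> p 0 i != 0}.
    have [nd|nd] := ltnP n d; last first.
      by apply: nearW => p i e; move: (ltn_ord i); rewrite -[nat_of_ord i]/(val i) e ltnNge nd.
    apply: filterS (ae_coord_neq (Ordinal nd) 0) => p h i e.
    by rewrite (_ : i = Ordinal nd)//; exact: val_inj.
  by apply: filterS (ae_foralln h) => p hp i; exact: hp (val i) i erefl.
apply: filterS h => p p0.
pose r := root4 (omega 0 p).
have a0 : 0 < omega 0 p.
  have [i _] : exists i : 'I_d, true by case: hd => ->; exists ord0.
  by apply: lt_le_trans (coord_le_omega 0 p i); rewrite normr_gt0.
have r0 : 0 < r := root4_gt0 a0.
have q2 : Num.sqrt (omega 0 p) = r ^+ 2 by rewrite sqr_sqrtr// sqrtr_ge0.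
have q4 : omega 0 p = r ^+ 4 by rewrite -[LHS](sqr_sqrtr (omega_ge0 0 p)) q2 -exprM.
have le1 i : (r ^+ 3 * (1 + r) ^+ 2)^-1 <= ell `|p 0 i|.
  have u0 : 0 < root4 `|p 0 i| by rewrite root4_gt0// normr_gt0.
  have ur : root4 `|p 0 i| <= r by rewrite !ler_wsqrtr// coord_le_omega.
  rewrite lef_pV2 ?posrE ?mulr_gt0 ?exprn_gt0// ?ltr_pwDl ?(ltW u0) ?(ltW r0)//.
  by apply: ler_pM; rewrite ?exprn_ge0 ?addr_ge0 ?(ltW u0)// lerXn2r ?nnegrE ?addr_ge0 ?(ltW u0) ?(ltW r0)// lerD2l.
have prd : ((r ^+ 3 * (1 + r) ^+ 2)^-1) ^+ d <= \prod_(i < d) ell `|p 0 i|.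
  rewrite -[X in _ ^+ X](card_ord d) -prodr_const; apply: ler_prod => i _.
  by side.
set P := \prod_(i < d) _ in prd.
have D0 : 0 < r ^+ 3 * (1 + r) ^+ 2 by side.
have {}prd : 1 <= P * (r ^+ 3 * (1 + r) ^+ 2) ^+ d.
  by rewrite -ler_pdivrMr ?exprn_gt0// div1r -exprVn.
have P0 : 0 <= P by apply: prodr_ge0 => i _; exact: ell_ge0.
have rk k : 0 <= r ^+ k by side.
split => // ha.
- have r1 : r <= 1 by rewrite -(@ler_pXn2r _ 4) ?nnegrE ?(ltW r0)// expr1n -q4.
  rewrite q2 q4 -exprD /majorant -/P; apply: (le_trans prd).
  rewrite (_ : 64 * P * r ^+ (4 + 2) = P * (64 * r ^+ 6)); last by ring.
  rewrite ler_wpM2l//; have q : (1 + r) ^+ 2 <= 4 by nra.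
  apply: (@le_trans _ _ ((r ^+ 3 * 4) ^+ d)).
    by rewrite lerXn2r ?nnegrE ?(ltW D0) ?(mulr_ge0 (rk 3))// ler_wpM2l.
  case: hd => ->; rewrite exprMn -exprM mulrC.
    by rewrite ler_wpM2r// -natrX ler_nat.
  by rewrite -natrX ler_wpM2l// ler_wiXn2l; side.
- have r1 : 1 <= r by rewrite -(@ler_pXn2r _ 4) ?nnegrE ?(ltW r0)// expr1n -q4.
  rewrite q4 -exprM /majorant -/P; apply: (le_trans prd).
  rewrite (_ : 64 * P * r ^+ (4 * 4) = P * (64 * r ^+ 16)); last by ring.
  rewrite ler_wpM2l//; have q : (1 + r) ^+ 2 <= 4 * r ^+ 2 by nra.
  apply: (@le_trans _ _ ((r ^+ 3 * (4 * r ^+ 2)) ^+ d)).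
    by rewrite lerXn2r ?nnegrE ?(ltW D0) ?(mulr_ge0 (rk 3) (mulr_ge0 _ (rk 2)))// ler_wpM2l.
  rewrite mulrCA -exprD; case: hd => ->; rewrite exprMn -exprM -natrX; apply: ler_pM => //.
  - by rewrite ler_nat.
  - by rewrite ler_weXn2l.
  - by rewrite ler_weXn2l.
Qed.

Section pointwise.
Variables (m : R) (p : Rd).
Hypothesis m0 : 0 <= m.
Hypothesis a0 : 0 < omega 0 p.
Hypothesis hA : omega 0 p <= 1 -> 1 <= majorant p * (omega 0 p * Num.sqrt (omega 0 p)).
Hypothesis hB : 1 <= omega 0 p -> 1 <= majorant p * omega 0 p ^+ 4.

Local Notation a := (omega 0 p).
Local Notation W := (omega m p).
Local Notation w := (omega 1 p).
Local Notation L := (majorant p).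

Lemma a_sqr : a ^+ 2 = eucl2 p. by rewrite omega_sqr expr0n add0r. Qed.

Lemma W_sqr : W ^+ 2 = m ^+ 2 + a ^+ 2. by rewrite a_sqr omega_sqr. Qed.

Lemma w_sqr : w ^+ 2 = 1 + a ^+ 2. by rewrite a_sqr omega_sqr expr1n. Qed.

Lemma a_le_W : a <= W.
by rewrite -(@ler_pXn2r _ 2) ?nnegrE ?omega_ge0// W_sqr lerDr sqr_ge0. Qed.

Lemma W_gt0 : 0 < W. exact: lt_le_trans a0 a_le_W. Qed.

Lemma w_ge1 : 1 <= w. exact: omega1_ge1. Qed.

Lemma a_le_w : a <= w.
by rewrite -(@ler_pXn2r _ 2) ?nnegrE ?omega_ge0// w_sqr lerDr. Qed.

Lemma W_le_ma : W <= m + a.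
rewrite -(@ler_pXn2r _ 2) ?nnegrE ?omega_ge0 ?addr_ge0 ?(ltW a0)// W_sqr sqrrD.
rewrite lerD2r lerDl mulrn_wge0////; side.
Qed.

Lemma W_le_w : W <= (1 + m) * w.
apply: (le_trans W_le_ma); rewrite mulrDl mul1r addrC; apply: lerD; first exact: a_le_w.
by rewrite ler_peMr// w_ge1.
Qed.

Lemma w_le2 : a <= 1 -> w <= 2.
move=> h; rewrite -(@ler_pXn2r _ 2) ?nnegrE ?omega_ge0// w_sqr.
have : a ^+ 2 <= 1 by rewrite exprn_ile1// ltW.
lra.
Qed.

Lemma w_le2a : 1 <= a -> w <= 2 * a.
move=> h; rewrite -(@ler_pXn2r _ 2) ?nnegrE ?omega_ge0 ?mulr_ge0 ?(ltW a0)// w_sqr.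
have : 1 <= a ^+ 2 by rewrite exprn_ege1.
rewrite exprMn; lra.
Qed.

Lemma W_sub_le : 1 <= a -> W - a <= m ^+ 2 / a.
move=> h; have Wa : (W - a) * (W + a) = m ^+ 2 by rewrite -subr_sqr W_sqr addrK.
rewrite ler_pdivlMr// -Wa ler_wpM2l ?subr_ge0 ?a_le_W// lerDr; side.
Qed.

Lemma small_a : a <= 1 -> a^-1 <= L /\ (a * Num.sqrt a)^-1 <= L /\ 1 <= L.
move=> h; have s0 : 0 < Num.sqrt a by side.
have s1 : Num.sqrt a <= 1 by rewrite -[leRHS]sqrtr1 ler_wsqrtr.
have q0 : 0 < a * Num.sqrt a by side.
have q : (a * Num.sqrt a)^-1 <= L by rewrite -div1r ler_pdivrMr// hA.
split; last split => //.
  by apply: le_trans q; rewrite lef_pV2// ler_piMr// ltW.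
apply: le_trans q; rewrite -[leLHS]invr1 lef_pV2 ?posrE// -[leRHS]mulr1 ler_pM// ltW//.
Qed.

Lemma large_a : 1 <= a -> (a ^+ 4)^-1 <= L.
by move=> h; rewrite -div1r ler_pdivrMr ?exprn_gt0// hB. Qed.

(** A Hardy inequality in weight form: the singularity 1/|p| becomes harmless on functions with
    bounded point values. *)
Lemma hardy_weight : w / a <= 2 + 2 * L.
have L0 := majorant_ge0 p; have [h|h] := leP a 1.
  have [h1 _] := small_a h; apply: (@le_trans _ _ (2 * a^-1)).
    by rewrite ler_wpM2r ?w_le2// invr_ge0 ltW.
  lra.
apply: (@le_trans _ _ 2); last by rewrite lerDl mulr_ge0.
by rewrite ler_pdivrMr// w_le2a// ltW.
Qed.

(** The weight a / w degenerates at 0. Where a <= r the majorant compensates with the small factor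
    r, which can be absorbed later; elsewhere the weight is at least r / 2. *)
Lemma poincare_weight (r : R) : 0 < r -> r <= 1 -> 1 <= r * L \/ 1 <= 2 / r * (a / w).
move=> r0 r1; have w0 : 0 < w := lt_le_trans ltr01 w_ge1.
have [h|h] := leP a r.
  left; have h1 := le_trans h r1; apply: (le_trans (hA h1)); rewrite mulrC ler_wpM2r ?majorant_ge0//.
  apply: le_trans h; rewrite ler_piMr ?(ltW a0)// -[leRHS]sqrtr1 ler_wsqrtr//.
right; rewrite mulf_div ler_pdivlMr ?mulr_gt0// mul1r.
have [h1|h1] := leP a 1.
  apply: (@le_trans _ _ (r * 2)); first by rewrite ler_wpM2l ?(ltW r0)// w_le2.
  by rewrite mulrC ler_wpM2l// ltW.
apply: (@le_trans _ _ (1 * (2 * a))); last by rewrite mul1r.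
by apply: ler_pM; rewrite ?(ltW r0) ?(ltW w0)// w_le2a// ltW.
Qed.

(** With t = 1 - a/W: for a <= 1, t lies between 0 and min(1, m/a), so t^2 <= sqrt(m/a), an exponent
    for which a^(-3/2) remains, integrable already in dimension 2. For a > 1, t <= m^2 / a^2. *)
Lemma a_weight : w / a * (1 - a / W) ^+ 2 <= 2 * (Num.sqrt m + m ^+ 4) * L.
have L0 := majorant_ge0 p; have W0 := W_gt0; have ai : 0 <= a^-1 by side.
pose t := 1 - a / W.
have tE : t = (W - a) / W by rewrite /t mulrBl divff// gt_eqF.
have t0 : 0 <= t by rewrite tE divr_ge0 ?subr_ge0 ?a_le_W// ltW.
have t1 : t <= 1 by rewrite /t gerBl divr_ge0// ltW.
have [h|h] := leP a 1.
  have [_ [h1 _]] := small_a h.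
  have tm : t <= m / a.
    rewrite tE ler_pdivlMr// mulrAC ler_pdivrMr//.
    by apply: ler_pM; rewrite ?subr_ge0 ?a_le_W ?(ltW a0)// lerBlDr W_le_ma.
  have t2 : t ^+ 2 <= Num.sqrt m / Num.sqrt a.
    have -> : Num.sqrt m / Num.sqrt a = Num.sqrt (m / a) by rewrite sqrtrM// sqrtrV// ltW.
    apply: (@le_trans _ _ (Num.sqrt t)); last by rewrite ler_wsqrtr.
    apply: (@le_trans _ _ t); first by rewrite ler_piMr.
    rewrite -{1}(sqr_sqrtr t0) ler_piMl// -[leRHS]sqrtr1 ler_wsqrtr//.
  apply: (@le_trans _ _ (2 * a^-1 * (Num.sqrt m / Num.sqrt a))).
    by apply: ler_pM; rewrite ?mulr_ge0 ?omega_ge0// ler_wpM2r// w_le2.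
  rewrite (_ : _ * _ * _ = 2 * Num.sqrt m * (a * Num.sqrt a)^-1); last by rewrite invfM; ring.
  apply: (@le_trans _ _ (2 * Num.sqrt m * L)); first by rewrite ler_wpM2l//; side.
  by rewrite ler_wpM2r// ler_wpM2l// lerDl exprn_ge0.
have h1 := large_a (ltW h).
have tm : t <= m ^+ 2 / a ^+ 2.
  rewrite tE ler_pdivrMr//; apply: (le_trans (W_sub_le (ltW h))).
  rewrite (_ : m ^+ 2 / a ^+ 2 * W = m ^+ 2 / a * (W / a)); last by move/lt0r_neq0: (a0) => q; field.
  by rewrite ler_peMr ?divr_ge0 ?sqr_ge0 ?(ltW a0)// ler_pdivlMr// mul1r a_le_W.
apply: (@le_trans _ _ (2 * (m ^+ 2 / a ^+ 2) ^+ 2)).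
  apply: ler_pM; rewrite ?sqr_ge0 ?divr_ge0 ?omega_ge0//.
    by rewrite ler_pdivrMr// w_le2a// ltW.
  by rewrite lerXn2r ?nnegrE// divr_ge0// sqr_ge0.
rewrite expr_div_n -!exprM mulrA; apply: (@le_trans _ _ (2 * m ^+ 4 * L)).
  by rewrite ler_wpM2l// mulr_ge0// exprn_ge0.
by rewrite ler_wpM2r// ler_wpM2l// lerDr.
Qed.

(** W - a is at most m, and at most m^2 / a when a >= 1. *)
Lemma b_weight : ((W - a) / w) ^+ 2 <= (m ^+ 2 + m ^+ 4) * L.
have L0 := majorant_ge0 p; have w0 : 0 < w := lt_le_trans ltr01 w_ge1.
have d0 : 0 <= W - a by rewrite subr_ge0 a_le_W.
have [h|h] := leP a 1.
  have [_ [_ h1]] := small_a h.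
  apply: (@le_trans _ _ (m ^+ 2)).
    rewrite lerXn2r ?nnegrE ?divr_ge0 ?(ltW w0)// ler_pdivrMr//.
    apply: (@le_trans _ _ m); first by rewrite lerBlDr W_le_ma.
    by rewrite ler_peMr// w_ge1.
  by apply: (@le_trans _ _ (m ^+ 2 * L)); rewrite ?ler_peMr ?sqr_ge0// ler_wpM2r// lerDl exprn_ge0.
have h1 := large_a (ltW h).
apply: (@le_trans _ _ ((m ^+ 2 / a / a) ^+ 2)).
  rewrite lerXn2r ?nnegrE ?divr_ge0 ?sqr_ge0 ?(ltW w0) ?(ltW a0)//.
  apply: ler_pM; rewrite ?invr_ge0 ?(ltW w0)//; first exact: W_sub_le (ltW h).
  by rewrite lef_pV2// a_le_w.
rewrite (_ : (m ^+ 2 / a / a) ^+ 2 = m ^+ 4 * (a ^+ 4)^-1); last first.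
  by have := a0; move=> /lt0r_neq0 q; field.
apply: (@le_trans _ _ (m ^+ 4 * L)); first by rewrite ler_wpM2l; side.
by rewrite ler_wpM2r// lerDr sqr_ge0.
Qed.

End pointwise.
End majorant.

Ltac side_leaf18 := match goal with
  | _ => side_leaf14
  | |- is_true (0 <= majorant _) => exact: majorant_ge0
  | |- is_true (0 <= height _) => exact: le_trans ler01 (height_ge1 _)
  end.
Ltac side_leaf ::= side_leaf18.

#[local] Opaque majorant.

(** * Domination almost everywhere and multiplication operators *)

Section ae_domination.
Context d (T : measurableType d) (R : realType) (mu : {measure set T -> \bar R}).

Lemma ae_le_Rintegral (f g : T -> R) : mfun f -> (forall x, 0 <= f x) ->
  (forall x, 0 <= g x) -> L1 mu g -> {ae mu, forall x, f x <= g x} ->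
  L1 mu f /\ \int[mu]_x f x <= \int[mu]_x g x.
move=> mf f0 g0 ig fg; have mg := L1_meas ig.
have le : (\int[mu]_x (f x)%:E <= \int[mu]_x (g x)%:E)%E.
  apply: ae_ge0_le_integral => //; try exact/measurable_EFinP.
  - by move=> x _; rewrite lee_fin.
  - by move=> x _; rewrite lee_fin.
  by apply: filterS fg => x h _; rewrite lee_fin.
have gf : (\int[mu]_x (g x)%:E < +oo)%E.
  have /integrableP[_] := ig; under eq_integral do rewrite /= ger0_norm//.
  by [].
have fi : L1 mu f.
  apply/integrableP; split; first exact/measurable_EFinP.
  under eq_integral do rewrite /= ger0_norm//.
  exact: le_lt_trans gf.
split => //; rewrite /Rintegral fine_le ?integrable_fin_num//.
Qed.

End ae_domination.

Section multiplication.
Context (R : realType) (d : nat).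
Local Notation Rd := 'rV[R]_d.
Local Notation leb := (leb R d).
Local Notation Hs := (Hspace R d).
Local Notation dot := (@Hdot R d).
Implicit Types (h : Rd -> R) (u v z : Hs).

Let ip : semi_inner dot. by case: (Hdot_hilbert R d). Qed.

(** Kept explicit, because [mulH] takes the value 0 outside this domain. *)
Definition mul_dom h u := sqint leb (fun p => (h p)%:C * repr u p).
Definition mulH h u : Hs := L2_of leb (fun p => (h p)%:C * repr u p).

Lemma mulH_ae h u : mul_dom h u -> {ae leb, forall p, repr (mulH h u) p = (h p)%:C * repr u p}.
exact: L2_of_ae. Qed.

Lemma cmeas_mulH h u : mfun h -> cmeas (fun p => (h p)%:C * repr u p).
by move=> mh; apply: cmeasM; [side|case: (repr_sqint u)]. Qed.

Lemma mulH_lin h (k : R[i]) u v : mfun h -> mul_dom h u -> mul_dom h v ->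
  mul_dom h (k *: u + v) /\ mulH h (k *: u + v) = k *: mulH h u + mulH h v.
move=> mh du dv; have sl := sqint_lin k du dv.
have e : {ae leb, forall p, k * ((h p)%:C * repr u p) + (h p)%:C * repr v p =
    (h p)%:C * repr (k *: u + v) p}.
  by apply: filterS (repr_lin k u v) => p ->; rewrite mulrDr mulrCA.
have dk : mul_dom h (k *: u + v) by apply: ae_sqint sl; [exact: cmeas_mulH|].
split => //; rewrite /mulH -(L2_of_lin k du dv); apply: L2_of_eq => //.
apply: filterS2 e (L2_of_ae sl) => p e1 e2; rewrite e2.
by [].
Qed.

Lemma mulH_dot_eq h1 h2 h3 h4 u v : mul_dom h1 u -> mul_dom h2 v -> mul_dom h3 u -> mul_dom h4 v ->
  {ae leb, forall p, h1 p * h2 p = h3 p * h4 p} ->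
  dot (mulH h1 u) (mulH h2 v) = dot (mulH h3 u) (mulH h4 v).
move=> d1 d2 d3 d4 e; rewrite /Hdot !L2_dot_of//; apply: ae_eq_cint.
- by apply: cmeasM; [apply: cmeas_conj; case: d1|case: d2].
- by apply: cmeasM; [apply: cmeas_conj; case: d3|case: d4].
apply: filterS e => p e; rewrite !conjcM !cconj_real mulrACA [RHS]mulrACA.
by rewrite -!real_complexM e.
Qed.

Lemma sqnorm_mulH h u : mul_dom h u -> sqnorm dot (mulH h u) = \int[leb]_p nc ((h p)%:C * repr u p) ^+ 2.
by move=> du; apply: sqnorm_L2; [case: du|exact: mulH_ae]. Qed.

Lemma star_dot u v : dot (star u) (star v) = dot v u.
by rewrite /star Hrefl_dot HreflK Hconj_dot. Qed.

Lemma mulH_star h u : (forall p, h (- p) = h p) -> mul_dom h u -> mul_dom h (star u) ->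
  mulH h (star u) = star (mulH h u).
move=> hN du ds; apply: L2_of_eq => //.
apply: filterS3 (star_ae u) (star_ae (mulH h u)) (ae_refl (mulH_ae du)) => p -> -> ->.
by rewrite hN conjcM cconj_real.
Qed.

End multiplication.

(** * Multiplier bounds for functions with bounded point values *)

Section estimates.
Context (R : realType) (d : nat).
Hypothesis hd : d = 2%N \/ d = 3%N.
Local Notation Rd := 'rV[R]_d.
Local Notation leb := (leb R d).
Local Notation Hs := (Hspace R d).
Local Notation dot := (@Hdot R d).
Local Notation nsq := (sqnorm dot).

Let ip : semi_inner dot. by case: (Hdot_hilbert R d). Qed.

Definition majorant_int : R := \int[leb]_p majorant p.
(** The quantity under whose integral sign Bessel's inequality is applied at each p; it is finite
    once the point values are bounded. *)
Definition mass (z : Hs) : R := \int[leb]_p (majorant p * nc (repr z p) ^+ 2).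

Lemma majorant_int_ge0 : 0 <= majorant_int.
by apply: Rintegral_ge0 => p _; side. Qed.

Lemma mass_ge0 z : 0 <= mass z.
by apply: Rintegral_ge0 => p _; side. Qed.

Lemma mfun_majorant : mfun (@majorant R d).
exact: L1_meas (L1_majorant R d). Qed.

Section one.
Variables (z : Hs) (K : R).
Hypothesis K0 : 0 <= K.
Hypothesis hz : {ae leb, forall p, nc (repr z p) ^+ 2 <= K * nsq z}.

Let s0 : 0 <= nsq z. by side. Qed.

Let mz : mfun (fun p => nc (repr z p) ^+ 2).
by apply/measurable_funX/cmeas_nc; case: (repr_sqint z). Qed.

Lemma mass_le : L1 leb (fun p => majorant p * nc (repr z p) ^+ 2) /\
  mass z <= K * majorant_int * nsq z.
have [] := ae_le_Rintegral (f := fun p => majorant p * nc (repr z p) ^+ 2) _ _ _ (L1Z (K * nsq z) (L1_majorant R d)).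
- by apply: measurable_funM => //; exact: mfun_majorant.
- by side.
- by side.
- by apply: filterS hz => p h; rewrite mulrC ler_wpM2r ?majorant_ge0.
by rewrite RintegralZl; [rewrite mulrAC| |exact: L1_majorant].
Qed.

Lemma mulH_bound (h : Rd -> R) (c1 c2 : R) : mfun h -> 0 <= c1 -> 0 <= c2 ->
  {ae leb, forall p, h p ^+ 2 <= c1 + c2 * majorant p} ->
  mul_dom h z /\ nsq (mulH h z) <= c1 * nsq z + c2 * mass z.
move=> mh c10 c20 hh; have [i1 _] := mass_le; have [_ i2] := repr_sqint z.
have j1 := L1Z c1 i2; have j2 := L1Z c2 i1.
have [] := ae_le_Rintegral (f := fun p => nc ((h p)%:C * repr z p) ^+ 2) _ _ _ (L1D j1 j2).
- exact/measurable_funX/cmeas_nc/cmeas_mulH.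
- by side.
- by side.
- apply: filterS hh => p hp; rewrite ncM nc_real exprMn real_normK ?num_real// mulrA -mulrDl.
  by rewrite ler_wpM2r; side.
move=> h1 h2; have dz : mul_dom h z by split => //; exact: cmeas_mulH.
split => //; rewrite sqnorm_mulH//; apply: (le_trans h2).
rewrite (@RintegralD _ _ _ leb _ _ _ _ j1 j2)// !RintegralZl//.
by rewrite (@sqnorm_L2 _ _ _ _ z (repr z))//; [case: (repr_sqint z)|exact: nearW].
Qed.

(** Where r L >= 1 the point bound is integrated against the majorant L; elsewhere c h^2 >= 1 bounds
    z by h z. For small r the first term can be absorbed into the left-hand side. *)
Lemma mulH_lower (h : Rd -> R) (r c : R) : mul_dom h z -> 0 <= r -> 0 <= c ->
  {ae leb, forall p, 1 <= r * majorant p \/ 1 <= c * h p ^+ 2} ->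
  nsq z <= r * K * majorant_int * nsq z + c * nsq (mulH h z).
move=> dz r0 c0 hh; have [_ i2] := dz.
have im := L1_majorant R d.
have j1 := L1Z (r * (K * nsq z)) im; have j2 := L1Z c i2.
have [] := ae_le_Rintegral (f := fun p => nc (repr z p) ^+ 2) mz _ _ (L1D j1 j2).
- by side.
- by side.
- apply: filterS2 hz hh => p h1 [] h2.
    rewrite -[leLHS]addr0; apply: lerD; last by side.
    by apply: (le_trans h1); rewrite mulrAC ler_peMl// mulr_ge0.
  rewrite -[leLHS]add0r; apply: lerD.
    by side.
  by rewrite ncM nc_real exprMn real_normK ?num_real// mulrA ler_peMl ?sqr_ge0.
move=> _ h2; rewrite {1}(@sqnorm_L2 _ _ _ _ z (repr z))//; [|by case: (repr_sqint z)|exact: nearW].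
have e1 : \int[leb]_p (r * (K * nsq z) * majorant p) = r * (K * nsq z) * majorant_int.
  by rewrite /majorant_int -RintegralZl.
have e2 : \int[leb]_p (c * nc ((h p)%:C * repr z p) ^+ 2) = c * nsq (mulH h z).
  by rewrite sqnorm_mulH// -RintegralZl.
apply: (le_trans h2); rewrite (@RintegralD _ _ _ leb _ _ _ _ j1 j2)// e1 e2 le_eqVlt; apply/orP; left; apply/eqP; ring.
Qed.

End one.
End estimates.

(** * The weights of order 1/2 and -1/2 and the space X of pairs *)

Section sobolev_weights.
Context (R : realType) (d : nat).
Local Notation Rd := 'rV[R]_d.
Local Notation leb := (leb R d).
Local Notation Hs := (Hspace R d).
Local Notation dot := (@Hdot R d).
Local Notation nsq := (sqnorm dot).
Implicit Types (p q : Rd) (m : R).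

Record sobolev_weight (s : R) (w : Rd -> R) : Prop := SobolevWeight {
  sw_meas : mfun w;
  sw_measV : mfun (fun p => (w p)^-1);
  sw_even : forall p, w (- p) = w p;
  sw_gt0 : forall p, 0 < w p;
  sw_le : forall p, w p <= omega 1 p;
  sw_leV : forall p, (w p)^-1 <= omega 1 p;
  sw_powR : forall p, (1 + eucl2 p) `^ s = w p ^+ 2;
  sw_peetre : forall p q, (w p / w q) ^+ 2 <= 2 * (1 + eucl2 (q - p)) }.

Lemma eucl2_le_sum x y : eucl2 (x + y : Rd) <= 2 * eucl2 x + 2 * eucl2 y.
rewrite /eucl2 /inner !mulr_sumr -big_split; apply: ler_sum => i _.
by rewrite mxE; have := sqr_ge0 (x 0 i - y 0 i) => h; rewrite -[leRHS]/(_ + _); nra.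
Qed.

(** Peetre's inequality, from |p|^2 <= 2 |q|^2 + 2 |q - p|^2. It is stated for omega_1, the square
    of the weight of order 1/2, and with p and q exchanged it serves the order -1/2. *)
Lemma omega1_shift p q : omega 1 p / omega 1 q <= 2 * (1 + eucl2 (q - p)).
have e0 := eucl2_ge0 (q - p); have w0 : 0 < omega 1 q := lt_le_trans ltr01 (omega1_ge1 q).
rewrite ler_pdivrMr// -(@ler_pXn2r _ 2) ?nnegrE ?omega_ge0 ?mulr_ge0 ?addr_ge0 ?(ltW w0)//.
rewrite [leRHS]exprMn !omega_sqr.
have h : eucl2 p <= 2 * eucl2 q + 2 * eucl2 (q - p).
  by have := eucl2_le_sum q (p - q); rewrite addrC subrK -[eucl2 (p - q)]eucl2N opprB.
by have q0 := eucl2_ge0 q; set e := eucl2 (q - p) in h e0 *; nra.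
Qed.

Definition wm p : R := (omegaq 1 p)^-1.
Definition wp p : R := omegaq 1 p.

Let q0 p : 0 < omegaq 1 p. exact: lt_le_trans (omegaq1_ge1 p). Qed.

Lemma wp_weight : sobolev_weight 2^-1 wp.
split => [|||p|p|p|p|p q].
- by side.
- by side.
- exact: omegaqN.
- exact: q0.
- exact: omegaq1_le.
- by rewrite (le_trans _ (omega1_ge1 p))// invf_le1// omegaq1_ge1.
- by rewrite powR12_sqrt ?addr_ge0 ?eucl2_ge0// /wp omegaq_sqr /omega expr1n.
- by rewrite expr_div_n !omegaq_sqr omega1_shift.
Qed.

Lemma wm_weight : sobolev_weight (- 2^-1) wm.
split => [|||p|p|p|p|p q].
- by side.
- by side.
- by move=> p; rewrite /wm omegaqN.
- by rewrite invr_gt0.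
- exact: sw_leV wp_weight p.
- by rewrite invrK; exact: sw_le wp_weight p.
- by rewrite powRN (sw_powR wp_weight) exprVn.
- rewrite /wm invrK mulrC; apply: (le_trans (sw_peetre wp_weight q p)).
  by rewrite -eucl2N opprB.
Qed.

Section multipliers.
Variable m : R.
Hypothesis m0 : 0 <= m.

(** [alpha] and [beta] are reciprocal almost everywhere for every mass, the reason why the
    symplectic form does not depend on it. *)
Definition alpha p : R := omegaq 1 p / omegaq m p.
Definition beta p : R := omegaq m p / omegaq 1 p.

Lemma mfun_alpha : mfun alpha.
by side.
Qed.

Lemma mfun_beta : mfun beta.
by side. Qed.

Lemma alphaN p : alpha (- p) = alpha p. by rewrite /alpha !omegaqN. Qed.

Lemma betaN p : beta (- p) = beta p. by rewrite /beta !omegaqN. Qed.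

Lemma alpha_sqr p : alpha p ^+ 2 = omega 1 p / omega m p.
by rewrite expr_div_n !omegaq_sqr. Qed.

Lemma beta_sqr p : beta p ^+ 2 = omega m p / omega 1 p.
by rewrite expr_div_n !omegaq_sqr. Qed.

Hypothesis hd : d = 2%N \/ d = 3%N.

Lemma omegaq_gt0_ae : {ae leb, forall p, 0 < omegaq m p}.
by apply: filterS (majorantP R hd) => p [a0 _ _]; rewrite sqrtr_gt0; exact: W_gt0. Qed.

Lemma alpha_beta : {ae leb, forall p, alpha p * beta p = 1}.
apply: filterS omegaq_gt0_ae => p h.
by rewrite /alpha /beta mulrA divfK ?gt_eqF// divff// gt_eqF.
Qed.

Lemma alpha_le : {ae leb, forall p, alpha p ^+ 2 <= 2 + 2 * majorant p}.
apply: filterS (majorantP R hd) => p [a0 hA _]; rewrite alpha_sqr.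
apply: (le_trans _ (hardy_weight a0 hA)); rewrite ler_wpM2l ?omega_ge0//.
have W0 : 0 < omega m p by exact: W_gt0.
by rewrite lef_pV2// a_le_W.
Qed.

Lemma alpha_ge : {ae leb, forall p, 1 <= 0 * majorant p \/ 1 <= (1 + m) * alpha p ^+ 2}.
apply: filterS (majorantP R hd) => p [a0 _ _]; right; rewrite alpha_sqr mulrA.
have W0 : 0 < omega m p by exact: W_gt0.
by rewrite ler_pdivlMr// mul1r W_le_w.
Qed.

Lemma beta_le : {ae leb, forall p, beta p ^+ 2 <= (1 + m) + 0 * majorant p}.
apply: filterS (majorantP R hd) => p [a0 _ _]; rewrite beta_sqr mul0r addr0.
by rewrite ler_pdivrMr ?W_le_w// (lt_le_trans ltr01 (omega1_ge1 p)).
Qed.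

Lemma beta_ge (r : R) : 0 < r -> r <= 1 ->
  {ae leb, forall p, 1 <= r * majorant p \/ 1 <= 2 / r * beta p ^+ 2}.
move=> r0 r1; apply: filterS (majorantP R hd) => p [a0 hA _]; rewrite beta_sqr.
have [h|h] := poincare_weight a0 hA r0 r1; [by left|right].
apply: (le_trans h); rewrite ler_wpM2l ?divr_ge0 ?(ltW r0)// ler_wpM2r ?a_le_W//.
by side.
Qed.

End multipliers.

Definition Xpred : {pred Hs * Hs} := mem [set z : Hs * Hs | Xset wm z.1 /\ Xset wp z.2].

Lemma sw_subspace s w : sobolev_weight s w -> subspace (Xset w).
by case=> *; exact: Xset_subspace. Qed.

Lemma sw_star s w a : sobolev_weight s w -> Xset w a -> Xset w (star a).
by case=> *; exact: Xset_star. Qed.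

Lemma Xpred_submod_closed : submod_closed Xpred.
have [m0 mD] := sw_subspace wm_weight; have [p0 pD] := sw_subspace wp_weight.
split; first by rewrite inE.
by move=> k x y /[!inE]/= -[xm xp] [ym yp]; split; [exact: mD|exact: pD].
Qed.

HB.instance Definition _ := GRing.isSubmodClosed.Build _ _ Xpred Xpred_submod_closed.

(** One vector space for all masses: K_m + i K_m and K_0 + i K_0 are two images of it, and Q becomes
    its identity map. *)
Record Xspace := MkX { Xval :> Hs * Hs; _ : Xval \in Xpred }.

HB.instance Definition _ := [isSub for Xval].
HB.instance Definition _ := [Choice of Xspace by <:].
HB.instance Definition _ := [SubChoice_isSubLmodule of Xspace by <:].

Implicit Types (x y z : Xspace).

Definition xa x : Hs := (Xval x).1.
Definition xb x : Hs := (Xval x).2.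

Lemma xaP x : Xset wm (xa x). by have := valP x; rewrite inE => -[]. Qed.
Lemma xbP x : Xset wp (xb x). by have := valP x; rewrite inE => -[]. Qed.

Lemma X_exists a b : Xset wm a -> Xset wp b -> exists x, xa x = a /\ xb x = b.
move=> ha hb; have h : (a, b) \in Xpred by rewrite inE.
by exists (MkX h).
Qed.

Lemma X_eq x y : xa x = xa y -> xb x = xb y -> x = y.
move=> ea eb; apply: val_inj => /=; move: ea eb; rewrite /xa /xb.
by case: (Xval x) (Xval y) => ? ? [? ?] /= -> ->.
Qed.

Lemma xa_lin (k : R[i]) x y : xa (k *: x + y) = k *: xa x + xa y. by []. Qed.
Lemma xb_lin (k : R[i]) x y : xb (k *: x + y) = k *: xb x + xb y. by []. Qed.

Lemma X_star_subproof x : (star (xa x), star (xb x)) \in Xpred.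
by rewrite inE; split; [exact: sw_star wm_weight (xaP x)|exact: sw_star wp_weight (xbP x)]. Qed.

Definition X_star x : Xspace := MkX (X_star_subproof x).

Lemma X_star_lin (k : R[i]) x y : X_star (k *: x + y) = k^* *: X_star x + X_star y.
by apply: X_eq; rewrite ?xa_lin ?xb_lin; [rewrite -star_lin|rewrite -star_lin].
Qed.

Lemma X_starK x : X_star (X_star x) = x.
by apply: X_eq; exact: starK. Qed.

Lemma eval_constant : exists2 K : R, 0 <= K & forall p,
  nsq (eval_at wm p) <= K /\ nsq (eval_at wp p) <= K.
have [a1 a2 _ _ _ _ _ a3] := wm_weight; have [b1 b2 _ _ _ _ _ b3] := wp_weight.
have [C C0 hC] : exists2 C : R, 0 <= C & forall p, nsq (eval_at wm p) <= C by exact: eval_bound.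
have [D D0 hD] : exists2 C : R, 0 <= C & forall p, nsq (eval_at wp p) <= C by exact: eval_bound.
exists (C + D) => [|p]; first side.
by split; [apply: (le_trans (hC p)); rewrite lerDl|apply: (le_trans (hD p)); rewrite lerDr].
Qed.

Definition evalK : R := projT1 (cid2 eval_constant).

Lemma evalK_ge0 : 0 <= evalK. by rewrite /evalK; case: cid2. Qed.

Lemma evalK_a p : nsq (eval_at wm p) <= evalK.
by rewrite /evalK; case: cid2 => K _ /= h; case: (h p). Qed.

Lemma evalK_b p : nsq (eval_at wp p) <= evalK.
by rewrite /evalK; case: cid2 => K _ /= h; case: (h p). Qed.

Lemma xa_eval x : {ae leb, forall p, repr (xa x) p = dot (eval_at wm p) (xa x)}.
by have [? ? ? ? ? ? ? ?] := wm_weight; apply: eval_ae => //; exact: xaP. Qed.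

Lemma xb_eval x : {ae leb, forall p, repr (xb x) p = dot (eval_at wp p) (xb x)}.
by have [? ? ? ? ? ? ? ?] := wp_weight; apply: eval_ae => //; exact: xbP. Qed.

Let ip : semi_inner dot. by case: (Hdot_hilbert R d). Qed.

Lemma xa_bounded x : {ae leb, forall p, nc (repr (xa x) p) ^+ 2 <= evalK * nsq (xa x)}.
apply: filterS (xa_eval x) => p ->; apply: (le_trans (cauchy_schwarz ip _ _)).
by apply: ler_wpM2r (evalK_a p); side.
Qed.

Lemma xb_bounded x : {ae leb, forall p, nc (repr (xb x) p) ^+ 2 <= evalK * nsq (xb x)}.
apply: filterS (xb_eval x) => p ->; apply: (le_trans (cauchy_schwarz ip _ _)).
by apply: ler_wpM2r (evalK_b p); side.
Qed.

End sobolev_weights.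

Ltac side_leaf20 := match goal with
  | _ => side_leaf18
  | |- measurable_fun _ (alpha _) => exact: mfun_alpha
  | |- measurable_fun _ (fun _ => alpha _ _) => exact: mfun_alpha
  | |- measurable_fun _ (beta _) => exact: mfun_beta
  | |- measurable_fun _ (fun _ => majorant _) => exact: mfun_majorant
  end.
Ltac side_leaf ::= side_leaf20.

(** * Scalar products of combinations u + iv *)

Section complex_combination.
Context (R : realType) (V : lmodType R[i]) (dot : V -> V -> R[i]) (U S : V -> V).
Hypothesis ip : semi_inner dot.
Hypothesis U_dot : forall u v, dot (U u) (U v) = dot u v.
Hypothesis S_dot : forall u v, dot (S u) (S v) = dot v u.

Lemma dot_sum_i u v u' v' : dot (U u + 'i *: U v) (U u' + 'i *: U v') =
  dot u u' + dot v v' + 'i * (dot u v' - dot v u').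
rewrite !(dotDl ip) !(dotDr ip) !(dotZl ip) !(dotZr ip) cconj_i !U_dot.
have ii : ('i : R[i]) * 'i = -1 by apply: complex_eqP => /=; ring.
set aa := dot u u'; set ab := dot u v'; set ba := dot v u'; set bb := dot v v'.
rewrite (_ : - 'i * ('i * bb) = - ('i * 'i * bb)); last by rewrite mulNr mulrA.
by rewrite ii; ring.
Qed.

Lemma dot_star_sum_i u v u' v' : dot (U (S u') + 'i *: U (S v')) (U (S u) + 'i *: U (S v)) =
  dot u u' + dot v v' - 'i * (dot u v' - dot v u').
by rewrite dot_sum_i !S_dot -mulrN opprB. Qed.

End complex_combination.

(** * The embeddings of X and the graph scalar products *)

Section standard_subspace.
Context (R : realType) (d : nat).
Hypothesis hd : d = 2%N \/ d = 3%N.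
Local Notation Rd := 'rV[R]_d.
Local Notation leb := (leb R d).
Local Notation Hs := (Hspace R d).
Local Notation dot := (@Hdot R d).
Local Notation nsq := (sqnorm dot).
Local Notation X := (@Xspace R d).
Local Notation K := (@evalK R d).
Local Notation I := (@majorant_int R d).
Implicit Types (p : Rd) (x y z : X).

Let hH : hilbert dot. exact: Hdot_hilbert. Qed.
Let ip : semi_inner dot. by case: hH. Qed.

Definition Aop m x : Hs := mulH (alpha m) (xa x).
Definition Bop m x : Hs := mulH (beta m) (xb x).
(** The range is K_m + i K_m, and the pairs fixed by [X_star] give K_m itself, by
    [Kspace_real_part]. *)
Definition Jop m x : Hs := Uinv (Aop m x) + 'i *: Uinv (Bop m x).
(** The cross terms of <J x, J y> and <S J y, S J x> are opposite and the other terms are equal,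
    whence the factor 2. *)
Definition Mform m x y : R[i] := (2 : R)%:C * (dot (Aop m x) (Aop m y) + dot (Bop m x) (Bop m y)).

Definition equivC : R := 4 * (1 + 2 * (K * I)).

Let KI0 : 0 <= K * I. exact: mulr_ge0 (evalK_ge0 R d) (majorant_int_ge0 R d). Qed.

Lemma equivC_ge4 : 4 <= equivC.
by have := KI0; rewrite /equivC; set k := K * I; lra. Qed.

Let scaled_le_sum (c k s t : R) : 0 <= s -> 0 <= t -> 0 <= k -> c <= k -> c * s <= k * (s + t).
by move=> *; nra. Qed.

Section mass.
Variable m : R.
Hypothesis m0 : 0 <= m.

Let h1m : 0 <= 1 + m. by side. Qed.

Lemma Aop_bound x : mul_dom (alpha m) (xa x) /\ nsq (Aop m x) <= equivC * nsq (xa x).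
have [dx h] := mulH_bound (evalK_ge0 R d) (xa_bounded x) (mfun_alpha m) (ler0n _ 2) (ler0n _ 2)
  (alpha_le m hd).
split => //; apply: (le_trans h).
have [_ h1] := mass_le (evalK_ge0 R d) (xa_bounded x); have s0 := sqnorm_ge0 ip (xa x).
by have := mulr_ge0 KI0 s0; rewrite /equivC; set k := K * I in h1 *; nra.
Qed.

Lemma Bop_bound x : mul_dom (beta m) (xb x) /\ nsq (Bop m x) <= (1 + m) * nsq (xb x).
have [dx h] := mulH_bound (evalK_ge0 R d) (xb_bounded x) (mfun_beta m) h1m (lexx 0)
  (beta_le m0 hd).
by split => //; apply: (le_trans h); rewrite mul0r addr0.
Qed.

Let dA x : mul_dom (alpha m) (xa x). by have [] := Aop_bound x. Qed.
Let dB x : mul_dom (beta m) (xb x). by have [] := Bop_bound x. Qed.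

Lemma Aop_lower x : nsq (xa x) <= (1 + m) * nsq (Aop m x).
have := mulH_lower (evalK_ge0 R d) (xa_bounded x) (dA x) (lexx 0) h1m (alpha_ge m0 hd).
by rewrite !mul0r add0r.
Qed.

(** With r = 1/q the term to absorb has the coefficient K I / q <= 1/2; doubling the remaining
    coefficient 2/r = 2 q gives 4 q, which is [equivC]. *)
Lemma Bop_lower x : nsq (xb x) <= equivC * nsq (Bop m x).
pose q : R := 1 + 2 * (K * I).
have q1 : 1 <= q by rewrite /q lerDl mulr_ge0.
have q0 : 0 < q := lt_le_trans ltr01 q1.
have r0 : 0 < q^-1 by side.
have r1 : q^-1 <= 1 by rewrite invf_le1.
have c0 : 0 <= 2 / q^-1 by side.
have := mulH_lower (evalK_ge0 R d) (xb_bounded x) (dB x) (ltW r0) c0 (beta_ge m hd r0 r1).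
have e : q^-1 * (K * I) <= 2^-1 by rewrite mulrC ler_pdivrMr// /q; set k := K * I; lra.
rewrite /equivC -/q -/(Bop m x) -(mulrA q^-1).
have s0 := sqnorm_ge0 ip (xb x).
have : q^-1 * (K * I) * nsq (xb x) <= 2^-1 * nsq (xb x) by rewrite ler_wpM2r.
by set s := nsq (xb x); set b := nsq (Bop m x); set t := _ * s => *; lra.
Qed.

Lemma Aop_lin (k : R[i]) x y : Aop m (k *: x + y) = k *: Aop m x + Aop m y.
by rewrite /Aop; have [] := mulH_lin k (mfun_alpha m) (dA x) (dA y). Qed.

Lemma Bop_lin (k : R[i]) x y : Bop m (k *: x + y) = k *: Bop m x + Bop m y.
by rewrite /Bop; have [] := mulH_lin k (mfun_beta m) (dB x) (dB y). Qed.

Lemma Aop_star x : Aop m (X_star x) = star (Aop m x).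
by rewrite /Aop mulH_star//; [exact: alphaN|exact: (dA (X_star x))]. Qed.

Lemma Bop_star x : Bop m (X_star x) = star (Bop m x).
by rewrite /Bop mulH_star//; [exact: betaN|exact: (dB (X_star x))]. Qed.

Lemma sqnorm_Mform x : sqnorm (Mform m) x = 2 * (nsq (Aop m x) + nsq (Bop m x)).
by rewrite /sqnorm /Mform ReZ ReD. Qed.

Lemma Mform_semi_inner : semi_inner (Mform m).
have AD x y : Aop m (x + y) = Aop m x + Aop m y by have := Aop_lin 1 x y; rewrite !scale1r.
have BD x y : Bop m (x + y) = Bop m x + Bop m y by have := Bop_lin 1 x y; rewrite !scale1r.
have A0 : Aop m 0 = 0 by apply: (addrI (Aop m 0)); rewrite -AD !addr0.
have B0 : Bop m 0 = 0 by apply: (addrI (Bop m 0)); rewrite -BD !addr0.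
have AZ k x : Aop m (k *: x) = k *: Aop m x by have := Aop_lin k x 0; rewrite A0 !addr0.
have BZ k x : Bop m (k *: x) = k *: Bop m x by have := Bop_lin k x 0; rewrite B0 !addr0.
split => [z x y|z k x|x y|x].
- by rewrite /Mform AD BD !(dotDr ip) addrACA mulrDr.
- by rewrite /Mform AZ BZ !(dotZr ip) -mulrDr mulrCA.
- by rewrite /Mform (dotC ip (Aop m x)) (dotC ip (Bop m x)) conjcM conjcD cconj_real.
- rewrite -[X in _ <= X]/(sqnorm (Mform m) x) sqnorm_Mform mulr_ge0// addr_ge0//; side.
Qed.

Definition kappa : R := equivC * (1 + m).

Let C4 := equivC_ge4.
Let C0 : 0 <= equivC. exact: le_trans C4. Qed.
Let kapC : equivC <= kappa. by rewrite ler_peMr// lerDl. Qed.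
Let kapm : 1 + m <= kappa. by rewrite ler_peMl// (le_trans _ C4)// ler1n. Qed.

Lemma kappa_gt0 : 0 < kappa.
by apply: lt_le_trans kapC; exact: lt_le_trans C4. Qed.

Let kap0 := ltW kappa_gt0.

Lemma xa_le_Mform x : nsq (xa x) <= kappa / 2 * sqnorm (Mform m) x.
rewrite sqnorm_Mform mulrA divfK//; apply: (le_trans (Aop_lower x)).
have a0 := sqnorm_ge0 ip (Aop m x); have b0 := sqnorm_ge0 ip (Bop m x).
exact: scaled_le_sum a0 b0 kap0 kapm.
Qed.

Lemma xb_le_Mform x : nsq (xb x) <= kappa / 2 * sqnorm (Mform m) x.
rewrite sqnorm_Mform mulrA divfK//; apply: (le_trans (Bop_lower x)).
have a0 := sqnorm_ge0 ip (Aop m x); have b0 := sqnorm_ge0 ip (Bop m x).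
by rewrite addrC; exact: scaled_le_sum b0 a0 kap0 kapC.
Qed.

Lemma Mform_le x : sqnorm (Mform m) x <= 2 * kappa * (nsq (xa x) + nsq (xb x)).
have [_ ha] := Aop_bound x; have [_ hb] := Bop_bound x.
have a0 := sqnorm_ge0 ip (xa x); have b0 := sqnorm_ge0 ip (xb x).
rewrite sqnorm_Mform -mulrA ler_wpM2l// mulrDr lerD//.
- by apply: (le_trans ha); rewrite ler_wpM2r.
- by apply: (le_trans hb); rewrite ler_wpM2r.
Qed.

(** The norm is equivalent to that of the pair of components in L^2, and both component spaces are
    closed. *)
Lemma Mform_hilbert : hilbert (Mform m).
have k0 := kappa_gt0; have sub x y : xa (x - y) = xa x - xa y /\ xb (x - y) = xb x - xb y by [].
split; first exact: Mform_semi_inner.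
  move=> x e; apply: X_eq; apply: (sqnorm_eq0 hH); apply/eqP.
    by rewrite eq_le sqnorm_ge0// andbT (le_trans (xa_le_Mform x))// e mulr0.
  by rewrite eq_le sqnorm_ge0// andbT (le_trans (xb_le_Mform x))// e mulr0.
move=> u cu; have h2 : 0 < kappa / 2 by side.
have [a ta] : exists a, tends dot (fun n => xa (u n)) a.
  case: hH => _ _; apply => e e0; have [N hN] := cu _ (divr_gt0 e0 h2).
  exists N => i j iN jN; rewrite /= -(sub _ _).1; apply: (le_lt_trans (xa_le_Mform _)).
  by rewrite mulrC -ltr_pdivlMr// hN.
have [b tb] : exists b, tends dot (fun n => xb (u n)) b.
  case: hH => _ _; apply => e e0; have [N hN] := cu _ (divr_gt0 e0 h2).
  exists N => i j iN jN; rewrite /= -(sub _ _).2; apply: (le_lt_trans (xb_le_Mform _)).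
  by rewrite mulrC -ltr_pdivlMr// hN.
have [x [ex1 ex2]] := X_exists (Xset_closed (fun n => xaP (u n)) ta) (Xset_closed (fun n => xbP (u n)) tb).
exists x => e e0; have k4 : 0 < 4 * kappa by side.
have [N hN] := ta _ (divr_gt0 e0 k4); have [N' hN'] := tb _ (divr_gt0 e0 k4).
exists (maxn N N') => n; rewrite geq_max => /andP[n1 n2]; apply: (le_lt_trans (Mform_le _)).
have := hN n n1; have := hN' n n2; rewrite (sub _ _).1 (sub _ _).2 ex1 ex2 /=.
rewrite !ltr_pdivlMr//; set s := sqnorm _ _; set t := sqnorm _ _ => h h'; lra.
Qed.

Lemma Jop_lin (k : R[i]) x y : Jop m (k *: x + y) = k *: Jop m x + Jop m y.
rewrite /Jop Aop_lin Bop_lin !Uinv_lin !scalerDr addrACA; congr (_ + _).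
by rewrite !scalerA mulrC.
Qed.

Lemma Jop_dot x y : dot (Jop m x) (Jop m y) = dot (Aop m x) (Aop m y) + dot (Bop m x) (Bop m y) +
  'i * (dot (Aop m x) (Bop m y) - dot (Bop m x) (Aop m y)).
rewrite /Jop; exact: (dot_sum_i ip (@Uinv_dot R d)).
Qed.

Lemma Jop_star_dot x y : dot (Jop m (X_star y)) (Jop m (X_star x)) =
  dot (Aop m x) (Aop m y) + dot (Bop m x) (Bop m y) -
  'i * (dot (Aop m x) (Bop m y) - dot (Bop m x) (Aop m y)).
rewrite /Jop (Aop_star x) (Aop_star y) (Bop_star x) (Bop_star y).
exact: (dot_star_sum_i ip (@Uinv_dot R d) (@star_dot R d)).
Qed.

Lemma Jop_symplectic x y : dot (Jop m x) (Jop m y) - dot (Jop m (X_star y)) (Jop m (X_star x)) =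
  'i * (dot (Aop m x) (Bop m y) - dot (Bop m x) (Aop m y)) +
  'i * (dot (Aop m x) (Bop m y) - dot (Bop m x) (Aop m y)).
by rewrite (Jop_dot x y) (Jop_star_dot x y); move: (_ + _) ('i * _) => a b; ring.
Qed.

Lemma Mform_graph x y : Mform m x y = dot (Jop m x) (Jop m y) + dot (Jop m (X_star y)) (Jop m (X_star x)).
rewrite (Jop_dot x y) (Jop_star_dot x y) /Mform (rmorph_nat (real_complex R) 2).
move: (_ + _) ('i * _) => a b; ring.
Qed.

End mass.

(** Only the product of [alpha] and [beta] enters, and it is 1 for every mass. *)
Lemma symplectic_form m m' x y : 0 <= m -> 0 <= m' ->
  dot (Jop m x) (Jop m y) - dot (Jop m (X_star y)) (Jop m (X_star x)) =
  dot (Jop m' x) (Jop m' y) - dot (Jop m' (X_star y)) (Jop m' (X_star x)).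
move=> m0 m0'; have e : {ae leb, forall p, alpha m p * beta m p = alpha m' p * beta m' p}.
  by apply: filterS2 (alpha_beta m hd) (alpha_beta m' hd) => p -> ->.
have e' : {ae leb, forall p, beta m p * alpha m p = beta m' p * alpha m' p}.
  by apply: filterS e => p; rewrite mulrC => ->; rewrite mulrC.
apply: etrans (Jop_symplectic m0 x y) _; apply: etrans _ (esym (Jop_symplectic m0' x y)).
have e1 : dot (Aop m x) (Bop m y) = dot (Aop m' x) (Bop m' y).
  exact (mulH_dot_eq (Aop_bound m x).1 (Bop_bound m0 y).1 (Aop_bound m' x).1 (Bop_bound m0' y).1 e).
have e2 : dot (Bop m x) (Aop m y) = dot (Bop m' x) (Aop m' y).
  exact (mulH_dot_eq (Bop_bound m0 x).1 (Aop_bound m y).1 (Bop_bound m0' x).1 (Aop_bound m' y).1 e').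
have congr2 (a b a' b' : R[i]) : a = a' -> b = b' ->
    'i * (a - b) + 'i * (a - b) = 'i * (a' - b') + 'i * (a' - b') by move=> -> ->.
exact: congr2 e1 e2.
Qed.

End standard_subspace.

Lemma leibniz_eq0 (R : realType) (f g : nat -> R -> R) n a b x :
  (forall k, f k x = 0) -> leibniz f g n a b x = 0.
by move=> f0; elim: n a b => [|n ih] a b /=; rewrite ?f0 ?mul0r// !ih addr0. Qed.

Lemma bump_left (R : realType) (a b : R) k n x : x <= a -> bumpf a b k n x = 0.
move=> xa; apply: leibniz_eq0 => j; rewrite /psi ltNge (_ : _ <= 0) ?mulr0//.
by rewrite -mulrBr pmulr_rle0// subr_le0.
Qed.

(** * Local test functions and their annihilators *)

Section separating.
Context (R : realType) (d : nat).
Local Notation Rd := 'rV[R]_d.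
Local Notation leb := (leb R d).
Local Notation Hs := (Hspace R d).
Local Notation dot := (@Hdot R d).
Implicit Types (f g h : Rd -> R[i]) (p : Rd) (u v : Hs).

Let hH : hilbert dot. exact: Hdot_hilbert. Qed.
Let ip : semi_inner dot. by case: hH. Qed.

Lemma Hconj_dotE u v f : cmeas f -> {ae leb, forall p, repr v p = f p} ->
  dot (Hconj u) v = cint leb (fun p => repr u p * f p).
move=> mf vf; have mu : cmeas (fun p => (repr u p)^*).
  by apply: cmeas_conj; case: (repr_sqint u).
rewrite /Hdot (L2_dotE mu mf (Hconj_ae u) vf); apply: eq_cint => p.
by rewrite cconjK.
Qed.

Lemma Fou_Fou u : Fou (Fou u) = Hrefl u.
by rewrite -[in LHS](HreflK u) -/(Uinv (Hrefl u)) UinvK. Qed.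

(** The bilinear pairing of h^ and f^ is the integral of h(x) f(-x), because the square of the
    Fourier transform is the reflection. *)
Lemma fourier_disjoint h f : nice h -> nice f -> (forall x, h x * f (- x) = 0) ->
  dot (Hconj (L2_of leb (fourier h))) (L2_of leb (fourier f)) = 0.
move=> nh nf hf; rewrite -(Fou_nice nh) -(Fou_nice nf) Fou_sym Fou_Fou.
have [mf _] := sqint_refl (nice_sqint nf); have [mh _] := nice_sqint nh.
have e : {ae leb, forall p, repr (Hrefl (L2_of leb f)) p = f (- p)}.
  by apply: filterS2 (Hrefl_ae (L2_of leb f)) (ae_refl (L2_of_ae (nice_sqint nf))) => p -> ->.
rewrite (Hconj_dotE _ mf e) (@ae_eq_cint _ _ _ _ _ (fun=> 0)) ?cint0//.
- by apply: cmeasM => //; case: (repr_sqint (L2_of leb h)).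
- by side.
- by apply: filterS (L2_of_ae (nice_sqint nh)) => p ->.
Qed.

(** u / w is the transform of a limit of test functions of the ball, so it annihilates h^ when the
    support of h misses the reflected ball. *)
Lemma Xset_orthogonal s w u h : sobolev_weight s w -> Xset w u -> schwartz h ->
  (forall f x, testC f -> h x * f (- x) = 0) ->
  cint leb (fun p => repr u p * ((w p)^-1%:C * fourier h p)) = 0.
case=> mw mwV wN w0 wle wVle _ _ [u_ [hu tu]] sh hf.
have sV := wV_sqint mwV w0 wVle sh; have nh := schwartz_nice sh.
have [mV _] := sV; pose Z := L2_of leb (fun p => (w p)^-1%:C * fourier h p).
rewrite -(Hconj_dotE u mV (L2_of_ae sV)) Hconj_dotC -/Z -(dot0r ip (Hconj Z)).
apply: (tends_dot_eq ip tu (tends_cst ip 0)) => n; rewrite (dot0r ip).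
have [f tf <-] := hu n; have sf := testC_schwartz tf.
rewrite -(fourier_disjoint nh (schwartz_nice sf) (fun x => hf f x tf)).
have sw := wF_sqint mw w0 wle sf; have [sh2 _] := plancherel nh.
have [sf2 _] := plancherel (schwartz_nice sf).
rewrite /wF (Hconj_dotE Z sw.1 (L2_of_ae sw)) (Hconj_dotE _ sf2.1 (L2_of_ae sf2)).
apply: ae_eq_cint.
- by apply: cmeasM sw.1; case: (repr_sqint Z).
- by apply: cmeasM sf2.1; case: (repr_sqint (L2_of leb (fourier h))).
apply: filterS2 (L2_of_ae sV) (L2_of_ae sh2) => p e1 e2; rewrite /Z e1 e2.
by rewrite mulrACA -real_complexM mulVf ?gt_eqF// mul1r.
Qed.

(** Provides the damped integrability assumed in [local_transform_unique]: q / (1 + |p|^2)^d is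
    square integrable even with the singularity that the majorant allows. *)
Lemma decay_integrable u (q : Rd -> R) : mfun q ->
  {ae leb, forall p, q p ^+ 2 <= 2 + 2 * majorant p} ->
  L1 leb (fun p => nc (repr u p * (q p)%:C) / (1 + eucl2 p) ^+ d).
move=> mq hq; pose D p : R := (1 + eucl2 p) ^+ d.
have e1 p : 1 <= 1 + eucl2 p by rewrite lerDl eucl2_ge0.
have D1 p : 1 <= D p by rewrite exprn_ege1.
have D0 p : 0 < D p := lt_le_trans ltr01 (D1 p).
have mD : mfun (fun p => (D p)^-1) by apply/mfun_funV/measurable_funX/measurable_funD => //; exact: mfun_eucl2.
have mqD : mfun (fun p => q p / D p) by side.
have sq : sqint leb (fun p => (q p / D p)%:C).
  split; first side.
  have [||||//] := ae_le_Rintegral (f := fun p => nc (q p / D p)%:C ^+ 2) _ _ _ (L1D (L1Z 2 (Pn1_int R d).1) (L1Z 2 (L1_majorant R d))).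
  - by side.
  - by side.
  - by move=> p; apply: addr_ge0; apply: mulr_ge0 => //; [exact: Pn_ge0|side].
  apply: filterS hq => p h; rewrite nc_real real_normK ?num_real// expr_div_n.
  have D2 : D p <= D p ^+ 2 by rewrite expr2 ler_peMl// ltW.
  have D20 : 0 < D p ^+ 2 by side.
  have DV : (D p ^+ 2)^-1 <= 1 by rewrite invf_le1// (le_trans (D1 p)).
  have DP : (D p ^+ 2)^-1 <= Pn 1 p.
    apply: (@le_trans _ _ (D p)^-1); first by rewrite lef_pV2 ?posrE.
    by rewrite -div1r ler_pdivrMr// mulrC Pn1_weight.
  apply: (@le_trans _ _ ((2 + 2 * majorant p) * (D p ^+ 2)^-1)).
    by rewrite ler_wpM2r// invr_ge0 sqr_ge0.
  rewrite mulrDl; apply: lerD; first by rewrite ler_wpM2l.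
  rewrite -mulrA ler_wpM2l//; have := ler_wpM2l (majorant_ge0 p) DV; by rewrite mulr1.
have := cint_nc (sqint_mul (repr_sqint u) sq); congr (_.-integrable _ (_ \o _)).
apply/funext => p; rewrite real_complexM mulrA ncM [X in _ * X]nc_real ger0_norm//.
by side.
Qed.

Hypothesis hd : d = 2%N \/ d = 3%N.

Let some_i : exists i : 'I_d, true. by case: hd => ->; exists ord0. Qed.

Lemma localized_schwartz (x0 : Rd) (e : R) k : schwartz (fun x => (localized x0 e k x)%:C).
apply: (@schwartz_prodf _ _ _ _ (\sum_i (`|x0 0 i| + `|e|))) => [i|i y h].
  exact: dseq_bump.
apply: bump_at_support; apply: le_lt_trans h; rewrite (bigD1 i)//= lerDl.
by side.
Qed.

Lemma localized_test (e : R) k : 0 < e -> e <= 2^-1 -> test_function (localized (0 : Rd) e k).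
move=> e0 e1; apply: (@test_prodf _ _ _ _ 2^-1) => [i||i y h].
- exact: dseq_bump.
(* The cube of half-side 1/2 lies in the unit ball because d / 4 < 1. *)
- by case: hd => ->; lra.
- by apply: bump_at_support; rewrite mxE normr0 add0r gtr0_norm// (le_lt_trans e1).
Qed.

(** With the centre (3, ..., 3) and a radius at most 1, the bump lives where all coordinates are at
    least 2, away from the reflected ball. *)
Lemma localized_far (e : R) k f x : 0 < e -> e <= 1 -> testC f ->
  (localized (const_mx 3) e k x)%:C * f (- x) = 0.
move=> e0 e1 [[_ _ s1] [_ _ s2]]; have [i _] := some_i.
have [h|h] := leP (x 0 i) (3 - e).
  by rewrite /localized /prodf (bigD1 i)//= /bump_at mxE bump_left ?mul0r.
suff -> : f (- x) = 0 by rewrite mulr0.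
have big : ~ unit_ball (- x).
  rewrite /unit_ball /=; apply/negP; rewrite -leNgt eucl2N.
  have := coord_le_omega 0 x i; have x1 : 1 <= x 0 i by lra.
  rewrite ger0_norm ?(le_trans _ x1)// => h1; have w1 := le_trans x1 h1.
  have : 1 <= omega 0 x ^+ 2 by rewrite exprn_ege1.
  by rewrite omega_sqr expr0n add0r.
apply: complex_eqP => /=; apply: contra_notP big => /eqP n0.
  by apply/s1/subset_closure.
by apply/s2/subset_closure.
Qed.

End separating.

(** * Injectivity and density of the embeddings *)

Section tomita.
Context (R : realType) (d : nat).
Hypothesis hd : d = 2%N \/ d = 3%N.
Local Notation Rd := 'rV[R]_d.
Local Notation leb := (leb R d).
Local Notation Hs := (Hspace R d).
Local Notation dot := (@Hdot R d).
Local Notation X := (@Xspace R d).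
Implicit Types (p : Rd) (x y z : X).

Let hH : hilbert dot. exact: Hdot_hilbert. Qed.
Let ip : semi_inner dot. by case: hH. Qed.

Variable m : R.
Hypothesis m0 : 0 <= m.

Lemma Uinv_eq0 (u : Hs) : Uinv u = 0 -> u = 0.
by move=> h; apply: (sqnorm_eq0 hH); rewrite -Uinv_sqnorm h (sqnorm0 ip). Qed.

(** J x = 0 reads omega_m g^ = i f^ with g^ = b <p>^(-1/2) and f^ = a <p>^(1/2), transforms of
    distributions carried by the ball. Both annihilate the transforms of bumps around (3, ..., 3),
    so anti-locality of omega_m gives g = 0, and then f = 0. *)
Lemma Jop_inj x : Jop m x = 0 -> x = 0.
rewrite /Jop addrC -(Uinv_lin 'i (Bop m x) (Aop m x)) => /Uinv_eq0 AB.
have [dA _] := Aop_bound hd m x; have [dB _] := Bop_bound hd m0 x.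
have rel : {ae leb, forall p, repr (xb x) p * (wm p)%:C * (omega m p)%:C =
    'i * (repr (xa x) p * ((wm p)^-1)%:C)}.
  have [_ z0] := mulH_lin 0 (mfun_alpha m) dA dA.
  have eAB : {ae leb, forall p, 'i * repr (Bop m x) p + repr (Aop m x) p = 0}.
    have h0 : {ae leb, forall p, repr (0 : Hs) p = 0}.
      by apply: filterS (reprZ 0 (0 : Hs)) => p; rewrite scale0r mul0r.
    by apply: filterS2 (repr_lin 'i (Bop m x) (Aop m x)) h0 => p <-; rewrite AB.
  apply: filterS (filterI eAB (filterI (omegaq_gt0_ae m hd) (filterI (mulH_ae dA) (mulH_ae dB)))).
  move=> p [e [q0 [eA eB]]]; move: e; rewrite [repr (Aop m x) p]eA [repr (Bop m x) p]eB.
  have q1 : 0 < omegaq 1 p := lt_le_trans ltr01 (omegaq1_ge1 p).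
  have ii : ('i : R[i]) * 'i = -1 by apply: complex_eqP => /=; ring.
  rewrite -omegaq_sqr /alpha /beta /wm invrK; move: (repr (xa x) p) (repr (xb x) p) => a b e.
  have : (omegaq m p)%:C * ('i * ((omegaq m p / omegaq 1 p)%:C * b) +
    (omegaq 1 p / omegaq m p)%:C * a) * 'i = 0 by rewrite e mulr0 mul0r.
  have -> : (omegaq m p)%:C * ('i * ((omegaq m p / omegaq 1 p)%:C * b) +
    (omegaq 1 p / omegaq m p)%:C * a) * 'i =
    ('i * 'i) * (b * (omegaq m p * (omegaq m p / omegaq 1 p))%:C) +
    'i * (a * (omegaq m p * (omegaq 1 p / omegaq m p))%:C).
    by rewrite [in RHS]real_complexM [in X in _ = _ + X]real_complexM; ring.
  rewrite ii mulN1r [omegaq m p * (omegaq 1 p / _)]mulrC divfK ?gt_eqF// addrC => /subr0_eq ->.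
  by rewrite -mulrA -real_complexM expr2; congr (_ * _%:C); field; rewrite gt_eqF.
have mb : cmeas (repr (xb x)) by case: (repr_sqint (xb x)).
have ma : cmeas (repr (xa x)) by case: (repr_sqint (xa x)).
have mm : cmeas (fun p => (wm p)%:C) by side.
have mV : cmeas (fun p => ((wm p)^-1)%:C) by side.
have G0 : {ae leb, forall p, repr (xb x) p * (wm p)%:C = 0}.
  apply: (@local_transform_unique _ _ _ d m (const_mx 3) 1) => //; first side.
    apply: decay_integrable; first side.
    apply: nearW => p; have w1 : wm p <= 1 by rewrite invf_le1 ?omegaq1_ge1// (lt_le_trans ltr01 (omegaq1_ge1 p)).
    have w0 := sw_gt0 (wm_weight R d) p.
    have := majorant_ge0 p; have : wm p ^+ 2 <= 1 by rewrite exprn_ile1// ltW.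
    by move=> *; lra.
  move=> e k e0 e1; have sl := localized_schwartz (const_mx 3 : Rd) e k.
  have far f (y : Rd) : testC f -> (localized (const_mx 3) e k y)%:C * f (- y) = 0 by exact: localized_far.
  have hb := Xset_orthogonal (wp_weight R d) (xbP x) sl far.
  have ha := Xset_orthogonal (wm_weight R d) (xaP x) sl far.
  have [sF _] := plancherel (schwartz_nice sl); have [mF _] := sF.
  set F := fourier _ in hb ha mF sF *.
  split; first by rewrite -[RHS]hb; apply: eq_cint => p; rewrite mulrA.
  have ia : cL1 leb (fun p => repr (xa x) p * (((wm p)^-1)%:C * F p)).
    apply: sqint_mul (repr_sqint _) _; have [? ? ? ? ? ? ? ?] := wm_weight R d.
    exact: wV_sqint _ _ _ sl.
  transitivity ('i * cint leb (fun p => repr (xa x) p * (((wm p)^-1)%:C * F p))); last by rewrite ha mulr0.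
  rewrite -(cintZ _ ia); apply: ae_eq_cint.
  - by side.
  - by side.
  by apply: filterS rel => p h; rewrite mulrA h !mulrA.
have b0 : xb x = 0.
  apply/L2_eqP; apply: filterS2 (reprZ 0 (0 : Hs)) G0 => p; rewrite scale0r mul0r => ->.
  move=> /eqP; rewrite mulf_eq0 => /orP[/eqP//|/eqP h].
  have := sw_gt0 (wm_weight R d) p; have -> : wm p = 0 by apply: complexI h.
  by rewrite ltxx.
have B0 : Bop m x = 0.
  apply: (sqnorm_le0 hH).
  by have [_] := Bop_bound hd m0 x; rewrite b0 (sqnorm0 ip) mulr0.
have A0 : Aop m x = 0 by move: AB; rewrite B0 scaler0 add0r.
apply: X_eq => //; apply: (sqnorm_le0 hH).
by have := Aop_lower hd m0 x; rewrite A0 (sqnorm0 ip) mulr0.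
Qed.

(** Pairs with one component 0 show that, up to conjugation, omega_m^(-1/2) v^ and omega_m^(1/2) v^
    annihilate the transforms of all test functions. The second is omega_m times the first, so
    uniqueness applies with bumps around 0 inside the ball. *)
Lemma Jop_dense v : (forall x, dot (Jop m x) v = 0) -> v = 0.
move=> hv; have [wmm wmV wmN wm0 wmle wmVle _ _] := wm_weight R d.
have [wpm wpV wpN wp0 wple wpVle _ _] := wp_weight R d.
pose u := Hconj (Fou v).
have key (w : Hs) (f : Rd -> R[i]) : cmeas f -> {ae leb, forall p, repr w p = f p} ->
    dot (Uinv w) v = 0 -> cint leb (fun p => repr u p * f p) = 0.
  move=> mf wf; rewrite -{1}(FouK v) Uinv_dot => h.
  by rewrite -(Hconj_dotE u mf wf) HconjK (dotC ip) h cconj0.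
have UJ (w w' : Hs) : w' = 0 -> Uinv w + 'i *: Uinv w' = Uinv w /\ Uinv w' + 'i *: Uinv w = 'i *: Uinv w.
  have U0 : Uinv (0 : Hs) = 0 by apply: (sqnorm_eq0 hH); rewrite Uinv_sqnorm (sqnorm0 ip).
  by move=> ->; rewrite U0 scaler0 addr0 add0r.
have mu : cmeas (repr u) by case: (repr_sqint u).
have mqV : mfun (fun p => (omegaq m p)^-1) by side.
have test_zero f : testC f -> cint leb (fun p => repr u p * (((omegaq m p)^-1)%:C * fourier f p)) = 0 /\
    cint leb (fun p => repr u p * ((omegaq m p)%:C * fourier f p)) = 0.
  move=> tf; have sf := testC_schwartz tf; have [[mF _] _] := plancherel (schwartz_nice sf).
  have X0 w s : sobolev_weight s w -> Xset w (0 : Hs) by case/sw_subspace.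
  have Xw s w : sobolev_weight s w -> Xset w (wF w f).
    by move=> _; apply: (closure_incl hH); exists f.
  split.
    have [x [ea eb]] := X_exists (Xw _ _ (wm_weight R d)) (X0 _ _ (wp_weight R d)).
    have [dA _] := Aop_bound hd m x.
    have B0 : Bop m x = 0.
      apply: (sqnorm_le0 hH).
      by have [_] := Bop_bound hd m0 x; rewrite eb (sqnorm0 ip) mulr0.
    apply: (key (Aop m x)); first by side.
      have := L2_of_ae (wF_sqint wmm wm0 wmle sf); rewrite -/(wF (@wm R d) f) -ea => ha.
      apply: filterS2 (mulH_ae dA) ha => p h1 h2; rewrite [LHS]h1 h2 mulrA -real_complexM.
      congr (_%:C * _); rewrite /alpha /wm mulrAC divff ?mul1r// gt_eqF//.
      exact: lt_le_trans ltr01 (omegaq1_ge1 p).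
    by have := hv x; rewrite /Jop; have [-> _] := UJ (Aop m x) _ B0.
  have [x [ea eb]] := X_exists (X0 _ _ (wm_weight R d)) (Xw _ _ (wp_weight R d)).
  have [dB _] := Bop_bound hd m0 x.
  have A0 : Aop m x = 0.
    apply: (sqnorm_le0 hH).
    by have [_] := Aop_bound hd m x; rewrite ea (sqnorm0 ip) mulr0.
  apply: (key (Bop m x)).
  - by side.
  - have := L2_of_ae (wF_sqint wpm wp0 wple sf); rewrite -/(wF (@wp R d) f) -eb => hb.
    apply: filterS2 (mulH_ae dB) hb => p h1 h2; rewrite [LHS]h1 h2 mulrA -real_complexM.
    congr (_%:C * _); rewrite /beta /wp divfK// gt_eqF//.
    exact: lt_le_trans ltr01 (omegaq1_ge1 p).
  have := hv x; rewrite /Jop; have [_ ->] := UJ (Bop m x) _ A0.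
  rewrite (dotZl ip) => /eqP; rewrite mulf_eq0 => /orP[|/eqP//].
  by rewrite cconj_i oppr_eq0 => /eqP h; have := congr1 (fun z : R[i] => Im z) h => /= /eqP; rewrite oner_eq0.
have u0 : {ae leb, forall p, repr u p * ((omegaq m p)^-1)%:C = 0}.
  apply: (@local_transform_unique _ _ _ d m 0 2^-1) => //.
  - by side.
  - apply: decay_integrable => //; apply: filterS2 (alpha_le m hd) (omegaq_gt0_ae m hd) => p h q0.
    apply: le_trans h; rewrite lerXn2r ?nnegrE ?divr_ge0 ?invr_ge0 ?omegaq_ge0//.
    by rewrite /alpha ler_peMl ?omegaq1_ge1// invr_ge0 ltW.
  move=> e k e0 e1; have [] := test_zero _ (testC_real (localized_test hd k e0 e1)).
  set F := fourier _; move=> h1 h2.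
  have mF : cmeas F.
    by have [[? _] _] := plancherel (schwartz_nice (localized_schwartz (0 : Rd) e k)).
  have mq : cmeas (fun p => (omegaq m p)%:C) by side.
  have mo : cmeas (fun p => (omega m p)%:C) by side.
  have mqC : cmeas (fun p => ((omegaq m p)^-1)%:C) by side.
  split; first by rewrite -[RHS]h1; apply: eq_cint => p; rewrite mulrA.
  rewrite -[RHS]h2; apply: ae_eq_cint.
  - by side.
  - by side.
  apply: filterS (omegaq_gt0_ae m hd) => p q0; rewrite -mulrA; congr (_ * _).
  by rewrite mulrA -real_complexM -omegaq_sqr expr2 mulKf// gt_eqF.
have u00 : u = 0.
  apply/L2_eqP; apply: filterS (filterI (reprZ 0 (0 : Hs)) (filterI u0 (omegaq_gt0_ae m hd))) => p [].
  rewrite scale0r mul0r => -> [/eqP h q0]; move: h; rewrite mulf_eq0 => /orP[/eqP//|/eqP h].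
  by have := complexI h => /eqP; rewrite invr_eq0 gt_eqF.
have F0 : sqnorm dot (Fou v) = 0 by rewrite -Hconj_sqnorm -/u u00 (sqnorm0 ip).
by apply: (sqnorm_eq0 hH); rewrite -Fou_sqnorm.
Qed.

Lemma Jop_tomita_data : tomita_data dot (@X_star R d) (Jop m) (Mform m).
split; [exact: Mform_hilbert|exact: Jop_lin|exact: Jop_inj|exact: Jop_dense|exact: Mform_graph].
Qed.

End tomita.

(** * Identification of K_m and of Q on X *)

Section real_subspaces.
Context (R : realType) (d : nat).
Hypothesis hd : d = 2%N \/ d = 3%N.
Local Notation Rd := 'rV[R]_d.
Local Notation leb := (leb R d).
Local Notation Hs := (Hspace R d).
Local Notation dot := (@Hdot R d).
Local Notation X := (@Xspace R d).
Implicit Types (p : Rd) (x y z : X) (u v a : Hs).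

Section one.
Variables (s m m' : R) (w g g' : Rd -> R).
Hypothesis sw : sobolev_weight s w.
Hypothesis mg : mfun g.
Hypothesis mg' : mfun g'.
Hypothesis hg : forall p, (m ^+ 2 + eucl2 p) `^ (s / 2) = g p * w p.
Hypothesis hg' : forall p, (m' ^+ 2 + eucl2 p) `^ (s / 2) = g' p * w p.

Lemma omega_pow_dist_of a : Xset w a -> star a = a -> mul_dom g a ->
  omega_pow m s (dist_of w a) (Uinv (mulH g a)).
case: sw => mw mwV wN w0 wle wVle ws _ xa sa da.
exists (fun p => repr a p * (w p)^-1%:C); split; first exact: dist_fourier_dist_of.
apply: dist_fourier_ae (dist_fourier_L2 _) _ _.
  apply: cmeasM; last by apply: cmeasM; [case: (repr_sqint a)|side].
  apply: cmeas_real; under eq_fun do rewrite hg; exact: measurable_funM.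
rewrite UinvK; apply: filterS (mulH_ae da) => p ->; rewrite hg real_complexM mulrACA.
by rewrite -[(w p)%:C * _]real_complexM divff ?gt_eqF// mulr1.
Qed.

(** The vector a is determined by the distribution T alone, so the images of T for the two masses
    share it. *)
Lemma omega_pow_Xset T u u' : sobolev_ball s T -> omega_pow m s T u -> omega_pow m' s T u' ->
  exists a, [/\ Xset w a, star a = a, u = Uinv (mulH g a) & u' = Uinv (mulH g' a)].
case: sw => mw mwV wN w0 wle wVle ws _ bT [v [Tv uv]] [v' [Tv' uv']].
have [sv Xv stv] := sobolev_ball_Xset mw wN w0 wle ws bT Tv.
set a := L2_of leb (fun p => (w p)%:C * v p).
have rec (z : Hs) (h : Rd -> R) : mfun h ->
    {ae leb, forall p, repr (Fou z) p = (h p)%:C * repr a p} -> z = Uinv (mulH h a).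
  move=> mh e; rewrite -[LHS]FouK; congr Uinv; symmetry; apply: L2_of_eq; last by apply: filterS e => p ->.
  by apply: ae_sqint (repr_sqint (Fou z)); first exact: cmeas_mulH.
exists a; split => //; apply: rec => //.
  apply: filterS2 (dist_fourier_unique (dist_fourier_L2 u) uv) (L2_of_ae sv) => p -> ->.
  by rewrite hg real_complexM mulrA.
apply: filterS3 (dist_fourier_unique (dist_fourier_L2 u') uv') (L2_of_ae sv)
  (dist_fourier_unique Tv Tv') => p -> -> ->.
by rewrite hg' real_complexM mulrA.
Qed.

End one.

Let q1 p : omegaq 1 p != 0. by rewrite gt_eqF// (lt_le_trans ltr01 (omegaq1_ge1 p)). Qed.

Lemma alpha_wm m p : (m ^+ 2 + eucl2 p) `^ (- 2^-1 / 2) = alpha m p * wm p.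
by rewrite powR_omegaqN /alpha /wm mulrAC divff// mul1r. Qed.

Lemma beta_wp m p : (m ^+ 2 + eucl2 p) `^ (2^-1 / 2) = beta m p * wp p.
by rewrite powR_omegaq /beta /wp divfK. Qed.

Lemma real_pair m m' f g u v u' v' : sobolev_ball (- 2^-1) f -> sobolev_ball 2^-1 g ->
  omega_pow m (- 2^-1) f u -> omega_pow m 2^-1 g v ->
  omega_pow m' (- 2^-1) f u' -> omega_pow m' 2^-1 g v' ->
  exists x, [/\ X_star x = x, u + 'i *: v = Jop m x & u' + 'i *: v' = Jop m' x].
move=> bf bg fu gv fu' gv'.
have [a [Xa sa eu eu']] := omega_pow_Xset (wm_weight R d) (mfun_alpha m)
  (mfun_alpha m') (alpha_wm m) (alpha_wm m') bf fu fu'.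
have [b [Xb sb ev ev']] := omega_pow_Xset (wp_weight R d) (mfun_beta m)
  (mfun_beta m') (beta_wp m) (beta_wp m') bg gv gv'.
have [x [ea eb]] := X_exists Xa Xb; exists x; split.
- by apply: X_eq; [rewrite -[LHS]/(star (xa x)) ea|rewrite -[LHS]/(star (xb x)) eb].
- by rewrite /Jop /Aop /Bop ea eb -eu -ev.
- by rewrite /Jop /Aop /Bop ea eb -eu' -ev'.
Qed.

Lemma real_pair_dist m x : 0 <= m -> X_star x = x ->
  omega_pow m (- 2^-1) (dist_of (@wm R d) (xa x)) (Uinv (Aop m x)) /\
  omega_pow m 2^-1 (dist_of (@wp R d) (xb x)) (Uinv (Bop m x)).
move=> m0 xs; have [dA _] := Aop_bound hd m x; have [dB _] := Bop_bound hd m0 x.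
have sa : star (xa x) = xa x by rewrite -{2}xs.
have sb : star (xb x) = xb x by rewrite -{2}xs.
split.
- exact (omega_pow_dist_of (wm_weight R d) (mfun_alpha m) (alpha_wm m) (xaP x) sa dA).
- exact (omega_pow_dist_of (wp_weight R d) (mfun_beta m) (beta_wp m) (xbP x) sb dB).
Qed.

Lemma real_ball x : X_star x = x -> sobolev_ball (- 2^-1) (dist_of (@wm R d) (xa x)) /\
  sobolev_ball 2^-1 (dist_of (@wp R d) (xb x)).
move=> xs; have sa : star (xa x) = xa x by rewrite -{2}xs.
have sb : star (xb x) = xb x by rewrite -{2}xs.
have [? ? ? ? ? ? ? _] := wm_weight R d; have [? ? ? ? ? ? ? _] := wp_weight R d.
by split; apply: sobolev_ball_dist_of => //; [exact: xaP|exact: xbP].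
Qed.

Lemma Kspace_real_part m : 0 <= m -> Kspace d m = real_part (Jop m) (@X_star R d).
move=> m0; apply/seteqP; split=> [h [f [g [u [v [bf bg fu gv ->]]]]]|h [x [xs ->]]].
  by have [x [xs e _]] := real_pair bf bg fu gv fu gv; exists x.
have [bf bg] := real_ball xs; have [fu gv] := real_pair_dist m0 xs.
by exists (dist_of (@wm R d) (xa x)), (dist_of (@wp R d) (xb x)), (Uinv (Aop m x)), (Uinv (Bop m x)).
Qed.

Lemma QsympE m u v : 0 <= m -> Qsymp m u v <-> exists x, [/\ X_star x = x, u = Jop m x & v = Jop 0 x].
move=> m0; split.
  move=> [f [g [bf bg [u1 [v1 [fu gv ->]]] [u2 [v2 [fu' gv' ->]]]]]].
  exact: real_pair bf bg fu gv fu' gv'.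
move=> [x [xs -> ->]]; have [bf bg] := real_ball xs.
have [fu gv] := real_pair_dist m0 xs; have [fu' gv'] := real_pair_dist (lexx 0) xs.
exists (dist_of (@wm R d) (xa x)), (dist_of (@wp R d) (xb x)); split => //.
  by exists (Uinv (Aop m x)), (Uinv (Bop m x)); split; [exact: fu|exact: gv|rewrite /Jop].
by exists (Uinv (Aop 0 x)), (Uinv (Bop 0 x)); split; [exact: fu'|exact: gv'|rewrite /Jop].
Qed.

Lemma QextE m u v : 0 <= m -> Qext d m u v <-> exists x, u = Jop m x /\ v = Jop 0 x.
move=> m0; have Ji m' x y : 0 <= m' -> Jop m' x + 'i *: Jop m' y = Jop m' ('i *: y + x).
  by move=> m0'; rewrite (Jop_lin hd m0') addrC.
split.
  move=> [h [k [h' [k' [/(QsympE _ _ m0)[x [_ -> ->]] /(QsympE _ _ m0)[y [_ -> ->]] -> ->]]]]].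
  by exists ('i *: y + x); split; [exact: (Ji m x y m0)|exact: (Ji 0 x y (lexx 0))].
move=> [x [-> ->]].
have [x1 [x2 [s1 s2 -> _]]] := re_im_star (@X_star_lin R d) (@X_starK R d) x.
exists (Jop m x1), (Jop m x2), (Jop 0 x1), (Jop 0 x2); split.
- by apply/(QsympE _ _ m0); exists x1.
- by apply/(QsympE _ _ m0); exists x2.
- by rewrite addrC; exact: esym (Ji m x1 x2 m0).
- by rewrite addrC; exact: esym (Ji 0 x1 x2 (lexx 0)).
Qed.

End real_subspaces.

(** * The Hilbert-Schmidt estimate for the difference of the forms *)

Section hilbert_schmidt_bound.
Context (R : realType) (d : nat).
Hypothesis hd : d = 2%N \/ d = 3%N.
Local Notation Rd := 'rV[R]_d.
Local Notation leb := (leb R d).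
Local Notation Hs := (Hspace R d).
Local Notation dot := (@Hdot R d).
Local Notation nsq := (sqnorm dot).
Local Notation X := (@Xspace R d).
Local Notation K := (@evalK R d).
Local Notation I := (@majorant_int R d).
Local Notation C := (@equivC R d).
Implicit Types (p : Rd) (x y z : X) (u v a : Hs).

Let hH : hilbert dot. exact: Hdot_hilbert. Qed.
Let ip : semi_inner dot. by case: hH. Qed.

Lemma mulH_dot_sub (h1 h2 h3 h4 : Rd -> R) u v : mul_dom h1 u -> mul_dom h1 v -> mul_dom h2 u ->
  mul_dom h2 v -> mul_dom h3 u -> mul_dom h4 v ->
  {ae leb, forall p, h1 p * h1 p - h2 p * h2 p = h3 p * h4 p} ->
  dot (mulH h1 u) (mulH h1 v) - dot (mulH h2 u) (mulH h2 v) = dot (mulH h3 u) (mulH h4 v).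
move=> d1 d1' d2 d2' d3 d4 e; rewrite /Hdot (L2_dot_of d1 d1') (L2_dot_of d2 d2') (L2_dot_of d3 d4).
have i1 := sqint_mul (sqint_conj d1) d1'; have i2 := sqint_mul (sqint_conj d2) d2'.
rewrite -(cintB i1 i2); apply: ae_eq_cint.
- by side.
- exact: cL1_meas (sqint_mul (sqint_conj d3) d4).
apply: filterS e => p e; rewrite !conjcM !cconj_real mulrACA [X in _ - X]mulrACA [RHS]mulrACA.
by rewrite -!real_complexM -mulrBl -e rmorphB.
Qed.

(** Sum and integral are exchanged; by point evaluation the inner sum is one of squared scalar
    products, bounded at each p separately. *)
Lemma mass_sum (s : seq X) (F : X -> Hs) (k : Rd -> Hs) (c : R) : 0 <= c ->
  (forall e, L1 leb (fun p => majorant p * nc (repr (F e) p) ^+ 2)) ->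
  (forall e, {ae leb, forall p, repr (F e) p = dot (k p) (F e)}) ->
  (forall p, \sum_(e <- s) nc (dot (k p) (F e)) ^+ 2 <= c) ->
  \sum_(e <- s) mass (F e) <= c * I.
move=> c0 iF eF bF; pose S p : R := \sum_(e <- s) majorant p * nc (repr (F e) p) ^+ 2.
have [iS eS] := Rintegral_sumR s iF.
have ae_s : {ae leb, forall p, \sum_(e <- s) nc (repr (F e) p) ^+ 2 = \sum_(e <- s) nc (dot (k p) (F e)) ^+ 2}.
  elim: (s) => [|e r ih]; first by apply: nearW => p; rewrite !big_nil.
  by apply: filterS2 (eF e) ih => p e1 e2; rewrite !big_cons e2 {1}e1.
have [||||_] := ae_le_Rintegral (f := S) _ _ _ (L1Z c (L1_majorant R d)).
- exact: L1_meas iS.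
- by move=> p; apply: sumr_ge0 => e _; side.
- by side.
- apply: filterS ae_s => p ep; rewrite /S -mulr_sumr ep mulrC.
  by apply: ler_wpM2r (bF p); side.
have -> : \int[leb]_p (c * majorant p) = c * I by rewrite /majorant_int -RintegralZl//; exact: L1_majorant.
by rewrite {1}/S eS.
Qed.

Variable m : R.
Hypothesis m0 : 0 <= m.

Local Notation kap := (@kappa R d m).

Let ipM : semi_inner (@Mform R d m). exact: Mform_semi_inner. Qed.
Let C4 : 4 <= C. exact: equivC_ge4. Qed.
Let C0 : 0 <= C. exact: le_trans C4. Qed.
Let h1m : 0 <= 1 + m. by side. Qed.
Let kap0 : 0 < kap. exact: kappa_gt0. Qed.
Let sn u : 0 <= nsq u. by side. Qed.

Let le_eq2 (a b a' b' k : R) : a = a' -> b = b' -> a' <= k * b' -> a <= k * b.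
by move=> -> ->. Qed.

Let le_combine (c k a1 b1 a2 b2 : R) : a1 <= c * (k * a2) -> b1 <= k * (c * b2) ->
  2 * (a1 + b1) <= c * k * (2 * (a2 + b2)).
by move=> h1 h2; rewrite [leRHS]mulrCA ler_pM2l// mulrDr -!mulrA lerD// mulrCA. Qed.

Lemma Mform_le_kappa m1 m2 x : 0 <= m1 <= m -> 0 <= m2 <= m -> sqnorm (Mform m1) x <= kap * sqnorm (Mform m2) x.
move=> /andP[p1 q1] /andP[p2 q2]; apply: (le_eq2 (sqnorm_Mform m1 x) (sqnorm_Mform m2 x)); rewrite /kappa.
have [_ h1] := Aop_bound hd m1 x; have [_ h2] := Bop_bound hd p1 x.
have r1 : C * nsq (xa x) <= C * ((1 + m) * nsq (Aop m2 x)).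
  by rewrite ler_wpM2l// (le_trans (Aop_lower hd p2 x))// ler_wpM2r// lerD2l.
have r2 : (1 + m1) * nsq (xb x) <= (1 + m) * (C * nsq (Bop m2 x)).
  by apply: ler_pM; rewrite ?addr_ge0 ?lerD2l//; exact: Bop_lower.
exact: le_combine (le_trans h1 r1) (le_trans h2 r2).
Qed.

Lemma Mform0_le x : sqnorm (Mform 0) x <= kap * sqnorm (Mform m) x.
by apply: Mform_le_kappa; rewrite ?lexx ?m0. Qed.

Lemma Mform_le0 x : sqnorm (Mform m) x <= kap * sqnorm (Mform 0) x.
by apply: Mform_le_kappa; rewrite ?lexx ?m0. Qed.

Definition mass_error : R := 2 * (Num.sqrt m + m ^+ 4) + (m ^+ 2 + m ^+ 4).

Let cA : R := 2 * (Num.sqrt m + m ^+ 4).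
Let cB : R := m ^+ 2 + m ^+ 4.
Let cA0 : 0 <= cA. by rewrite mulr_ge0//; side. Qed.
Let cB0 : 0 <= cB. by rewrite addr_ge0; side. Qed.

(** The difference of the squared weights [alpha] at masses m and 0 is [alpha 0] times gA: the
    singular factor stays with z, where the norm controls it, and gA carries the smallness in m. For
    [beta] the whole difference gB is put on the other side. *)
Let gA p : R := alpha 0 p * (omega 0 p / omega m p - 1).
Let gB p : R := (omega m p - omega 0 p) / omega 1 p.

Let gA_bound x : mul_dom gA (xa x) /\ nsq (mulH gA (xa x)) <= cA * mass (xa x).
have mgA : mfun gA by rewrite /gA; side.
have hA : {ae leb, forall p, gA p ^+ 2 <= 0 + cA * majorant p}.
  apply: filterS (majorantP R hd) => p [a0 h1 h2]; rewrite add0r /gA exprMn alpha_sqr -sqrrN opprB.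
  exact: a_weight.
have [dx h] := mulH_bound (evalK_ge0 R d) (xa_bounded x) mgA (lexx 0) cA0 hA.
by split => //; apply: (le_trans h); rewrite mul0r add0r.
Qed.

Let gB_bound x : mul_dom gB (xb x) /\ nsq (mulH gB (xb x)) <= cB * mass (xb x).
have mgB : mfun gB by rewrite /gB; side.
have hB : {ae leb, forall p, gB p ^+ 2 <= 0 + cB * majorant p}.
  by apply: filterS (majorantP R hd) => p [a0 h1 h2]; rewrite add0r; exact: b_weight.
have [dx h] := mulH_bound (evalK_ge0 R d) (xb_bounded x) mgB (lexx 0) cB0 hB.
by split => //; apply: (le_trans h); rewrite mul0r add0r.
Qed.

Let diffA z x : dot (Aop m z) (Aop m x) - dot (Aop 0 z) (Aop 0 x) = dot (Aop 0 z) (mulH gA (xa x)).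
have [d1 _] := Aop_bound hd m z; have [d2 _] := Aop_bound hd m x.
have [d3 _] := Aop_bound hd 0 z; have [d4 _] := Aop_bound hd 0 x; have [d5 _] := gA_bound x.
apply: (mulH_dot_sub d1 d2 d3 d4 d3 d5); apply: filterS (majorantP R hd) => p [a0 _ _].
rewrite /gA mulrA -!expr2 !alpha_sqr mulrBr mulr1; congr (_ - _).
by rewrite mulrA divfK// gt_eqF.
Qed.

Let diffB z x : dot (Bop m z) (Bop m x) - dot (Bop 0 z) (Bop 0 x) = dot (xb z) (mulH gB (xb x)).
have [d1 _] := Bop_bound hd m0 z; have [d2 _] := Bop_bound hd m0 x.
have [d3 _] := Bop_bound hd (lexx 0) z; have [d4 _] := Bop_bound hd (lexx 0) x.
have e : (fun p => 1%:C * repr (xb z) p) = repr (xb z) by apply/funext => p; rewrite mul1r.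
have d6 : mul_dom (fun=> 1) (xb z) by rewrite /mul_dom e; exact: repr_sqint.
have -> : dot (xb z) (mulH gB (xb x)) = dot (mulH (fun=> 1) (xb z)) (mulH gB (xb x)).
  by rewrite {2}/mulH e L2_of_repr.
apply: (mulH_dot_sub d1 d2 d3 d4 d6 (gB_bound x).1); apply: nearW => p.
by rewrite mul1r -!expr2 !beta_sqr -mulrBl.
Qed.

Let sqr_ncD (a b : R[i]) : nc (a + b) ^+ 2 <= 2 * nc a ^+ 2 + 2 * nc b ^+ 2.
have h := ncD a b; have : nc (a + b) ^+ 2 <= (nc a + nc b) ^+ 2 by rewrite lerXn2r ?nnegrE// (le_trans (nc_ge0 (a + b))).
have := sqr_ge0 (nc a - nc b); nra.
Qed.

Lemma form_diff_bound z x : nc (form_diff (Mform m) (Mform 0) z x) ^+ 2 <=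
  kap * mass_error * (mass (xa x) + mass (xb x)) * sqnorm (Mform m) z.
have -> : form_diff (Mform m) (Mform 0) z x =
    dot (Aop 0 z) (mulH gA (xa x)) + dot (xb z) (mulH gB (xb x)).
  rewrite -diffA -diffB /form_diff /Mform -mulrBr mulrA -real_complexM mulVf ?pnatr_eq0// mul1r.
  by rewrite opprD addrACA.
apply: (le_trans (sqr_ncD _ _)).
have h1 := cauchy_schwarz ip (Aop 0 z) (mulH gA (xa x)).
have h2 := cauchy_schwarz ip (xb z) (mulH gB (xb x)).
have [_ h3] := gA_bound x; have [_ h4] := gB_bound x.
have [_ h5] := Aop_bound hd 0 z; have h6 := Aop_lower hd m0 z; have h7 := Bop_lower hd m0 z.
have n1 := sn (mulH gA (xa x)); have n2 := sn (mulH gB (xb x)); have n3 := sn (Aop 0 z).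
have n4 := sn (xb z); have n5 := sn (Aop m z); have n6 := sn (Bop m z).
have k1 : C * (1 + m) = kap by [].
have k2 : C <= kap by rewrite -k1 ler_peMr// lerDl.
rewrite sqnorm_Mform; have a0 := mass_ge0 (xa x); have b0 := mass_ge0 (xb x).
have := kap0; rewrite /mass_error -/cA -/cB.
move: (nc (dot (Aop 0 z) (mulH gA (xa x)))) (nc (dot (xb z) (mulH gB (xb x)))) h1 h2 => X1 X2 h1 h2.
move: kap k1 k2 => k k1 k2 k0.
move: (nsq (mulH gA (xa x))) (nsq (mulH gB (xb x))) (nsq (Aop 0 z)) (nsq (xb z))
 (nsq (xa z)) (nsq (Aop m z)) (nsq (Bop m z)) (mass (xa x)) (mass (xb x))
 h1 h2 h3 h4 h5 h6 h7 n1 n2 n3 n4 n5 n6 a0 b0.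
move=> g1 g2 A0 sb sa A B ma mb h1 h2 h3 h4 h5 h6 h7 n1 n2 n3 n4 n5 n6 a0 b0.
have e1 : A0 <= k * A by apply: (le_trans h5); rewrite -k1 -mulrA ler_wpM2l.
have e2 : sb <= k * B by apply: (le_trans h7); rewrite ler_wpM2r.
have f1 : X1 ^+ 2 <= k * A * (cA * ma) by apply: (le_trans h1); exact: ler_pM.
have f2 : X2 ^+ 2 <= k * B * (cB * mb) by apply: (le_trans h2); exact: ler_pM.
have kA : 0 <= k * A by side.
have kB : 0 <= k * B by side.
have f3 : k * A * (cA * ma) <= k * A * ((cA + cB) * (ma + mb)).
  by rewrite ler_wpM2l// ler_pM// ?lerDl.
have f4 : k * B * (cB * mb) <= k * B * ((cA + cB) * (ma + mb)).
  by rewrite ler_wpM2l// ler_pM// ?lerDr.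
rewrite (_ : k * (cA + cB) * (ma + mb) * (2 * (A + B)) =
  2 * (k * A * ((cA + cB) * (ma + mb))) + 2 * (k * B * ((cA + cB) * (ma + mb)))); last by ring.
by apply: lerD; rewrite ler_wpM2l//; [apply: le_trans f3|apply: le_trans f4].
Qed.

Definition hs_error : R := kap * mass_error * (K * kap * I).

Lemma mass_error_ge0 : 0 <= mass_error. exact: addr_ge0 cA0 cB0. Qed.

Lemma hs_error_ge0 : 0 <= hs_error.
apply: mulr_ge0; first exact: mulr_ge0 (ltW kap0) mass_error_ge0.
exact: mulr_ge0 (mulr_ge0 (evalK_ge0 R d) (ltW kap0)) (majorant_int_ge0 R d).
Qed.

(** For each p, x |-> <k p, F (B x)> is a functional of squared norm at most K (kap / 2) b, so
    Bessel's inequality bounds the sum over s at p; integration against the majorant gives the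
    factor I. *)
Lemma Bessel_mass (B : X -> X) (b : R) (s : seq X) (F : X -> Hs) (k : Rd -> Hs) : lin B -> 0 <= b ->
  (forall x, sqnorm (Mform m) (B x) <= b * sqnorm (Mform m) x) -> uniq s ->
  {in s &, forall e e', Mform m e e' = (e == e')%:R} ->
  (forall (c : R[i]) x y, F (c *: x + y) = c *: F x + F y) ->
  (forall p, nsq (k p) <= K) ->
  (forall x, {ae leb, forall p, repr (F x) p = dot (k p) (F x)}) ->
  (forall x, {ae leb, forall p, nc (repr (F x) p) ^+ 2 <= K * nsq (F x)}) ->
  (forall x, nsq (F x) <= kap / 2 * sqnorm (Mform m) x) ->
  \sum_(e <- s) mass (F (B e)) <= K * (kap / 2 * b) * I.
move=> Bl b0 Bb us os Fl kK ek bk Fk.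
have K0 := evalK_ge0 R d; have kap2 : 0 <= kap / 2 by side.
move: (kap / 2) kap2 Fk => c c0 Fk; have Kcb : 0 <= K * (c * b) := mulr_ge0 K0 (mulr_ge0 c0 b0).
apply: (@mass_sum s (fun e => F (B e)) k) => [|e|e|p].
- exact: Kcb.
- by have [] := mass_le K0 (bk (B e)).
- exact: ek.
apply: (bessel ipM (phi := fun x => dot (k p) (F (B x)))) => //.
- by move=> t x y; rewrite Bl Fl (dotDr ip) (dotZr ip).
- move=> x; apply: (le_trans (cauchy_schwarz ip _ _)); rewrite -(mulrA K).
  apply: ler_pM (kK p) _; [exact: sn|exact: sn|].
  by apply: (le_trans (Fk (B x))); rewrite -(mulrA c) ler_wpM2l.
Qed.

Lemma form_diff_hs (B : X -> X) (b : R) (s : seq X) : lin B -> 0 <= b ->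
  (forall x, sqnorm (Mform m) (B x) <= b * sqnorm (Mform m) x) -> uniq s ->
  {in s &, forall e e', Mform m e e' = (e == e')%:R} ->
  exists f : X -> R, [/\ forall e, 0 <= f e,
    {in s, forall e z, nc (form_diff (Mform m) (Mform 0) z (B e)) ^+ 2 <= f e * sqnorm (Mform m) z}
    & \sum_(e <- s) f e <= b * hs_error].
move=> Bl b0 Bb us os; have e0 := mass_error_ge0.
have ke0 : 0 <= kap * mass_error by side.
exists (fun e => kap * mass_error * (mass (xa (B e)) + mass (xb (B e)))); split.
- by move=> e; apply: mulr_ge0 ke0 (addr_ge0 (mass_ge0 _) (mass_ge0 _)).
- by move=> e _ z; exact: form_diff_bound.
rewrite -mulr_sumr big_split /hs_error mulrCA ler_wpM2l//.
have ha := Bessel_mass Bl b0 Bb us os (@xa_lin R d) (@evalK_a R d) (@xa_eval R d) (@xa_bounded R d)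
  (xa_le_Mform hd m0).
have hb := Bessel_mass Bl b0 Bb us os (@xb_lin R d) (@evalK_b R d) (@xb_eval R d) (@xb_bounded R d)
  (xb_le_Mform hd m0).
apply: (le_trans (lerD ha hb)); apply/eqW; by field.
Qed.

End hilbert_schmidt_bound.

(** * The limit of vanishing mass *)

Section limit.
Context (R : realType) (d : nat).
Hypothesis hd : d = 2%N \/ d = 3%N.
Variables (lambda : R[i]) (c : R).
Hypothesis c0 : 0 < c.
Hypothesis hc : forall s t : R, 0 <= s -> 0 <= t -> c * (s + t) <= nc (s%:C - lambda * t%:C).
Local Notation K := (@evalK R d).
Local Notation I := (@majorant_int R d).
Local Notation C := (@equivC R d).

(** The bound of [resolvent_difference_hs] as a function of the norm equivalence constant k and of
    the error e. *)
Definition hs_bound (k e : R) : R :=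
  (2 + 2 * (nc (1 - lambda) ^+ 2 * (k * (k / c ^+ 2)))) * e / c ^+ 2.

Lemma resolvent_difference_bound m : 0 <= m -> exists E,
  [/\ orthonormal_basis (K_complex d m) (dot_s d m) E,
      bounded_linear_on (K_complex d m) (dot_s d m) (resolvent_difference d m lambda)
    & (hs_sum (dot_s d m) (resolvent_difference d m lambda) E
        <= (hs_bound (@kappa R d m) (@hs_error R d m))%:E)%E].
move=> m0; have D := Jop_tomita_data hd m0; have D0 := Jop_tomita_data hd (lexx (0 : R)).
have h := resolvent_difference_hs (@Hdot_hilbert R d) (@X_star_lin R d) (@X_starK R d) c0 hc D D0
  (fun x y => symplectic_form hd x y m0 (lexx 0)) (kappa_gt0 d m0) (Mform0_le hd m0) (Mform_le0 hd m0)
  (form_diff_hs hd m0) (fun u v => QextE hd u v m0).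
rewrite /K_complex /dot_s /resolvent_difference /modular_K.
move: (Kspace_real_part hd m0) (Kspace_real_part hd (lexx (0 : R))).
generalize (Kspace d m) (@Kspace R d 0); move=> Km K0 -> ->; exact: h.
Qed.

Lemma mass_error_le (m : R) : 0 <= m -> m <= 1 -> mass_error m <= 6 * Num.sqrt m.
move=> m0 m1; have s0 : 0 <= Num.sqrt m := sqrtr_ge0 m.
have s1 : Num.sqrt m <= 1 by rewrite -[leRHS]sqrtr1 ler_wsqrtr.
have ms : m <= Num.sqrt m by rewrite -{1}(sqr_sqrtr m0) ler_piMl.
have m2 : m ^+ 2 <= m by rewrite ler_piMl.
have m4 : m ^+ 4 <= m by rewrite exprS ler_piMr// exprn_ile1.
by rewrite /mass_error; lra.
Qed.

Lemma hs_bound_ge0 (k e : R) : 0 <= k -> 0 <= e -> 0 <= hs_bound k e.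
have n0 := sqr_ge0 (nc (1 - lambda)); rewrite /hs_bound.
by side.
Qed.

Lemma hs_bound_le (q k e f t : R) : 0 <= q -> q <= k -> 0 <= e -> e <= f * t ->
  hs_bound q e <= hs_bound k f * t.
move=> q0 qk e0 ef; have k0 := le_trans q0 qk.
have c20 : 0 <= (c ^+ 2)^-1 by side.
have n0 := sqr_ge0 (nc (1 - lambda)); rewrite /hs_bound.
rewrite [leRHS]mulrAC ler_wpM2r// -[leRHS]mulrA; apply: ler_pM => //.
  by side.
rewrite lerD2l ler_wpM2l// ler_wpM2l//; apply: ler_pM; rewrite ?mulr_ge0//.
by rewrite ler_wpM2r.
Qed.

(** For m <= 1 the equivalence constants are bounded by their values at m = 1, so the only
    dependence left is the factor sqrt m coming from [mass_error]. *)
Lemma hs_error_le : exists2 f : R, 0 <= f & forall m : R, 0 <= m -> m <= 1 ->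
  0 <= @kappa R d m <= 2 * C /\ 0 <= @hs_error R d m <= f * Num.sqrt m.
have C0 : 0 <= C := le_trans (ler0n _ 4) (equivC_ge4 R d).
have K0 := evalK_ge0 R d; have I0 := majorant_int_ge0 R d.
have C2 : 0 <= 2 * C by side.
exists (2 * C * 6 * (K * (2 * C) * I)).
  by side.
move=> m m0 m1; have kp0 := ltW (kappa_gt0 d m0).
have kk : @kappa R d m <= 2 * C.
  by rewrite /kappa [leRHS]mulrC; apply: (ler_wpM2l C0); lra.
rewrite kp0 kk hs_error_ge0//; split => //.
have e1 := mass_error_le m0 m1; have e0 := mass_error_ge0 m0.
rewrite /hs_error; move: (@kappa R d m) (2 * C) C2 kk kp0 K0 I0 => q k k0 qk q0.
move: K I => u v u0 v0.
rewrite [leRHS](_ : _ = k * (6 * Num.sqrt m) * (u * k * v)); last by ring.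
apply: ler_pM; rewrite ?mulr_ge0//; first exact: ler_pM.
by rewrite ler_wpM2r// ler_wpM2l.
Qed.

End limit.

Theorem theorem3p4 (R : realType) (d : nat) (hd : d = 2%N \/ d = 3%N)
    (lambda : R[i]) (hlambda : ~~ (0 <= lambda)) :
  (forall m : R, 0 < m ->
     hilbert_schmidt (K_complex d m) (dot_s d m)
       (resolvent_difference d m lambda)) /\
  hs_norm (K_complex d m) (dot_s d m) (resolvent_difference d m lambda)
    @[m --> (0 : R)^'+] --> 0%E.
Proof.
have [c [c0 hc]] := coercive_scalar hlambda.
split=> [m m0|].
  have [E [oE bl hs]] := resolvent_difference_bound hd c0 hc (ltW m0).
  by split => //; exists E; split => //; apply: le_lt_trans hs (ltry _).
have [f f0 hf] := hs_error_le R d; pose B := hs_bound lambda c (2 * @equivC R d) f.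
have B0 : 0 <= B.
  by have [/andP[k0 k1] _] := hf 0 (lexx 0) ler01; apply: hs_bound_ge0 f0; exact: le_trans k1.
(* The sum of squares is at most B sqrt m, so the norm is of order m^(1/4). *)
pose g (m : R) : R := Num.sqrt (B * Num.sqrt m).
have gc : g m @[m --> (0 : R)^'+] --> (0 : R).
  apply: cvg_at_right_filter; have g0 : g 0 = 0 by rewrite /g sqrtr0 mulr0 sqrtr0.
  rewrite -[X in _ --> X]g0; apply: (@continuous_comp _ _ _ (fun m : R => B * Num.sqrt m) Num.sqrt).
    by apply: cvgM; [exact: cvg_cst|exact: sqrt_continuous].
  exact: sqrt_continuous.
apply: (@squeeze_cvge _ _ _ _ (fun=> 0%E) _ (fun m => (g m)%:E)); last 2 first.
- exact: cvg_cst.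
- by apply: cvg_EFin; [exact: nearW|exact: gc].
near=> m; have m0 : 0 < m by near: m; exact: nbhs_right_gt.
have m1 : m <= 1 by near: m; apply: nbhs_right_le.
have [E [oE bl hs]] := resolvent_difference_bound hd c0 hc (ltW m0).
apply/andP; split.
  by apply: le_ereal_inf_tmp => _ [F _ <-]; exact: poweR_ge0.
have hs0 : (0 <= hs_sum (dot_s d m) (resolvent_difference d m lambda) E)%E.
  apply: esum_ge0 => e _; rewrite /sqnorm /dot_s /graph_dot ReD.
  by have [ip _ _] := @Hdot_hilbert R d; apply: addr_ge0; exact: (sqnorm_ge0 ip).
have hs1 := le_trans hs (_ : _ <= (B * Num.sqrt m)%:E)%E.
have -> : g m = (B * Num.sqrt m) `^ 2^-1 by rewrite powR12_sqrt// mulr_ge0//.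
rewrite -poweR_EFin; apply: (@le_trans _ _ ((hs_sum (dot_s d m) (resolvent_difference d m lambda) E) `^ 2^-1)%E).
  (* The norm is an infimum over orthonormal bases, so the single basis E bounds it. *)
  by apply: ereal_inf_lbound; exists E.
apply: gt0_ler_poweR => //.
- by rewrite in_itv /= leey andbT.
- by rewrite in_itv /= leey lee_fin mulr_ge0//.
- apply: hs1; rewrite lee_fin; have [/andP[k0 k1] /andP[e0 e1]] := hf m (ltW m0) m1.
  exact: hs_bound_le.
Unshelve. all: by end_near. Qed.
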